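(* Assume (A) (see context). Then there exist two constants $0<h_0<1$ and $0<\tau_0<1$, sufficiently small and independent of $\varepsilon$, such that for any $0<\varepsilon\le 1$, whenever $0<h\le h_0$ and $0<\tau\le\tau_0$, we have for all integers $0\le n\le T/\tau$: \begin{align*} &\|e^n_\psi\|_{H^1}+\|e^n_\phi\|_{H^1}+\varepsilon^2\|\dot e^n_\phi\|_{H^1}\lesssim h^{m_0-1}+\frac{\tau^2}{\varepsilon^2},\\ &\|e^n_\psi\|_{H^1}+\|e^n_\phi\|_{H^1}+\varepsilon^2\|\dot e^n_\phi\|_{H^1}\lesssim h^{m_0-1}+\varepsilon^2,\\ &\|I_N\Psi^n\|_{H^1}\le C_\psi+1,\qquad \|I_N\Phi^n\|_{H^1}\le C_\phi+1,\qquad \|I_N\dot\Phi^n\|_{H^1}\le \frac{1}{\varepsilon^2}(C_\phi+1). \end{align*} Consequently, uniformly for $\varepsilon\in(0,1]$, $$\|e^n_\psi\|_{H^1}+\|e^n_\phi\|_{H^1}+\varepsilon^2\|\dot e^n_\phi\|_{H^1}\lesssim h^{m_0-1}+\max_{0<\varepsilon\le1}\min\Big\{\frac{\tau^2}{\varepsilon^2},\varepsilon^2\Big\}\lesssim h^{m_0-1}+\tau .$$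
   Context: **Notation.** $A\lesssim B$ means $|A|\le CB$ with a constant $C>0$ independent of $\varepsilon$, $h$, $\tau$ (and of $n$). $\overline{z}$ is complex conjugation. $\Omega=(a,b)$ is a bounded interval, $H^k=H^k(\Omega)$, and $H^m_{\rm per}(\Omega)=\{u\in H^m(\Omega): u^{(k)}(a)=u^{(k)}(b),\ k=0,\dots,m-1\}$. **Problem.** For $\varepsilon\in(0,1]$, let $\psi$ (complex-valued) and $\phi$ (real-valued), both depending on $\varepsilon$, solve on $\Omega$ with periodic boundary conditions (for the functions and their first $x$-derivatives) $$i\partial_t\psi+\partial_{xx}\psi+\phi\psi=0,\qquad \varepsilon^2\partial_{tt}\phi-\partial_{xx}\phi+\tfrac1{\varepsilon^2}\phi-|\psi|^2=0,$$ $$\psi(x,0)=\psi_0(x),\quad \phi(x,0)=\phi_0(x),\quad \partial_t\phi(x,0)=\tfrac1{\varepsilon^2}\phi_1(x),$$ where $\psi_0$ (complex-valued) and $\phi_0,\phi_1$ (real-valued) are independent of $\varepsilon$. Let $T>0$ be a fixed time smaller than the maximal existence time. **Assumption (A).** There is an integer $m_0\ge5$ such that $\psi\in C([0,T];H^{m_0}_{\rm per}(\Omega))$, $\phi\in C^1([0,T];H^{m_0}_{\rm per}(\Omega))$ and, uniformly in $\varepsilon\in(0,1]$, $$\|\psi\|_{L^\infty([0,T];H^{m_0})}\lesssim1,\qquad \|\phi\|_{L^\infty([0,T];H^{m_0})}+\varepsilon^2\|\partial_t\phi\|_{L^\infty([0,T];H^{m_0})}\lesssim1 .$$ Put $C_\psi=\sup_{0<\varepsilon\le1}\|\psi\|_{L^\infty([0,T];H^{m_0})}$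 and $C_\phi=\sup_{0<\varepsilon\le1}\max\{\|\phi\|_{L^\infty([0,T];H^{m_0})},\ \varepsilon^2\|\partial_t\phi\|_{L^\infty([0,T];H^{m_0})}\}$. **Grid and Fourier notation.** $\tau>0$ is the time step, $t_n=n\tau$. $N$ is a positive even integer, $h=(b-a)/N$, $x_j=a+jh$ ($0\le j\le N$), $\mu_l=\frac{2\pi l}{b-a}$. $Y_N=\{\mathbf v=(v_0,\dots,v_N)^T\in\mathbb C^{N+1}:v_0=v_N\}$; products, conjugates, real parts and moduli of elements of $Y_N$ are taken componentwise. For $\mathbf v\in Y_N$, $\widetilde{\mathbf v}_l=\frac1N\sum_{j=0}^{N-1}v_je^{-i\mu_l(x_j-a)}$ and $(I_N\mathbf v)(x)=\sum_{l=-N/2}^{N/2-1}\widetilde{\mathbf v}_le^{i\mu_l(x-a)}$. **Coefficients.** $\omega_l=\frac1{\varepsilon^2}\sqrt{1+\varepsilon^2\mu_l^2}$, $\lambda_l^\pm=-\frac1{\varepsilon^2}\big[1\pm\sqrt{1+\varepsilon^2\mu_l^2}\big]$, $$a_l(s)=\frac{\lambda_l^+e^{is\lambda_l^-}-\lambda_l^-e^{is\lambda_l^+}}{\lambda_l^+-\lambda_l^-},\qquad a_l'(s)=i\lambda_l^+\lambda_l^-\frac{e^{is\lambda_l^-}-e^{is\lambda_l^+}}{\lambda_l^+-\lambda_l^-},$$ $$p_l(\tau)=\int_0^\tau\frac{\sin(\omega_l(\tau-\theta))}{\varepsilon^2\omega_l}d\theta,\quad q_l(\tau)=\int_0^\tau\theta\frac{\sin(\omega_l(\tau-\theta))}{\varepsilon^2\omega_l}d\theta,$$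 $$p_l'(\tau)=\int_0^\tau\frac{\cos(\omega_l(\tau-\theta))}{\varepsilon^2}d\theta,\quad q_l'(\tau)=\int_0^\tau\theta\frac{\cos(\omega_l(\tau-\theta))}{\varepsilon^2}d\theta,$$ $$c_l^\pm(\tau)=ie^{-i\mu_l^2\tau}\int_0^\tau e^{i(\mu_l^2\pm\frac1{\varepsilon^2})\theta}d\theta,\qquad d_l^\pm(\tau)=ie^{-i\mu_l^2\tau}\int_0^\tau\theta e^{i(\mu_l^2\pm\frac1{\varepsilon^2})\theta}d\theta .$$ **MTI-FP scheme.** Vectors $\Psi^n,\Phi^n,\dot\Phi^n\in Y_N$ (components $\psi_j^n,\phi_j^n,\dot\phi_j^n$) are defined by $\psi^0_j=\psi_0(x_j)$, $\phi^0_j=\phi_0(x_j)$, $\dot\phi^0_j=\frac1{\varepsilon^2}\phi_1(x_j)$ and, for $n\ge0$, as follows. Let $\mathbf v^{n,0}=\frac12(\Phi^n-i\varepsilon^2\dot\Phi^n)\in Y_N$ and let $\dot\Psi^n\in Y_N$ have discrete Fourier coefficients $\widetilde{(\dot\Psi^n)}_l=-i\frac{\sin(\mu_l^2\tau)}{\tau}\widetilde{(\Psi^n)}_l+i\widetilde{(\Phi^n\Psi^n)}_l$. For $-\frac N2\le l\le\frac N2-1$ set \begin{align*} &\widetilde{(\mathbf v^{n,1})}_l=a_l(\tau)\widetilde{(\mathbf v^{n,0})}_l,\qquad \widetilde{(\dot{\mathbf v}^{n,1})}_l=a_l'(\tau)\widetilde{(\mathbf v^{n,0})}_l,\\ &\widetilde{(\mathbf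 r^{n,1})}_l=p_l(\tau)\widetilde{(|\Psi^n|^2)}_l+2q_l(\tau)\widetilde{(\mathrm{Re}\{\overline{\Psi^n}\dot\Psi^n\})}_l,\\ &\widetilde{(\dot{\mathbf r}^{n,1})}_l=p_l'(\tau)\widetilde{(|\Psi^n|^2)}_l+2q_l'(\tau)\widetilde{(\mathrm{Re}\{\overline{\Psi^n}\dot\Psi^n\})}_l,\\ &\widetilde{(\Psi^{n+1})}_l=e^{-i\mu_l^2\tau}\widetilde{(\Psi^n)}_l+c_l^+(\tau)\widetilde{(\mathbf v^{n,0}\Psi^n)}_l+d_l^+(\tau)\widetilde{(\mathbf v^{n,0}\dot\Psi^n)}_l+c_l^-(\tau)\widetilde{(\overline{\mathbf v^{n,0}}\Psi^n)}_l+d_l^-(\tau)\widetilde{(\overline{\mathbf v^{n,0}}\dot\Psi^n)}_l, \end{align*} which determine vectors in $Y_N$ via $v_j=\sum_{l=-N/2}^{N/2-1}\widetilde{\mathbf v}_le^{i\mu_l(x_j-a)}$, and then \begin{align*} &\phi^{n+1}_j=e^{i\tau/\varepsilon^2}v_j^{n,1}+e^{-i\tau/\varepsilon^2}\overline{v_j^{n,1}}+r_j^{n,1},\\ &\dot\phi_j^{n+1}=e^{i\tau/\varepsilon^2}\Big(\dot v_j^{n,1}+\frac i{\varepsilon^2}v_j^{n,1}\Big)+e^{-i\tau/\varepsilon^2}\Big(\overline{\dot v_j^{n,1}}-\frac i{\varepsilon^2}\overline{v_j^{n,1}}\Big)+\dot r_j^{n,1}. \end{align*} **Errors.** $e^n_\psi(x)=\psi(x,t_n)-(I_N\Psi^n)(x)$,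 $e^n_\phi(x)=\phi(x,t_n)-(I_N\Phi^n)(x)$, $\dot e^n_\phi(x)=\partial_t\phi(x,t_n)-(I_N\dot\Phi^n)(x)$. *)

(* Defs.v *)
From HB Require Import structures.
From mathcomp Require Export all_boot all_order all_algebra.
From mathcomp Require Export complex.
From mathcomp Require Export all_classical all_reals all_analysis.
Export Order.TTheory GRing.Theory Num.Theory.
Export numFieldNormedType.Exports.

Set Implicit Arguments.
Unset Strict Implicit.
Unset Printing Implicit Defensive.

Local Open Scope classical_set_scope.
Local Open Scope ring_scope.
Local Open Scope complex_scope.

Local Notation normc := ComplexField.Normc.normc.

Section ComplexCalculus.
Context {R : realType}.

Definition cis (x : R) : R[i] := cos x +i* sin x.

(* All calculus on functions R -> R[i] is componentwise. *)
Definition cint (D : set R) (f : R -> R[i]) : R[i] :=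
  (\int[lebesgue_measure]_(x in D) complex.Re (f x))
  +i* (\int[lebesgue_measure]_(x in D) complex.Im (f x)).

Definition cderivable (f : R -> R[i]) (x : R) : Prop :=
  derivable (@complex.Re R \o f) x 1 /\ derivable (@complex.Im R \o f) x 1.

Definition cderive (f : R -> R[i]) (x : R) : R[i] :=
  derive1 (@complex.Re R \o f) x +i* derive1 (@complex.Im R \o f) x.

Definition ccontinuous_on (A : set R) (f : R -> R[i]) : Prop :=
  {within A, continuous (@complex.Re R \o f)} /\
  {within A, continuous (@complex.Im R \o f)}.

End ComplexCalculus.

Section Sobolev.
Context {R : realType} (a b : R).

Definition square_integrable (f : R -> R[i]) : Prop :=
  [/\ measurable_fun `]a, b[ (@complex.Re R \o f),
      measurable_fun `]a, b[ (@complex.Im R \o f) &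
      (@lebesgue_measure R).-integrable `]a, b[
        (fun x => (normc (f x) ^+ 2)%:E)].

(* C^1 functions with compact support in ]a, b[, the test functions of the
   usual one-dimensional definition of weak derivatives (Brezis, Functional
   Analysis, Sobolev Spaces and PDE, Section 8.2).  Real-valued ones suffice,
   by linearity. *)
Definition test_function (w : R -> R) : Prop :=
  [/\ forall x, derivable w x 1,
      continuous (derive1 w) &
      exists c d : R, [/\ a < c, d < b & forall x, ~~ (c <= x <= d) -> w x = 0]].

Definition weak_derivative (f g : R -> R[i]) : Prop :=
  forall w, test_function w ->
    cint `]a, b[ (fun x => f x * (derive1 w x)%:C) =
    - cint `]a, b[ (fun x => g x * (w x)%:C).

(* U 0 = u, U 1, ..., U m are u and its successive weak derivatives, all
   in L^2(a, b): u has such a family exactly when u is in H^m(a, b). *)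
Definition sobolev_derivatives (m : nat) (u : R -> R[i])
    (U : nat -> R -> R[i]) : Prop :=
  [/\ U 0%N = u,
      forall k, (k < m)%N -> weak_derivative (U k) (U k.+1) &
      forall k, (k <= m)%N -> square_integrable (U k)].

(* Weak derivatives being unique almost everywhere, the infimum is over a
   singleton when u is in H^m(a, b); it is over the empty set, and the norm is
   +oo, when u is not. *)
Definition sobolev_norm (m : nat) (u : R -> R[i]) : \bar R :=
  ereal_inf [set (Num.sqrt (\sum_(k < m.+1)
      \int[lebesgue_measure]_(x in `]a, b[) (normc (U k x) ^+ 2)))%:E
    | U in sobolev_derivatives m u].

(* u is the continuous representative of an element of H^m_per; the boundary
   values u^(k)(a), u^(k)(b), k < m, are those of the continuous
   representatives U k of the weak derivatives. *)
Definition sobolev_periodic (m : nat) (u : R -> R[i]) : Prop :=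
  exists2 U, sobolev_derivatives m u U &
    forall k, (k < m)%N -> ccontinuous_on `[a, b] (U k) /\ U k a = U k b.

(* Below, a function of time and space is u : R -> R -> R[i], with u t x. *)

(* C([0,T]; H^m_per) *)
Definition sobolev_C0 (T : R) (m : nat) (u : R -> R -> R[i]) : Prop :=
  (forall t, 0 <= t <= T -> sobolev_periodic m (u t)) /\
  (forall t0, 0 <= t0 <= T ->
    sobolev_norm m (fun x => u t x - u t0 x)
      @[t --> within `[0, T] (nbhs t0)] --> 0%E).

(* u is in C^1([0,T]; H^m_per), with time derivative ut (one-sided at the
   endpoints) *)
Definition sobolev_C1 (T : R) (m : nat) (u ut : R -> R -> R[i]) : Prop :=
  [/\ sobolev_C0 T m u, sobolev_C0 T m ut &
      forall t0, 0 <= t0 <= T ->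
        sobolev_norm m (fun x => (u t x - u t0 x) / (t - t0)%:C - ut t0 x)
          @[t --> within `[0, T] t0^'] --> 0%E].

(* The L^oo([0,T]; H^m) norm; it is only used for u in C([0,T]; H^m), where
   the essential supremum is the supremum. *)
Definition sobolev_sup_norm (T : R) (m : nat) (u : R -> R -> R[i]) : \bar R :=
  ereal_sup [set sobolev_norm m (u t) | t in `[0, T]].

End Sobolev.

Section Problem.
Context {R : realType} (a b T : R).

Definition cplx (u : R -> R -> R) : R -> R -> R[i] := fun t x => (u t x)%:C.

(* Classical solution on ]0,T[ x ]a,b[, phit being the time derivative of phi.
   The periodic boundary conditions, and the continuity up to the boundary that
   gives the initial conditions their meaning, are part of the regularity
   assumption below. *)
Record KGS_solution (eps : R) (psi0 : R -> R[i]) (phi0 phi1 : R -> R)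
    (psi : R -> R -> R[i]) (phi phit : R -> R -> R) : Prop := {
  KGS_psi_derivable : forall t x, 0 < t < T -> a < x < b ->
    [/\ cderivable (psi^~ x) t, cderivable (psi t) x &
        cderivable (cderive (psi t)) x];
  KGS_phi_derivable : forall t x, 0 < t < T -> a < x < b ->
    [/\ is_derive t 1 (phi^~ x) (phit t x), derivable (phit^~ x) t 1,
        derivable (phi t) x 1 & derivable (derive1 (phi t)) x 1];
  KGS_schrodinger : forall t x, 0 < t < T -> a < x < b ->
    'i%C * cderive (psi^~ x) t + cderive (cderive (psi t)) x
      + (phi t x)%:C * psi t x = 0;
  KGS_klein_gordon : forall t x, 0 < t < T -> a < x < b ->
    eps ^+ 2 * derive1 (phit^~ x) t - derive1 (derive1 (phi t)) x
      + phi t x / eps ^+ 2 - normc (psi t x) ^+ 2 = 0;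
  KGS_psi_init : forall x, a <= x <= b -> psi 0 x = psi0 x;
  KGS_phi_init : forall x, a <= x <= b -> phi 0 x = phi0 x;
  KGS_phit_init : forall x, a <= x <= b -> phit 0 x = phi1 x / eps ^+ 2
}.

(* In the following, the first argument of psi, phi, phit is eps. *)
Record assumption_A (m0 : nat) (psi : R -> R -> R -> R[i])
    (phi phit : R -> R -> R -> R) : Prop := {
  A_psi_C0 : forall eps, 0 < eps <= 1 -> sobolev_C0 a b T m0 (psi eps);
  A_phi_C1 : forall eps, 0 < eps <= 1 ->
    sobolev_C1 a b T m0 (cplx (phi eps)) (cplx (phit eps));
  A_psi_bounded : exists M : R, forall eps, 0 < eps <= 1 ->
    (sobolev_sup_norm a b T m0 (psi eps) <= M%:E)%E;
  A_phi_bounded : exists M : R, forall eps, 0 < eps <= 1 ->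
    (sobolev_sup_norm a b T m0 (cplx (phi eps))
     + (eps ^+ 2)%:E * sobolev_sup_norm a b T m0 (cplx (phit eps)) <= M%:E)%E
}.

Definition C_psi (m0 : nat) (psi : R -> R -> R -> R[i]) : \bar R :=
  ereal_sup [set sobolev_sup_norm a b T m0 (psi eps) | eps in `]0, 1]].

Definition C_phi (m0 : nat) (phi phit : R -> R -> R -> R) : \bar R :=
  ereal_sup [set maxe (sobolev_sup_norm a b T m0 (cplx (phi eps)))
      ((eps ^+ 2)%:E * sobolev_sup_norm a b T m0 (cplx (phit eps)))%E
    | eps in `]0, 1]].

End Problem.

Section Fourier.
Context {R : realType} (a b : R) (N : nat).

Definition mesh : R := (b - a) / N%:R.
Definition node (j : nat) : R := a + j%:R * mesh.
Definition mu (l : int) : R := 2 * pi * l%:~R / (b - a).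

(* Vectors (v_0, ..., v_N).  The condition v_0 = v_N defining Y_N need not be
   imposed: it holds for samples of periodic functions and for the vectors
   built by grid_of_coef, and is preserved by componentwise operations. *)
Definition grid : Type := 'I_N.+1 -> R[i].

Definition sample (f : R -> R[i]) : grid := fun j => f (node j).

Definition dft (v : grid) (l : int) : R[i] :=
  N%:R^-1 * \sum_(j < N)
    v (widen_ord (leqnSn N) j) * cis (- (mu l * (node j - a))).

(* l = k - N/2 runs through -N/2, ..., N/2 - 1 (N is even). *)
Definition trig_poly (c : int -> R[i]) (x : R) : R[i] :=
  \sum_(k < N) let l := (k : nat)%:Z - (N./2)%:Z in
    c l * cis (mu l * (x - a)).

Definition grid_of_coef (c : int -> R[i]) : grid := sample (trig_poly c).

Definition interp (v : grid) : R -> R[i] := trig_poly (dft v).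

End Fourier.

Section Scheme.
Context {R : realType} (a b eps tau : R) (N : nat).
Local Notation Y := (@grid R N).
Local Notation mu := (mu a b).
Local Notation dft := (dft a b).
Local Notation vec := (grid_of_coef a b).

Definition omega (l : int) : R :=
  Num.sqrt (1 + eps ^+ 2 * mu l ^+ 2) / eps ^+ 2.
Definition lambdap (l : int) : R :=
  - ((1 + Num.sqrt (1 + eps ^+ 2 * mu l ^+ 2)) / eps ^+ 2).
Definition lambdam (l : int) : R :=
  - ((1 - Num.sqrt (1 + eps ^+ 2 * mu l ^+ 2)) / eps ^+ 2).

Definition coef_a (l : int) (s : R) : R[i] :=
  ((lambdap l)%:C * cis (s * lambdam l) - (lambdam l)%:C * cis (s * lambdap l))
  / (lambdap l - lambdam l)%:C.
Definition coef_a' (l : int) (s : R) : R[i] :=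
  'i%C * (lambdap l * lambdam l)%:C *
  ((cis (s * lambdam l) - cis (s * lambdap l)) / (lambdap l - lambdam l)%:C).

Definition coef_p (l : int) : R :=
  \int[lebesgue_measure]_(th in `[0, tau])
    (sin (omega l * (tau - th)) / (eps ^+ 2 * omega l)).
Definition coef_q (l : int) : R :=
  \int[lebesgue_measure]_(th in `[0, tau])
    (th * (sin (omega l * (tau - th)) / (eps ^+ 2 * omega l))).
Definition coef_p' (l : int) : R :=
  \int[lebesgue_measure]_(th in `[0, tau])
    (cos (omega l * (tau - th)) / eps ^+ 2).
Definition coef_q' (l : int) : R :=
  \int[lebesgue_measure]_(th in `[0, tau])
    (th * (cos (omega l * (tau - th)) / eps ^+ 2)).

(* sg = 1 and sg = -1 give c_l^+, d_l^+ and c_l^-, d_l^- *)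
Definition coef_c (sg : R) (l : int) : R[i] :=
  'i%C * cis (- (mu l ^+ 2 * tau)) *
  cint `[0, tau] (fun th => cis ((mu l ^+ 2 + sg / eps ^+ 2) * th)).
Definition coef_d (sg : R) (l : int) : R[i] :=
  'i%C * cis (- (mu l ^+ 2 * tau)) *
  cint `[0, tau] (fun th => th%:C * cis ((mu l ^+ 2 + sg / eps ^+ 2) * th)).

(* (Psi^n, Phi^n, \dot Phi^n) *)
Record state := State { s_psi : Y; s_phi : Y; s_dphi : Y }.

Definition mti_init (psi0 : R -> R[i]) (phi0 phi1 : R -> R) : state :=
  State (sample a b psi0) (sample a b (fun x => (phi0 x)%:C))
        (sample a b (fun x => (phi1 x / eps ^+ 2)%:C)).

Definition mti_step (S : state) : state :=
  let Psi := s_psi S in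
  let Phi := s_phi S in
  let v0 : Y := fun j =>
    2^-1 * (Phi j - 'i%C * (eps ^+ 2)%:C * s_dphi S j) in
  let v0b : Y := fun j => (v0 j)^* in
  let dPsi : Y := vec (fun l =>
    - 'i%C * (sin (mu l ^+ 2 * tau) / tau)%:C * dft Psi l
    + 'i%C * dft (fun j => Phi j * Psi j) l) in
  let rho : Y := fun j => (normc (Psi j) ^+ 2)%:C in
  let drho : Y := fun j => (complex.Re ((Psi j)^* * dPsi j))%:C in
  let v1 : Y := vec (fun l => coef_a l tau * dft v0 l) in
  let dv1 : Y := vec (fun l => coef_a' l tau * dft v0 l) in
  let r1 : Y := vec (fun l =>
    (coef_p l)%:C * dft rho l + 2 * (coef_q l)%:C * dft drho l) in
  let dr1 : Y := vec (fun l =>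
    (coef_p' l)%:C * dft rho l + 2 * (coef_q' l)%:C * dft drho l) in
  let Psi1 : Y := vec (fun l =>
    cis (- (mu l ^+ 2 * tau)) * dft Psi l
    + coef_c 1 l * dft (fun j => v0 j * Psi j) l
    + coef_d 1 l * dft (fun j => v0 j * dPsi j) l
    + coef_c (-1) l * dft (fun j => v0b j * Psi j) l
    + coef_d (-1) l * dft (fun j => v0b j * dPsi j) l) in
  let Phi1 : Y := fun j =>
    cis (tau / eps ^+ 2) * v1 j + cis (- (tau / eps ^+ 2)) * (v1 j)^* + r1 j in
  let dPhi1 : Y := fun j =>
    cis (tau / eps ^+ 2) * (dv1 j + 'i%C * (eps ^- 2)%:C * v1 j)
    + cis (- (tau / eps ^+ 2)) * ((dv1 j)^* - 'i%C * (eps ^- 2)%:C * (v1 j)^*)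
    + dr1 j in
  State Psi1 Phi1 dPhi1.

Definition mti_fp (psi0 : R -> R[i]) (phi0 phi1 : R -> R) (n : nat) : state :=
  iter n mti_step (mti_init psi0 phi0 phi1).

End Scheme.

(* ||e_psi^n||_{H^1} + ||e_phi^n||_{H^1} + eps^2 ||\dot e_phi^n||_{H^1} for the
   numerical solution S at time t *)
Definition total_error {R : realType} (a b eps : R) (N : nat)
    (psi : R -> R -> R[i]) (phi phit : R -> R -> R) (S : @state R N) (t : R)
    : \bar R :=
  (sobolev_norm a b 1 (fun x => (psi t x - interp a b (s_psi S) x)%R)
   + sobolev_norm a b 1 (fun x => ((phi t x)%:C - interp a b (s_phi S) x)%R)
   + (eps ^+ 2)%:E *
     sobolev_norm a b 1 (fun x => ((phit t x)%:C - interp a b (s_dphi S) x)%R))%E.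

Definition is_maximum {R : realType} (A : set R) (M : R) : Prop :=
  A M /\ ubound A M.

(* Main.v *)
Require Import Defs.
From mathcomp Require Import measurable_realfun.
From mathcomp Require Import ring lra zify.

(** The numerical state is compared, frequency by frequency, with the Fourier
    coefficients [g], [f], [d] of [psi], [phi] and [phit], in the weighted
    [l2] norm [nrm N 1], equivalent to the H^1 norm of trigonometric
    polynomials.  Functions enter only at the two ends of the argument.

    Consistency.  With [F], [Q] the coefficients of [phi psi] and [|psi|^2],
      [g' = i (F - mu^2 g)],  [f' = d],
      [eps^2 d' = Q - (mu^2 + eps^-2) f].
    The field oscillates at the rate [eps^-2], but in
    [f = e^(is/eps^2) z_1 + e^(-is/eps^2) z_(-1)] the amplitudes have a
    derivative that is bounded uniformly in [eps].  In one step the scheme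
    freezes the amplitudes, replaces [g] by its tangent at the beginning of the
    step, and integrates the phases exactly.  In the interaction picture the
    derivative of the local error is thus a sum of terms phase times slow
    factor, where the slow factor vanishes at the beginning of the step.  An
    integration by parts trades the phase for a factor [eps^2]
    ([local_psi_eps], [local_kg_eps]); a Taylor expansion, in which every time
    derivative of the field costs [eps^-2], gives [tau^2 / eps^2] instead
    ([local_psi_tau], [local_kg_tau]).  No integral of the solution is ever
    formed: each bound is the mean value inequality [nrm_MVT] for a function
    that vanishes at the beginning of the step.

    Stability.  The linear Klein-Gordon flow is a rotation of the pair
    [(eps^2 omega f, eps^2 d)], hence an isometry for [en].  The nonlinear
    terms are locally Lipschitz because the weighted [l2] space is an algebra
    whose constant does not depend on [N] ([nrm_star]).  So one step multiplies
    the distance to the solution by at most [1 + C tau] and adds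
    [C tau (eta + kappa)], where [eta = O(h^(m-1))] is the aliasing error and
    [kappa = min (tau^2/eps^2, eps^2)] ([dist_step]).  This holds while the
    distance is at most 1, which the discrete Gronwall induction [dist_iter]
    carries along: [kappa <= tau], so for small [h] and [tau] its conclusion is
    below 1.  This is also what bounds the numerical solution in H^1.

    Space.  Membership in H^m_per is decay of the Fourier coefficients
    ([fam_bnd]), periodic Lipschitz functions are the sum of their Fourier
    series ([fourier_pointwise]), and therefore the coefficients of a product
    are a convolution ([fc_product]).  Sampling and multiplying on the grid then
    differ from their continuous counterparts by the contributions of
    frequencies of order at least [N], which are [O(h^(m-1))] ([product_aliasing],
    [sample_aliasing]).

    Initial data.  The factor [eps^2 omega] of the energy norm is comparable to
    [1 + eps |mu|], so the interpolation error of [phi0] is measured in H^2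
    when [eps = 1]; with [phi0] in H^m it would only be [O(h^(m-2))].  But
    [phi0] does not depend on [eps], and the solution for [eps = 1] could not
    stay bounded in H^m on [[0, T]] with a velocity in H^m if its energy, which
    involves one more derivative, were infinite: the virial identity [virial]
    bounds that energy by the quantities under control, so [phi0] is in H^(m+1)
    ([phi0_regular]). *)

Set Implicit Arguments.
Unset Strict Implicit.
Unset Printing Implicit Defensive.

Local Open Scope classical_set_scope.
Local Open Scope ring_scope.
Local Open Scope complex_scope.

Local Notation normc := ComplexField.Normc.normc.
Local Notation Re := complex.Re.
Local Notation Im := complex.Im.
Local Notation "x ^*" := (conjc x) : ring_scope.
Local Notation "''i'" := (Complex 0 1) : ring_scope.

(** * Complex numbers and finite sums *)
Section ComplexBasics.
Context {R : realType}.
Implicit Types (x y z : R[i]) (a b t : R).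

Lemma normcE2 z : normc z ^+ 2 = Re z ^+ 2 + Im z ^+ 2.
Proof. by case: z => a b /=; rewrite sqr_sqrtr ?addr_ge0 ?sqr_ge0. Qed.

Lemma normc_ge0 z : 0 <= normc z.
Proof. by case: z => a b /=; exact: sqrtr_ge0. Qed.

Lemma normc_real a : normc a%:C = `|a|.
Proof. by rewrite /= expr0n /= addr0 sqrtr_sqr. Qed.

Lemma normcJ z : normc z^* = normc z.
Proof. by case: z => a b /=; rewrite sqrrN. Qed.

Lemma normcM z y : normc (z * y) = normc z * normc y.
Proof. exact: ComplexField.Normc.normcM. Qed.

Lemma normcX z n : normc (z ^+ n) = normc z ^+ n.
Proof.
elim: n => [|n IH]; first by rewrite !expr0 ComplexField.Normc.normc1.
by rewrite !exprS normcM IH.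
Qed.

Lemma normc_eq0 z : normc z = 0 -> z = 0.
Proof. exact: ComplexField.Normc.eq0_normc. Qed.

Lemma normcD z y : normc (z + y) <= normc z + normc y.
Proof. exact: le_normcD. Qed.

Lemma normcB z y : normc (z - y) <= normc z + normc y.
Proof. by apply: (le_trans (normcD _ _)); rewrite normcN. Qed.

Lemma normc_distC z y : normc (z - y) = normc (y - z).
Proof. by rewrite -normcN opprB. Qed.

Lemma normc_i : normc ('i : R[i]) = 1.
Proof. by rewrite /= expr0n expr1n /= add0r sqrtr1. Qed.

Lemma normc_nat n : normc (n%:R : R[i]) = n%:R.
Proof.
by rewrite -[n%:R : R[i]](rmorph_nat (real_complex R)) normc_real normr_nat.
Qed.

Lemma normc_cis a : normc (cis a) = 1.
Proof. by rewrite /= cos2Dsin2 sqrtr1. Qed.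

Lemma normc_sum (I : Type) (r : seq I) (P : pred I) (F : I -> R[i]) :
  normc (\sum_(i <- r | P i) F i) <= \sum_(i <- r | P i) normc (F i).
Proof.
elim/big_ind2 : _ => //; first by rewrite ComplexField.Normc.normc0.
by move=> x1 a1 x2 a2 h1 h2; apply: (le_trans (normcD _ _)); exact: lerD.
Qed.

Lemma Re_le_normc z : `|Re z| <= normc z.
Proof.
case: z => a b /=; rewrite -sqrtr_sqr ler_wsqrtr // lerDl; exact: sqr_ge0.
Qed.

Lemma Im_le_normc z : `|Im z| <= normc z.
Proof.
case: z => a b /=; rewrite -sqrtr_sqr ler_wsqrtr // lerDr; exact: sqr_ge0.
Qed.

Lemma ReD x y : Re (x + y) = Re x + Re y.
Proof. by case: x y => [a b] [c d]. Qed.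
Lemma ImD x y : Im (x + y) = Im x + Im y.
Proof. by case: x y => [a b] [c d]. Qed.
Lemma ReN x : Re (- x) = - Re x. Proof. by case: x. Qed.
Lemma ImN x : Im (- x) = - Im x. Proof. by case: x. Qed.
Lemma ReB x y : Re (x - y) = Re x - Re y.
Proof. by case: x y => [a b] [c d]. Qed.
Lemma ImB x y : Im (x - y) = Im x - Im y.
Proof. by case: x y => [a b] [c d]. Qed.
Lemma ReM x y : Re (x * y) = Re x * Re y - Im x * Im y.
Proof. by case: x y => [a b] [c d]. Qed.
Lemma ImM x y : Im (x * y) = Re x * Im y + Im x * Re y.
Proof. by case: x y => [a b] [c d]. Qed.
Lemma ReJ x : Re x^* = Re x. Proof. by case: x. Qed.
Lemma ImJ x : Im x^* = - Im x. Proof. by case: x. Qed.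
Lemma Re_sum (I : Type) (r : seq I) (P : pred I) (F : I -> R[i]) :
  Re (\sum_(i <- r | P i) F i) = \sum_(i <- r | P i) Re (F i).
Proof. by elim/big_rec2 : _ => // i y1 y2 _ <-; rewrite ReD. Qed.
Lemma Im_sum (I : Type) (r : seq I) (P : pred I) (F : I -> R[i]) :
  Im (\sum_(i <- r | P i) F i) = \sum_(i <- r | P i) Im (F i).
Proof. by elim/big_rec2 : _ => // i y1 y2 _ <-; rewrite ImD. Qed.
Lemma conjcD x y : (x + y)^* = x^* + y^*. Proof. exact: raddfD. Qed.
Lemma conjcB x y : (x - y)^* = x^* - y^*. Proof. exact: raddfB. Qed.
Lemma conjcN x : (- x)^* = - x^*. Proof. exact: raddfN. Qed.
Lemma conjcM x y : (x * y)^* = x^* * y^*. Proof. exact: rmorphM. Qed.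
Lemma conjc_i : ('i : R[i])^* = - 'i.
Proof. by apply/eqP; rewrite eq_complex /= oppr0 !eqxx. Qed.
Lemma conjc_sum (I : Type) (r : seq I) (P : pred I) (F : I -> R[i]) :
  (\sum_(i <- r | P i) F i)^* = \sum_(i <- r | P i) (F i)^*.
Proof. exact: raddf_sum. Qed.
Lemma sqri : ('i : R[i]) * 'i = -1.
Proof. by rewrite -expr2 sqr_i. Qed.

Lemma rcM a b : (a * b)%:C = a%:C * b%:C :> R[i]. Proof. exact: rmorphM. Qed.
Lemma rcD a b : (a + b)%:C = a%:C + b%:C :> R[i]. Proof. exact: rmorphD. Qed.
Lemma rcB a b : (a - b)%:C = a%:C - b%:C :> R[i]. Proof. exact: rmorphB. Qed.
Lemma rcN a : (- a)%:C = - a%:C :> R[i]. Proof. exact: rmorphN. Qed.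
Lemma rcV a : (a^-1)%:C = (a%:C)^-1 :> R[i]. Proof. exact: fmorphV. Qed.

Lemma cisD a b : cis (a + b) = cis a * cis b.
Proof.
apply/eqP; rewrite eq_complex ReM ImM /= cosD sinD; apply/andP; split => //.
by rewrite addrC.
Qed.
Lemma cis0 : cis (0 : R) = 1.
Proof. by rewrite /cis cos0 sin0. Qed.
Lemma cisN a : cis (- a) = (cis a)^*.
Proof. by rewrite /cis cosN sinN. Qed.
Lemma cis_unit a : cis a * cis (- a) = 1.
Proof. by rewrite -cisD subrr cis0. Qed.
Lemma cos_cis a : (cos a)%:C = (cis a + cis (- a)) / 2.
Proof.
have -> : cis a + cis (- a) = 2 * (cos a)%:C.
  by rewrite cisN addcJ.
by rewrite mulrAC divff ?mul1r // pnatr_eq0.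
Qed.
Lemma sin_cis a : (sin a)%:C = - 'i * (cis a - cis (- a)) / 2.
Proof.
have -> : cis a - cis (- a) = 2 * (sin a)%:C * 'i.
  by rewrite cisN subcJ.
have -> : - 'i * (2 * (sin a)%:C * 'i) = 2 * (sin a)%:C * - ('i * 'i : R[i]) by ring.
by rewrite sqri opprK mulr1 mulrAC divff ?mul1r // pnatr_eq0.
Qed.

End ComplexBasics.

Section FiniteSums.
Context {R : realType}.

Lemma sum_CauchySchwarz (I : Type) (r : seq I) (P : pred I) (a b : I -> R) :
  (\sum_(i <- r | P i) a i * b i) ^+ 2 <=
  (\sum_(i <- r | P i) a i ^+ 2) * (\sum_(i <- r | P i) b i ^+ 2).
Proof.
set S := \sum_(i <- r | P i) a i * b i.
set A := \sum_(i <- r | P i) a i ^+ 2.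
set B := \sum_(i <- r | P i) b i ^+ 2.
have A0 : 0 <= A by apply: sumr_ge0 => i _; exact: sqr_ge0.
have B0 : 0 <= B by apply: sumr_ge0 => i _; exact: sqr_ge0.
have H : forall c d : R, 0 <= c ^+ 2 * A - 2 * c * d * S + d ^+ 2 * B.
  move=> c d.
  have -> : c ^+ 2 * A - 2 * c * d * S + d ^+ 2 * B =
      \sum_(i <- r | P i) (c * a i - d * b i) ^+ 2.
    rewrite /A /B /S !mulr_sumr -sumrB -big_split /=; apply: eq_bigr => i _.
    ring.
  by apply: sumr_ge0 => i _; exact: sqr_ge0.
have := H B S.
have -> : B ^+ 2 * A - 2 * B * S * S + S ^+ 2 * B = B * (A * B - S ^+ 2) by ring.
move: B0; rewrite le_eqVlt => /predU1P[B0 _|B0]; last first.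
  by rewrite pmulr_rge0 // subr_ge0.
have h k : 2 * k * S <= A by have := H 1 k; rewrite -B0; lra.
have [->|S0] := eqVneq S 0; first by rewrite expr0n /= mulr_ge0 // -B0.
have := h ((A + 1) / (2 * S)).
have -> : 2 * ((A + 1) / (2 * S)) * S = A + 1 by field.
by lra.
Qed.

(** Euclidean norm of a vector that is not a matrix, so that the weights can be
    part of the entries. *)
Definition l2 (n : nat) (x : 'I_n -> R) : R := Num.sqrt (\sum_(i < n) x i ^+ 2).

Lemma l2_ge0 n (x : 'I_n -> R) : 0 <= l2 x.
Proof. exact: sqrtr_ge0. Qed.

Lemma l2_sq n (x : 'I_n -> R) : l2 x ^+ 2 = \sum_(i < n) x i ^+ 2.
Proof. by rewrite sqr_sqrtr // sumr_ge0 // => i _; exact: sqr_ge0. Qed.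

Lemma ler_sqr2 (x y : R) : 0 <= y -> x ^+ 2 <= y ^+ 2 -> x <= y.
Proof.
move=> y0 h; have [x0|x0] := leP 0 x; first by move: h; rewrite ler_pXn2r.
exact: (le_trans (ltW x0)).
Qed.

Lemma l2_le n (x : 'I_n -> R) B : 0 <= B -> \sum_(i < n) x i ^+ 2 <= B ^+ 2 ->
  l2 x <= B.
Proof. by move=> B0 h; apply: ler_sqr2 => //; rewrite l2_sq. Qed.

Lemma l2D n (x y : 'I_n -> R) : l2 (fun i => x i + y i) <= l2 x + l2 y.
Proof.
apply: l2_le; first by rewrite addr_ge0 ?l2_ge0.
rewrite sqrrD !l2_sq.
have -> : \sum_(i < n) (x i + y i) ^+ 2 =
  \sum_(i < n) x i ^+ 2 + (\sum_(i < n) x i * y i) *+ 2 + \sum_(i < n) y i ^+ 2.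
  rewrite -sumrMnl -!big_split /=; apply: eq_bigr => i _; ring.
rewrite lerD2r lerD2l lerMn2r /=; apply: ler_sqr2.
  by rewrite mulr_ge0 ?l2_ge0.
by rewrite exprMn !l2_sq; exact: sum_CauchySchwarz.
Qed.

Lemma l2_mono n (x y : 'I_n -> R) : (forall i, 0 <= x i <= y i) -> l2 x <= l2 y.
Proof.
move=> h; rewrite ler_wsqrtr // ler_sum // => i _.
have /andP[h1 h2] := h i; rewrite ler_pXn2r // ?nnegrE //; exact: (le_trans h1).
Qed.

Lemma l2Z n (c : R) (x : 'I_n -> R) : 0 <= c -> l2 (fun i => c * x i) = c * l2 x.
Proof.
move=> c0; rewrite /l2; under eq_bigr do rewrite exprMn.
by rewrite -mulr_sumr sqrtrM ?sqr_ge0 // sqrtr_sqr ger0_norm.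
Qed.

End FiniteSums.

(** * Complex-valued functions of time *)
Section Differentiation.
Context {R : realType}.
Implicit Types (t s : R) (f g : R -> R[i]).

(** Real and imaginary parts are differentiated separately, as in [cderivable]
    and [cderive]. *)
Definition cder f s (d : R[i]) : Prop :=
  is_derive s 1 (fun x => Re (f x)) (Re d) /\
  is_derive s 1 (fun x => Im (f x)) (Im d).

(** The regularity that the mean value theorem needs: continuity on [[0, t]] and
    differentiability inside.  Solutions are only known to be differentiable in
    time on the open interval. *)
Record CD (t : R) f (f' : R -> R[i]) : Prop := MkCD {
  CD_re : {within `[0, t], continuous (fun x => Re (f x))};
  CD_im : {within `[0, t], continuous (fun x => Im (f x))};
  CD_der : forall s, 0 < s < t -> cder f s (f' s) }.

Lemma withinD (A : set R) (u v : R -> R) : {within A, continuous u} ->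
  {within A, continuous v} -> {within A, continuous (fun x => u x + v x)}.
Proof. by move=> hu hv x; apply: cvgD; [exact: hu|exact: hv]. Qed.

Lemma withinB (A : set R) (u v : R -> R) : {within A, continuous u} ->
  {within A, continuous v} -> {within A, continuous (fun x => u x - v x)}.
Proof. by move=> hu hv x; apply: cvgB; [exact: hu|exact: hv]. Qed.

Lemma withinM (A : set R) (u v : R -> R) : {within A, continuous u} ->
  {within A, continuous v} -> {within A, continuous (fun x => u x * v x)}.
Proof. by move=> hu hv x; apply: cvgM; [exact: hu|exact: hv]. Qed.

Lemma within_ext (A : set R) (u v : R -> R) : u =1 v ->
  {within A, continuous u} -> {within A, continuous v}.
Proof. by move=> /funext ->. Qed.

Lemma is_derive_ext s (u v : R -> R) d d' : is_derive s 1 u d -> u =1 v ->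
  d = d' -> is_derive s 1 v d'.
Proof. by move=> h /funext <- <-. Qed.

Lemma within_cst (A : set R) (c : R) : {within A, continuous (fun _ => c)}.
Proof. by move=> x; exact: cvg_cst. Qed.

Lemma is_derive_cst_fun s (c : R) : is_derive s 1 (fun _ : R => c) 0.
Proof. exact: is_derive_cst. Qed.

Lemma is_deriveD_fun s (u v : R -> R) du dv : is_derive s 1 u du ->
  is_derive s 1 v dv -> is_derive s 1 (fun x => u x + v x) (du + dv).
Proof. by move=> hu hv; exact: is_deriveD. Qed.

Lemma is_deriveB_fun s (u v : R -> R) du dv : is_derive s 1 u du ->
  is_derive s 1 v dv -> is_derive s 1 (fun x => u x - v x) (du - dv).
Proof. by move=> hu hv; exact: is_deriveB. Qed.

Lemma is_deriveM_fun s (u v : R -> R) du dv : is_derive s 1 u du ->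
  is_derive s 1 v dv -> is_derive s 1 (fun x => u x * v x) (u s * dv + du * v s).
Proof.
move=> hu hv; have h := is_deriveM hu hv.
by move: h; rewrite /GRing.scale /= (mulrC du) => h; exact: h.
Qed.

Lemma CD_eq t f f' g' : CD t f f' -> (forall s, 0 < s < t -> f' s = g' s) ->
  CD t f g'.
Proof.
by move=> [h1 h2 h3] e; split => // s hs; rewrite -e //; exact: h3.
Qed.

Lemma CD_ext t f g f' : CD t f f' -> f =1 g -> CD t g f'.
Proof. by move=> h /funext <-. Qed.

Lemma CD_cst t (c : R[i]) : CD t (fun _ => c) (fun _ => 0).
Proof.
split; [exact: within_cst|exact: within_cst|].
by move=> s _; split; exact: is_derive_cst_fun.
Qed.

Lemma CD_D t f g f' g' : CD t f f' -> CD t g g' ->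
  CD t (fun s => f s + g s) (fun s => f' s + g' s).
Proof.
move=> [f1 f2 f3] [g1 g2 g3]; split.
- by apply: within_ext (withinD f1 g1) => x; rewrite ReD.
- by apply: within_ext (withinD f2 g2) => x; rewrite ImD.
- move=> s hs; have [a1 a2] := f3 s hs; have [b1 b2] := g3 s hs; split.
    by apply: is_derive_ext (is_deriveD_fun a1 b1) _ _ => [x|]; rewrite ReD.
  by apply: is_derive_ext (is_deriveD_fun a2 b2) _ _ => [x|]; rewrite ImD.
Qed.

Lemma CD_M t f g f' g' : CD t f f' -> CD t g g' ->
  CD t (fun s => f s * g s) (fun s => f' s * g s + f s * g' s).
Proof.
move=> [f1 f2 f3] [g1 g2 g3]; split.
- by apply: within_ext (withinB (withinM f1 g1) (withinM f2 g2)) => x; rewrite ReM.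
- by apply: within_ext (withinD (withinM f1 g2) (withinM f2 g1)) => x; rewrite ImM.
- move=> s hs; have [a1 a2] := f3 s hs; have [b1 b2] := g3 s hs; split.
    apply: is_derive_ext (is_deriveB_fun (is_deriveM_fun a1 b1)
      (is_deriveM_fun a2 b2)) _ _ => [x|]; first by rewrite ReM.
    rewrite ReD !ReM; ring.
  apply: is_derive_ext (is_deriveD_fun (is_deriveM_fun a1 b2)
    (is_deriveM_fun a2 b1)) _ _ => [x|]; first by rewrite ImM.
  rewrite ImD !ImM; ring.
Qed.

Lemma CD_Z t (c : R[i]) f f' : CD t f f' ->
  CD t (fun s => c * f s) (fun s => c * f' s).
Proof.
move=> h; apply: CD_eq (CD_M (CD_cst t c) h) _ => s _ /=.
by rewrite mul0r add0r.
Qed.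

Lemma CD_N t f f' : CD t f f' -> CD t (fun s => - f s) (fun s => - f' s).
Proof.
move=> /(CD_Z (-1)) h; apply: CD_eq (CD_ext h _) _; move=> s; last move=> _.
  by rewrite mulN1r.
by rewrite mulN1r.
Qed.

Lemma CD_B t f g f' g' : CD t f f' -> CD t g g' ->
  CD t (fun s => f s - g s) (fun s => f' s - g' s).
Proof. by move=> hf /CD_N hg; exact: CD_D. Qed.

Lemma CD_conj t f f' : CD t f f' -> CD t (fun s => (f s)^*) (fun s => (f' s)^*).
Proof.
move=> [f1 f2 f3]; split.
- by apply: within_ext f1 => x; rewrite ReJ.
- have h := withinB (@within_cst `[0, t] 0) f2.
  by apply: within_ext h => x; rewrite ImJ sub0r.
- move=> s hs; have [a1 a2] := f3 s hs; split.
    by apply: is_derive_ext a1 _ _ => [x|]; rewrite ReJ.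
  apply: is_derive_ext (is_deriveB_fun (is_derive_cst_fun s 0) a2) _ _ => [x|];
    by rewrite ImJ sub0r.
Qed.

Lemma CD_sum t (I : Type) (r : seq I) (P : pred I) (F F' : I -> R -> R[i]) :
  (forall i, P i -> CD t (F i) (F' i)) ->
  CD t (fun s => \sum_(i <- r | P i) F i s) (fun s => \sum_(i <- r | P i) F' i s).
Proof.
move=> h; elim: r => [|i r IH].
  apply: (CD_ext (f := fun _ => 0)); last by move=> s; rewrite big_nil.
  by apply: CD_eq (CD_cst t 0) _ => s _; rewrite big_nil.
have [Pi|Pi] := boolP (P i).
  apply: CD_eq (CD_ext (CD_D (h i Pi) IH) _) _ => [s|s _]; by rewrite big_cons Pi.
apply: CD_eq (CD_ext IH _) _ => [s|s _]; by rewrite big_cons (negbTE Pi).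
Qed.

Lemma CD_real t (u u' : R -> R) : (forall s, is_derive s 1 u (u' s)) ->
  CD t (fun s => (u s)%:C) (fun s => (u' s)%:C).
Proof.
move=> h; split => //=; last by move=> s _; split => /=; [exact: h|exact: is_derive_cst_fun].
  apply: continuous_subspaceT => x; apply: differentiable_continuous.
  by apply/derivable1_diffP; have [] := h x.
exact: within_cst.
Qed.

Lemma is_derive_cos_lin (k b s : R) :
  is_derive s 1 (fun x => cos (k * x + b)) (- (k * sin (k * s + b))).
Proof.
have h : is_derive s 1 (fun x => k * x + b) k.
  apply: is_derive_ext (is_deriveD_fun (is_deriveM_fun (is_derive_cst_fun s k)
    (is_derive_id s 1)) (is_derive_cst_fun s b)) _ _ => //; ring.
have hh := @is_derive1_comp R cos (fun x => k * x + b) s _ _ (is_derive_cos (k * s + b)) h.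
apply: (is_derive_ext hh) => //=; ring.
Qed.

Lemma is_derive_sin_lin (k b s : R) :
  is_derive s 1 (fun x => sin (k * x + b)) (k * cos (k * s + b)).
Proof.
have h : is_derive s 1 (fun x => k * x + b) k.
  apply: is_derive_ext (is_deriveD_fun (is_deriveM_fun (is_derive_cst_fun s k)
    (is_derive_id s 1)) (is_derive_cst_fun s b)) _ _ => //; ring.
have hh := @is_derive1_comp R sin (fun x => k * x + b) s _ _ (is_derive_sin (k * s + b)) h.
apply: (is_derive_ext hh) => //=; ring.
Qed.

Lemma CD_cis t (k b : R) :
  CD t (fun s => cis (k * s + b)) (fun s => 'i * k%:C * cis (k * s + b)).
Proof.
have c1 := CD_real t (is_derive_cos_lin k b).
have c2 := CD_real t (is_derive_sin_lin k b).
apply: CD_eq (CD_ext (CD_D c1 (CD_Z 'i c2)) _) _ => [s|s _] /=.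
  apply/eqP; rewrite eq_complex ReD ImD ReM ImM /=; apply/andP; split; apply/eqP; ring.
apply/eqP; rewrite eq_complex !(ReD, ImD, ReM, ImM) /=.
apply/andP; split; apply/eqP; ring.
Qed.

Lemma CD_id t : CD t (fun s => s%:C) (fun _ => 1).
Proof. by apply: (CD_real t (u := id) (u' := fun=> 1)) => s; exact: is_derive_id. Qed.

Lemma CD_sub t t' f f' : t' <= t -> CD t f f' -> CD t' f f'.
Proof.
move=> tt' [h1 h2 h3]; split.
- by apply: continuous_subspaceW h1; apply: subset_itvl; rewrite bnd_simp.
- by apply: continuous_subspaceW h2; apply: subset_itvl; rewrite bnd_simp.
- by move=> s /andP[s0 st]; apply: h3; rewrite s0 (lt_le_trans st).
Qed.

(** Mean value inequality for vector-valued functions: testing against the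
    increment itself reduces it to the scalar mean value theorem, so that the
    derivative need be neither continuous nor integrable. *)
Lemma MVT_sum n t (F F' : 'I_n -> R -> R[i]) (r : 'I_n -> R) B : 0 <= t ->
  (forall i, CD t (F i) (F' i)) -> 0 <= B ->
  (forall s, 0 < s < t -> \sum_(i < n) (r i * normc (F' i s)) ^+ 2 <= B ^+ 2) ->
  \sum_(i < n) (r i * normc (F i t - F i 0)) ^+ 2 <= (t * B) ^+ 2.
Proof.
rewrite le_eqVlt => /predU1P[<-|t0] hF B0 hB.
  rewrite mul0r expr0n /= big1 // => i _.
  by rewrite subrr ComplexField.Normc.normc0 mulr0 expr0n.
pose D i := F i t - F i 0.
pose g s := \sum_(i < n) r i ^+ 2 * Re ((D i)^* * F i s).
pose g' s := \sum_(i < n) r i ^+ 2 * Re ((D i)^* * F' i s).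
have hG : CD t (fun s => \sum_(i < n) (r i ^+ 2)%:C * ((D i)^* * F i s))
    (fun s => \sum_(i < n) (r i ^+ 2)%:C * ((D i)^* * F' i s)).
  by apply: CD_sum => i _; apply: CD_Z; exact: CD_Z.
have gE s : g s = Re (\sum_(i < n) (r i ^+ 2)%:C * ((D i)^* * F i s)).
  by rewrite Re_sum; apply: eq_bigr => i _; rewrite [in RHS]ReM /= mul0r subr0.
have g'E s : g' s = Re (\sum_(i < n) (r i ^+ 2)%:C * ((D i)^* * F' i s)).
  by rewrite Re_sum; apply: eq_bigr => i _; rewrite [in RHS]ReM /= mul0r subr0.
have [c ct] : exists2 c, c \in `]0, t[ & g t - g 0 = g' c * (t - 0).
  apply: MVT => //.
    move=> s; rewrite in_itv /= => hs.
    rewrite g'E (funext gE); exact: (CD_der hG hs).1.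
  by rewrite (funext gE); exact: CD_re hG.
set S := \sum_(i < n) (r i * normc (F i t - F i 0)) ^+ 2.
have -> : g t - g 0 = S.
  rewrite /g -sumrB /S; apply: eq_bigr => i _; rewrite exprMn normcE2 -mulrBr; congr (_ * _).
  by rewrite -ReB -mulrBr -/(D i) ReM ReJ ImJ; ring.
rewrite subr0 => eS.
have S0 : 0 <= S by apply: sumr_ge0 => i _; exact: sqr_ge0.
have hg' : g' c ^+ 2 <= S * B ^+ 2.
  have : `|g' c| <= \sum_(i < n) (r i * normc (D i)) * (r i * normc (F' i c)).
    apply: (le_trans (ler_norm_sum _ _ _)); apply: ler_sum => i _.
    rewrite normrM ger0_norm ?sqr_ge0 // mulrACA -expr2 ler_wpM2l ?sqr_ge0 //.
    by apply: (le_trans (Re_le_normc _)); rewrite normcM normcJ.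
  move=> h; rewrite -real_normK ?num_real //.
  apply: (@le_trans _ _ ((\sum_(i < n) (r i * normc (D i)) * (r i * normc (F' i c))) ^+ 2)).
    by rewrite ler_pXn2r // ?nnegrE //; exact: (le_trans _ h).
  apply: (le_trans (sum_CauchySchwarz _ _ _ _)); rewrite ler_wpM2l //; apply: hB.
  by move: ct; rewrite in_itv.
have : S ^+ 2 <= S * (t * B) ^+ 2.
  have -> : S ^+ 2 = g' c ^+ 2 * t ^+ 2 by rewrite eS exprMn.
  have -> : S * (t * B) ^+ 2 = S * B ^+ 2 * t ^+ 2 by ring.
  by rewrite ler_wpM2r ?sqr_ge0.
move: S0; rewrite le_eqVlt => /predU1P[<- _|S0]; first exact: sqr_ge0.
by rewrite expr2 ler_pM2l.
Qed.

End Differentiation.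

(** * Weighted norms of Fourier coefficients *)
Section WeightedNorms.
Context {R : realType}.
Implicit Types (c d : int -> R[i]) (n s : nat).

(** The window of frequencies of [trig_poly]; it is symmetric up to the extra
    frequency [- n/2] when [n] is even. *)
Definition lidx (n k : nat) : int := k%:Z - (n./2)%:Z.

(** [1 + |l|], a weight that never vanishes. *)
Definition wt (l : int) : R := (absz l).+1%:R.

Definition nrm n s c : R :=
  l2 (fun k : 'I_n => wt (lidx n k) ^+ s * normc (c (lidx n k))).

Lemma wt_ge1 l : 1 <= wt l.
Proof. by rewrite /wt -[leLHS]/(1%:R) ler_nat. Qed.
Lemma wt_gt0 l : 0 < wt l.
Proof. exact: lt_le_trans ltr01 (wt_ge1 l). Qed.
Lemma wt_ge0 l : 0 <= wt l.
Proof. exact: ltW (wt_gt0 l). Qed.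
Lemma wtX_ge0 l s : 0 <= wt l ^+ s.
Proof. by rewrite exprn_ge0 ?wt_ge0. Qed.
Lemma wtX_ge1 l s : 1 <= wt l ^+ s.
Proof. by rewrite exprn_ege1 ?wt_ge1. Qed.
Lemma wtX_mono l s s' : (s <= s')%N -> wt l ^+ s <= wt l ^+ s'.
Proof. by move=> h; rewrite ler_weXn2l // wt_ge1. Qed.

Lemma nrm_ge0 n s c : 0 <= nrm n s c. Proof. exact: l2_ge0. Qed.

Lemma eq_nrm n s c d : (forall k : 'I_n, c (lidx n k) = d (lidx n k)) ->
  nrm n s c = nrm n s d.
Proof. by move=> h; rewrite /nrm /l2; under eq_bigr do rewrite h. Qed.

Lemma nrm_le n s j c d B : 0 <= B ->
  (forall k : 'I_n, normc (c (lidx n k)) <=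
     B * wt (lidx n k) ^+ j * normc (d (lidx n k))) ->
  nrm n s c <= B * nrm n (s + j) d.
Proof.
move=> B0 h; rewrite /nrm -l2Z //; apply: l2_mono => k.
rewrite mulr_ge0 ?wtX_ge0 ?normc_ge0 //= exprD.
apply: (le_trans (ler_wpM2l (wtX_ge0 _ s) (h k))).
by rewrite le_eqVlt; apply/orP; left; apply/eqP; ring.
Qed.

Lemma nrm_le0 n s c d : (forall k : 'I_n, normc (c (lidx n k)) <=
     normc (d (lidx n k))) -> nrm n s c <= nrm n s d.
Proof.
move=> h; have := @nrm_le n s 0 c d 1 ler01; rewrite mul1r addn0; apply => k.
by rewrite mul1r expr0 mul1r.
Qed.

Lemma nrm_mono n s s' c : (s <= s')%N -> nrm n s c <= nrm n s' c.
Proof.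
move=> ss'; apply: l2_mono => k.
by rewrite mulr_ge0 ?wtX_ge0 ?normc_ge0 //= ler_wpM2r ?normc_ge0 ?wtX_mono.
Qed.

Lemma nrmD n s c d : nrm n s (fun l => c l + d l) <= nrm n s c + nrm n s d.
Proof.
apply: (le_trans _ (l2D _ _)); apply: l2_mono => k.
rewrite mulr_ge0 ?wtX_ge0 ?normc_ge0 //= -mulrDr ler_wpM2l ?wtX_ge0 //.
exact: normcD.
Qed.

Lemma nrmN n s c : nrm n s (fun l => - c l) = nrm n s c.
Proof. by rewrite /nrm; congr l2; apply/funext => k; rewrite normcN. Qed.

Lemma nrmB n s c d : nrm n s (fun l => c l - d l) <= nrm n s c + nrm n s d.
Proof. by rewrite -(nrmN n s d); exact: nrmD. Qed.

Lemma nrm_distC n s c d : nrm n s (fun l => c l - d l) = nrm n s (fun l => d l - c l).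
Proof. by rewrite -nrmN; apply: eq_nrm => k; rewrite opprB. Qed.

Lemma nrmZ n s (z : R[i]) c : nrm n s (fun l => z * c l) = normc z * nrm n s c.
Proof.
rewrite /nrm -l2Z ?normc_ge0 //; congr l2; apply/funext => k.
by rewrite normcM; ring.
Qed.

Lemma nrm_unit n s (u : int -> R[i]) c : (forall l, normc (u l) = 1) ->
  nrm n s (fun l => u l * c l) = nrm n s c.
Proof.
move=> h; rewrite /nrm; congr l2; apply/funext => k.
by rewrite normcM h mul1r.
Qed.

Lemma nrm_mul n s (m : int -> R[i]) c B : 0 <= B ->
  (forall k : 'I_n, normc (m (lidx n k)) <= B) ->
  nrm n s (fun l => m l * c l) <= B * nrm n s c.
Proof.
move=> B0 h; rewrite -{2}(addn0 s); apply: nrm_le => // k.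
by rewrite normcM expr0 mulr1 ler_wpM2r ?normc_ge0.
Qed.

(** The form in which every estimate in time is used: it replaces Duhamel
    integrals of the solution. *)
Lemma nrm_MVT n s t (F F' : R -> int -> R[i]) B : 0 <= t -> 0 <= B ->
  (forall k : 'I_n, CD t (fun x => F x (lidx n k)) (fun x => F' x (lidx n k))) ->
  (forall x, 0 < x < t -> nrm n s (F' x) <= B) ->
  nrm n s (fun l => F t l - F 0 l) <= t * B.
Proof.
move=> t0 B0 h1 h2; apply: l2_le; first exact: mulr_ge0.
apply: (MVT_sum (F' := fun k x => F' x (lidx n k)) t0 h1 B0) => x hx.
have := h2 x hx; rewrite /nrm => h.
by rewrite -l2_sq ler_pXn2r // ?nnegrE ?l2_ge0.
Qed.

End WeightedNorms.
Arguments wt {R} l.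

(** * Convolution of Fourier coefficients *)
Section Convolution.
Context {R : realType}.
Implicit Types (A B : int -> R[i]) (f : int -> R).

Lemma lidx_inj n (k k' : nat) : lidx n k = lidx n k' -> k = k'.
Proof. rewrite /lidx; lia. Qed.

(** Sums along an injective family of frequencies are compared with sums over a
    symmetric window; all bounds uniform in the window are used in this way. *)
Lemma sum_inj (I : finType) (P : pred I) (e : I -> int) f (L : nat) :
  {in P &, injective e} -> (forall i, P i -> - L%:Z <= e i < L%:Z) ->
  (forall l, 0 <= f l) ->
  \sum_(i | P i) f (e i) <= \sum_(k < L.*2) f (lidx L.*2 k).
Proof.
move=> einj eL f0.
have [L0|L0] := posnP L.
  rewrite big1 ?sumr_ge0 // => i /eL; rewrite L0 /=; lia.
have Lgt i : P i -> (absz (e i + L%:Z)%R < L.*2)%N by move=> /eL; lia.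
have L2 : (0 < L.*2)%N by lia.
pose h (i : I) : 'I_L.*2 := insubd (Ordinal L2) (absz (e i + L%:Z)%R).
have hE i : P i -> lidx L.*2 (h i) = e i.
  move=> Pi; rewrite /h val_insubd Lgt // /lidx doubleK.
  by have := eL i Pi; lia.
have hinj : {in P &, injective h}.
  by move=> i j Pi Pj hij; apply: einj => //; rewrite -(hE i) // -(hE j) // hij.
rewrite (eq_bigr (fun i => f (lidx L.*2 (h i)))); last by move=> i /hE ->.
rewrite -(big_imset (fun k : 'I_L.*2 => f (lidx L.*2 k)) hinj) /=.
by rewrite [leRHS](bigID (mem (h @: P))) /= lerDl sumr_ge0.
Qed.

Lemma sum_inj_le (I : finType) (P : pred I) (e : I -> int) f C :
  {in P &, injective e} -> (forall l, 0 <= f l) ->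
  (forall L, \sum_(k < L.*2) f (lidx L.*2 k) <= C) ->
  \sum_(i | P i) f (e i) <= C.
Proof.
move=> einj f0 h; apply: le_trans (h (\sum_i (absz (e i)).+1)%N).
apply: sum_inj => // i Pi.
have : (absz (e i) < \sum_i (absz (e i)).+1)%N.
  by rewrite (bigD1 i) //= leq_addr.
lia.
Qed.

Lemma sum_range_recr f L :
  \sum_(k < L.+1.*2) f (lidx L.+1.*2 k) =
  f (- L.+1%:Z) + \sum_(k < L.*2) f (lidx L.*2 k) + f L%:Z.
Proof.
rewrite doubleS big_ord_recl big_ord_recr /= addrA; congr (_ + _ + _).
- by congr f; rewrite /lidx -doubleS doubleK; lia.
- apply: eq_bigr => i _; congr f; rewrite /lidx /bump /= !doubleK; lia.
- by congr f; rewrite /lidx /bump /= doubleK; lia.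
Qed.

(** The weights [(1+|l|)^-2] are summable, which makes H^1 coefficients
    absolutely summable. *)
Lemma sum_wtV2 L : \sum_(k < L.*2) (wt (lidx L.*2 k) ^+ 2)^-1 <= 4 :> R.
Proof.
case: L => [|L]; first by rewrite big_ord0.
apply: (@le_trans _ _ (4 - 2 / L.+1%:R)); last by rewrite gerBl divr_ge0 ?ler0n.
elim: L => [|L IH].
  rewrite (sum_range_recr (fun l => (wt l ^+ 2)^-1)) big_ord0 /wt /=; lra.
rewrite (sum_range_recr (fun l => (wt l ^+ 2)^-1)).
have -> : wt (- L.+2%:Z) = L.+3%:R :> R by rewrite /wt; congr (_%:R); lia.
have -> : wt L.+1%:Z = L.+2%:R :> R by rewrite /wt; congr (_%:R); lia.
have h : (L.+3%:R ^+ 2)^-1 + (L.+2%:R ^+ 2)^-1 <= 2 / L.+1%:R - 2 / L.+2%:R :> R.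
  have -> : 2 / L.+1%:R - 2 / L.+2%:R = 2 / (L.+1%:R * L.+2%:R) :> R.
    rewrite -[L.+2%:R]natr1; have : 0 < L.+1%:R :> R by rewrite ltr0n.
    set x := L.+1%:R => x0; field; rewrite !gt_eqF //; lra.
  have p1 : 0 < L.+1%:R * L.+2%:R :> R by rewrite mulr_gt0 ?ltr0n.
  have h1 : (L.+3%:R ^+ 2)^-1 <= (L.+1%:R * L.+2%:R)^-1 :> R.
    by rewrite lef_pV2 ?posrE ?exprn_gt0 ?ltr0n // expr2 -!natrM ler_nat; lia.
  have h2 : (L.+2%:R ^+ 2)^-1 <= (L.+1%:R * L.+2%:R)^-1 :> R.
    by rewrite lef_pV2 ?posrE ?exprn_gt0 ?ltr0n // expr2 -!natrM ler_nat; lia.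
  by rewrite [leRHS]mulr_natl mulr2n; exact: lerD.
move: IH h; move: (\sum_(_ < _) _) (2 / L.+1%:R) (2 / L.+2%:R) => x y z.
move: (L.+3%:R ^- 2) (L.+2%:R ^- 2) => u v; lra.
Qed.

(** A uniform bound over all windows stands for the norm of the infinite
    sequence, so that no series has to be summed. *)
Definition bnd s A (al : R) : Prop := forall L, nrm L.*2 s A <= al.

Lemma bnd_ge0 s A al : bnd s A al -> 0 <= al.
Proof. by move=> h; exact: le_trans (nrm_ge0 _ _ _) (h 0%N). Qed.

Lemma bnd_mono s s' A al : (s <= s')%N -> bnd s' A al -> bnd s A al.
Proof. by move=> ss' h L; exact: le_trans (nrm_mono _ _ ss') (h L). Qed.

Lemma bnd_le s A al al' : al <= al' -> bnd s A al -> bnd s A al'.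
Proof. by move=> h1 h L; exact: le_trans (h L) h1. Qed.

Lemma bnd_sum (I : finType) (P : pred I) (e : I -> int) s A al :
  {in P &, injective e} -> bnd s A al ->
  \sum_(i | P i) (wt (e i) ^+ s * normc (A (e i))) ^+ 2 <= al ^+ 2.
Proof.
move=> einj h; apply: (sum_inj_le (f := fun l => (wt l ^+ s * normc (A l)) ^+ 2)) => //.
  by move=> l; exact: sqr_ge0.
move=> L; rewrite -l2_sq ler_pXn2r ?nnegrE ?l2_ge0 //; first exact: h.
exact: bnd_ge0 h.
Qed.

Lemma bnd_sum1 (I : finType) (P : pred I) (e : I -> int) A al :
  {in P &, injective e} -> bnd 1 A al ->
  \sum_(i | P i) normc (A (e i)) <= 2 * al.
Proof.
move=> einj h; have al0 := bnd_ge0 h.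
apply: ler_sqr2; first by rewrite mulr_ge0.
rewrite (eq_bigr (fun i => (wt (e i))^-1 * (wt (e i) ^+ 1 * normc (A (e i))))); last first.
  by move=> i _; rewrite mulrA expr1 mulVf ?mul1r // gt_eqF ?wt_gt0.
apply: (le_trans (sum_CauchySchwarz _ _ _ _)); rewrite exprMn.
have -> : 2 ^+ 2 = 4 :> R by ring.
apply: ler_pM.
- by apply: sumr_ge0 => i _; exact: sqr_ge0.
- by apply: sumr_ge0 => i _; exact: sqr_ge0.
- rewrite (eq_bigr (fun i => (wt (e i) ^+ 2)^-1)); last by move=> i _; rewrite exprVn.
  apply: (sum_inj_le (f := fun l => (wt l ^+ 2)^-1)) => //.
    by move=> l; rewrite invr_ge0 wtX_ge0.
  exact: sum_wtV2.
- exact: bnd_sum.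
Qed.

(** The discrete Young inequality l1 * l2 -> l2, by Cauchy-Schwarz with the
    weight [x]. *)
Lemma young_l1 (I J : finType) (x : J -> R) (Y : I -> J -> R) a b :
  (forall j, 0 <= x j) -> 0 <= a -> \sum_j x j <= a ->
  (forall j, \sum_i Y i j ^+ 2 <= b ^+ 2) ->
  \sum_i (\sum_j x j * Y i j) ^+ 2 <= (a * b) ^+ 2.
Proof.
move=> x0 a0 xa Yb.
apply: (@le_trans _ _ (\sum_i (\sum_j x j) * (\sum_j x j * Y i j ^+ 2))).
  apply: ler_sum => i _.
  rewrite (eq_bigr (fun j => Num.sqrt (x j) * (Num.sqrt (x j) * Y i j))); last first.
    by move=> j _; rewrite mulrA -expr2 sqr_sqrtr.
  apply: (le_trans (sum_CauchySchwarz _ _ _ _)).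
  by under eq_bigr do rewrite sqr_sqrtr //; under [X in _ * X]eq_bigr do rewrite exprMn sqr_sqrtr //.
rewrite -mulr_sumr exchange_big /= exprMn expr2 -mulrA.
apply: ler_pM => //; first exact: sumr_ge0.
  by apply: sumr_ge0 => j _; apply: sumr_ge0 => i _; rewrite mulr_ge0 ?sqr_ge0.
apply: (@le_trans _ _ (\sum_j x j * b ^+ 2)).
  by apply: ler_sum => j _; rewrite -mulr_sumr ler_wpM2l.
by rewrite -mulr_suml ler_wpM2r ?sqr_ge0.
Qed.

(** The same inequality with the l1 bound on the kernel: its row and column
    sums are bounded (Schur test). *)
Lemma young_l2 (I J : finType) (x : J -> R) (Y : I -> J -> R) a b :
  (forall i j, 0 <= Y i j) -> 0 <= b -> \sum_j x j ^+ 2 <= a ^+ 2 ->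
  (forall i, \sum_j Y i j <= b) -> (forall j, \sum_i Y i j <= b) ->
  \sum_i (\sum_j x j * Y i j) ^+ 2 <= (a * b) ^+ 2.
Proof.
move=> Y0 b0 xa Y1 Y2.
apply: (@le_trans _ _ (\sum_i b * (\sum_j x j ^+ 2 * Y i j))).
  apply: ler_sum => i _.
  rewrite (eq_bigr (fun j => Num.sqrt (Y i j) * (x j * Num.sqrt (Y i j)))); last first.
    by move=> j _; rewrite mulrCA -expr2 sqr_sqrtr.
  apply: (le_trans (sum_CauchySchwarz _ _ _ _)).
  under eq_bigr do rewrite sqr_sqrtr //.
  under [X in _ * X]eq_bigr do rewrite exprMn sqr_sqrtr //.
  rewrite ler_wpM2r //; apply: sumr_ge0 => j _; rewrite mulr_ge0 ?sqr_ge0 //.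
rewrite -mulr_sumr exchange_big /= exprMn mulrC expr2 mulrA.
rewrite ler_wpM2r //.
apply: (@le_trans _ _ (\sum_j x j ^+ 2 * b)).
  by apply: ler_sum => j _; rewrite -mulr_sumr ler_wpM2l ?sqr_ge0.
by rewrite -mulr_suml ler_wpM2r.
Qed.

Definition conv (M : nat) A B (l : int) : R[i] :=
  \sum_(j < M.*2) A (lidx M.*2 j) * B (l - lidx M.*2 j).

(** Peetre-type inequality: it distributes a weight on the two factors of a
    convolution. *)
Lemma wt_sub l j : wt l <= wt j + wt (l - j) :> R.
Proof. by rewrite /wt -natrD ler_nat; lia. Qed.

Lemma exprD_le2 (x y : R) s : 0 <= x -> 0 <= y ->
  (x + y) ^+ s <= 2 ^+ s * (x ^+ s + y ^+ s).
Proof.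
move=> x0 y0; wlog xy : x y x0 y0 / x <= y => [h|].
  have [xy|/ltW yx] := leP x y; first exact: h.
  by rewrite addrC (addrC (x ^+ s)); exact: h.
apply: (@le_trans _ _ ((2 * y) ^+ s)).
  rewrite lerXn2r ?nnegrE ?addr_ge0 ?mulr_ge0 //; lra.
by rewrite exprMn ler_wpM2l ?exprn_ge0 // lerDr exprn_ge0.
Qed.

(** H^s is an algebra for [s >= 1]: the weight falls on one of the factors, which
    stays in l2, and the other one is absolutely summable. *)
Lemma conv_bnd s M A B al be : (1 <= s)%N -> bnd s A al -> bnd s B be ->
  bnd s (conv M A B) (2 ^+ s.+2 * al * be).
Proof.
move=> s1 hA hB L; have al0 := bnd_ge0 hA; have be0 := bnd_ge0 hB.
have hA1 := bnd_mono s1 hA; have hB1 := bnd_mono s1 hB.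
pose n := L.*2; pose m := M.*2.
pose l (i : 'I_n) := lidx n i; pose p (j : 'I_m) := lidx m j.
have inj1 (i : 'I_n) : injective (fun j : 'I_m => l i - p j).
  by move=> j j' h; apply/ord_inj/(@lidx_inj m); move: h; rewrite /p /=; lia.
have inj2 (j : 'I_m) : injective (fun i : 'I_n => l i - p j).
  by move=> i i' h; apply/ord_inj/(@lidx_inj n); move: h; rewrite /l /=; lia.
have inj3 : injective p by move=> i i' h; apply/ord_inj/(@lidx_inj m).
pose T1 (i : 'I_n) := \sum_(j < m) (wt (p j) ^+ s * normc (A (p j))) * normc (B (l i - p j)).
pose T2 (i : 'I_n) := \sum_(j < m) normc (A (p j)) * (wt (l i - p j) ^+ s * normc (B (l i - p j))).
have h1 : l2 T1 <= al * (2 * be).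
  apply: l2_le; first by rewrite !mulr_ge0.
  apply: young_l2.
  - by move=> *; exact: normc_ge0.
  - by rewrite mulr_ge0.
  - by apply: (@bnd_sum _ predT) => // i j _ _; exact: inj3.
  - by move=> i; apply: (@bnd_sum1 _ predT (fun j => l i - p j)) => // x y _ _; exact: inj1.
  - by move=> j; apply: (@bnd_sum1 _ predT (fun i => l i - p j)) => // x y _ _; exact: inj2.
have h2 : l2 T2 <= (2 * al) * be.
  apply: l2_le; first by rewrite !mulr_ge0.
  apply: young_l1.
  - by move=> *; exact: normc_ge0.
  - by rewrite mulr_ge0.
  - by apply: (@bnd_sum1 _ predT p) => // i j _ _; exact: inj3.
  - by move=> j; apply: (@bnd_sum _ predT (fun i => l i - p j)) => // x y _ _; exact: inj2.
have h3 : nrm n s (conv M A B) <= 2 ^+ s * l2 (fun i => T1 i + T2 i).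
  rewrite /nrm -l2Z ?exprn_ge0 //; apply: l2_mono => i.
  rewrite mulr_ge0 ?wtX_ge0 ?normc_ge0 //= -/(l i).
  rewrite /T1 /T2 -big_split mulr_sumr /=.
  apply: (@le_trans _ _ (\sum_(j < m) wt (l i) ^+ s * (normc (A (p j)) * normc (B (l i - p j))))).
    rewrite -mulr_sumr ler_wpM2l ?wtX_ge0 //.
    by apply: (le_trans (normc_sum _ _ _)); apply: ler_sum => j _; rewrite normcM.
  apply: ler_sum => j _.
  have -> : wt (p j) ^+ s * normc (A (p j)) * normc (B (l i - p j)) +
    normc (A (p j)) * (wt (l i - p j) ^+ s * normc (B (l i - p j))) =
    (wt (p j) ^+ s + wt (l i - p j) ^+ s) * (normc (A (p j)) * normc (B (l i - p j))) by ring.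
  rewrite mulrA ler_wpM2r ?mulr_ge0 ?normc_ge0 //.
  apply: le_trans (exprD_le2 _ (wt_ge0 _) (wt_ge0 _)).
  by rewrite lerXn2r ?nnegrE ?addr_ge0 ?wt_ge0 // wt_sub.
apply: (le_trans h3); apply: (@le_trans _ _ (2 ^+ s * (al * (2 * be) + 2 * al * be))).
  by rewrite ler_wpM2l ?exprn_ge0 // (le_trans (l2D _ _)) // lerD.
by rewrite le_eqVlt; apply/orP; left; apply/eqP; rewrite !exprS; ring.
Qed.

(** Low frequencies, those of the window; [hi] is the tail. *)
Definition lo (n : nat) A (l : int) : R[i] :=
  if - (n./2)%:Z <= l < n%:Z - (n./2)%:Z then A l else 0.

Lemma lo_idx n A (k : 'I_n) : lo n A (lidx n k) = A (lidx n k).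
Proof. by rewrite /lo ifT //; have := ltn_ord k; rewrite /lidx; lia. Qed.

Lemma lo_bnd n s A : ~~ odd n -> bnd s (lo n A) (nrm n s A).
Proof.
move=> ne L; have nE : n = (n./2).*2 by rewrite halfK (negbTE ne) subn0.
apply: l2_le; first exact: nrm_ge0.
rewrite /nrm l2_sq.
pose P (k : 'I_L.*2) := - (n./2)%:Z <= lidx L.*2 k < (n./2)%:Z.
rewrite (bigID P) /= [X in _ + X]big1 ?addr0; last first.
  move=> k; rewrite /P /lo => /negbTE h.
  rewrite ifF ?ComplexField.Normc.normc0 ?mulr0 ?expr0n //.
  by move: h; lia.
rewrite (eq_bigr (fun k : 'I_L.*2 => (fun l => (wt l ^+ s * normc (A l)) ^+ 2) (lidx L.*2 k))); last first.
  by move=> k; rewrite /P /lo /= => h; rewrite ifT //; move: h; lia.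
have h : \sum_(k < L.*2 | P k) (fun l => (wt l ^+ s * normc (A l)) ^+ 2) (lidx L.*2 k) <=
   \sum_(k < (n./2).*2) (wt (lidx (n./2).*2 k) ^+ s * normc (A (lidx (n./2).*2 k))) ^+ 2.
  apply: (sum_inj (f := fun l => (wt l ^+ s * normc (A l)) ^+ 2)) => //.
    by move=> k k' _ _ h; apply/ord_inj/(@lidx_inj L.*2).
  by move=> l; exact: sqr_ge0.
by apply: (le_trans h); rewrite -nE.
Qed.

Definition hi (n : nat) A (l : int) : R[i] := A l - lo n A l.

(** Outside the window the weight is at least [n/2], and each spare power of it is
    worth a factor [2/n]. *)
Lemma hi_bnd n m r A al : ~~ odd n -> (0 < n)%N -> (r <= m)%N ->
  bnd m A al -> bnd r (hi n A) (al * (2 / n%:R) ^+ (m - r)).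
Proof.
move=> ne n0 rm hA L.
have c0 : 0 <= (2 / n%:R : R) by rewrite divr_ge0.
rewrite mulrC; apply: (@le_trans _ _ ((2 / n%:R) ^+ (m - r) * nrm L.*2 m A)); last first.
  by rewrite ler_wpM2l ?exprn_ge0.
rewrite -{2}(subnKC rm); apply: nrm_le; first exact: exprn_ge0.
move=> k; set l := lidx _ _; rewrite /hi /lo.
case: ifPn => [_|h].
  by rewrite subrr ComplexField.Normc.normc0 !mulr_ge0 ?exprn_ge0 ?wt_ge0 ?normc_ge0.
rewrite subr0 -exprMn ler_peMl ?normc_ge0 // exprn_ege1 //.
rewrite mulrAC ler_pdivlMr ?ltr0n // mul1r /wt -natrM ler_nat.
by move: h; lia.
Qed.

End Convolution.

(** * The discrete Fourier transform and products on the grid *)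
Section CisTwoPi.
Context {R : realType}.

Lemma cis_2pi (m : int) : cis (2 * pi * m%:~R : R) = 1.
Proof.
have hn (n : nat) : cis (2 * pi * n%:R : R) = 1.
  elim: n => [|n IH]; first by rewrite mulr0 cis0.
  rewrite -[n.+1%:R]natr1 mulrDr mulr1 cisD IH mul1r mulr_natl.
  by rewrite /cis cos2pi sin2pi.
case: m => n; first by rewrite -pmulrn hn.
by rewrite NegzE mulrNz mulrN cisN -pmulrn hn conjc1.
Qed.

Lemma cis_neq1 (x : R) : 0 < x < 2 * pi -> cis x != 1.
Proof.
move=> /andP[x0 x2]; apply/negP => /eqP h.
have hc : cos x = 1 by have := congr1 (@complex.Re R) h.
have hs : 0 < sin (x / 2).
  apply: sin_gt0_pi; lra.
have : cos ((x / 2) *+ 2) = 1.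
  by rewrite -[RHS]hc; congr cos; rewrite -[_ *+ 2]mulr_natr divfK.
rewrite cos_mulr2n cos2sin2; nra.
Qed.

End CisTwoPi.

Section Characters.
Context {R : realType} (a b : R).
Implicit Types (l m q : int).

Definition chi l (x : R) : R[i] := cis (mu a b l * (x - a)).

Lemma muD l m : mu a b (l + m) = mu a b l + mu a b m.
Proof. by rewrite /mu intrD; ring. Qed.
Lemma muN l : mu a b (- l) = - mu a b l.
Proof. by rewrite /mu mulrNz; ring. Qed.
Lemma mu0 : mu a b 0 = 0.
Proof. by rewrite /mu mulr0 mul0r. Qed.

Lemma chiD l m x : chi (l + m) x = chi l x * chi m x.
Proof. by rewrite /chi muD mulrDl cisD. Qed.
Lemma chiN l x : chi (- l) x = (chi l x)^*.
Proof. by rewrite /chi muN mulNr cisN. Qed.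
Lemma chi0 x : chi 0 x = 1.
Proof. by rewrite /chi mu0 mul0r cis0. Qed.
Lemma normc_chi l x : normc (chi l x) = 1.
Proof. exact: normc_cis. Qed.

End Characters.

Lemma dvd_small (N : nat) (x : int) : (N%:Z %| x)%Z -> - N%:Z < x < N%:Z -> x = 0.
Proof.
move=> /dvdzP[q ->] h; have : q <= -1 \/ q = 0 \/ 1 <= q by lia.
by case=> [q1|[->|q1]]; [nia|rewrite mul0r|nia].
Qed.

Section DFT.
Context {R : realType} (a b : R) (ab : a < b) (N : nat) (N0 : (0 < N)%N).
Implicit Types (l m q : int) (v : @grid R N).
Local Notation node := (node a b N).
Local Notation dft := (@dft R a b N).
Local Notation chi := (@chi R a b).
Local Notation vec := (@grid_of_coef R a b N).

Let ba0 : b - a != 0. Proof. by rewrite subr_eq0 gt_eqF. Qed.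
Let Nn0 : N%:R != 0 :> R. Proof. by rewrite pnatr_eq0 -lt0n. Qed.
Let Nc0 : N%:R != 0 :> R[i]. Proof. by rewrite pnatr_eq0 -lt0n. Qed.

Lemma mu_node l (j : nat) : mu a b l * (node j - a) = 2 * pi * (l%:~R * j%:R) / N%:R.
Proof. by rewrite /mu /node /mesh; field; rewrite Nn0 ba0. Qed.

Lemma chi_mulN q (j : nat) : chi (q * N%:Z) (node j) = 1.
Proof.
rewrite /chi mu_node -(cis_2pi (q * j%:Z)); congr cis.
by rewrite !intrM -!pmulrn; field.
Qed.

Lemma chi_node l (j : nat) : chi l (node j) = cis (2 * pi * l%:~R / N%:R) ^+ j.
Proof.
elim: j => [|j IH]; first by rewrite expr0 /chi mu_node mulr0 mulr0 mul0r cis0.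
rewrite exprS -IH /chi !mu_node -cisD; congr cis.
by rewrite -natr1; field.
Qed.

(** The characters are orthogonal on the grid up to aliasing: frequencies that
    differ by a multiple of [N] coincide at the nodes. *)
Lemma sum_chi l : \sum_(j < N) chi l (node j) = if (N%:Z %| l)%Z then N%:R else 0.
Proof.
case: ifPn => h.
  move/dvdzP: h => [q ->]; rewrite (eq_bigr (fun=> 1)).
    by rewrite sumr_const card_ord.
  by move=> j _; rewrite chi_mulN.
set z := cis (2 * pi * l%:~R / N%:R : R).
rewrite (eq_bigr (fun j : 'I_N => z ^+ j)); last by move=> j _; rewrite chi_node.
have z1 : z != 1.
  have rn0 : (l %% N%:Z)%Z != 0 by apply: contra h => /eqP/dvdz_mod0P.
  have N0' : N%:Z != 0 by lia.
  have r0 := modz_ge0 l N0'.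
  have rN := ltz_pmod l (_ : 0 < N%:Z).
  set r := (l %% N%:Z)%Z in rn0 r0 rN.
  have -> : z = cis (2 * pi * r%:~R / N%:R : R).
    rewrite /z {1}(divz_eq l N%:Z) -/r intrD intrM -pmulrn.
    have -> : 2 * pi * ((l %/ N)%Z%:~R * N%:R + r%:~R) / N%:R =
      2 * pi * (l %/ N)%Z%:~R + 2 * pi * r%:~R / N%:R :> R by field.
    by rewrite cisD cis_2pi mul1r.
  apply: cis_neq1.
  have r0' : 0 < r%:~R :> R by rewrite ltr0z lt_neqAle eq_sym rn0.
  have rN' : r%:~R < N%:R :> R by rewrite pmulrn ltr_int rN //; lia.
  rewrite !mulr_gt0 ?pi_gt0 ?invr_gt0 ?ltr0n //=.
  rewrite ltr_pdivrMr ?ltr0n // ltr_pM2l // mulr_gt0 ?pi_gt0 //; lra.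
have : (z - 1) * (\sum_(j < N) z ^+ j) = 0.
  rewrite -subrX1 -chi_node.
  have := chi_mulN l 1; rewrite /chi !mu_node => h1.
  have -> : 2 * pi * (l%:~R * N%:R) / N%:R = 2 * pi * ((l * N)%:~R * 1%:R) / N%:R :> R.
    by rewrite intrM -pmulrn mulr1.
  by rewrite h1 subrr.
by move/eqP; rewrite mulf_eq0 subr_eq0 (negbTE z1) => /eqP.
Qed.

Lemma dftE v l : dft v l = N%:R^-1 * \sum_(j < N) v (widen_ord (leqnSn N) j) * chi (- l) (node j).
Proof. by rewrite /Defs.dft; congr (_ * _); apply: eq_bigr => j _; rewrite /chi muN mulNr. Qed.

Lemma dft_ext v w l : (forall j : 'I_N, v (widen_ord (leqnSn N) j) = w (widen_ord (leqnSn N) j)) ->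
  dft v l = dft w l.
Proof. by move=> h; rewrite !dftE; congr (_ * _); apply: eq_bigr => j _; rewrite h. Qed.

Lemma dftD v w l : dft (fun j => v j + w j) l = dft v l + dft w l.
Proof. by rewrite !dftE -mulrDr -big_split; congr (_ * _); apply: eq_bigr => j _; rewrite mulrDl. Qed.

Lemma dftZ z v l : dft (fun j => z * v j) l = z * dft v l.
Proof.
rewrite !dftE [RHS]mulrCA [z * _]mulr_sumr; congr (_ * _); apply: eq_bigr => j _; ring.
Qed.

Lemma dftN v l : dft (fun j => - v j) l = - dft v l.
Proof. by rewrite -mulN1r -dftZ; apply: dft_ext => j; rewrite mulN1r. Qed.

Lemma dftB v w l : dft (fun j => v j - w j) l = dft v l - dft w l.
Proof. by rewrite dftD dftN. Qed.

Lemma dft_sum (I : Type) (r : seq I) (P : pred I) (F : I -> grid N) l :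
  dft (fun j => \sum_(i <- r | P i) F i j) l = \sum_(i <- r | P i) dft (F i) l.
Proof.
elim: r => [|i r IH].
  rewrite big_nil -[RHS](mul0r (dft (fun=> 0) l)) -dftZ; apply: dft_ext => j.
  by rewrite big_nil mulr0.
rewrite big_cons; case: ifPn => Pi; rewrite -IH ?(=^~ dftD); apply: dft_ext => j;
  by rewrite big_cons ?Pi ?(negbTE Pi).
Qed.

Lemma dft_chi_mul m v l : dft (fun j => chi m (node j) * v j) l = dft v (l - m).
Proof.
rewrite !dftE; congr (_ * _); apply: eq_bigr => j _ /=.
rewrite opprB chiD; ring.
Qed.

Lemma dft_chi m l : dft (sample a b (chi m)) l = if (N%:Z %| m - l)%Z then 1 else 0.
Proof.
rewrite dftE /sample.
rewrite (eq_bigr (fun j : 'I_N => chi (m - l) (node j))); last first.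
  by move=> j _ /=; rewrite -chiD.
by rewrite sum_chi; case: ifP => _; rewrite ?mulr0 // mulVf.
Qed.

Lemma dft_period q v l : dft v (l + q * N%:Z) = dft v l.
Proof.
rewrite !dftE; congr (_ * _); apply: eq_bigr => j _.
by rewrite opprD chiD -mulNr chi_mulN mulr1.
Qed.

Lemma trig_polyE n c x : trig_poly a b n c x =
  \sum_(k < n) c (lidx n k) * chi (lidx n k) x.
Proof. by []. Qed.

Lemma dft_trig n c l : dft (sample a b (trig_poly a b n c)) l =
  \sum_(k < n | (N%:Z %| lidx n k - l)%Z) c (lidx n k).
Proof.
rewrite (@dft_ext _ (fun j => \sum_(k < n) c (lidx n k) * sample a b (chi (lidx n k)) j)) //.
rewrite dft_sum [RHS]big_mkcond; apply: eq_bigr => k _.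
by rewrite dftZ dft_chi; case: ifP => _; rewrite ?mulr1 ?mulr0.
Qed.

Context (Ne : ~~ odd N).
Let NE : N = (N./2).*2. Proof. by rewrite halfK (negbTE Ne) subn0. Qed.

Lemma sum_alias c m (m0 : - (N./2)%:Z <= m < (N./2)%:Z) :
  \sum_(k < N | (N%:Z %| lidx N k - m)%Z) c (lidx N k) = c m :> R[i].
Proof.
have kN : (absz (m + (N./2)%:Z)%R < N)%N by lia.
have kE : lidx N (Ordinal kN) = m by rewrite /lidx /=; lia.
rewrite (bigD1 (Ordinal kN)) /=; last by rewrite kE subrr dvdz0.
rewrite kE big1 ?addr0 // => k /andP[h1 h2]; case/negP: h2; apply/eqP/val_inj => /=.
have := dvd_small h1; have := ltn_ord k; rewrite /lidx => h3 h4.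
have : k%:Z - (N./2)%:Z - m = 0 by apply: h4; lia.
lia.
Qed.

Lemma dft_vec c (k : 'I_N) : dft (vec c) (lidx N k) = c (lidx N k).
Proof. by rewrite dft_trig sum_alias // /lidx; have := ltn_ord k; lia. Qed.

(** The coefficient of a grid function is periodic in the frequency, whereas its
    window is not; between [-N] and [N] three shifts of the window suffice. *)
Lemma dft_vec_lo c m : - N%:Z <= m <= N%:Z ->
  dft (vec c) m = lo N c m + lo N c (m + N%:Z) + lo N c (m - N%:Z).
Proof.
move=> hm.
have per q x : dft (vec c) x = dft (vec c) (x + q * N%:Z) by rewrite dft_period.
have lo0 x : ~~ (- (N./2)%:Z <= x < (N./2)%:Z) -> lo N c x = 0.
  by rewrite /lo => h; rewrite ifF //; lia.
have lo1 x : (- (N./2)%:Z <= x < (N./2)%:Z) -> lo N c x = dft (vec c) x.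
  by move=> h; rewrite dft_trig sum_alias // /lo ifT //; lia.
have [h|h] := boolP (- (N./2)%:Z <= m < (N./2)%:Z).
  rewrite (lo1 m) // (lo0 (m + N%:Z)); last by move: h; clear -NE N0; lia.
  by rewrite (lo0 (m - N%:Z)) ?addr0 //; move: h; clear -NE N0; lia.
have [h1|h1] := boolP (m < 0).
  rewrite (lo0 m) // (lo0 (m - N%:Z)); last by move: hm h h1; clear -NE N0; lia.
  rewrite add0r addr0 lo1; first by rewrite (per 1 m) mul1r.
  by move: hm h h1; clear -NE N0; lia.
rewrite (lo0 m) // (lo0 (m + N%:Z)); last by move: hm h h1; clear -NE N0; lia.
rewrite !add0r lo1; first by rewrite (per (-1) m) mulN1r.
by move: hm h h1; clear -NE N0; lia.
Qed.

Lemma vec_dft v (j : 'I_N) : vec (dft v) (widen_ord (leqnSn N) j) = v (widen_ord (leqnSn N) j).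
Proof.
set w := widen_ord _ _.
rewrite /grid_of_coef /sample trig_polyE.
rewrite (eq_bigr (fun k : 'I_N => \sum_(i < N) N%:R^-1 * v (widen_ord (leqnSn N) i) *
    (chi (i%:Z - j%:Z) (node (N./2)) * chi (j%:Z - i%:Z) (node k)))); last first.
  move=> k _; rewrite dftE mulr_sumr mulr_suml; apply: eq_bigr => i _.
  have -> : chi (i%:Z - j%:Z) (node (N./2)) * chi (j%:Z - i%:Z) (node k) =
      chi (- lidx N k) (node i) * chi (lidx N k) (node j).
    rewrite /chi !mu_node -!cisD; congr cis.
    by rewrite /lidx !(intrD, mulrNz) -!pmulrn; field.
  by rewrite !mulrA.
rewrite exchange_big /= (bigD1 j) //= [X in _ + X]big1 ?addr0; last first.
  move=> i ij; rewrite -!mulr_sumr sum_chi ifF ?mulr0 //; apply/negP => h.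
  case/negP: ij; apply/eqP/val_inj => /=.
  have := ltn_ord i; have := ltn_ord j => h1 h2.
  have : j%:Z - i%:Z = 0 by apply: dvd_small h _; lia.
  lia.
rewrite -!mulr_sumr sum_chi subrr dvdz0 chi0 mul1r.
by rewrite mulrAC mulVf // mul1r.
Qed.

(** The product of grid functions, on the coefficients: a convolution folded
    modulo [N]. *)
Definition star c d (l : int) : R[i] := dft (fun j => vec c j * vec d j) l.

(** A sum of two frequencies of the window leaves it by at most [N]. *)
Lemma star_conv c d (k : 'I_N) (l := lidx N k) : star c d l =
  conv (N./2) (lo N c) (lo N d) l + conv (N./2) (lo N c) (lo N d) (l + N%:Z)
  + conv (N./2) (lo N c) (lo N d) (l - N%:Z).
Proof.
rewrite /star (@dft_ext _ (fun j => \sum_(i < N) c (lidx N i) * (chi (lidx N i) (node j) * vec d j))); last first.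
  by move=> j; rewrite mulr_suml; apply: eq_bigr => i _; rewrite mulrA.
rewrite dft_sum /conv -NE -!big_split /=; apply: eq_bigr => i _.
rewrite dftZ dft_chi_mul lo_idx -!mulrDr dft_vec_lo; last first.
  by rewrite /l /lidx; have := ltn_ord k; have := ltn_ord i; lia.
by congr (_ * (_ + lo N d _ + lo N d _)); lia.
Qed.

(** Folding a frequency back into the window does not increase its weight. *)
Lemma nrm_fold s (C : int -> R[i]) al q : bnd s C al -> 
  (forall k : 'I_N, wt (lidx N k) <= wt (lidx N k + q) :> R) ->
  nrm N s (fun l => C (l + q)) <= al.
Proof.
move=> hC h; have al0 := bnd_ge0 hC; apply: l2_le => //.
apply: (@le_trans _ _ (\sum_(k < N) (wt (lidx N k + q) ^+ s * normc (C (lidx N k + q))) ^+ 2)).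
  apply: ler_sum => k _; rewrite ler_pXn2r ?nnegrE ?mulr_ge0 ?wtX_ge0 ?normc_ge0 //.
  by rewrite ler_wpM2r ?normc_ge0 // lerXn2r ?nnegrE ?wt_ge0.
apply: (@bnd_sum _ _ predT (fun k : 'I_N => lidx N k + q)) => // i j _ _ hij.
by apply/ord_inj/(@lidx_inj N); move: hij => /=; lia.
Qed.

Lemma wt_fold (k : 'I_N) q : (-1 <= q <= 1) -> wt (lidx N k) <= wt (lidx N k + q * N%:Z) :> R.
Proof.
move=> hq; rewrite /wt ler_nat; have := ltn_ord k; rewrite /lidx.
have : q = 0 \/ q = 1 \/ q = -1 by lia.
by case=> [->|[->|->]]; lia.
Qed.

(** The weighted [l2] spaces of grid vectors are Banach algebras, with a
    constant that does not depend on the number of nodes. *)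
Lemma nrm_star s c d : (1 <= s)%N ->
  nrm N s (star c d) <= 3 * 2 ^+ s.+2 * nrm N s c * nrm N s d.
Proof.
move=> s1; have hC := conv_bnd (N./2) s1 (lo_bnd s c Ne) (lo_bnd s d Ne).
set C := conv _ _ _ in hC.
rewrite (@eq_nrm _ _ _ _ (fun l => C (l + 0 * N%:Z) + C (l + 1 * N%:Z) + C (l + (-1) * N%:Z))); last first.
  by move=> k; rewrite star_conv mul0r addr0 mul1r mulN1r.
have h q : -1 <= q <= 1 -> nrm N s (fun l => C (l + q * N%:Z)) <= 2 ^+ s.+2 * nrm N s c * nrm N s d.
  by move=> hq; apply: nrm_fold => // k; exact: wt_fold.
apply: (le_trans (nrmD _ _ _ _)).
have h0 := le_trans (nrmD N s (fun l => C (l + 0 * N%:Z)) (fun l => C (l + 1 * N%:Z)))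
  (lerD (h 0 isT) (h 1 isT)).
apply: (le_trans (lerD h0 (h (-1) isT))).
by rewrite le_eqVlt; apply/orP; left; apply/eqP; ring.
Qed.

Lemma vecD c d j : vec (fun l => c l + d l) j = vec c j + vec d j.
Proof.
by rewrite /grid_of_coef /sample !trig_polyE -big_split; apply: eq_bigr => k _; rewrite mulrDl.
Qed.

Lemma vecZ z c j : vec (fun l => z * c l) j = z * vec c j.
Proof.
by rewrite /grid_of_coef /sample !trig_polyE mulr_sumr; apply: eq_bigr => k _; rewrite mulrA.
Qed.

Lemma vecB c d j : vec (fun l => c l - d l) j = vec c j - vec d j.
Proof. by rewrite vecD; congr (_ + _); rewrite -mulN1r -vecZ; congr (vec _ j); apply/funext => l; rewrite mulN1r. Qed.

Lemma vec_ext c d j : (forall k : 'I_N, c (lidx N k) = d (lidx N k)) -> vec c j = vec d j.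
Proof. by move=> h; rewrite /grid_of_coef /sample !trig_polyE; apply: eq_bigr => k _; rewrite h. Qed.

Lemma starC c d l : star c d l = star d c l.
Proof. by rewrite /star; apply: dft_ext => j; rewrite mulrC. Qed.

Lemma star_ext c c' d d' l : (forall k : 'I_N, c (lidx N k) = c' (lidx N k)) ->
  (forall k : 'I_N, d (lidx N k) = d' (lidx N k)) -> star c d l = star c' d' l.
Proof. by move=> h h'; apply: dft_ext => j; rewrite (vec_ext _ h) (vec_ext _ h'). Qed.

Lemma starDl c c' d l : star (fun x => c x + c' x) d l = star c d l + star c' d l.
Proof. by rewrite /star -dftD; apply: dft_ext => j; rewrite vecD mulrDl. Qed.
Lemma starBl c c' d l : star (fun x => c x - c' x) d l = star c d l - star c' d l.
Proof. by rewrite /star -dftB; apply: dft_ext => j; rewrite vecB mulrBl. Qed.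
Lemma starZl z c d l : star (fun x => z * c x) d l = z * star c d l.
Proof. by rewrite /star -dftZ; apply: dft_ext => j; rewrite vecZ mulrA. Qed.
Lemma starDr c d d' l : star c (fun x => d x + d' x) l = star c d l + star c d' l.
Proof. by rewrite starC starDl !(starC c). Qed.
Lemma starBr c d d' l : star c (fun x => d x - d' x) l = star c d l - star c d' l.
Proof. by rewrite starC starBl !(starC c). Qed.
Lemma starZr z c d l : star c (fun x => z * d x) l = z * star c d l.
Proof. by rewrite starC starZl (starC c). Qed.

Lemma CD_vec t (u u' : R -> int -> R[i]) j :
  (forall k : 'I_N, CD t (fun s => u s (lidx N k)) (fun s => u' s (lidx N k))) ->
  CD t (fun s => vec (u s) j) (fun s => vec (u' s) j).
Proof.
move=> h; apply: CD_sum => k _.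
apply: CD_eq (CD_M (h k) (CD_cst t _)) _ => s _ /=.
by rewrite mulr0 addr0.
Qed.

Lemma CD_dft t (u u' : R -> grid N) l :
  (forall j : 'I_N.+1, CD t (fun s => u s j) (fun s => u' s j)) ->
  CD t (fun s => dft (u s) l) (fun s => dft (u' s) l).
Proof.
move=> h; apply: CD_Z; apply: CD_sum => j _.
apply: CD_eq (CD_M (h _) (CD_cst t _)) _ => s _ /=.
by rewrite mulr0 addr0.
Qed.

Lemma CD_star t (u u' w w' : R -> int -> R[i]) l :
  (forall k : 'I_N, CD t (fun s => u s (lidx N k)) (fun s => u' s (lidx N k))) ->
  (forall k : 'I_N, CD t (fun s => w s (lidx N k)) (fun s => w' s (lidx N k))) ->
  CD t (fun s => star (u s) (w s) l) (fun s => star (u' s) (w s) l + star (u s) (w' s) l).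
Proof.
move=> hu hw.
apply: CD_eq (CD_dft l (u' := fun s j => vec (u' s) j * vec (w s) j + vec (u s) j * vec (w' s) j) _) _.
  by move=> j; apply: CD_M; exact: CD_vec.
by move=> s _; rewrite dftD.
Qed.

(** Conjugation of grid functions, on the coefficients. *)
Definition cj c (l : int) : R[i] := dft (fun j => (vec c j)^*) l.

Lemma dft_conj v l : dft (fun j => (v j)^*) l = (dft v (- l))^*.
Proof.
rewrite !dftE [RHS]conjcM; congr (_ * _); first by rewrite conjc_inv conjc_nat.
rewrite [RHS]conjc_sum; apply: eq_bigr => j _.
by rewrite [RHS]conjcM opprK chiN.
Qed.

Lemma vec_cj c (j : 'I_N) (w := widen_ord (leqnSn N) j) : vec (cj c) w = (vec c w)^*.
Proof. exact: vec_dft. Qed.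

Lemma oppk_subproof (k : 'I_N) : ((N - k) %% N < N)%N.
Proof. by rewrite ltn_mod. Qed.
(** The index of the opposite frequency modulo [N]; [-N/2] is its own opposite. *)
Definition oppk (k : 'I_N) : 'I_N := Ordinal (oppk_subproof k).

Lemma lidx_oppk (k : 'I_N) : exists2 q : int, - lidx N k = lidx N (oppk k) + q * N%:Z & -1 <= q <= 1.
Proof.
have kN := ltn_ord k; have [k0|k0] := posnP k.
  by exists 1 => //; rewrite /lidx /oppk /= k0 subn0 modnn; move: NE; clear; lia.
exists 0 => //; rewrite /lidx /oppk /= modn_small; last by lia.
by move: NE kN; clear; lia.
Qed.

Lemma oppkK : involutive oppk.
Proof.
move=> k; apply/val_inj => /=; have kN := ltn_ord k.
have [k0|k0] := posnP k; first by rewrite k0 subn0 modnn subn0 modnn.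
by rewrite (modn_small (m := N - k)) ?subKn ?modn_small //; lia.
Qed.

Lemma cj_idx c (k : 'I_N) : cj c (lidx N k) = (c (lidx N (oppk k)))^*.
Proof. by rewrite /cj dft_conj; have [q -> _] := lidx_oppk k; rewrite dft_period dft_vec. Qed.

Lemma wt_oppk (k : 'I_N) : wt (lidx N (oppk k)) = wt (lidx N k) :> R.
Proof.
have kN := ltn_ord k; rewrite /wt; congr (_%:R); congr S.
have [k0|k0] := posnP k; first by rewrite /lidx /oppk /= k0 subn0 modnn.
rewrite /lidx /oppk /= modn_small; last by lia.
by move: NE kN; clear; lia.
Qed.

Lemma nrm_cj s c : nrm N s (cj c) = nrm N s c.
Proof.
rewrite /nrm /l2; congr Num.sqrt; rewrite [RHS](reindex_inj (inv_inj oppkK)) /=.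
by apply: eq_bigr => k _; rewrite cj_idx normcJ wt_oppk.
Qed.

Lemma cj_ext c d l : (forall k : 'I_N, c (lidx N k) = d (lidx N k)) -> cj c l = cj d l.
Proof. by move=> h; apply: dft_ext => j; rewrite (vec_ext _ h). Qed.
Lemma cjB c d l : cj (fun x => c x - d x) l = cj c l - cj d l.
Proof. by rewrite /cj -dftB; apply: dft_ext => j; rewrite vecB conjcB. Qed.
Lemma cjZ z c l : cj (fun x => z * c x) l = z^* * cj c l.
Proof. by rewrite /cj -dftZ; apply: dft_ext => j; rewrite vecZ conjcM. Qed.

Lemma CD_cj t (u u' : R -> int -> R[i]) l :
  (forall k : 'I_N, CD t (fun s => u s (lidx N k)) (fun s => u' s (lidx N k))) ->
  CD t (fun s => cj (u s) l) (fun s => cj (u' s) l).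
Proof. by move=> h; apply: CD_dft => j; apply: CD_conj; exact: CD_vec. Qed.

End DFT.

(** * Aliasing errors *)
Section Limits.
Context {R : realType}.

(** Termwise convergence is enough: limits are only taken in norms over finite
    windows. *)
Definition clim (X : nat -> int -> R[i]) (Y : int -> R[i]) : Prop :=
  forall l (de : R), 0 < de -> exists M0 : nat, forall M, (M0 <= M)%N -> normc (Y l - X M l) <= de.

Lemma nrm_lim n s X Y Z (B : R) (M1 : nat) : clim X Y ->
  (forall M, (M1 <= M)%N -> nrm n s (fun l => X M l - Z l) <= B) ->
  nrm n s (fun l => Y l - Z l) <= B.
Proof.
move=> hX hB; pose K := nrm n s (fun _ => 1 : R[i]).
have K0 : 0 <= K by exact: nrm_ge0.
apply/ler_addgt0Pr => e e0.
pose de := e / (K + 1).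
have de0 : 0 < de by rewrite divr_gt0 // ltr_wpDl.
have [M0 hM0] := choice (fun k : 'I_n => hX (lidx n k) de de0).
pose M := maxn M1 (\max_(k < n) M0 k).
have h1 : nrm n s (fun l => Y l - X M l) <= de * K.
  rewrite /K -{2}(addn0 s); apply: nrm_le; first exact: ltW.
  move=> k; rewrite expr0 mulr1 ComplexField.Normc.normc1 mulr1; apply: hM0.
  by rewrite /M leq_max; apply/orP; right; exact: leq_bigmax.
have h2 : nrm n s (fun l => X M l - Z l) <= B by apply: hB; exact: leq_maxl.
rewrite (@eq_nrm _ _ _ _ (fun l => (Y l - X M l) + (X M l - Z l))); last by move=> k; ring.
apply: (le_trans (nrmD _ _ _ _)); rewrite addrC; apply: lerD => //.
apply: (le_trans h1); rewrite /de mulrAC ler_pdivrMr ?ltr_wpDl // ler_wpM2l ?(ltW e0) //.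
by rewrite lerDl.
Qed.

Lemma bnd_lim s X Y (B : R) : clim X Y -> (forall M, bnd s (X M) B) -> bnd s Y B.
Proof.
move=> hX hB L.
rewrite (@eq_nrm _ _ _ _ (fun l => Y l - 0)); last by move=> k; rewrite subr0.
apply: (nrm_lim (M1 := 0) hX) => M _.
rewrite (@eq_nrm _ _ _ _ (X M)); last by move=> k; rewrite subr0.
exact: hB.
Qed.

End Limits.

Section Aliasing.
Context {R : realType} (a b : R) (ab : a < b) (N : nat) (N0 : (0 < N)%N) (Ne : ~~ odd N).
Implicit Types (A B F : int -> R[i]).
Local Notation star := (@star R a b N).
Let NE : N = (N./2).*2. Proof. by rewrite halfK (negbTE Ne) subn0. Qed.

Lemma conv_lo M A B l : (N./2 <= M)%N -> conv M (lo N A) B l = conv (N./2) (lo N A) B l.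
Proof.
elim: M => [|M IH]; first by rewrite leqn0 => /eqP ->.
rewrite leq_eqVlt => /predU1P[<- //|]; rewrite ltnS => h; rewrite -IH //.
rewrite /conv doubleS big_ord_recl big_ord_recr /=.
rewrite [X in X * _ + _](_ : _ = 0) ?mul0r ?add0r; last first.
  by rewrite /lo ifF // /lidx -doubleS doubleK; move: h; rewrite NE !doubleK; lia.
rewrite [X in _ + X * _](_ : _ = 0) ?mul0r ?addr0; last first.
  by rewrite /lo ifF // /lidx /bump /= doubleK; move: h; rewrite NE !doubleK; lia.
apply: eq_bigr => i _.
have -> : lidx M.*2.+2 (bump 0 i) = lidx M.*2 i by rewrite /lidx /bump /= !doubleK; lia.
by [].
Qed.

Lemma convBl M A A' B l : conv M (fun l => A l - A' l) B l = conv M A B l - conv M A' B l.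
Proof. by rewrite /conv -sumrB; apply: eq_bigr => j _; rewrite mulrBl. Qed.
Lemma convBr M A B B' l : conv M A (fun l => B l - B' l) l = conv M A B l - conv M A B' l.
Proof. by rewrite /conv -sumrB; apply: eq_bigr => j _; rewrite mulrBr. Qed.

Definition Calias (m : nat) : R := 16 + 2 ^+ m.+3.

(** The coefficients of a product of two smooth functions against those of
    the product on the grid: every discarded or aliased term involves a
    frequency of modulus at least [N/4]. *)
Lemma product_aliasing m A B F al be : (1 <= m)%N -> bnd m A al -> bnd m B be ->
  clim (fun M => conv M A B) F ->
  nrm N 1 (fun l => F l - star A B l) <= Calias m * al * be * (2 / N%:R) ^+ (m - 1).
Proof.
move=> m1 hA hB hF; have al0 := bnd_ge0 hA; have be0 := bnd_ge0 hB.
set et := (2 / N%:R) ^+ (m - 1).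
have hiA := hi_bnd Ne N0 m1 hA; have hiB := hi_bnd Ne N0 m1 hB; rewrite -/et in hiA hiB.
have loA s x : bnd s A x -> bnd s (lo N A) x.
  by move=> h; apply: bnd_le (lo_bnd s A Ne); rewrite {1}NE; exact: h.
have loB s x : bnd s B x -> bnd s (lo N B) x.
  by move=> h; apply: bnd_le (lo_bnd s B Ne); rewrite {1}NE; exact: h.
have hC : bnd m (conv (N./2) (lo N A) (lo N B)) (2 ^+ m.+2 * al * be).
  by apply: conv_bnd => //; [exact: loA|exact: loB].
set C := conv _ _ _ in hC.
have hiC := hi_bnd Ne N0 m1 hC; rewrite -/et in hiC.
apply: (nrm_lim (M1 := N./2) hF) => M hM.
pose T1 := conv M (hi N A) B; pose T2 := conv M (lo N A) (hi N B).
rewrite (@eq_nrm _ _ _ _ (fun l => (T1 l + T2 l) -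
   (hi N C (l + 1 * N%:Z) + hi N C (l + (-1) * N%:Z)))); last first.
  move=> k; rewrite star_conv // -/C /T1 /T2 convBl convBr (conv_lo A (lo N B)) // -/C.
  have hiE q : q = 1 \/ q = -1 -> hi N C (lidx N k + q * N%:Z) = C (lidx N k + q * N%:Z).
    move=> hq; rewrite /hi /lo ifF ?subr0 //; have := ltn_ord k; rewrite /lidx.
    by move: NE; case: hq => ->; clear; lia.
  rewrite (hiE 1 (or_introl erefl)) (hiE (-1) (or_intror erefl)).
  by rewrite mul1r mulN1r; ring.
apply: (le_trans (nrmB _ _ _ _)).
have h1 : nrm N 1 T1 <= 2 ^+ 3 * (al * et) * be.
  by rewrite {1}NE; apply: conv_bnd => //; exact: bnd_mono hB.
have h2 : nrm N 1 T2 <= 2 ^+ 3 * al * (be * et).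
  by rewrite {1}NE; apply: conv_bnd => //; apply: loA; exact: bnd_mono hA.
have h3 q : -1 <= q <= 1 -> nrm N 1 (fun l => hi N C (l + q * N%:Z)) <= 2 ^+ m.+2 * al * be * et.
  by move=> hq; apply: nrm_fold => // k; exact: wt_fold.
have h4 := le_trans (nrmD N 1 T1 T2) (lerD h1 h2).
have h5 := le_trans (nrmD N 1 (fun l => hi N C (l + 1 * N%:Z)) (fun l => hi N C (l + (-1) * N%:Z)))
  (lerD (h3 1 isT) (h3 (-1) isT)).
apply: (le_trans (lerD h4 h5)).
by rewrite le_eqVlt /Calias; apply/orP; left; apply/eqP; rewrite [2 ^+ m.+3]exprS; ring.
Qed.

End Aliasing.

Section SampleAliasing.
Context {R : realType} (a b : R) (ab : a < b) (N : nat) (N0 : (0 < N)%N) (Ne : ~~ odd N).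
Let NE : N = (N./2).*2. Proof. by rewrite halfK (negbTE Ne) subn0. Qed.
Let Nr0 : 0 < N%:R :> R. Proof. by rewrite ltr0n. Qed.

(** The aliases [l + q N], [q <> 0], of a frequency of the window are far away, and
    increasingly so with [q]; the factor [1 / (1+|q|)] keeps the sum over [q]
    square summable. *)
Lemma wt_alias (m : nat) (k : 'I_N) (q : int) : (1 <= m)%N -> q != 0 ->
  (wt (lidx N k + q * N%:Z) ^+ m)^-1 <= (4 / N%:R) ^+ m * (wt q)^-1 :> R.
Proof.
move=> m1 q0.
have h : wt q <= 4 / N%:R * wt (lidx N k + q * N%:Z) :> R.
  rewrite mulrAC ler_pdivlMr // /wt -!natrM ler_nat.
  have := ltn_ord k; rewrite /lidx; move: NE q0; clear; nia.
apply: (@le_trans _ _ ((4 / N%:R) ^+ m * (wt q ^+ m)^-1)).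
  rewrite -[leLHS]mul1r ler_pdivrMr ?exprn_gt0 ?wt_gt0 //.
  rewrite -mulrA mulrCA mulrC ler_pdivlMr ?exprn_gt0 ?wt_gt0 // mul1r -exprMn.
  by rewrite lerXn2r ?nnegrE ?mulr_ge0 ?wt_ge0.
rewrite ler_wpM2l ?exprn_ge0 ?divr_ge0 //.
rewrite lef_pV2 ?posrE ?exprn_gt0 ?wt_gt0 // -[leLHS]expr1.
by rewrite ler_weXn2l // wt_ge1.
Qed.

Definition Csample (m : nat) : R := 2 * 4 ^+ m.

(** Interpolation against truncation: a coefficient of the samples is the sum
    of the coefficients at all congruent frequencies. *)
Lemma sample_aliasing m r (A : int -> R[i]) al (u : R -> R[i]) :
  (1 <= m)%N -> (r <= m)%N -> bnd m A al ->
  (forall de : R, 0 < de -> exists M0 : nat, forall M, (M0 <= M)%N ->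
     forall j : 'I_N, normc (u (node a b N j) - trig_poly a b M.*2 A (node a b N j)) <= de) ->
  nrm N r (fun l => dft a b (sample a b (N := N) u) l - A l) <=
    Csample m * al * (N%:R^-1) ^+ (m - r).
Proof.
move=> m1 rm hA hu; have al0 := bnd_ge0 hA.
pose X M (l : int) : R[i] := dft a b (sample a b (N := N) (trig_poly a b M.*2 A)) l.
have hX : clim X (dft a b (sample a b (N := N) u)).
  move=> l de de0; have [M0 hM0] := hu de de0; exists M0 => M hM.
  rewrite /X -dftB dftE normcM ComplexField.Normc.normcV normc_nat.
  rewrite mulrC ler_pdivrMr //; apply: (le_trans (normc_sum _ _ _)).
  apply: (@le_trans _ _ (\sum_(j < N) de)); last by rewrite sumr_const card_ord mulr_natr.
  by apply: ler_sum => j _; rewrite normcM normc_chi mulr1; exact: hM0.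
apply: (nrm_lim (M1 := N./2) hX) => M hM.
pose T (k : 'I_N) (i : 'I_M.*2) := (N%:Z %| lidx M.*2 i - lidx N k)%Z && (lidx M.*2 i != lidx N k).
have XE (k : 'I_N) : X M (lidx N k) - A (lidx N k) = \sum_(i < M.*2 | T k i) A (lidx M.*2 i).
  rewrite /X dft_trig //.
  have kM : (absz (lidx N k + M%:Z)%R < M.*2)%N.
    by have := ltn_ord k; rewrite /lidx; move: NE hM; clear; lia.
  have kE : lidx M.*2 (Ordinal kM) = lidx N k.
    by have := ltn_ord k; rewrite /lidx /=; move: NE hM; clear; lia.
  rewrite (bigD1 (Ordinal kM)) /=; last by rewrite kE subrr dvdz0.
  rewrite kE addrC addrK; apply: eq_bigl => i; rewrite /T; congr (_ && _).
  apply/idP/idP; apply: contra => /eqP h; apply/eqP; last by rewrite h kE.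
  by apply/ord_inj/(@lidx_inj M.*2); rewrite kE.
have qE (k : 'I_N) i : T k i -> exists2 q, lidx M.*2 i = lidx N k + q * N%:Z & q != 0.
  move=> /andP[/dvdzP[q hq] ne]; exists q; first by rewrite -hq; ring.
  by apply: contra ne => /eqP q0; move: hq; rewrite q0 mul0r => /eqP; rewrite subr_eq0.
have S1 (k : 'I_N) : \sum_(i < M.*2 | T k i) (wt (lidx M.*2 i) ^+ m)^-1 ^+ 2 <= 4 * ((4 / N%:R) ^+ m) ^+ 2 :> R.
  pose e (i : 'I_M.*2) : int := ((lidx M.*2 i - lidx N k) %/ N%:Z)%Z.
  have eE i : T k i -> lidx M.*2 i = lidx N k + e i * N%:Z.
    by move=> /andP[h _]; rewrite /e divzK //; ring.
  apply: (@le_trans _ _ (((4 / N%:R) ^+ m) ^+ 2 * \sum_(i < M.*2 | T k i) (wt (e i) ^+ 2)^-1)).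
    rewrite mulr_sumr; apply: ler_sum => i Ti.
    have [q hq q0] := qE k i Ti.
    have -> : e i = q.
      have : e i * N%:Z = q * N%:Z by apply: (@addrI _ (lidx N k)); rewrite -eE.
      by move/mulIf; apply; move: N0; clear; lia.
    have -> : ((4 / N%:R) ^+ m) ^+ 2 * (wt q ^+ 2)^-1 = ((4 / N%:R) ^+ m * (wt q)^-1) ^+ 2 :> R.
      by rewrite [RHS]exprMn exprVn.
    rewrite hq lerXn2r ?nnegrE ?invr_ge0 ?wtX_ge0 //; last exact: wt_alias.
    by rewrite mulr_ge0 ?invr_ge0 ?wt_ge0 // exprn_ge0 // divr_ge0.
  rewrite mulrC ler_wpM2r ?sqr_ge0 //.
  apply: (sum_inj_le (f := fun l => (wt l ^+ 2)^-1)).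
  - move=> i j Ti Tj hij; apply/ord_inj/(@lidx_inj M.*2).
    by rewrite (eE i Ti) (eE j Tj) hij.
  - by move=> l; rewrite invr_ge0 wtX_ge0.
  - exact: sum_wtV2.
apply: l2_le; first by rewrite !mulr_ge0 ?exprn_ge0 ?invr_ge0.
apply: (@le_trans _ _ (\sum_(k < N) ((N%:R ^+ r) ^+ 2 * (4 * ((4 / N%:R) ^+ m) ^+ 2)) *
    \sum_(i < M.*2 | T k i) (wt (lidx M.*2 i) ^+ m * normc (A (lidx M.*2 i))) ^+ 2)).
  apply: ler_sum => k _; rewrite exprMn -mulrA; apply: ler_pM; rewrite ?sqr_ge0 //.
    rewrite lerXn2r ?nnegrE ?exprn_ge0 ?wt_ge0 // lerXn2r ?nnegrE ?wt_ge0 //.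
    by rewrite /wt ler_nat; have := ltn_ord k; rewrite /lidx; move: NE; clear; lia.
  rewrite XE.
  apply: (@le_trans _ _ ((\sum_(i < M.*2 | T k i) (wt (lidx M.*2 i) ^+ m)^-1 *
      (wt (lidx M.*2 i) ^+ m * normc (A (lidx M.*2 i)))) ^+ 2)).
    rewrite lerXn2r ?nnegrE ?normc_ge0 ?sumr_ge0 //.
      by move=> i _; rewrite !mulr_ge0 ?invr_ge0 ?wtX_ge0 ?normc_ge0.
    apply: (le_trans (normc_sum _ _ _)); apply: ler_sum => i _.
    by rewrite mulrA mulVf ?mul1r // gt_eqF // exprn_gt0 // wt_gt0.
  apply: (le_trans (sum_CauchySchwarz _ _ _ _)); rewrite ler_wpM2r //.
  by apply: sumr_ge0 => i _; exact: sqr_ge0.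
rewrite -mulr_sumr pair_big_dep /=.
apply: (@le_trans _ _ ((N%:R ^+ r) ^+ 2 * (4 * ((4 / N%:R) ^+ m) ^+ 2) * al ^+ 2)).
  rewrite ler_wpM2l ?mulr_ge0 ?sqr_ge0 //.
  apply: (@bnd_sum _ _ (fun p : 'I_N * 'I_M.*2 => T p.1 p.2) (fun p => lidx M.*2 p.2)) => //.
  move=> [k i] [k' i']; rewrite !unfold_in /= => h1 h2 /lidx_inj/ord_inj ei; subst i'; congr pair.
  have [q hq _] := qE _ _ h1; have [q' hq' _] := qE _ _ h2.
  apply/ord_inj/(@lidx_inj N).
  have d : (N%:Z %| lidx N k - lidx N k')%Z.
    apply/dvdzP; exists (q' - q); rewrite mulrBl.
    have -> : lidx N k = lidx M.*2 i - q * N%:Z by rewrite hq; ring.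
    have -> : lidx N k' = lidx M.*2 i - q' * N%:Z by rewrite hq'; ring.
    ring.
  have h0 : - N%:Z < lidx N k - lidx N k' < N%:Z -> lidx N k - lidx N k' = 0.
    exact: dvd_small.
  apply/eqP; rewrite -subr_eq0; apply/eqP/h0; rewrite /lidx.
  by have := ltn_ord k; have := ltn_ord k'; clear; lia.
rewrite le_eqVlt /Csample; apply/orP; left; apply/eqP.
have -> : (4 / N%:R) ^+ m = 4 ^+ m * (N%:R^-1) ^+ (m - r) * (N%:R^-1) ^+ r :> R.
  by rewrite exprMn -mulrA -exprD subnK.
have -> : (N%:R^-1) ^+ r = (N%:R ^+ r)^-1 :> R by rewrite exprVn.
by field; rewrite expf_neq0 // gt_eqF.
Qed.

End SampleAliasing.

(** * Elementary integrals and trigonometric bounds *)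
Section ParametricIntegral.
Context {R : realType}.
Notation mu := (@lebesgue_measure R).

Lemma CD_Rint (t : R) (u : R -> R) : continuous u ->
  {within `[0, t], continuous (fun s => \int[mu]_(x in `[0, s]) u x)} /\
  (forall s, 0 < s < t -> is_derive s 1 (fun s => \int[mu]_(x in `[0, s]) u x) (u s)).
Proof.
move=> cu.
have intu (c d : R) : mu.-integrable `[c, d] (EFin \o u).
  apply: continuous_compact_integrable; first exact: segment_compact.
  by apply: continuous_subspaceT.
split.
  have [t0|t0] := leP 0 t; first exact: parameterized_integral_continuous.
  by rewrite set_itv_ge ?bnd_simp -?ltNge //; exact: continuous_subspace0.
move=> s /andP[s0 st].
have h1 : s < s + 1 by rewrite ltrDl.
have [|h3 h4] := @continuous_FTC1 R u (BLeft 0) s (s + 1) h1 (intu 0 (s + 1)) _ (cu s).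

  by rewrite /= lte_fin.
by apply: DeriveDef; [exact: h3|rewrite -derive1E; exact: h4].
Qed.

Lemma CD_cint t (f : R -> R[i]) : continuous (fun x => Re (f x)) ->
  continuous (fun x => Im (f x)) ->
  CD t (fun s => cint `[0, s] f) f.
Proof.
move=> cr ci; have [r1 r2] := CD_Rint t cr; have [i1 i2] := CD_Rint t ci.
by split => // s hs; split; [exact: r2|exact: i2].
Qed.

Lemma cint_00 (f : R -> R[i]) : cint `[0, 0] f = 0.
Proof. by rewrite /cint set_itv1 !Rintegral_set1. Qed.

Lemma Rint_00 (f : R -> R) : \int[mu]_(x in `[0, 0]) f x = 0.
Proof. by rewrite set_itv1 !Rintegral_set1. Qed.

Lemma MVT1 t (f f' : R -> R[i]) B : 0 <= t -> 0 <= B -> CD t f f' ->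
  (forall s, 0 < s < t -> normc (f' s) <= B) -> normc (f t - f 0) <= t * B.
Proof.
move=> t0 B0 hf hB.
have h := @MVT_sum R 1 t (fun _ => f) (fun _ => f') (fun _ => 1) B t0 (fun _ => hf) B0.
apply: ler_sqr2; first exact: mulr_ge0.
move: h; rewrite !big_ord1 mul1r; apply => s hs; rewrite big_ord1 mul1r.
by rewrite ler_pXn2r ?nnegrE ?normc_ge0 //; exact: hB.
Qed.

Lemma continuous_cos_lin (k c : R) : continuous (fun x => cos (k * x + c)).
Proof.
move=> x; apply: differentiable_continuous; apply/derivable1_diffP.
by have [] := is_derive_cos_lin k c x.
Qed.
Lemma continuous_sin_lin (k c : R) : continuous (fun x => sin (k * x + c)).
Proof.
move=> x; apply: differentiable_continuous; apply/derivable1_diffP.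
by have [] := is_derive_sin_lin k c x.
Qed.

End ParametricIntegral.

Ltac cfield_eq := apply/eqP; rewrite eq_complex !(ReD, ImD, ReN, ImN, ReM, ImM, ReJ, ImJ) /=;
  apply/andP; split; apply/eqP; field.

Section Trigonometry.
Context {R : realType}.

Lemma sin_le_id (y : R) : 0 <= y -> `|sin y| <= y.
Proof.
move=> y0.
have h := @MVT1 R y (fun s => (sin (1 * s + 0))%:C) (fun s => (1 * cos (1 * s + 0))%:C) 1 y0 ler01.
have := h (CD_real y (is_derive_sin_lin 1 0)).
rewrite -rmorphB !mul1r !addr0 sin0 subr0 normc_real mulr1; apply => s _.
by rewrite mul1r addr0 normc_real cos_max.
Qed.

Lemma sin_le_norm (y : R) : `|sin y| <= `|y|.
Proof.
have [y0|y0] := leP 0 y; first by rewrite (ger0_norm y0) sin_le_id.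
have h : 0 <= - y by rewrite oppr_ge0 ltW.
by have := sin_le_id h; rewrite sinN normrN (ltr0_norm y0).
Qed.

Lemma cos_sub1_le (y : R) : 0 <= y -> `|1 - cos y| <= y.
Proof.
move=> y0.
have h := @MVT1 R y (fun s => (cos (1 * s + 0))%:C) (fun s => (- (1 * sin (1 * s + 0)))%:C) 1 y0 ler01.
have := h (CD_real y (is_derive_cos_lin 1 0)).
rewrite -rmorphB !mul1r !addr0 cos0 normc_real mulr1 distrC; apply => s _.
by rewrite mul1r addr0 normc_real normrN sin_max.
Qed.

Lemma sub_sin_le (y : R) : 0 <= y -> `|y - sin y| <= y ^+ 2.
Proof.
move=> y0.
have hd (s : R) : is_derive s 1 (fun s => s - sin (1 * s + 0)) (1 - 1 * cos (1 * s + 0)).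
  exact: is_deriveB_fun (is_derive_id s 1) (is_derive_sin_lin 1 0 s).
have h := @MVT1 R y (fun s => (s - sin (1 * s + 0))%:C) (fun s => (1 - 1 * cos (1 * s + 0))%:C) y y0 y0.
have := h (CD_real y hd).
rewrite -rmorphB !mul1r !addr0 sin0 !subr0 normc_real expr2; apply => s /andP[s0 sy].
rewrite mul1r mul1r addr0 normc_real (le_trans (cos_sub1_le (ltW s0))) //; exact: ltW.
Qed.

Lemma CD_cis0 (t k : R) : CD t (fun s => cis (k * s)) (fun s => 'i * k%:C * cis (k * s)).
Proof.
apply: CD_eq (CD_ext (CD_cis t k 0) _) _ => [s|s _]; by rewrite addr0.
Qed.

Lemma CD_Icis (t k : R) : CD t (fun s => cint `[0, s] (fun x => cis (k * x))) (fun s => cis (k * s)).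
Proof.
apply: CD_cint => /=.
  rewrite (_ : (fun x => cos (k * x)) = fun x => cos (k * x + 0)); first exact: continuous_cos_lin.
  by apply/funext => x; rewrite addr0.
rewrite (_ : (fun x => sin (k * x)) = fun x => sin (k * x + 0)); first exact: continuous_sin_lin.
  by apply/funext => x; rewrite addr0.
Qed.

Lemma CD_Idcis (t k : R) :
  CD t (fun s => cint `[0, s] (fun x => x%:C * cis (k * x))) (fun s => s%:C * cis (k * s)).
Proof.
have cc : continuous (fun x : R => cos (k * x)).
  rewrite (_ : (fun x => cos (k * x)) = fun x => cos (k * x + 0)); first exact: continuous_cos_lin.
  by apply/funext => x; rewrite addr0.
have cs : continuous (fun x : R => sin (k * x)).
  rewrite (_ : (fun x => sin (k * x)) = fun x => sin (k * x + 0)); first exact: continuous_sin_lin.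
  by apply/funext => x; rewrite addr0.
apply: CD_cint.
- rewrite (_ : (fun x => _) = fun x => x * cos (k * x)).
    by move=> x; apply: cvgM; [exact: cvg_id|exact: cc].
  by apply/funext => x; rewrite ReM /= mul0r subr0.
- rewrite (_ : (fun x => _) = fun x => x * sin (k * x)).
    by move=> x; apply: cvgM; [exact: cvg_id|exact: cs].
  by apply/funext => x; rewrite ImM /= mul0r addr0.
Qed.

End Trigonometry.

(** * One step of the scheme on Fourier coefficients *)
Section Step.
Context {R : realType} (a b : R) (N : nat) (eps tau : R).
Local Notation star := (@star R a b N).
Local Notation cj := (@cj R a b N).
Local Notation mu := (@mu R a b).
Implicit Types (G F D : int -> R[i]).

(** [zcoef 1] and [zcoef (-1)] are the coefficients of [v^{n,0}] and of its
    conjugate, the amplitudes of the two phases [e^(is/eps^2)] and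
    [e^(-is/eps^2)] of the field. *)
Definition zcoef (sg : R) F D l : R[i] :=
  2^-1 * (F l - 'i * sg%:C * (eps ^+ 2)%:C * D l).
(** The filter [sin (mu^2 tau) / tau] replaces [mu^2]: it agrees with it up to
    [O(tau mu^4)], and is bounded by [1 / tau], which is what stability needs. *)
Definition dtpsi G F l : R[i] :=
  - 'i * (sin (mu l ^+ 2 * tau) / tau)%:C * G l + 'i * star F G l.
Definition psi_step G F D l : R[i] :=
  cis (- (mu l ^+ 2 * tau)) * G l
  + coef_c a b eps tau 1 l * star (zcoef 1 F D) G l
  + coef_d a b eps tau 1 l * star (zcoef 1 F D) (dtpsi G F) l
  + coef_c a b eps tau (-1) l * star (zcoef (-1) F D) G l
  + coef_d a b eps tau (-1) l * star (zcoef (-1) F D) (dtpsi G F) l.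
(** The first two Taylor coefficients in time of [|psi|^2]. *)
Definition rho0 G l : R[i] := star G (cj G) l.
Definition rho1 G F l : R[i] := star (dtpsi G F) (cj G) l + star G (cj (dtpsi G F)) l.
(** Multiplication by the phases turns the coefficients [a_l], [a_l'] of the
    scheme into the exact propagator of the linear Klein-Gordon equation. *)
Definition phi_step G F D l : R[i] :=
  (cos (omega a b eps l * tau))%:C * F l
  + (sin (omega a b eps l * tau) / omega a b eps l)%:C * D l
  + (coef_p a b eps tau l)%:C * rho0 G l + (coef_q a b eps tau l)%:C * rho1 G F l.
Definition dphi_step G F D l : R[i] :=
  - (omega a b eps l * sin (omega a b eps l * tau))%:C * F l
  + (cos (omega a b eps l * tau))%:C * D l
  + (coef_p' a b eps tau l)%:C * rho0 G l + (coef_q' a b eps tau l)%:C * rho1 G F l.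

End Step.

Section Bounds.
Context {R : realType} (a b : R) (ab : a < b) (N : nat) (N0 : (0 < N)%N) (Ne : ~~ odd N).
Context (tau K : R) (K96 : 96 <= K) (tau0 : 0 < tau)
  (hmu : forall l, mu a b l ^+ 2 <= K * wt l ^+ 2).
Local Notation star := (@star R a b N).
Local Notation cj := (@cj R a b N).
Local Notation mu := (@mu R a b).
Implicit Types (c d : int -> R[i]) (x y : R).

Let K0 : 0 <= K. Proof. exact: le_trans K96. Qed.

Lemma nrmD_le s c d x y : nrm N s c <= x -> nrm N s d <= y ->
  nrm N s (fun l => c l + d l) <= x + y.
Proof. by move=> h1 h2; apply: (le_trans (nrmD _ _ _ _)); exact: lerD. Qed.

Lemma nrmB_le s c d x y : nrm N s c <= x -> nrm N s d <= y ->
  nrm N s (fun l => c l - d l) <= x + y.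
Proof. by move=> h1 h2; apply: (le_trans (nrmB _ _ _ _)); exact: lerD. Qed.

Lemma nrmZ_le s (z : R[i]) c B x : normc z <= B -> nrm N s c <= x ->
  nrm N s (fun l => z * c l) <= B * x.
Proof.
move=> h1 h2; rewrite nrmZ; apply: ler_pM => //; [exact: normc_ge0|exact: nrm_ge0].
Qed.

(** [K] absorbs the constants of the products, so that all bounds become powers of
    [K]; consistency takes place in H^1 and in H^3. *)
Lemma star_le s c d x y : (s == 1%N) || (s == 3%N) -> nrm N s c <= x -> nrm N s d <= y ->
  nrm N s (star c d) <= K * x * y.
Proof.
move=> hs h1 h2.
have s1 : (1 <= s)%N by case/orP: hs => /eqP ->.
apply: (le_trans (nrm_star ab N0 Ne c d s1)).
have h3 : 3 * 2 ^+ s.+2 <= K.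
  by apply: le_trans K96; case/orP: hs => /eqP ->; rewrite -natrX -natrM ler_nat.
have h0 : 0 <= 3 * 2 ^+ s.+2 :> R by rewrite mulr_ge0 ?exprn_ge0.
apply: ler_pM h2; [|exact: nrm_ge0|]; first by rewrite mulr_ge0 ?nrm_ge0.
by apply: ler_pM h3 h1; rewrite ?nrm_ge0.
Qed.

Lemma mu2_le s c x : nrm N (s + 2) c <= x ->
  nrm N s (fun l => (mu l ^+ 2)%:C * c l) <= K * x.
Proof.
move=> h; apply: (@le_trans _ _ (K * nrm N (s + 2) c)); last by rewrite ler_wpM2l.
apply: nrm_le => // k; rewrite normcM ler_wpM2r ?normc_ge0 //.
by rewrite normc_real ger0_norm ?sqr_ge0.
Qed.

Lemma sinc_le s c x : nrm N (s + 2) c <= x ->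
  nrm N s (fun l => (sin (mu l ^+ 2 * tau) / tau)%:C * c l) <= K * x.
Proof.
move=> h; apply: le_trans (mu2_le h); apply: nrm_le0 => k.
rewrite !normcM ler_wpM2r ?normc_ge0 // !normc_real normrM (ger0_norm (x := tau^-1)) ?invr_ge0 ?(ltW tau0) //.
rewrite ler_pdivrMr // -{2}(ger0_norm (ltW tau0)) -normrM; exact: sin_le_norm.
Qed.

Lemma sincV_le s c x : nrm N s c <= x ->
  nrm N s (fun l => (sin (mu l ^+ 2 * tau) / tau)%:C * c l) <= tau^-1 * x.
Proof.
move=> h; apply: (@le_trans _ _ (tau^-1 * nrm N s c)); last by rewrite ler_wpM2l // invr_ge0 (ltW tau0).
apply: nrm_mul; first by rewrite invr_ge0 (ltW tau0).
move=> k; rewrite normc_real normrM (ger0_norm (x := tau^-1)) ?invr_ge0 ?(ltW tau0) //.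
by rewrite ler_piMl ?invr_ge0 ?(ltW tau0) // sin_max.
Qed.

(** The consistency of the filter costs four derivatives; this is where [g] is
    needed in H^5. *)
Lemma mu4_sinc_le s c x : nrm N (s + 4) c <= x ->
  nrm N s (fun l => (mu l ^+ 2 - sin (mu l ^+ 2 * tau) / tau)%:C * c l) <= K ^+ 2 * tau * x.
Proof.
move=> h; apply: (@le_trans _ _ (K ^+ 2 * tau * nrm N (s + 4) c)).
  apply: nrm_le; first by rewrite mulr_ge0 ?sqr_ge0 ?(ltW tau0).
  move=> k; rewrite normcM ler_wpM2r ?normc_ge0 // normc_real.
  set m := mu _ ^+ 2; have m0 : 0 <= m by exact: sqr_ge0.
  have -> : m - sin (m * tau) / tau = (m * tau - sin (m * tau)) / tau.
    by field; rewrite gt_eqF.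
  rewrite normrM (ger0_norm (x := tau^-1)) ?invr_ge0 ?(ltW tau0) // ler_pdivrMr //.
  apply: (le_trans (sub_sin_le (mulr_ge0 m0 (ltW tau0)))).
  have -> : K ^+ 2 * tau * wt (lidx N k) ^+ 4 * tau = (K * wt (lidx N k) ^+ 2 * tau) ^+ 2 by ring.
  have h1 : m * tau <= K * wt (lidx N k) ^+ 2 * tau.
    by rewrite ler_wpM2r ?(ltW tau0) //; exact: hmu.
  have h2 : 0 <= m * tau by rewrite mulr_ge0 // ltW.
  by apply: lerXn2r => //; rewrite nnegrE //; exact: le_trans h1.
by rewrite ler_wpM2l // mulr_ge0 ?sqr_ge0 ?(ltW tau0).
Qed.

Lemma cj_le s c x : nrm N s c <= x -> nrm N s (cj c) <= x.
Proof. by rewrite nrm_cj. Qed.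

Lemma nrm_i s c x : nrm N s c <= x -> nrm N s (fun l => 'i * c l) <= x.
Proof. by move=> h; rewrite nrmZ normc_i mul1r. Qed.

Lemma dtpsi_le s G F x y z : (s == 1%N) || (s == 3%N) -> nrm N s G <= x -> nrm N (s + 2) G <= z ->
  nrm N s F <= y -> nrm N s (dtpsi a b N tau G F) <= K * z + K * y * x.
Proof.
move=> hs hG hG2 hF.
rewrite /dtpsi (@eq_nrm _ _ _ _ (fun l => 'i * - ((sin (mu l ^+ 2 * tau) / tau)%:C * G l) + 'i * star F G l)).
  apply: nrmD_le; apply: nrm_i; last exact: star_le.
  by rewrite nrmN; exact: sinc_le.
by move=> k; ring.
Qed.

(** Without loss of derivatives, but at the price of [1 / tau]. *)
Lemma dtpsiV_le G F x y : nrm N 1 G <= x ->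
  nrm N 1 F <= y -> nrm N 1 (dtpsi a b N tau G F) <= tau^-1 * x + K * y * x.
Proof.
move=> hG hF.
rewrite /dtpsi (@eq_nrm _ _ _ _ (fun l => 'i * - ((sin (mu l ^+ 2 * tau) / tau)%:C * G l) + 'i * star F G l)).
  apply: nrmD_le; apply: nrm_i; last exact: star_le.
  by rewrite nrmN; exact: sincV_le.
by move=> k; ring.
Qed.

Lemma zcoef_le eps s sg F D x y : sg = 1 \/ sg = -1 -> nrm N s F <= x ->
  nrm N s (fun l => (eps ^+ 2)%:C * D l) <= y ->
  nrm N s (zcoef eps sg F D) <= 2^-1 * (x + y).
Proof.
move=> hsg hF hD; apply: nrmZ_le.
  by rewrite ComplexField.Normc.normcV normc_nat.
apply: nrmB_le => //.
rewrite (@eq_nrm _ _ _ _ (fun l => ('i * sg%:C) * ((eps ^+ 2)%:C * D l))); last by move=> k; ring.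
rewrite nrmZ normcM normc_i mul1r normc_real.
by case: hsg => ->; rewrite ?normrN normr1 mul1r.
Qed.

Lemma coef_c_le eps sg l : normc (coef_c a b eps tau sg l) <= tau.
Proof.
rewrite /coef_c !normcM normc_i normc_cis !mul1r.
have := MVT1 (ltW tau0) ler01 (CD_Icis tau (mu l ^+ 2 + sg / eps ^+ 2)) .
rewrite cint_00 subr0 mulr1; apply => s _; by rewrite normc_cis.
Qed.

Lemma coef_d_le eps sg l : normc (coef_d a b eps tau sg l) <= tau * tau.
Proof.
rewrite /coef_d !normcM normc_i normc_cis !mul1r.
have := MVT1 (ltW tau0) (ltW tau0) (CD_Idcis tau (mu l ^+ 2 + sg / eps ^+ 2)) .
rewrite cint_00 subr0; apply => s /andP[s0 st].
by rewrite normcM normc_cis mulr1 normc_real ger0_norm ltW.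
Qed.

End Bounds.

(** * Local errors of one step *)
Section LocalError.
Context {R : realType} (a b : R) (ab : a < b) (N : nat) (N0 : (0 < N)%N) (Ne : ~~ odd N).
Context (eps tau K eta : R) (K96 : 96 <= K) (tau0 : 0 < tau) (tau1 : tau <= 1)
  (eps0 : 0 < eps) (eps1 : eps <= 1) (eta0 : 0 <= eta)
  (hmu : forall l, mu a b l ^+ 2 <= K * wt l ^+ 2).
Local Notation star := (@star R a b N).
Local Notation cj := (@cj R a b N).
Local Notation mu := (@mu R a b).
Local Notation zcoef := (zcoef eps).
Local Notation dtpsi := (dtpsi a b N tau).
Local Notation m2 l := ((mu l ^+ 2)%:C).
Local Notation ie2 := ((eps ^+ 2)^-1).
Context (g f d F Q : R -> int -> R[i]).
Context
  (dg : forall k : 'I_N, CD tau (fun s => g s (lidx N k))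
     (fun s => 'i * (F s (lidx N k) - m2 (lidx N k) * g s (lidx N k))))
  (df : forall k : 'I_N, CD tau (fun s => f s (lidx N k)) (fun s => d s (lidx N k)))
  (dd : forall k : 'I_N, CD tau (fun s => d s (lidx N k))
     (fun s => ie2%:C * (Q s (lidx N k) - (m2 (lidx N k) + ie2%:C) * f s (lidx N k)))).
Context
  (bg : forall s, 0 <= s <= tau -> nrm N 5 (g s) <= K)
  (bf : forall s, 0 <= s <= tau -> nrm N 3 (f s) <= K)
  (bd : forall s, 0 <= s <= tau -> nrm N 3 (fun l => (eps ^+ 2)%:C * d s l) <= K)
  (bF : forall s, 0 <= s <= tau -> nrm N 3 (F s) <= K)
  (bQ : forall s, 0 <= s <= tau -> nrm N 1 (Q s) <= K)
  (aF : forall s, 0 <= s <= tau -> nrm N 1 (fun l => F s l - star (f s) (g s) l) <= eta)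
  (aQ : forall s, 0 <= s <= tau -> nrm N 1 (fun l => Q s l - star (g s) (cj (g s)) l) <= eta).

Let K0 : 0 <= K. Proof. exact: le_trans K96. Qed.
Let e20 : eps ^+ 2 != 0. Proof. by rewrite expf_neq0 // gt_eqF. Qed.
Let t0 := ltW tau0.
Let KX n : 0 <= K ^+ n. Proof. by rewrite exprn_ge0. Qed.

Let K_le n : (n <= 6)%N -> K ^+ n <= K ^+ 6.
Proof. by move=> h; rewrite ler_weXn2l // (le_trans _ K96) // ler1n. Qed.

Let sub_ivl (s : R) : 0 < s < tau -> 0 <= s <= tau.
Proof. by move=> /andP[h1 h2]; rewrite !ltW. Qed.
Let i00 : 0 <= (0 : R) <= tau. Proof. by rewrite lexx t0. Qed.
Let itt : 0 <= tau <= tau. Proof. by rewrite lexx t0. Qed.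
Let bg_s (s : R) n : 0 <= s <= tau -> (n <= 5)%N -> nrm N n (g s) <= K.
Proof. by move=> hs hn; apply: le_trans (bg hs); exact: nrm_mono. Qed.
Let bf_s (s : R) n : 0 <= s <= tau -> (n <= 3)%N -> nrm N n (f s) <= K.
Proof. by move=> hs hn; apply: le_trans (bf hs); exact: nrm_mono. Qed.
Let bd_s (s : R) n : 0 <= s <= tau -> (n <= 3)%N -> nrm N n (fun l => (eps ^+ 2)%:C * d s l) <= K.
Proof. by move=> hs hn; apply: le_trans (bd hs); exact: nrm_mono. Qed.

Definition phase (sg s : R) : R[i] := cis (sg * ie2 * s).
Definition zmod (sg s : R) l : R[i] := phase (- sg) s * zcoef sg (f s) (d s) l.
Definition Gfor (s : R) l : R[i] := Q s l - m2 l * f s l.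

Lemma phase_inv sg s : phase sg s * phase (- sg) s = 1.
Proof. by rewrite /phase !mulNr cis_unit. Qed.

Lemma zmod_sum s l : f s l = phase 1 s * zmod 1 s l + phase (-1) s * zmod (-1) s l.
Proof.
rewrite /zmod !mulrA phase_inv phase_inv !mul1r /zcoef.
have -> : ((-1 : R)%:C : R[i]) = - 1 by rewrite rmorphN.
by field.
Qed.

Lemma e2_ie2 : (eps ^+ 2)%:C * ie2%:C = 1 :> R[i].
Proof. by rewrite -rmorphM mulfV. Qed.

(** The amplitudes are slow: in the derivative of [f - i sg eps^2 d] the singular
    terms [eps^-2 f] and [d] cancel against the derivative of the phase. *)
Lemma CD_zmod sg (k : 'I_N) : sg = 1 \/ sg = -1 -> CD tau (fun s => zmod sg s (lidx N k))
  (fun s => - ('i * (sg / 2)%:C) * (phase (- sg) s * Gfor s (lidx N k))).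
Proof.
move=> hsg; set l := lidx N k.
have h1 := CD_M (CD_cis0 tau (- sg * ie2)) (CD_Z 2^-1 (CD_B (df k) (CD_Z ('i * sg%:C * (eps ^+ 2)%:C) (dd k)))).
apply: CD_eq h1 _ => s _ /=; rewrite -/l /phase /Gfor.
set c := cis _; set x := f s l; set y := d s l; set z := Q s l; set m := m2 l.
have -> : (- sg / eps ^+ 2)%:C = - (sg%:C * ie2%:C) :> R[i] by rewrite mulNr rmorphN rmorphM.
have -> : (sg / 2)%:C = sg%:C / 2 :> R[i] by rewrite rmorphM fmorphV rmorph_nat.
have h := e2_ie2; set ie := ie2%:C in h *; set e2 := (eps ^+ 2)%:C in h *.
have hs : sg%:C * sg%:C = 1 :> R[i].
  by rewrite -rmorphM; case: hsg => ->; rewrite ?mulrNN mulr1.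
set S := sg%:C in hs *; set I : R[i] := 'i%C.
have hI : I * I = -1 by exact: sqri.
have -> : I * - (S * ie) * c * (2^-1 * (x - I * S * e2 * y)) +
   c * (2^-1 * (y - I * S * e2 * (ie * (z - (m + ie) * x)))) =
   c / 2 * ((I * I * (S * S) * (e2 * ie) + 1) * y - I * S * (e2 * ie - 1) * (z - (m + ie) * x))
   + - (I * (S / 2)) * (c * (z - m * x)) by ring.
by rewrite h hs hI; ring.
Qed.

Definition zmod' sg s l : R[i] := - ('i * (sg / 2)%:C) * (phase (- sg) s * Gfor s l).

Lemma normc_phase sg s : normc (phase sg s) = 1.
Proof. exact: normc_cis. Qed.

Lemma Gfor_le s : 0 <= s <= tau -> nrm N 1 (Gfor s) <= K + K * K.
Proof. by move=> hs; apply: nrmB_le; [exact: bQ|apply: mu2_le hmu _ _ _ _ => //; exact: bf]. Qed.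

Lemma zmod_le sg s n : sg = 1 \/ sg = -1 -> 0 <= s <= tau -> (n <= 3)%N -> nrm N n (zmod sg s) <= K.
Proof.
move=> hsg hs hn; rewrite nrm_unit; last by move=> l; exact: normc_phase.
have -> : K = 2^-1 * (K + K) by field.
by apply: zcoef_le => //; [exact: bf_s|exact: bd_s].
Qed.

Lemma zcoef0_le sg n : sg = 1 \/ sg = -1 -> (n <= 3)%N -> nrm N n (zcoef sg (f 0) (d 0)) <= K.
Proof.
move=> hsg hn; have -> : K = 2^-1 * (K + K) by field.
by apply: zcoef_le => //; [exact: bf_s|exact: bd_s].
Qed.

Definition g' s l : R[i] := 'i * (F s l - m2 l * g s l).

Lemma g'_le s : 0 <= s <= tau -> nrm N 3 (g' s) <= K + K * K.
Proof.
move=> hs; apply: nrm_i; apply: nrmB_le; first exact: bF.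
by apply: mu2_le hmu _ _ _ _ => //; exact: bg_s.
Qed.

Notation gF := (dtpsi (g 0) (f 0)).

Lemma gF_le : nrm N 3 gF <= K * K + K * K * K.
Proof. by apply: dtpsi_le => //; [exact: bg_s|exact: bg_s|exact: bf_s]. Qed.

(** The tangent of [g] at the beginning of the step, with the filtered slope of
    the scheme. *)
Definition incr s l : R[i] := g 0 l + s%:C * gF l.

Lemma CD_incr l : CD tau (fun s => incr s l) (fun _ => gF l).
Proof.
apply: CD_eq (CD_D (CD_cst tau _) (CD_M (CD_id tau) (CD_cst tau _))) _ => s _ /=.
by rewrite mul1r mulr0 addr0 add0r.
Qed.

Lemma incr_le s n : 0 <= s <= tau -> (n <= 3)%N -> nrm N n (incr s) <= K + (K * K + K * K * K).
Proof.
move=> hs hn; apply: nrmD_le; first by apply: bg_s => //; exact: leq_trans hn _.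
rewrite -[leRHS]mul1r; apply: nrmZ_le.
  have /andP[s0 st] := hs.
  by rewrite normc_real ger0_norm // (le_trans st).
by apply: le_trans gF_le; exact: nrm_mono.
Qed.

(** The part of the nonlinearity carried by one phase, minus its numerical
    approximation.  It vanishes at the beginning of the step, and its derivative
    is bounded uniformly in [eps]. *)
Definition kdef sg s l : R[i] := star (zmod sg s) (g s) l - star (zcoef sg (f 0) (d 0)) (incr s) l.
Definition kdef' sg s l : R[i] :=
  star (zmod' sg s) (g s) l
  + star (zmod sg s) (g' s) l - star (zcoef sg (f 0) (d 0)) gF l.

Lemma CD_kdef sg l : sg = 1 \/ sg = -1 ->
  CD tau (fun s => kdef sg s l) (kdef' sg ^~ l).
Proof.
move=> hsg.
have h1 := @CD_star R a b N tau (zmod sg) (zmod' sg) g g' l (fun k => CD_zmod k hsg) dg.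
have h2 := @CD_star R a b N tau (fun _ => zcoef sg (f 0) (d 0)) (fun _ _ => 0) incr (fun _ => gF) l
  (fun k => CD_cst tau (zcoef sg (f 0) (d 0) (lidx N k))) (fun k => CD_incr (lidx N k)).
apply: CD_eq (CD_B h1 h2) _ => s _ /=; rewrite /kdef'; congr (_ - _).
rewrite (_ : (fun=> 0) = fun l0 => 0 * incr s l0); last by apply/funext => x; rewrite mul0r.
by rewrite starZl mul0r add0r.
Qed.

Lemma kdef0 sg l : sg = 1 \/ sg = -1 -> kdef sg 0 l = 0.
Proof.
move=> hsg; rewrite /kdef; apply/eqP; rewrite subr_eq0; apply/eqP.
apply: star_ext => k; last by rewrite /incr mul0r addr0.
by rewrite /zmod /phase mulr0 cis0 mul1r.
Qed.

Lemma kdef_le sg s : sg = 1 \/ sg = -1 -> 0 <= s <= tau ->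
  nrm N 3 (kdef sg s) <= K * K * K + K * K * (K + (K * K + K * K * K)).
Proof.
move=> hsg hs; apply: nrmB_le; apply: star_le => //.
- exact: zmod_le.
- exact: bg_s.
- exact: zcoef0_le.
- exact: incr_le.
Qed.

Lemma kdef'_le sg s : sg = 1 \/ sg = -1 -> 0 <= s <= tau ->
  nrm N 1 (kdef' sg s) <= K * (2^-1 * (K + K * K)) * K + K * K * (K + K * K) + K * K * (K * K + K * K * K).
Proof.
move=> hsg hs; apply: nrmB_le; first apply: nrmD_le; apply: star_le => //.
- apply: nrmZ_le; last by rewrite nrm_unit; [exact: Gfor_le|move=> l; exact: normc_phase].
  rewrite normcN normcM normc_i mul1r normc_real normrM.
  by case: hsg => ->; rewrite ?normrN normr1 mul1r ger0_norm.
- exact: bg_s.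
- exact: zmod_le.
- by apply: le_trans (g'_le hs); exact: nrm_mono.
- exact: zcoef0_le.
- by apply: le_trans gF_le; exact: nrm_mono.
Qed.

(** The Schroedinger phase is slow for smooth functions: its derivative costs two
    space derivatives of [kdef], not a power of [eps^-1]. *)
Definition Kdef sg s l : R[i] := cis (mu l ^+ 2 * s) * kdef sg s l.
Definition Kdef' sg s l : R[i] := cis (mu l ^+ 2 * s) * ('i * (m2 l * kdef sg s l) + kdef' sg s l).

Lemma CD_Kdef sg l : sg = 1 \/ sg = -1 -> CD tau (fun s => Kdef sg s l) (Kdef' sg ^~ l).
Proof.
move=> hsg; apply: CD_eq (CD_M (CD_cis0 tau (mu l ^+ 2)) (CD_kdef l hsg)) _ => s _ /=.
by rewrite /Kdef'; ring.
Qed.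

Lemma Kdef'_le sg s : sg = 1 \/ sg = -1 -> 0 <= s <= tau -> nrm N 1 (Kdef' sg s) <= 9 * K ^+ 6.
Proof.
move=> hsg hs; rewrite nrm_unit; last by move=> l; exact: normc_cis.
apply: le_trans (nrmD_le (nrm_i (mu2_le (s := 1) K96 hmu (kdef_le hsg hs))) (kdef'_le hsg hs)) _.
have := @K_le 3 isT; have := @K_le 4 isT; have := @K_le 5 isT; lra.
Qed.

Notation cI sg s l := (cint `[0, s] (fun th => cis ((mu l ^+ 2 + sg / eps ^+ 2) * th))).
Notation dI sg s l := (cint `[0, s] (fun th => th%:C * cis ((mu l ^+ 2 + sg / eps ^+ 2) * th))).

Definition Dnum sg s l : R[i] :=
  cI sg s l * star (zcoef sg (f 0) (d 0)) (g 0) l + dI sg s l * star (zcoef sg (f 0) (d 0)) gF l.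

(** The local error in the interaction picture, as a function of the time [s]
    elapsed in the step; [Dpsi_tau] recovers the error of the step. *)
Definition Dpsi s l : R[i] :=
  cis (mu l ^+ 2 * s) * g s l - g 0 l - 'i * (Dnum 1 s l + Dnum (-1) s l).

Lemma Dpsi0 l : Dpsi 0 l = 0.
Proof. by rewrite /Dpsi /Dnum !cint_00 !mul0r !addr0 !mulr0 cis0 mul1r subrr subr0. Qed.

Lemma Dpsi_tau (k : 'I_N) (l := lidx N k) :
  g tau l - psi_step a b N eps tau (g 0) (f 0) (d 0) l = cis (- (mu l ^+ 2 * tau)) * Dpsi tau l.
Proof.
rewrite /psi_step /Dpsi /Dnum /coef_c /coef_d.
have h := cis_unit (mu l ^+ 2 * tau); rewrite -/dtpsi.
set c := cis (- _) in h *; set c' := cis (mu l ^+ 2 * tau) in h *.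
transitivity ((c' * c) * g tau l - (c * g 0 l + 'i * c * cI 1 tau l * star (zcoef 1 (f 0) (d 0)) (g 0) l
  + 'i * c * dI 1 tau l * star (zcoef 1 (f 0) (d 0)) gF l
  + 'i * c * cI (-1) tau l * star (zcoef (-1) (f 0) (d 0)) (g 0) l
  + 'i * c * dI (-1) tau l * star (zcoef (-1) (f 0) (d 0)) gF l)); first by rewrite h (mul1r (g tau l)).
ring.
Qed.

Lemma cis_split sg s l : cis ((mu l ^+ 2 + sg / eps ^+ 2) * s) = cis (mu l ^+ 2 * s) * phase sg s.
Proof. by rewrite mulrDl cisD. Qed.

Definition Dnum' sg s l : R[i] :=
  cis (mu l ^+ 2 * s) * (phase sg s * star (zcoef sg (f 0) (d 0)) (incr s) l).

Lemma CD_Dnum sg l : CD tau (fun s => Dnum sg s l) (fun s => Dnum' sg s l).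
Proof.
set k := mu l ^+ 2 + sg / eps ^+ 2.
have h1 := CD_M (CD_Icis tau k) (CD_cst tau (star (zcoef sg (f 0) (d 0)) (g 0) l)).
have h2 := CD_M (CD_Idcis tau k) (CD_cst tau (star (zcoef sg (f 0) (d 0)) gF l)).
apply: CD_eq (CD_D h1 h2) _ => s _ /=.
rewrite /Dnum' /incr starDr starZr /k cis_split; ring.
Qed.

Definition Dpsi' s l : R[i] := 'i * (cis (mu l ^+ 2 * s) * F s l - (Dnum' 1 s l + Dnum' (-1) s l)).

Lemma CD_Dpsi (k : 'I_N) : CD tau (fun s => Dpsi s (lidx N k)) (fun s => Dpsi' s (lidx N k)).
Proof.
set l := lidx N k.
have h1 := CD_B (CD_M (CD_cis0 tau (mu l ^+ 2)) (dg k)) (CD_cst tau (g 0 l)).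
have h2 := CD_Z 'i (CD_D (CD_Dnum 1 l) (CD_Dnum (-1) l)).
apply: CD_eq (CD_B h1 h2) _ => s _ /=; rewrite /Dpsi' -/l; ring.
Qed.

Lemma star_modes s l : star (f s) (g s) l =
  phase 1 s * star (zmod 1 s) (g s) l + phase (-1) s * star (zmod (-1) s) (g s) l.
Proof.
rewrite -!starZl -starDl; apply: star_ext => // k; exact: zmod_sum.
Qed.

(** Consistency error of the product on the grid, plus the oscillating terms. *)
Lemma Dpsi'E s l : Dpsi' s l = 'i * (cis (mu l ^+ 2 * s) * (F s l - star (f s) (g s) l))
  + 'i * (phase 1 s * Kdef 1 s l) + 'i * (phase (-1) s * Kdef (-1) s l).
Proof. by rewrite /Dpsi' /Dnum' /Kdef /kdef star_modes; ring. Qed.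

(** [Dpsi] minus the antiderivative of its oscillating part: its derivative
    contains the phases only with a factor [eps^2]. *)
Definition Dbp s l : R[i] :=
  Dpsi s l - (eps ^+ 2)%:C * (phase 1 s * Kdef 1 s l) + (eps ^+ 2)%:C * (phase (-1) s * Kdef (-1) s l).
Definition Dbp' s l : R[i] :=
  'i * (cis (mu l ^+ 2 * s) * (F s l - star (f s) (g s) l))
  + (eps ^+ 2)%:C * (phase (-1) s * Kdef' (-1) s l - phase 1 s * Kdef' 1 s l).

Lemma CD_phase sg : CD tau (phase sg) (fun s => 'i * (sg%:C * ie2%:C) * phase sg s).
Proof.
apply: CD_eq (CD_cis0 tau (sg * ie2)) _ => s _ /=.
by rewrite rmorphM.
Qed.

Lemma CD_Dbp (k : 'I_N) : CD tau (fun s => Dbp s (lidx N k)) (fun s => Dbp' s (lidx N k)).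
Proof.
set l := lidx N k.
have p1 := CD_Z (eps ^+ 2)%:C (CD_M (CD_phase 1) (CD_Kdef l (or_introl erefl))).
have p2 := CD_Z (eps ^+ 2)%:C (CD_M (CD_phase (-1)) (CD_Kdef l (or_intror erefl))).
apply: CD_eq (CD_D (CD_B (CD_Dpsi k) p1) p2) _ => s _ /=.
rewrite -/l Dpsi'E /Dbp'.
have h := e2_ie2; set ie := ie2%:C in h *; set e2 := (eps ^+ 2)%:C in h *.
have -> : ((-1 : R)%:C : R[i]) = - 1 by rewrite rmorphN.
have -> : ((1 : R)%:C : R[i]) = 1 by [].
set x := 'i * (_ * (_ - _)); set K1 := Kdef 1 s l; set K2 := Kdef (-1) s l.
set K1' := Kdef' 1 s l; set K2' := Kdef' (-1) s l; set p := phase 1 s; set q := phase (-1) s.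
transitivity (x + e2 * (q * K2' - p * K1') + (1 - e2 * ie) * ('i * (p * K1) + 'i * (q * K2))).
  ring.
by rewrite h subrr mul0r addr0.
Qed.

Let one_m1 : (1 : R) = 1 \/ (1 : R) = -1. Proof. by left. Qed.
Let m1_m1 : (-1 : R) = 1 \/ (-1 : R) = -1. Proof. by right. Qed.

Lemma Kdef_tau_le sg : sg = 1 \/ sg = -1 -> nrm N 1 (Kdef sg tau) <= tau * (9 * K ^+ 6).
Proof.
move=> hsg.
have := @nrm_MVT R N 1 tau (Kdef sg) (Kdef' sg) (9 * K ^+ 6) t0 (mulr_ge0 _ (KX 6))
  (fun k => CD_Kdef (lidx N k) hsg).
rewrite (@eq_nrm _ _ _ _ (Kdef sg tau)); last first.
  by move=> k; rewrite /Kdef kdef0 // mulr0 subr0.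
by apply => // s hs; apply: Kdef'_le => //; exact: sub_ivl.
Qed.

Let e2_ge0 : 0 <= eps ^+ 2. Proof. exact: sqr_ge0. Qed.

(** The boundary terms of the integration by parts are [eps^2 Kdef tau], and
    [Kdef] is [O(tau)] as it vanishes at 0. *)
Lemma local_psi_eps : nrm N 1 (fun l => g tau l - psi_step a b N eps tau (g 0) (f 0) (d 0) l)
  <= tau * (eta + 36 * K ^+ 6 * eps ^+ 2).
Proof.
rewrite (@eq_nrm _ _ _ _ (fun l => cis (- (mu l ^+ 2 * tau)) * Dpsi tau l)); last exact: Dpsi_tau.
rewrite nrm_unit; last by move=> l; exact: normc_cis.
have h1 : nrm N 1 (fun l => Dbp tau l - Dbp 0 l) <= tau * (eta + eps ^+ 2 * (9 * K ^+ 6 + 9 * K ^+ 6)).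
  apply: (nrm_MVT t0 _ CD_Dbp); first by rewrite addr_ge0 // mulr_ge0 // addr_ge0 // mulr_ge0.
  move=> s /sub_ivl hs; apply: nrmD_le.
    by apply: nrm_i; rewrite nrm_unit; [exact: aF|move=> l; exact: normc_cis].
  apply: nrmZ_le; first by rewrite normc_real ger0_norm.
  by apply: nrmB_le; (rewrite nrm_unit; [exact: Kdef'_le|move=> l; exact: normc_phase]).
have h2 sg : sg = 1 \/ sg = -1 ->
    nrm N 1 (fun l => (eps ^+ 2)%:C * (phase sg tau * Kdef sg tau l)) <= eps ^+ 2 * (tau * (9 * K ^+ 6)).
  move=> hsg; apply: nrmZ_le; first by rewrite normc_real ger0_norm.
  by rewrite nrm_unit; [exact: Kdef_tau_le|move=> l; exact: normc_phase].
have -> : nrm N 1 (Dpsi tau) = nrm N 1 (fun l => (Dbp tau l - Dbp 0 l)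
    + ((eps ^+ 2)%:C * (phase 1 tau * Kdef 1 tau l) - (eps ^+ 2)%:C * (phase (-1) tau * Kdef (-1) tau l))).
  apply: eq_nrm => k; rewrite /Dbp Dpsi0 /Kdef !kdef0 // !mulr0; ring.
apply: (le_trans (nrmD_le h1 (nrmB_le (h2 1 one_m1) (h2 (-1) m1_m1)))).
lra.
Qed.

Lemma star_sub (u u' w w' : int -> R[i]) l : star u w l - star u' w' l =
  star (fun x => u x - u' x) w l + star u' (fun x => w x - w' x) l.
Proof. rewrite starBl starBr; ring. Qed.

(** The field with frozen amplitudes. *)
Definition fmod s l : R[i] := phase 1 s * zcoef 1 (f 0) (d 0) l + phase (-1) s * zcoef (-1) (f 0) (d 0) l.

Let ie2_ge0 : 0 <= ie2. Proof. by rewrite invr_ge0. Qed.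
Let ie2_ge1 : 1 <= ie2.
Proof. by rewrite invf_ge1 ?exprn_gt0 // exprn_ile1 // ltW. Qed.

(** Seen at time [s], the motions of the two amplitudes at time [r] combine into the
    force times [sin ((s - r) / eps^2)], which is at most [tau / eps^2]. *)
Lemma fmod_le s : 0 <= s <= tau ->
  nrm N 1 (fun l => f s l - fmod s l) <= tau * (tau * ie2 * (K + K * K)).
Proof.
move=> /andP[s0 st].
pose H r l := phase 1 s * zmod 1 r l + phase (-1) s * zmod (-1) r l.
pose H' r l := (sin (ie2 * (s - r)))%:C * Gfor r l.
have hH (k : 'I_N) : CD s (fun r => H r (lidx N k)) (fun r => H' r (lidx N k)).
  apply: CD_sub st _.
  apply: CD_eq (CD_D (CD_Z (phase 1 s) (CD_zmod k one_m1)) (CD_Z (phase (-1) s) (CD_zmod k m1_m1))) _ => r _ /=.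
  rewrite /H' sin_cis.
  have -> : cis (ie2 * (s - r)) = phase 1 s * phase (-1) r.
    by rewrite /phase -cisD; congr cis; ring.
  have -> : cis (- (ie2 * (s - r))) = phase (-1) s * phase 1 r.
    by rewrite /phase -cisD; congr cis; ring.
  have -> : (- (-1 : R)) = 1 by rewrite opprK.
  have -> : ((1 / 2 : R)%:C : R[i]) = 2^-1 by rewrite mul1r fmorphV rmorph_nat.
  have -> : ((-1 / 2 : R)%:C : R[i]) = - 2^-1 by rewrite mulN1r rmorphN fmorphV rmorph_nat.
  ring.
have hB0 : 0 <= tau * ie2 * (K + K * K) by rewrite !mulr_ge0 ?addr_ge0 ?mulr_ge0.
have := nrm_MVT (s := 1) s0 hB0 hH.
rewrite (@eq_nrm _ _ _ (fun l => H s l - H 0 l) (fun l => f s l - fmod s l)); last first.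
  move=> k; rewrite /H -zmod_sum /fmod.
  by rewrite /zmod /phase !mulr0 cis0 !mul1r.
move=> h; apply: le_trans (h _) _; last by rewrite ler_wpM2r.
move=> r /andP[r0 rs]; apply: (@le_trans _ _ (tau * ie2 * nrm N 1 (Gfor r))).
  apply: nrm_mul; first by rewrite mulr_ge0.
  move=> k; rewrite normc_real; apply: le_trans (sin_le_id _) _.
    by rewrite mulr_ge0 // subr_ge0 ltW.
  by rewrite mulrC ler_wpM2r //; lra.
by rewrite ler_wpM2l ?mulr_ge0 //; apply: Gfor_le; rewrite !ltW // (lt_le_trans rs).
Qed.

Lemma g_incr0_le s n : 0 <= s <= tau -> (n <= 3)%N ->
  nrm N n (fun l => g s l - g 0 l) <= tau * (K + K * K).
Proof.
move=> /andP[s0 st] hn.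
have hB0 : 0 <= K + K * K by rewrite addr_ge0 ?mulr_ge0.
apply: le_trans (nrm_mono N _ hn) _.
apply: le_trans (nrm_MVT (s := 3) (F' := g') s0 hB0 (fun k => CD_sub st (dg k)) _) _.
  by move=> r /andP[r0 rs]; apply: g'_le; rewrite !ltW // (lt_le_trans rs).
by rewrite ler_wpM2r.
Qed.

Lemma f_incr0_le s : 0 <= s <= tau -> nrm N 1 (fun l => f s l - f 0 l) <= tau * (ie2 * K).
Proof.
move=> /andP[s0 st].
have hB0 : 0 <= ie2 * K by rewrite mulr_ge0.
apply: le_trans (nrm_MVT (s := 1) (F' := d) s0 hB0 (fun k => CD_sub st (df k)) _) _.
  move=> r /andP[r0 rs].
  have hr : 0 <= r <= tau by rewrite !ltW // (lt_le_trans rs).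
  rewrite (@eq_nrm _ _ _ _ (fun l => ie2%:C * ((eps ^+ 2)%:C * d r l))); last first.
    by move=> k; rewrite mulrA (mulrC ie2%:C) e2_ie2 mul1r.
  by apply: nrmZ_le; [rewrite normc_real ger0_norm|exact: bd_s].
by rewrite ler_wpM2r.
Qed.

Definition Wb : R := eta + 6 * K ^+ 4 * (tau * ie2).

Let Wb_ge0 : 0 <= Wb.
Proof. by rewrite addr_ge0 // !mulr_ge0. Qed.

(** The slope of [g] moves by [O(tau / eps^2)] through the field, and by [O(tau)]
    through [g] itself and the filter, up to the aliasing error. *)
Lemma incr_err s : 0 <= s <= tau -> nrm N 1 (fun l => g s l - incr s l) <= tau * Wb.
Proof.
move=> /andP[s0 st].
have hCD (k : 'I_N) : CD s (fun r => g r (lidx N k) - incr r (lidx N k)) (fun r => g' r (lidx N k) - gF (lidx N k)).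
  apply: CD_sub st _; apply: CD_B; [exact: dg|exact: CD_incr].
have := nrm_MVT (s := 1) (F := fun r l => g r l - incr r l) (F' := fun r l => g' r l - gF l) s0 Wb_ge0 hCD.
rewrite (@eq_nrm _ _ _ _ (fun l => g s l - incr s l)); last first.
  by move=> k; rewrite {2}/incr mul0r addr0 subrr subr0.
move=> h; apply: le_trans (h _) _; last by rewrite ler_wpM2r.
move=> r /andP[r0 rs]; have hr : 0 <= r <= tau by rewrite !ltW // (lt_le_trans rs).
rewrite (@eq_nrm _ _ _ _ (fun l => 'i * ((((F r l - star (f r) (g r) l)
    + (star (fun x => f r x - f 0 x) (g r) l + star (f 0) (fun x => g r x - g 0 x) l))
    - m2 l * (g r l - g 0 l)) - (mu l ^+ 2 - sin (mu l ^+ 2 * tau) / tau)%:C * g 0 l))); last first.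
  by move=> k; rewrite -star_sub /g' /dtpsi rmorphB /=; ring.
eapply le_trans.
  apply: nrm_i; apply: nrmB_le; first apply: nrmB_le; first apply: nrmD_le; first exact: aF hr.
  - apply: nrmD_le.
      exact: (star_le (s := 1) ab N0 Ne K96 isT (f_incr0_le hr) (@bg_s r 1 hr isT)).
    exact: (star_le (s := 1) ab N0 Ne K96 isT (@bf_s 0 1 i00 isT) (g_incr0_le hr (n := 1) isT)).
  - exact: (mu2_le (s := 1) K96 hmu (g_incr0_le hr (n := 3) isT)).
  - have h4 := mu4_sinc_le (s := 1) tau0 hmu (@bg_s 0 5 i00 isT).
    exact: h4.
rewrite /Wb; have tT : tau <= tau * ie2 by rewrite ler_peMr.
set T := tau * ie2 in tT *.
have -> : K * (tau * (ie2 * K)) * K = K ^+ 3 * T by rewrite /T; ring.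
have hK2 : K ^+ 2 <= K ^+ 4 by rewrite ler_weXn2l // (le_trans _ K96) // ler1n.
have hK3 : K ^+ 3 <= K ^+ 4 by rewrite ler_weXn2l // (le_trans _ K96) // ler1n.
have T0 : 0 <= T by rewrite mulr_ge0.
have a1 : K ^+ 3 * T <= K ^+ 4 * T by rewrite ler_wpM2r.
have a2 : K ^+ 3 * tau <= K ^+ 4 * T by apply: ler_pM.
have a3 : K ^+ 2 * tau <= K ^+ 4 * T by apply: ler_pM.
have a4 : K ^+ 4 * tau <= K ^+ 4 * T by rewrite ler_wpM2l.
lra.
Qed.

(** The product of the field and of [g] is compared with the product of their
    approximations, with the error put on one factor at a time. *)
Lemma local_psi_tau : nrm N 1 (fun l => g tau l - psi_step a b N eps tau (g 0) (f 0) (d 0) l)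
  <= tau * (36 * K ^+ 6 * (eta + tau ^+ 2 / eps ^+ 2)).
Proof.
rewrite (@eq_nrm _ _ _ _ (fun l => cis (- (mu l ^+ 2 * tau)) * Dpsi tau l)); last exact: Dpsi_tau.
rewrite nrm_unit; last by move=> l; exact: normc_cis.
rewrite (@eq_nrm _ _ _ _ (fun l => Dpsi tau l - Dpsi 0 l)); last by move=> k; rewrite Dpsi0 subr0.
apply: (nrm_MVT t0 _ CD_Dpsi); first by rewrite !mulr_ge0 ?addr_ge0 ?divr_ge0 ?sqr_ge0.
move=> s /sub_ivl hs.
rewrite (@eq_nrm _ _ _ _ (fun l => 'i * (cis (mu l ^+ 2 * s) * ((F s l - star (f s) (g s) l)
   + (star (fun x => f s x - fmod s x) (g s) l + star (fmod s) (fun x => g s x - incr s x) l))))); last first.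
  move=> k; rewrite -star_sub /Dpsi' /Dnum' /fmod starDl !starZl; ring.
apply: le_trans (nrm_i _) (lexx _).
rewrite nrm_unit; last by move=> l; exact: normc_cis.
have hf : nrm N 1 (fmod s) <= K + K.
  by apply: nrmD_le; (rewrite nrm_unit; [exact: zcoef0_le|move=> l; exact: normc_phase]).
eapply le_trans.
  apply: nrmD_le; first exact: aF hs.
  apply: nrmD_le.
    exact: (star_le (s := 1) ab N0 Ne K96 isT (fmod_le hs) (@bg_s s 1 hs isT)).
  exact: (star_le (s := 1) ab N0 Ne K96 isT hf (incr_err hs)).
rewrite /Wb -mulrA; set T := tau * ie2.
have T0 : 0 <= T by rewrite mulr_ge0.
have -> : tau ^+ 2 / eps ^+ 2 = tau * T by rewrite /T; ring.
set X := tau * T; have X0 : 0 <= X by rewrite mulr_ge0.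
have -> : K * (tau * (T * (K + K * K)) * K) = (K ^+ 3 + K ^+ 4) * X by rewrite /X; ring.
have -> : K * (K + K) * (tau * (eta + 6 * K ^+ 4 * T)) = 2 * K ^+ 2 * (tau * eta) + 12 * K ^+ 6 * X.
  by rewrite /X; ring.
have te : tau * eta <= eta by rewrite ler_piMl.
have te0 : 0 <= tau * eta by rewrite mulr_ge0.
have a2 : K ^+ 2 * (tau * eta) <= K ^+ 6 * eta by apply: ler_pM => //; exact: K_le.
have a3 : K ^+ 3 * X <= K ^+ 6 * X by rewrite ler_wpM2r //; exact: K_le.
have a4 : K ^+ 4 * X <= K ^+ 6 * X by rewrite ler_wpM2r //; exact: K_le.
have a0 : 1 * eta <= K ^+ 6 * eta by rewrite ler_wpM2r // -(expr0 K); exact: K_le.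
have a6 : 0 <= K ^+ 6 * eta by rewrite mulr_ge0.
have a7 : 0 <= K ^+ 6 * X by rewrite mulr_ge0.
lra.
Qed.

Notation om := (omega a b eps).
Notation r0 := (rho0 a b N (g 0)).
Notation r1 := (rho1 a b N tau (g 0) (f 0)).

(** The forcing of the field on the grid minus its tangent: it vanishes at 0 and is
    slow, as it does not involve the phases. *)
Definition Jkg s l : R[i] := star (g s) (cj (g s)) l - (r0 l + s%:C * r1 l).
Definition Jkg' s l : R[i] := star (g' s) (cj (g s)) l + star (g s) (cj (g' s)) l - r1 l.

Lemma CD_Jkg l : CD tau (fun s => Jkg s l) (fun s => Jkg' s l).
Proof.
have h1 := @CD_star R a b N tau g g' (fun s => cj (g s)) (fun s => cj (g' s)) l dg
  (fun k => CD_cj a b (lidx N k) dg).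
apply: CD_eq (CD_B h1 (CD_D (CD_cst tau (r0 l)) (CD_M (CD_id tau) (CD_cst tau (r1 l))))) _ => s _ /=.
by rewrite /Jkg'; ring.
Qed.

Lemma Jkg0 l : Jkg 0 l = 0.
Proof. by rewrite /Jkg mul0r addr0 subrr. Qed.

Lemma Jkg'_le s : 0 <= s <= tau -> nrm N 1 (Jkg' s) <= 8 * K ^+ 5.
Proof.
move=> hs; have hg := @bg_s s 1 hs isT; have hg0 := @bg_s 0 1 i00 isT.
have hg' : nrm N 1 (g' s) <= K + K * K by apply: le_trans (g'_le hs); exact: nrm_mono.
have hF : nrm N 1 gF <= K * K + K * K * K by apply: le_trans gF_le; exact: nrm_mono.
eapply le_trans.
  apply: nrmB_le; first apply: nrmD_le.
  - exact: (star_le (s := 1) ab N0 Ne K96 isT hg' (cj_le ab N0 Ne hg)).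
  - exact: (star_le (s := 1) ab N0 Ne K96 isT hg (cj_le ab N0 Ne hg')).
  - apply: nrmD_le.
    + exact: (star_le (s := 1) ab N0 Ne K96 isT hF (cj_le ab N0 Ne hg0)).
    + exact: (star_le (s := 1) ab N0 Ne K96 isT hg0 (cj_le ab N0 Ne hF)).
have hK3 : K ^+ 3 <= K ^+ 5 by rewrite ler_weXn2l // (le_trans _ K96) // ler1n.
have hK4 : K ^+ 4 <= K ^+ 5 by rewrite ler_weXn2l // (le_trans _ K96) // ler1n.
lra.
Qed.

(** For the boundary terms of the integration by parts in [local_kg_eps], which carry
    a factor [eps^2]. *)
Lemma Jkg_eps s : 0 <= s <= tau -> nrm N 1 (Jkg s) <= tau * (8 * K ^+ 5).
Proof.
move=> /andP[s0 st]; have hB : 0 <= 8 * K ^+ 5 by rewrite mulr_ge0.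
rewrite (@eq_nrm _ _ _ _ (fun l => Jkg s l - Jkg 0 l)); last by move=> k; rewrite Jkg0 subr0.
apply: le_trans (nrm_MVT (s := 1) (F' := Jkg') s0 hB (fun k => CD_sub st (CD_Jkg (lidx N k))) _) _.
  by move=> r /andP[r0' rs]; apply: Jkg'_le; rewrite !ltW // (lt_le_trans rs).
by rewrite ler_wpM2r.
Qed.

(** The remainder of the tangent of the quadratic map [u -> |u|^2] along a curve:
    the defect [u - u0 - s q] of the curve from its tangent enters linearly, and
    the displacement quadratically. *)
Lemma quad_expand (u u0 q : int -> R[i]) s l :
  star u (cj u) l - (star u0 (cj u0) l + s%:C * (star q (cj u0) l + star u0 (cj q) l)) =
  star u0 (cj (fun x => u x - u0 x - s%:C * q x)) l + star (fun x => u x - u0 x - s%:C * q x) (cj u0) l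
  + star (fun x => u x - u0 x) (cj (fun x => u x - u0 x)) l.
Proof.
have e1 : cj (fun x => u x - u0 x - s%:C * q x) = (fun x => cj u x - cj u0 x - s%:C * cj q x).
  by apply/funext => x; rewrite !cjB cjZ conjc_real.
have e2 : cj (fun x => u x - u0 x) = (fun x => cj u x - cj u0 x) by apply/funext => x; rewrite cjB.
by rewrite e1 e2 !(starBr, starBl, starZl, starZr); ring.
Qed.

Lemma Jkg_tau s : 0 <= s <= tau -> nrm N 1 (Jkg s) <= 16 * K ^+ 6 * (eta + tau ^+ 2 / eps ^+ 2).
Proof.
move=> hs; have hg0 := @bg_s 0 1 i00 isT; have hw := incr_err hs.
have hd := g_incr0_le (n := 1) hs isT.
have E (k : 'I_N) (l := lidx N k) : Jkg s l =
    star (g 0) (cj (fun x => g s x - incr s x)) l + star (fun x => g s x - incr s x) (cj (g 0)) l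
    + star (fun x => g s x - g 0 x) (cj (fun x => g s x - g 0 x)) l.
  rewrite /Jkg (quad_expand _ _ gF s); congr (_ + _ + _).
    apply: star_ext => // i; apply: cj_ext => j; rewrite /incr; ring.
  apply: star_ext => // i; rewrite /incr; ring.
rewrite (@eq_nrm _ N 1 (Jkg s) (fun l =>
    star (g 0) (cj (fun x => g s x - incr s x)) l + star (fun x => g s x - incr s x) (cj (g 0)) l
    + star (fun x => g s x - g 0 x) (cj (fun x => g s x - g 0 x)) l)); last exact: E.
eapply le_trans.
  apply: nrmD_le; first apply: nrmD_le.
  - exact: (star_le (s := 1) ab N0 Ne K96 isT hg0 (cj_le ab N0 Ne hw)).
  - exact: (star_le (s := 1) ab N0 Ne K96 isT hw (cj_le ab N0 Ne hg0)).
  - exact: (star_le (s := 1) ab N0 Ne K96 isT hd (cj_le ab N0 Ne hd)).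
rewrite /Wb; set T := tau * ie2.
have T0 : 0 <= T by rewrite mulr_ge0.
have tT : tau <= T by rewrite ler_peMr.
have -> : tau ^+ 2 / eps ^+ 2 = tau * T by rewrite /T; ring.
set X := tau * T; have X0 : 0 <= X by rewrite mulr_ge0.
have -> : K * K * (tau * (eta + 6 * K ^+ 4 * T)) = K ^+ 2 * (tau * eta) + 6 * (K ^+ 6 * X) by rewrite /X; ring.
have -> : K * (tau * (eta + 6 * K ^+ 4 * T)) * K = K ^+ 2 * (tau * eta) + 6 * (K ^+ 6 * X) by rewrite /X; ring.
have -> : K * (tau * (K + K * K)) * (tau * (K + K * K)) = (K ^+ 3 + 2 * K ^+ 4 + K ^+ 5) * (tau * tau) by ring.
have tt : tau * tau <= X by rewrite /X ler_wpM2l.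
have te : tau * eta <= eta by rewrite ler_piMl.
have te0 : 0 <= tau * eta by rewrite mulr_ge0.
have a2 : K ^+ 2 * (tau * eta) <= K ^+ 6 * eta by apply: ler_pM => //; exact: K_le.
have tt0 : 0 <= tau * tau by rewrite mulr_ge0.
have a3 : K ^+ 3 * (tau * tau) <= K ^+ 6 * X by apply: ler_pM => //; exact: K_le.
have a4 : K ^+ 4 * (tau * tau) <= K ^+ 6 * X by apply: ler_pM => //; exact: K_le.
have a5 : K ^+ 5 * (tau * tau) <= K ^+ 6 * X by apply: ler_pM => //; exact: K_le.
have a6 : 0 <= K ^+ 6 * eta by rewrite mulr_ge0.
have a7 : 0 <= K ^+ 6 * X by rewrite mulr_ge0.
lra.
Qed.

Lemma om_sq l : eps ^+ 2 * om l = Num.sqrt (1 + eps ^+ 2 * mu l ^+ 2).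
Proof. by rewrite /omega mulrC divfK. Qed.

Lemma om_ge1 l : 1 <= eps ^+ 2 * om l.
Proof.
have h : 0 <= eps ^+ 2 * mu l ^+ 2 := mulr_ge0 (sqr_ge0 _) (sqr_ge0 _).
by rewrite om_sq -[leLHS](@sqrtr1 R) ler_wsqrtr // lerDl.
Qed.

Lemma om_gt0 l : 0 < om l.
Proof.
have := lt_le_trans ltr01 (om_ge1 l); rewrite pmulr_rgt0 // exprn_gt0 //.
Qed.

Lemma om_inv_le l : (om l)^-1 <= eps ^+ 2.
Proof. by rewrite -[leLHS]mul1r ler_pdivrMr ?om_gt0 // om_ge1. Qed.

Lemma om2 l : om l * om l = ie2 * (mu l ^+ 2 + ie2).
Proof.
rewrite -expr2 /omega expr_div_n sqr_sqrtr; last by rewrite addr_ge0 // mulr_ge0 ?sqr_ge0.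
by field; rewrite gt_eqF.
Qed.

Lemma CD_RintC t (u : R -> R) : continuous u ->
  CD t (fun s => (\int[lebesgue_measure]_(x in `[0, s]) u x)%:C) (fun s => (u s)%:C).
Proof.
move=> cu; have [h1 h2] := CD_Rint t cu; split => //=.
  exact: within_cst.
by move=> s hs; split => /=; [exact: h2|exact: is_derive_cst_fun].
Qed.

Lemma CD_Zr t (c : R) (u : R -> R) u' : CD t (fun s => (u s)%:C) u' ->
  CD t (fun s => (c * u s)%:C) (fun s => c%:C * u' s).
Proof. by move=> h; apply: (CD_ext (CD_Z c%:C h)) => s; rewrite rmorphM. Qed.

Let lin_arg l (s : R) : om l * (tau - s) = - om l * s + om l * tau.
Proof. by ring. Qed.

Let cont_sin l : continuous (fun s => sin (om l * (tau - s))).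
Proof.
rewrite (_ : (fun s => _) = fun s => sin (- om l * s + om l * tau)); first exact: continuous_sin_lin.
by apply/funext => s; rewrite lin_arg.
Qed.
Let cont_cos l : continuous (fun s => cos (om l * (tau - s))).
Proof.
rewrite (_ : (fun s => _) = fun s => cos (- om l * s + om l * tau)); first exact: continuous_cos_lin.
by apply/funext => s; rewrite lin_arg.
Qed.

Lemma CD_sinkg l : CD tau (fun s => (sin (om l * (tau - s)))%:C)
  (fun s => - ((om l)%:C * (cos (om l * (tau - s)))%:C)).
Proof.
apply: CD_eq (CD_ext (CD_real tau (is_derive_sin_lin (- om l) (om l * tau))) _) _ => [s|s _] /=.
  by rewrite lin_arg.
by rewrite lin_arg mulNr rmorphN rmorphM.
Qed.

Lemma CD_coskg l : CD tau (fun s => (cos (om l * (tau - s)))%:C)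
  (fun s => (om l)%:C * (sin (om l * (tau - s)))%:C).
Proof.
apply: CD_eq (CD_ext (CD_real tau (is_derive_cos_lin (- om l) (om l * tau))) _) _ => [s|s _] /=.
  by rewrite lin_arg.
by rewrite lin_arg mulNr opprK rmorphM.
Qed.

Notation Rint s u := (\int[lebesgue_measure]_(x in `[0, s]) u x).
Definition ps l (x : R) : R := sin (om l * (tau - x)) / (eps ^+ 2 * om l).
Definition qs l (x : R) : R := x * (sin (om l * (tau - x)) / (eps ^+ 2 * om l)).
Definition pc l (x : R) : R := cos (om l * (tau - x)) / eps ^+ 2.
Definition qc l (x : R) : R := x * (cos (om l * (tau - x)) / eps ^+ 2).

Let cont_ps l : continuous (ps l). Proof. by move=> x; apply: cvgM; [exact: cont_sin|exact: cvg_cst]. Qed.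
Let cont_pc l : continuous (pc l). Proof. by move=> x; apply: cvgM; [exact: cont_cos|exact: cvg_cst]. Qed.
Let cont_qs l : continuous (qs l). Proof. by move=> x; apply: cvgM; [exact: cvg_id|exact: cont_ps]. Qed.
Let cont_qc l : continuous (qc l). Proof. by move=> x; apply: cvgM; [exact: cvg_id|exact: cont_pc]. Qed.

Let eo_neq0 l : eps ^+ 2 * om l != 0.
Proof. by rewrite gt_eqF // (lt_le_trans ltr01) // om_ge1. Qed.

Lemma CD_P l : CD tau (fun s => (eps ^+ 2 * om l * Rint s (ps l))%:C)
  (fun s => (sin (om l * (tau - s)))%:C).
Proof.
apply: CD_eq (CD_Zr _ (CD_RintC tau (@cont_ps l))) _ => s _ /=.
by rewrite -rmorphM /ps mulrC divfK.
Qed.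
Lemma CD_Q l : CD tau (fun s => (eps ^+ 2 * om l * Rint s (qs l))%:C)
  (fun s => s%:C * (sin (om l * (tau - s)))%:C).
Proof.
apply: CD_eq (CD_Zr _ (CD_RintC tau (@cont_qs l))) _ => s _ /=.
by rewrite -!rmorphM /qs mulrCA (mulrC (eps ^+ 2 * om l)) divfK.
Qed.
Lemma CD_P' l : CD tau (fun s => (eps ^+ 2 * Rint s (pc l))%:C)
  (fun s => (cos (om l * (tau - s)))%:C).
Proof.
apply: CD_eq (CD_Zr _ (CD_RintC tau (@cont_pc l))) _ => s _ /=.
by rewrite -rmorphM /pc mulrC divfK.
Qed.
Lemma CD_Q' l : CD tau (fun s => (eps ^+ 2 * Rint s (qc l))%:C)
  (fun s => s%:C * (cos (om l * (tau - s)))%:C).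
Proof.
apply: CD_eq (CD_Zr _ (CD_RintC tau (@cont_qc l))) _ => s _ /=.
by rewrite -!rmorphM /qc mulrCA (mulrC (eps ^+ 2)) divfK.
Qed.

Notation e2c := ((eps ^+ 2)%:C).
Notation omc l := ((om l)%:C).
Notation SS l s := ((sin (om l * (tau - s)))%:C).
Notation CC l s := ((cos (om l * (tau - s)))%:C).

(** The local errors of the two components of the rotated pair, with the final
    time as reference: [CC] and [SS] are cosine and sine of [omega (tau - s)]. *)
Definition Dkg1 s l : R[i] :=
  (e2c * omc l * (CC l s * f s l) + e2c * (SS l s * d s l))
  - (e2c * omc l * (CC l 0 * f 0 l) + e2c * (SS l 0 * d 0 l))
  - (eps ^+ 2 * om l * Rint s (ps l))%:C * r0 l - (eps ^+ 2 * om l * Rint s (qs l))%:C * r1 l.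
Definition Dkg2 s l : R[i] :=
  (e2c * (CC l s * d s l) - e2c * omc l * (SS l s * f s l))
  - (e2c * (CC l 0 * d 0 l) - e2c * omc l * (SS l 0 * f 0 l))
  - (eps ^+ 2 * Rint s (pc l))%:C * r0 l - (eps ^+ 2 * Rint s (qc l))%:C * r1 l.

(** By variation of constants it is the only source of the local error. *)
Definition Jall s l : R[i] := Q s l - (r0 l + s%:C * r1 l).

Let om2c l : e2c * (omc l * omc l) = m2 l + ie2%:C.
Proof.
by rewrite -!rmorphM om2 mulrA mulfV // mul1r rmorphD.
Qed.

Lemma CD_Dkg1 (k : 'I_N) : CD tau (fun s => Dkg1 s (lidx N k)) (fun s => SS (lidx N k) s * Jall s (lidx N k)).
Proof.
set l := lidx N k.
have h1 := CD_Z (e2c * omc l) (CD_M (CD_coskg l) (df k)).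
have h2 := CD_Z e2c (CD_M (CD_sinkg l) (dd k)).
have h3 := CD_M (CD_P l) (CD_cst tau (r0 l)); have h4 := CD_M (CD_Q l) (CD_cst tau (r1 l)).
apply: CD_eq (CD_B (CD_B (CD_B (CD_D h1 h2) (CD_cst tau _)) h3) h4) _ => s _ /=; rewrite -/l.
rewrite /Jall; have o2 := om2c l; have h := e2_ie2; set ie := ie2%:C in h o2 *; set e2 := e2c in h o2 *.
set x := f s l; set y := d s l; set S := SS l s; set C := CC l s; set o := omc l in o2 *; set m := m2 l in o2 *.
set z := Q s l.
transitivity (S * (z - (r0 l + s%:C * r1 l)) + (e2 * (o * o) - (m + ie)) * (S * x)
   + (e2 * ie - 1) * (S * (z - (m + ie) * x))); first by ring.
by rewrite o2 h !subrr !mul0r !addr0.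
Qed.

Lemma CD_Dkg2 (k : 'I_N) : CD tau (fun s => Dkg2 s (lidx N k)) (fun s => CC (lidx N k) s * Jall s (lidx N k)).
Proof.
set l := lidx N k.
have h1 := CD_Z (e2c * omc l) (CD_M (CD_sinkg l) (df k)).
have h2 := CD_Z e2c (CD_M (CD_coskg l) (dd k)).
have h3 := CD_M (CD_P' l) (CD_cst tau (r0 l)); have h4 := CD_M (CD_Q' l) (CD_cst tau (r1 l)).
apply: CD_eq (CD_B (CD_B (CD_B (CD_B h2 h1) (CD_cst tau _)) h3) h4) _ => s _ /=; rewrite -/l.
rewrite /Jall; have o2 := om2c l; have h := e2_ie2; set ie := ie2%:C in h o2 *; set e2 := e2c in h o2 *.
set x := f s l; set y := d s l; set S := SS l s; set C := CC l s; set o := omc l in o2 *; set m := m2 l in o2 *.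
set z := Q s l.
transitivity (C * (z - (r0 l + s%:C * r1 l)) + (e2 * (o * o) - (m + ie)) * (C * x)
   + (e2 * ie - 1) * (C * (z - (m + ie) * x))); first by ring.
by rewrite o2 h !subrr !mul0r !addr0.
Qed.

Lemma Dkg1_0 l : Dkg1 0 l = 0.
Proof. by rewrite /Dkg1 !Rint_00 !mulr0 !mul0r !subr0 subrr. Qed.
Lemma Dkg2_0 l : Dkg2 0 l = 0.
Proof. by rewrite /Dkg2 !Rint_00 !mulr0 !mul0r !subr0 subrr. Qed.

Lemma Dkg1_tau l : Dkg1 tau l = (eps ^+ 2 * om l)%:C * (f tau l - phi_step a b N eps tau (g 0) (f 0) (d 0) l).
Proof.
rewrite /Dkg1 /phi_step /coef_p /coef_q -/(ps l) -/(qs l) subrr mulr0 subr0 cos0 sin0.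
have o0 : omc l != 0 :> R[i] by rewrite fmorph_eq0 gt_eqF // om_gt0.
have -> : (1 : R)%:C = 1 :> R[i] by [].
have -> : (0 : R)%:C = 0 :> R[i] by [].
rewrite !(rcM (eps ^+ 2 * om l)) (rcM (eps ^+ 2)) (rcM (sin _)) rcV.
have h (x y z : R[i]) : x * (y * z) = x * omc l * (y / omc l * z).
  have e : omc l * (omc l)^-1 = 1 by rewrite divff.
  transitivity ((omc l * (omc l)^-1) * (x * (y * z))); first by rewrite e mul1r.
  ring.
by rewrite (h e2c _ (d 0 l)); ring.
Qed.

Lemma Dkg2_tau l : Dkg2 tau l = (eps ^+ 2)%:C * (d tau l - dphi_step a b N eps tau (g 0) (f 0) (d 0) l).
Proof.
rewrite /Dkg2 /dphi_step /coef_p' /coef_q' -/(pc l) -/(qc l) subrr mulr0 subr0 cos0 sin0.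
have -> : (1 : R)%:C = 1 :> R[i] by [].
have -> : (0 : R)%:C = 0 :> R[i] by [].
rewrite !rcM; ring.
Qed.

Let Jall_split s l : Jall s l = (Q s l - star (g s) (cj (g s)) l) + Jkg s l.
Proof. by rewrite /Jall /Jkg; ring. Qed.

Let trig_le s c x (u : int -> R) : (forall l, `|u l| <= 1) -> nrm N s c <= x ->
  nrm N s (fun l => (u l)%:C * c l) <= x.
Proof.
move=> hu h; apply: le_trans h; rewrite -[leRHS]mul1r; apply: nrm_mul => // k.
by rewrite normc_real.
Qed.

Lemma local_kg_tau : nrm N 1 (Dkg1 tau) <= tau * (17 * K ^+ 6 * (eta + tau ^+ 2 / eps ^+ 2)) /\
  nrm N 1 (Dkg2 tau) <= tau * (17 * K ^+ 6 * (eta + tau ^+ 2 / eps ^+ 2)).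
Proof.
have X0 : 0 <= tau ^+ 2 / eps ^+ 2 := divr_ge0 (sqr_ge0 _) (sqr_ge0 _).
have B0 : 0 <= 17 * K ^+ 6 * (eta + tau ^+ 2 / eps ^+ 2).
  by apply: mulr_ge0; [exact: mulr_ge0|exact: addr_ge0].
have hJ s : 0 < s < tau -> nrm N 1 (Jall s) <= 17 * K ^+ 6 * (eta + tau ^+ 2 / eps ^+ 2).
  move=> /sub_ivl hs; rewrite (@eq_nrm _ _ _ _ (fun l => (Q s l - star (g s) (cj (g s)) l) + Jkg s l)); last first.
    by move=> k; exact: Jall_split.
  apply: (le_trans (nrmD_le (aQ hs) (Jkg_tau hs))).
  set X := tau ^+ 2 / eps ^+ 2 in X0 *.
  have a0 : 1 * eta <= K ^+ 6 * eta by rewrite ler_wpM2r // -(expr0 K); exact: K_le.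
  have a7 : 0 <= K ^+ 6 * X by rewrite mulr_ge0.
  lra.
split.
  rewrite (@eq_nrm _ _ _ _ (fun l => Dkg1 tau l - Dkg1 0 l)); last by move=> k; rewrite Dkg1_0 subr0.
  apply: (nrm_MVT (F' := fun s l => SS l s * Jall s l) t0 B0 CD_Dkg1) => s hs.
  apply: (trig_le (u := fun l => sin (om l * (tau - s)))); last exact: hJ.
  by move=> l; exact: sin_max.
rewrite (@eq_nrm _ _ _ _ (fun l => Dkg2 tau l - Dkg2 0 l)); last by move=> k; rewrite Dkg2_0 subr0.
apply: (nrm_MVT (F' := fun s l => CC l s * Jall s l) t0 B0 CD_Dkg2) => s hs.
apply: (trig_le (u := fun l => cos (om l * (tau - s)))); last exact: hJ.
by move=> l; exact: cos_max.
Qed.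

(** Since [1 / omega <= eps^2], integrating the cosine or sine of
    [omega (tau - s)] by parts against [Jkg] gains [eps^2]. *)
Lemma local_kg_eps : nrm N 1 (Dkg1 tau) <= tau * (eta + 16 * K ^+ 5 * eps ^+ 2) /\
  nrm N 1 (Dkg2 tau) <= tau * (eta + 16 * K ^+ 5 * eps ^+ 2).
Proof.
have oi_ge0 l : 0 <= (om l)^-1 by rewrite invr_ge0 ltW // om_gt0.
have hV s c x : nrm N s c <= x -> nrm N s (fun l => (om l)^-1%:C * c l) <= eps ^+ 2 * x.
  move=> h; apply: (@le_trans _ _ (eps ^+ 2 * nrm N s c)); last by rewrite ler_wpM2l.
  apply: nrm_mul => // k; rewrite normc_real ger0_norm //; exact: om_inv_le.
have B0 : 0 <= eta + eps ^+ 2 * (8 * K ^+ 5) by apply: addr_ge0 => //; apply: mulr_ge0 => //; exact: mulr_ge0.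
have oo l : (om l)^-1%:C * omc l = 1 :> R[i] by rewrite -rmorphM mulVf // gt_eqF // om_gt0.
pose E1 s l : R[i] := Dkg1 s l - (om l)^-1%:C * (CC l s * Jkg s l).
pose E1' s l : R[i] := SS l s * (Q s l - star (g s) (cj (g s)) l) - (om l)^-1%:C * (CC l s * Jkg' s l).
pose E2 s l : R[i] := Dkg2 s l + (om l)^-1%:C * (SS l s * Jkg s l).
pose E2' s l : R[i] := CC l s * (Q s l - star (g s) (cj (g s)) l) + (om l)^-1%:C * (SS l s * Jkg' s l).
have c1 (k : 'I_N) : CD tau (fun s => E1 s (lidx N k)) (fun s => E1' s (lidx N k)).
  set l := lidx N k.
  apply: CD_eq (CD_B (CD_Dkg1 k) (CD_Z _ (CD_M (CD_coskg l) (CD_Jkg l)))) _ => s _ /=.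
  rewrite -/l Jall_split /E1'.
  set S := SS l s; set C := CC l s; set z := _ - star _ _ _; set J := Jkg s l; set J' := Jkg' s l.
  transitivity (S * z - (om l)^-1%:C * (C * J') + (1 - (om l)^-1%:C * omc l) * (S * J)); first by ring.
  by rewrite oo subrr mul0r addr0.
have c2 (k : 'I_N) : CD tau (fun s => E2 s (lidx N k)) (fun s => E2' s (lidx N k)).
  set l := lidx N k.
  apply: CD_eq (CD_D (CD_Dkg2 k) (CD_Z _ (CD_M (CD_sinkg l) (CD_Jkg l)))) _ => s _ /=.
  rewrite -/l Jall_split /E2'.
  set S := SS l s; set C := CC l s; set z := _ - star _ _ _; set J := Jkg s l; set J' := Jkg' s l.
  transitivity (C * z + (om l)^-1%:C * (S * J') + (1 - (om l)^-1%:C * omc l) * (C * J)); first by ring.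
  by rewrite oo subrr mul0r addr0.
have n1 : nrm N 1 (fun l => E1 tau l - E1 0 l) <= tau * (eta + eps ^+ 2 * (8 * K ^+ 5)).
  apply: (nrm_MVT t0 B0 c1) => s /sub_ivl hs; apply: nrmB_le.
    by apply: trig_le; [move=> l; exact: sin_max|exact: aQ].
  by apply: hV; apply: trig_le; [move=> l; exact: cos_max|exact: Jkg'_le].
have n2 : nrm N 1 (fun l => E2 tau l - E2 0 l) <= tau * (eta + eps ^+ 2 * (8 * K ^+ 5)).
  apply: (nrm_MVT t0 B0 c2) => s /sub_ivl hs; apply: nrmD_le.
    by apply: trig_le; [move=> l; exact: cos_max|exact: aQ].
  by apply: hV; apply: trig_le; [move=> l; exact: sin_max|exact: Jkg'_le].
have nb1 : nrm N 1 (fun l => (om l)^-1%:C * (CC l tau * Jkg tau l)) <= eps ^+ 2 * (tau * (8 * K ^+ 5)).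
  by apply: hV; apply: trig_le; [move=> l; exact: cos_max|exact: Jkg_eps].
have nb2 : nrm N 1 (fun l => (om l)^-1%:C * (SS l tau * Jkg tau l)) <= eps ^+ 2 * (tau * (8 * K ^+ 5)).
  by apply: hV; apply: trig_le; [move=> l; exact: sin_max|exact: Jkg_eps].
split.
  rewrite (@eq_nrm _ _ _ _ (fun l => (E1 tau l - E1 0 l) + (om l)^-1%:C * (CC l tau * Jkg tau l))); last first.
    by move=> k; rewrite /E1 Dkg1_0 Jkg0 !mulr0; ring.
  apply: (le_trans (nrmD_le n1 nb1)); lra.
rewrite (@eq_nrm _ _ _ _ (fun l => (E2 tau l - E2 0 l) - (om l)^-1%:C * (SS l tau * Jkg tau l))); last first.
  by move=> k; rewrite /E2 Dkg2_0 Jkg0 !mulr0; ring.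
apply: (le_trans (nrmB_le n2 nb2)); lra.
Qed.

End LocalError.

(** * The scheme and its coefficient form *)
Section PhaseAlgebra.
Context {R : realType}.
Lemma cancel_phase (o ie S : R[i]) : o != 0 ->
  'i * ((- ie - o) * (- ie + o)) * ('i * S * (2 * o)) / - (2 * o) =
  - ('i * 'i) * ((- ie - o) * (- ie + o) * S).
Proof. by move=> h; rewrite invrN; field. Qed.

Lemma combine_phases (C S e2 ie f d : R[i]) : e2 * ie = 1 ->
  (C + 'i * ie * S) * (2^-1 * (f - 'i * 1 * e2 * d)) +
  (C + - 'i * ie * S) * (2^-1 * (f - 'i * -1 * e2 * d)) = C * f + S * d.
Proof.
move=> h; transitivity (C * f - ('i * 'i) * (e2 * ie) * S * d); first by field.
by rewrite h sqri; ring.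
Qed.
End PhaseAlgebra.

Section NumericalLink.
Context {R : realType} (a b : R) (ab : a < b) (N : nat) (N0 : (0 < N)%N) (Ne : ~~ odd N).
Context (eps tau : R) (eps0 : 0 < eps).
Local Notation star := (@star R a b N).
Local Notation cj := (@cj R a b N).
Local Notation mu := (@mu R a b).
Local Notation dft := (@dft R a b N).
Local Notation vec := (@grid_of_coef R a b N).
Local Notation Y := (@grid R N).
Local Notation w j := (widen_ord (leqnSn N) j).
Local Notation om := (omega a b eps).
Local Notation ie2 := ((eps ^+ 2)^-1).

Let e20 : eps ^+ 2 != 0. Proof. by rewrite expf_neq0 // gt_eqF. Qed.

Lemma star_dft (u v : Y) l : star (dft u) (dft v) l = dft (fun j => u j * v j) l.
Proof. by apply: dft_ext => j; rewrite !vec_dft. Qed.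

Lemma star_dft_vec (u : Y) c l : star (dft u) c l = dft (fun j => u j * vec c j) l.
Proof. by apply: dft_ext => j; rewrite vec_dft. Qed.

Lemma cj_dft (u : Y) l : cj (dft u) l = dft (fun j => (u j)^*) l.
Proof. by apply: dft_ext => j; rewrite vec_dft. Qed.

Lemma mu2_oppk (k : 'I_N) : mu (lidx N (oppk N0 k)) ^+ 2 = mu (lidx N k) ^+ 2.
Proof.
have kN := ltn_ord k.
have [k0|k0] := posnP k; first by rewrite /lidx /oppk /= k0 subn0 modnn.
have -> : lidx N (oppk N0 k) = - lidx N k.
  rewrite /lidx /oppk /= modn_small; last by lia.
  by have := halfK N; rewrite (negbTE Ne) subn0; move: kN; clear; lia.
by rewrite muN sqrrN.
Qed.

Lemma om_oppk (k : 'I_N) : om (lidx N (oppk N0 k)) = om (lidx N k).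
Proof. by rewrite /omega mu2_oppk. Qed.

Lemma sqr_normcE (z : R[i]) : (normc z ^+ 2)%:C = z * z^*.
Proof.
apply/eqP; rewrite eq_complex normcE2 !(ReM, ImM, ReJ, ImJ) /=.
by apply/andP; split; apply/eqP; ring.
Qed.

Lemma Re2E (z : R[i]) : 2 * (Re z)%:C = z + z^*.
Proof. by rewrite addcJ. Qed.

Lemma realE (z : R[i]) : Im z = 0 -> z^* = z.
Proof. by case: z => x y /= ->; rewrite oppr0. Qed.
Lemma real_conj (z : R[i]) : z^* = z -> Im z = 0.
Proof. by case: z => x y /= [] h; lra. Qed.

Lemma vec_real c : (forall k : 'I_N, (c (lidx N (oppk N0 k)))^* = c (lidx N k)) ->
  forall j : 'I_N, Im (vec c (w j)) = 0.
Proof.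
move=> h j; apply: real_conj; rewrite -vec_cj //; apply: vec_ext => k.
by rewrite (cj_idx ab N0 Ne) h.
Qed.

Lemma om_pos l : 0 < om l.
Proof. exact: om_gt0. Qed.

Lemma lambdapE l : lambdap a b eps l = - ie2 - om l.
Proof. by rewrite /lambdap /omega; field; rewrite gt_eqF. Qed.
Lemma lambdamE l : lambdam a b eps l = - ie2 + om l.
Proof. by rewrite /lambdam /omega; field; rewrite gt_eqF. Qed.

Let o0 l : (om l)%:C != 0 :> R[i].
Proof. by rewrite fmorph_eq0 gt_eqF // om_pos. Qed.

Let lamB l : (lambdap a b eps l - lambdam a b eps l)%:C = - (2 * (om l)%:C) :> R[i].
Proof.
have h2 : (2 : R)%:C = 2 :> R[i] by rewrite rmorph_nat.
by rewrite lambdapE lambdamE -h2 -rcM -rcN; congr (_%:C); ring.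
Qed.

(** The product of the phase [e^(i tau/eps^2)] with the two exponentials of [a_l]
    leaves [e^(i omega tau)] and [e^(-i omega tau)], since
    [lambda^(-/+) = - eps^-2 +/- omega]. *)
Lemma phase_a l : cis (tau / eps ^+ 2) * coef_a a b eps l tau =
  (cos (om l * tau))%:C + 'i * ie2%:C * (sin (om l * tau) / om l)%:C.
Proof.
rewrite /coef_a lamB lambdapE lambdamE rcM (rcV (om l)).
have E1 : cis (tau / eps ^+ 2) * cis (tau * (- ie2 + om l)) = cis (om l * tau).
  by rewrite -cisD; congr cis; ring.
have E2 : cis (tau / eps ^+ 2) * cis (tau * (- ie2 - om l)) = cis (- (om l * tau)).
  by rewrite -cisD; congr cis; ring.
rewrite cos_cis sin_cis; rewrite -{}E1 -{}E2.
set e := cis (tau / _); set x := cis (_ * (_ + om l)); set y := cis (_ * (_ - om l)).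
rewrite rcB rcD !rcN; set o := (om l)%:C; set ie := ie2%:C.
have hi (z : R[i]) : 'i * ie * (- 'i * z / 2 / o) = ie * (z / 2 / o).
  have -> : 'i * ie * (- 'i * z / 2 / o) = - ('i * 'i) * (ie * (z / 2 / o)) by ring.
  by rewrite sqri opprK mul1r.
have o0' : o != 0 by exact: o0.
rewrite hi -[- (2 * o)]mulrN1 invfM invrN1 mulrN1.
by move: o ie o0' {hi} => o ie o0'; field.
Qed.

Lemma phase_a' l : cis (tau / eps ^+ 2) * (coef_a' a b eps l tau + 'i * ie2%:C * coef_a a b eps l tau) =
  - (om l * sin (om l * tau))%:C + 'i * ie2%:C * (cos (om l * tau))%:C.
Proof.
have -> : cis (tau / eps ^+ 2) * (coef_a' a b eps l tau + 'i * ie2%:C * coef_a a b eps l tau) =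
  cis (tau / eps ^+ 2) * coef_a' a b eps l tau + 'i * ie2%:C * (cis (tau / eps ^+ 2) * coef_a a b eps l tau) by ring.
rewrite phase_a /coef_a' lamB lambdapE lambdamE.
have E1 : cis (tau / eps ^+ 2) * cis (tau * (- ie2 + om l)) = cis (om l * tau).
  by rewrite -cisD; congr cis; ring.
have E2 : cis (tau / eps ^+ 2) * cis (tau * (- ie2 - om l)) = cis (- (om l * tau)).
  by rewrite -cisD; congr cis; ring.
set S := (sin (om l * tau) / om l)%:C.
have ES : 'i * S * (2 * (om l)%:C) = cis (om l * tau) - cis (- (om l * tau)).
  rewrite /S rcM (rcV (om l)) sin_cis.
  have -> : 'i * (- 'i * (cis (om l * tau) - cis (- (om l * tau))) / 2 / (om l)%:C) * (2 * (om l)%:C) =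
    - ('i * 'i) * (cis (om l * tau) - cis (- (om l * tau))) by field; exact: o0.
  by rewrite sqri opprK mul1r.
set e := cis (tau / _) in E1 E2 *.
set x := cis (_ * (_ + om l)) in E1 *; set y := cis (_ * (_ - om l)) in E2 *.
have Exy : e * (x - y) = 'i * S * (2 * (om l)%:C) by rewrite ES mulrBr E1 E2.
have -> : e * ('i * ((- ie2 - om l) * (- ie2 + om l))%:C * ((x - y) / - (2 * (om l)%:C))) =
  'i * ((- ie2 - om l) * (- ie2 + om l))%:C * (e * (x - y)) / - (2 * (om l)%:C) by ring.
have -> : om l * sin (om l * tau) = (sin (om l * tau) / om l) * (om l * om l).
  by rewrite mulrA divfK 1?mulrC // gt_eqF // om_pos.
rewrite Exy (rcM (- ie2 - _)) rcB rcD rcN (rcM (sin _ / _)) -/S (rcM (om l)).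
set o := (om l)%:C; set C := (cos _)%:C; set ie := (eps ^+ 2)^-1%:C.
have -> : 'i * ((- ie - o) * (- ie + o)) * ('i * S * (2 * o)) / - (2 * o) =
   - ('i * 'i) * ((- ie - o) * (- ie + o) * S) by apply: cancel_phase; exact: o0.
have -> : 'i * ie * (C + 'i * ie * S) = 'i * ie * C + ('i * 'i) * (ie * ie * S) by ring.
by rewrite sqri; ring.
Qed.

Lemma coef_a_oppk (k : 'I_N) : coef_a a b eps (lidx N (oppk N0 k)) tau = coef_a a b eps (lidx N k) tau.
Proof. by rewrite /coef_a /lambdap /lambdam mu2_oppk. Qed.
Lemma coef_a'_oppk (k : 'I_N) : coef_a' a b eps (lidx N (oppk N0 k)) tau = coef_a' a b eps (lidx N k) tau.
Proof. by rewrite /coef_a' /lambdap /lambdam mu2_oppk. Qed.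

(** Tested on the first [N] entries, which determine the discrete Fourier
    transform; the last one repeats the first. *)
Definition real_grid (u : Y) : Prop := forall j : 'I_N, Im (u (w j)) = 0.

Context (S : @state R N) (rPhi : real_grid (s_phi S)) (rDPhi : real_grid (s_dphi S)).
Let Psi := s_psi S.
Let Phi := s_phi S.
Let DPhi := s_dphi S.
Let v0 : Y := fun j => 2^-1 * (Phi j - 'i * (eps ^+ 2)%:C * DPhi j).

Lemma dft_v0 l : dft v0 l = zcoef eps 1 (dft Phi) (dft DPhi) l.
Proof.
rewrite /v0 dftZ dftB dftZ /zcoef.
have -> : (1 : R)%:C = 1 :> R[i] by [].
by rewrite mulr1.
Qed.

Lemma dft_v0b l : dft (fun j => (v0 j)^*) l = zcoef eps (-1) (dft Phi) (dft DPhi) l.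
Proof.
rewrite (@dft_ext _ _ _ _ _ (fun j => 2^-1 * (Phi j + 'i * (eps ^+ 2)%:C * DPhi j))); last first.
  move=> j; rewrite /v0 conjcM conjcB !conjcM conjc_i conjc_real (realE (rPhi j)) (realE (rDPhi j)).
  rewrite (_ : (2^-1)^* = 2^-1 :> R[i]); first by rewrite -/Phi -/DPhi; ring.
  by rewrite -[2]/(2%:R) -[2%:R](rmorph_nat (real_complex R)) -rcV conjc_real.
rewrite dftZ dftD dftZ /zcoef.
have -> : (-1 : R)%:C = - 1 :> R[i] by rewrite rcN.
by ring.
Qed.

Let S' := mti_step a b eps tau S.
Let G := dft Psi.
Let F := dft Phi.
Let D := dft DPhi.

Let dPsi : Y := vec (dtpsi a b N tau G F).

Let dPsiE : vec (fun l => - 'i * (sin (mu l ^+ 2 * tau) / tau)%:C * dft Psi l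
    + 'i * dft (fun j => Phi j * Psi j) l) = dPsi.
Proof.
by apply/funext => j; apply: vec_ext => k; rewrite /dtpsi /G /F star_dft.
Qed.

Lemma step_psi (k : 'I_N) (l := lidx N k) : dft (s_psi S') l = psi_step a b N eps tau G F D l.
Proof.
rewrite /S' /mti_step /= -/Psi -/Phi -/DPhi (dft_vec ab N0 Ne) dPsiE /psi_step -/l.
have e1 : dft v0 = zcoef eps 1 F D by apply/funext => x; exact: dft_v0.
have e2 : dft (fun j => (v0 j)^*) = zcoef eps (-1) F D by apply/funext => x; exact: dft_v0b.
by rewrite -e1 -e2 /G !star_dft !star_dft_vec.
Qed.

Let rho : Y := fun j => (normc (Psi j) ^+ 2)%:C.
Let drho : Y := fun j => (Re ((Psi j)^* * dPsi j))%:C.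

Let rhoE l : dft rho l = rho0 a b N G l.
Proof.
rewrite /rho0 /G (_ : cj (dft Psi) = dft (fun j => (Psi j)^*)); last by apply/funext => x; exact: cj_dft.
by rewrite star_dft; apply: dft_ext => j; rewrite /rho sqr_normcE.
Qed.

Let drhoE l : 2 * dft drho l = rho1 a b N tau G F l.
Proof.
rewrite /rho1 -dftZ.
have -> : cj G = dft (fun j => (Psi j)^*) by apply/funext => x; exact: cj_dft.
rewrite starC star_dft_vec -/dPsi.
have -> : star G (cj (dtpsi a b N tau G F)) l = dft (fun j => Psi j * (dPsi j)^*) l.
  by apply: dft_ext => j; rewrite vec_dft // vec_cj.
rewrite -dftD; apply: dft_ext => j.
by rewrite /drho Re2E conjcM conjcK.
Qed.

Let r1 : Y := vec (fun l => (coef_p a b eps tau l)%:C * dft rho l + 2 * (coef_q a b eps tau l)%:C * dft drho l).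
Let dr1 : Y := vec (fun l => (coef_p' a b eps tau l)%:C * dft rho l + 2 * (coef_q' a b eps tau l)%:C * dft drho l).
Let v1 : Y := vec (fun l => coef_a a b eps l tau * dft v0 l).
Let dv1 : Y := vec (fun l => coef_a' a b eps l tau * dft v0 l).

Let dft_conj_vec (m : int -> R[i]) (k : 'I_N) (l := lidx N k) : m (lidx N (oppk N0 k)) = m l ->
  dft (fun j => (vec (fun x => m x * dft v0 x) j)^*) l = (m l)^* * zcoef eps (-1) F D l.
Proof.
move=> hm; rewrite -/(cj _ _) (cj_idx ab N0 Ne) conjcM hm -dft_v0b; congr (_ * _).
by rewrite -(cj_idx ab N0 Ne) cj_dft.
Qed.

Lemma step_phi (k : 'I_N) (l := lidx N k) : dft (s_phi S') l = phi_step a b N eps tau G F D l.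
Proof.
have -> : s_phi S' = (fun j => (cis (tau / eps ^+ 2) * v1 j + cis (- (tau / eps ^+ 2)) * (v1 j)^*) + r1 j).
  by rewrite /S' /mti_step /= -/Psi -/Phi -/DPhi dPsiE.
rewrite !dftD !dftZ {1}/v1 {1}/r1 !(dft_vec ab N0 Ne) dft_conj_vec ?coef_a_oppk // -/l.
rewrite rhoE dft_v0 -/F -/D.
have -> : 2 * (coef_q a b eps tau l)%:C * dft drho l = (coef_q a b eps tau l)%:C * rho1 a b N tau G F l.
  by rewrite -drhoE; ring.
rewrite /phi_step !addrA; congr (_ + _ + _).
move: (phase_a l); move: (coef_a a b eps l tau) => A ea; have eac := congr1 conjc ea.
rewrite conjcM -cisN conjcD !conjcM !conjc_real conjc_i in eac.
rewrite ![cis _ * (_ * _)]mulrA ea eac /zcoef.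
have -> : (1 : R)%:C = 1 :> R[i] by [].
have -> : (-1 : R)%:C = - 1 :> R[i] by rewrite rcN.
have h : (eps ^+ 2)%:C * ie2%:C = 1 :> R[i] by rewrite -rcM mulfV.
set C := (cos _)%:C; set SS := (sin _ / _)%:C; set e2 := (eps ^+ 2)%:C in h *; set ie := ie2%:C in h *.
exact: combine_phases.
Qed.

Lemma step_dphi (k : 'I_N) (l := lidx N k) : dft (s_dphi S') l = dphi_step a b N eps tau G F D l.
Proof.
have -> : s_dphi S' = (fun j => (cis (tau / eps ^+ 2) * (dv1 j + 'i * ie2%:C * v1 j) +
    cis (- (tau / eps ^+ 2)) * ((dv1 j)^* - 'i * ie2%:C * (v1 j)^*)) + dr1 j).
  by rewrite /S' /mti_step /= -/Psi -/Phi -/DPhi dPsiE.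
rewrite !dftD !dftZ dftD dftB !dftZ {1}/dv1 {1}/v1 {1}/dr1 !(dft_vec ab N0 Ne).
rewrite !dft_conj_vec ?coef_a_oppk ?coef_a'_oppk // -/l.
rewrite rhoE dft_v0 -/F -/D.
have -> : 2 * (coef_q' a b eps tau l)%:C * dft drho l = (coef_q' a b eps tau l)%:C * rho1 a b N tau G F l.
  by rewrite -drhoE; ring.
rewrite /dphi_step !addrA; congr (_ + _ + _).
move: (phase_a' l); move: (coef_a a b eps l tau) (coef_a' a b eps l tau) => A A' ea.
have eac := congr1 conjc ea.
rewrite conjcM -cisN !conjcD conjcN !conjcM !conjc_real conjc_i in eac.
set e := cis (tau / _) in ea *; set e' := cis (- _) in eac *.
have h : (eps ^+ 2)%:C * ie2%:C = 1 :> R[i] by rewrite -rcM mulfV.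
transitivity (e * (A' + 'i * ie2%:C * A) * zcoef eps 1 F D l
  + e' * (A'^* + - 'i * ie2%:C * A^*) * zcoef eps (-1) F D l); first by ring.
rewrite ea eac /zcoef.
have -> : (1 : R)%:C = 1 :> R[i] by [].
have -> : (-1 : R)%:C = - 1 :> R[i] by rewrite rcN.
set C := (cos _)%:C; set SS := (om l * sin _)%:C; set e2 := (eps ^+ 2)%:C in h *; set ie := ie2%:C in h *.
have := combine_phases (- SS) C (F l) (D l) h; set X := _ + _ => hX.
by rewrite -hX /X; ring.
Qed.

Let r_real (p q : int -> R) : (forall k : 'I_N, p (lidx N (oppk N0 k)) = p (lidx N k)) ->
  (forall k : 'I_N, q (lidx N (oppk N0 k)) = q (lidx N k)) ->
  real_grid (vec (fun l => (p l)%:C * dft rho l + 2 * (q l)%:C * dft drho l)).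
Proof.
move=> hp hq; apply: vec_real => k.
have h (u : Y) : (forall j, (u j)^* = u j) -> (dft u (lidx N (oppk N0 k)))^* = dft u (lidx N k).
  by move=> hu; rewrite -(cj_idx ab N0 Ne) cj_dft; apply: dft_ext => j; exact: hu.
rewrite -(h rho) -?(h drho); last 2 first.
- by move=> j; rewrite /drho conjc_real.
- by move=> j; rewrite /rho conjc_real.
move: (dft rho _) (dft drho _) => z1 z2.
by rewrite conjcD !conjcM !conjc_real hp hq conjc_nat.
Qed.

(** The field stays real because the multipliers of the scheme are even in the
    frequency, also at the unpaired frequency [-N/2]. *)
Lemma step_real : real_grid (s_phi S') /\ real_grid (s_dphi S').
Proof.
split=> j.
  have -> : s_phi S' = (fun j => (cis (tau / eps ^+ 2) * v1 j + cis (- (tau / eps ^+ 2)) * (v1 j)^*) + r1 j).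
    by rewrite /S' /mti_step /= -/Psi -/Phi -/DPhi dPsiE.
  rewrite ImD r_real ?addr0; last 2 first.
  - by move=> k; rewrite /coef_p om_oppk.
  - by move=> k; rewrite /coef_q om_oppk.
  by apply: real_conj; rewrite conjcD !conjcM cisN !conjcK addrC.
have -> : s_dphi S' = (fun j => (cis (tau / eps ^+ 2) * (dv1 j + 'i * ie2%:C * v1 j) +
    cis (- (tau / eps ^+ 2)) * ((dv1 j)^* - 'i * ie2%:C * (v1 j)^*)) + dr1 j).
  by rewrite /S' /mti_step /= -/Psi -/Phi -/DPhi dPsiE.
rewrite ImD r_real ?addr0; last 2 first.
- by move=> k; rewrite /coef_p' om_oppk.
- by move=> k; rewrite /coef_q' om_oppk.
apply: real_conj; rewrite conjcD !conjcM cisN conjcB conjcD !conjcM !conjcK conjc_i conjc_real.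
by rewrite addrC; congr (_ * _ + _ * _); ring.
Qed.

End NumericalLink.

(** * Stability of one step *)
Section Energy.
Context {R : realType} (N : nat).
Implicit Types (X Y U V : int -> R[i]).

(** The energy norm; it is the modulus of a complex number, which gives the triangle
    inequality. *)
Definition en X Y : R := Num.sqrt (nrm N 1 X ^+ 2 + nrm N 1 Y ^+ 2).

Lemma enE X Y : en X Y = normc (Complex (nrm N 1 X) (nrm N 1 Y)).
Proof. by []. Qed.

Lemma en_ge0 X Y : 0 <= en X Y. Proof. exact: sqrtr_ge0. Qed.

Lemma en_sq X Y : en X Y ^+ 2 = nrm N 1 X ^+ 2 + nrm N 1 Y ^+ 2.
Proof. by rewrite sqr_sqrtr // addr_ge0 ?sqr_ge0. Qed.

Lemma en_l X Y : nrm N 1 X <= en X Y.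
Proof. by apply: ler_sqr2; rewrite ?en_ge0 // en_sq lerDl sqr_ge0. Qed.
Lemma en_r X Y : nrm N 1 Y <= en X Y.
Proof. by apply: ler_sqr2; rewrite ?en_ge0 // en_sq lerDr sqr_ge0. Qed.

Lemma en_le X Y x y : nrm N 1 X <= x -> nrm N 1 Y <= y -> en X Y <= x + y.
Proof.
move=> hx hy; have := nrm_ge0 N 1 X; have := nrm_ge0 N 1 Y => y0 x0.
have h0 : 0 <= x + y by rewrite addr_ge0 // (le_trans _ hx, le_trans _ hy).
by apply: ler_sqr2 => //; rewrite en_sq; nra.
Qed.

Lemma enD X Y U V : en (fun l => X l + U l) (fun l => Y l + V l) <= en X Y + en U V.
Proof.
rewrite !enE; apply: le_trans (normcD _ _).
rewrite /= ler_wsqrtr // lerD // lerXn2r ?nnegrE ?addr_ge0 ?nrm_ge0 //; exact: nrmD.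
Qed.

(** The linear Klein-Gordon flow is an isometry. *)
Lemma en_rot X Y (t : int -> R) :
  en (fun l => (cos (t l))%:C * X l + (sin (t l))%:C * Y l)
     (fun l => - (sin (t l))%:C * X l + (cos (t l))%:C * Y l) = en X Y.
Proof.
rewrite /en !l2_sq -!big_split /=; congr Num.sqrt; apply: eq_bigr => k _.
move: (wt _ ^+ 1) (t _) (X _) (Y _) => w s x y.
rewrite !exprMn -!mulrDr; congr (_ * _).
rewrite !normcE2 !(ReD, ImD, ReM, ImM, ReN, ImN) /=.
have := cos2Dsin2 s; move: (cos s) (sin s) (Re x) (Im x) (Re y) (Im y) => c d p q u v h.
transitivity ((c ^+ 2 + d ^+ 2) * (p ^+ 2 + q ^+ 2 + (u ^+ 2 + v ^+ 2))); first by ring.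
by rewrite h mul1r.
Qed.

End Energy.

Section Shift.
Context {R : realType}.

Lemma within_shift (T t s0 : R) (f : R -> R) : 0 <= s0 -> s0 + t <= T ->
  {within `[0, T], continuous f} -> {within `[0, t], continuous (fun x => f (s0 + x))}.
Proof.
move=> s00 stT /subspace_continuousP hf; apply/subspace_continuousP => x /= hx.
have hx' : `[0, T]%classic (s0 + x).
  by move: hx => /=; rewrite !in_itv /= => /andP[h1 h2]; apply/andP; split; lra.
move=> P /(hf _ hx') h.
have hc : (fun z : R => s0 + z) z @[z --> x] --> s0 + x.
  by apply: cvgD; [exact: cvg_cst|exact: cvg_id].
have h2 : nbhs x (fun z => `[0, T]%classic (s0 + z) -> P (f (s0 + z))) := hc _ h.
change (nbhs x (fun z => `[0, t]%classic z -> P (f (s0 + z)))).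
apply: filterS h2 => z /= hz Az; apply: hz.
by move: Az; rewrite !in_itv /= => /andP[h1 h2]; apply/andP; split; lra.
Qed.

Lemma CD_shift (T t s0 : R) (f f' : R -> R[i]) : 0 <= s0 -> s0 + t <= T ->
  CD T f f' -> CD t (fun s => f (s0 + s)) (fun s => f' (s0 + s)).
Proof.
move=> s00 stT [h1 h2 h3]; split.
- exact: within_shift h1.
- exact: within_shift h2.
- move=> s /andP[hs hst].
  have [d1 d2] : cder f (s0 + s) (f' (s0 + s)) by apply: h3; apply/andP; split; lra.
  have hs1 : is_derive s 1 (fun s => s0 + s) 1.
    by have := is_deriveD_fun (is_derive_cst_fun s s0) (is_derive_id s 1); rewrite add0r.
  by split; [have := is_derive1_comp d1 hs1|have := is_derive1_comp d2 hs1]; rewrite mulr1.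
Qed.

End Shift.

Section Stability.
Context {R : realType} (a b : R) (ab : a < b) (N : nat) (N0 : (0 < N)%N) (Ne : ~~ odd N).
Context (eps tau K E : R) (K96 : 96 <= K) (tau0 : 0 < tau) (tau1 : tau <= 1)
  (eps0 : 0 < eps) (hmu : forall l, mu a b l ^+ 2 <= K * wt l ^+ 2).
Local Notation star := (@star R a b N).
Local Notation cj := (@cj R a b N).
Local Notation mu := (@mu R a b).
Local Notation zcoef := (zcoef eps).
Local Notation dtpsi := (dtpsi a b N tau).
Local Notation om := (omega a b eps).
Context (g f d G F D : int -> R[i]).
Let X l : R[i] := (eps ^+ 2 * om l)%:C * (f l - F l).
Let Y l : R[i] := (eps ^+ 2)%:C * (d l - D l).
Context (bg : nrm N 1 g <= K) (bf : nrm N 1 f <= K)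
  (bd : nrm N 1 (fun l => (eps ^+ 2)%:C * d l) <= K)
  (E1 : E <= 1) (eg : nrm N 1 (fun l => g l - G l) <= E) (ekg : en N X Y <= E).

Let E0 : 0 <= E. Proof. exact: le_trans (en_ge0 N X Y) ekg. Qed.
Let K0 : 0 <= K. Proof. exact: le_trans K96. Qed.
Let KX n : 0 <= K ^+ n. Proof. by rewrite exprn_ge0. Qed.
Let t0 := ltW tau0.
Let i1 : (1%N == 1%N) || (1%N == 3%N). Proof. by []. Qed.
Let iV : tau^-1 * tau = 1. Proof. by rewrite mulVf // gt_eqF. Qed.
Let V1 : 1 <= tau^-1. Proof. by rewrite invf_ge1. Qed.

Let ed : nrm N 1 Y <= E. Proof. exact: le_trans (en_r N X Y) ekg. Qed.

Let ef : nrm N 1 (fun l => f l - F l) <= E.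
Proof.
apply: le_trans ekg; apply: le_trans (en_l N X Y); apply: nrm_le0 => k.
rewrite /X normcM normc_real ger0_norm; last by apply: le_trans (om_ge1 a b eps0 _).
by rewrite ler_peMl ?normc_ge0 // om_ge1.
Qed.

Let num_le (u U : int -> R[i]) : nrm N 1 u <= K -> nrm N 1 (fun l => u l - U l) <= E -> nrm N 1 U <= 2 * K.
Proof.
move=> h1 h2; rewrite (@eq_nrm _ _ _ _ (fun l => u l - (u l - U l))); last by move=> k; ring.
apply: (le_trans (nrmB_le h1 h2)).
have hh : E <= K by apply: (le_trans E1); apply: le_trans K96; rewrite ler1n.
lra.
Qed.

Let bG : nrm N 1 G <= 2 * K. Proof. exact: num_le eg. Qed.
Let bF : nrm N 1 F <= 2 * K. Proof. exact: num_le ef. Qed.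

Let dstar (u v U V : int -> R[i]) x y x' y' :
  nrm N 1 v <= x -> nrm N 1 U <= y -> nrm N 1 (fun l => u l - U l) <= x' ->
  nrm N 1 (fun l => v l - V l) <= y' ->
  nrm N 1 (fun l => star u v l - star U V l) <= K * x' * x + K * y * y'.
Proof.
move=> h1 h2 h3 h4.
rewrite (@eq_nrm _ _ _ _ (fun l => star (fun l => u l - U l) v l + star U (fun l => v l - V l) l)); last first.
  by move=> k; rewrite starBl starBr; ring.
by apply: nrmD_le; apply: (star_le (s := 1) ab N0 Ne K96).
Qed.

Let bz sg : sg = 1 \/ sg = -1 -> nrm N 1 (zcoef sg f d) <= K.
Proof. by move=> h; have := zcoef_le h bf bd; lra. Qed.

Let ez sg : sg = 1 \/ sg = -1 -> nrm N 1 (fun l => zcoef sg f d l - zcoef sg F D l) <= E.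
Proof.
move=> h; have := zcoef_le h ef ed.
rewrite (@eq_nrm _ _ _ (zcoef _ _ _) (fun l => zcoef sg f d l - zcoef sg F D l)); first by lra.
by move=> k; rewrite /zcoef; ring.
Qed.

Let bZ sg : sg = 1 \/ sg = -1 -> nrm N 1 (zcoef sg F D) <= 2 * K.
Proof. by move=> h; exact: (num_le (bz h) (ez h)). Qed.

(* the factor [1 / tau] is compensated by [coef_d], which is [O(tau^2)] *)
Let edt : nrm N 1 (fun l => dtpsi g f l - dtpsi G F l) <= tau^-1 * (4 * K ^+ 2 * E).
Proof.
rewrite (@eq_nrm _ _ _ _ (fun l => 'i * (- ((sin (mu l ^+ 2 * tau) / tau)%:C * (g l - G l))
   + (star f g l - star F G l)))); last by move=> k; rewrite /dtpsi; ring.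
apply: (le_trans (nrm_i _)); first by apply: nrmD_le; [rewrite nrmN; exact: sincV_le eg|exact: dstar bg bF ef eg].
have : K * E * K + K * (2 * K) * E <= tau^-1 * (3 * K ^+ 2 * E).
  have -> : K * E * K + K * (2 * K) * E = 1 * (3 * K ^+ 2 * E) by ring.
  by rewrite ler_wpM2r // mulr_ge0 // mulr_ge0.
have : tau^-1 * E <= tau^-1 * (K ^+ 2 * E).
  by rewrite ler_wpM2l ?invr_ge0 // ler_peMl // exprn_ege1 // (le_trans _ K96) // ler1n.
lra.
Qed.

Let bdt : nrm N 1 (dtpsi g f) <= tau^-1 * (2 * K ^+ 3).
Proof.
apply: (le_trans (dtpsiV_le ab N0 Ne K96 tau0 bg bf)).
have : K * K * K <= tau^-1 * K ^+ 3 by rewrite -!expr2 -exprSr ler_peMl.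
have : tau^-1 * K <= tau^-1 * K ^+ 3.
  by rewrite ler_wpM2l ?invr_ge0 // ler_eXnr // (le_trans _ K96) // ler1n.
lra.
Qed.

Let bDT : nrm N 1 (dtpsi G F) <= tau^-1 * (6 * K ^+ 3).
Proof.
apply: (le_trans (dtpsiV_le ab N0 Ne K96 tau0 bG bF)).
have : K * (2 * K) * (2 * K) <= tau^-1 * (4 * K ^+ 3).
  by rewrite (_ : K * _ * _ = 4 * K ^+ 3); [rewrite ler_peMl // mulr_ge0|ring].
have : tau^-1 * (2 * K) <= tau^-1 * (2 * K ^+ 3).
  by rewrite ler_wpM2l ?invr_ge0 // ler_wpM2l // ler_eXnr // (le_trans _ K96) // ler1n.
lra.
Qed.

Let one_m1 : (1 : R) = 1 \/ (1 : R) = -1. Proof. by left. Qed.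
Let m1_m1 : (-1 : R) = 1 \/ (-1 : R) = -1. Proof. by right. Qed.

(** The nonlinear part of the step is [tau] times a locally Lipschitz map. *)
Lemma psi_stable : nrm N 1 (fun l => psi_step a b N eps tau g f d l - psi_step a b N eps tau G F D l)
  <= nrm N 1 (fun l => g l - G l) + tau * (26 * K ^+ 4 * E).
Proof.
pose T sg l : R[i] := coef_c a b eps tau sg l * (star (zcoef sg f d) g l - star (zcoef sg F D) G l)
  + coef_d a b eps tau sg l * (star (zcoef sg f d) (dtpsi g f) l - star (zcoef sg F D) (dtpsi G F) l).
have hT sg : sg = 1 \/ sg = -1 -> nrm N 1 (T sg) <= tau * (13 * K ^+ 4 * E).
  move=> h; rewrite /T.
  have h1 := dstar bg (bZ h) (ez h) eg.
  have h2 := dstar bdt (bZ h) (ez h) edt.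
  have c1 := coef_c_le a b tau0 eps sg; have c2 := coef_d_le a b tau0 eps sg.
  have k1 : nrm N 1 (fun l => coef_c a b eps tau sg l * (star (zcoef sg f d) g l - star (zcoef sg F D) G l))
    <= tau * (K * E * K + K * (2 * K) * E).
    apply: (@le_trans _ _ (tau * nrm N 1 (fun l => star (zcoef sg f d) g l - star (zcoef sg F D) G l))).
      by apply: nrm_mul.
    by rewrite ler_wpM2l.
  have k2 : nrm N 1 (fun l => coef_d a b eps tau sg l *
     (star (zcoef sg f d) (dtpsi g f) l - star (zcoef sg F D) (dtpsi G F) l))
    <= tau * tau * (K * E * (tau^-1 * (2 * K ^+ 3)) + K * (2 * K) * (tau^-1 * (4 * K ^+ 2 * E))).
    apply: (@le_trans _ _ (tau * tau * nrm N 1 (fun l => star (zcoef sg f d) (dtpsi g f) l - star (zcoef sg F D) (dtpsi G F) l))).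
      by apply: nrm_mul => //; exact: mulr_ge0.
    by rewrite ler_wpM2l // mulr_ge0.
  apply: (le_trans (nrmD_le k1 k2)).
  have -> : tau * tau * (K * E * (tau^-1 * (2 * K ^+ 3)) + K * (2 * K) * (tau^-1 * (4 * K ^+ 2 * E)))
    = tau * (10 * K ^+ 4 * E) by field; rewrite gt_eqF.
  rewrite -mulrDr ler_wpM2l //.
  have : K ^+ 2 * E <= K ^+ 4 * E by rewrite ler_wpM2r // ler_weXn2l // (le_trans _ K96) // ler1n.
  have -> : K * E * K + K * (2 * K) * E = 3 * (K ^+ 2 * E) by ring.
  by lra.
rewrite (@eq_nrm _ _ _ _ (fun l => cis (- (mu l ^+ 2 * tau)) * (g l - G l) + (T 1 l + T (-1) l))); last first.
  by move=> k; rewrite /psi_step /T; ring.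
apply: (le_trans (nrmD _ _ _ _)); apply: lerD.
  by rewrite nrm_unit // => l; rewrite normc_cis.
by apply: (le_trans (nrmD_le (hT _ one_m1) (hT _ m1_m1))); lra.
Qed.

Let er0 : nrm N 1 (fun l => rho0 a b N g l - rho0 a b N G l) <= 3 * K ^+ 4 * E.
Proof.
have ec : nrm N 1 (fun l => cj g l - cj G l) <= E.
  rewrite (@eq_nrm _ _ _ _ (cj (fun l => g l - G l))); first exact: (cj_le (s := 1) ab N0 Ne).
  by move=> k; rewrite cjB.
apply: (le_trans (dstar (cj_le ab N0 Ne bg) bG eg ec)).
have : K ^+ 2 * E <= K ^+ 4 * E by rewrite ler_wpM2r // ler_weXn2l // (le_trans _ K96) // ler1n.
have -> : K * E * K + K * (2 * K) * E = 3 * (K ^+ 2 * E) by ring.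
by lra.
Qed.

Let er1 : nrm N 1 (fun l => rho1 a b N tau g f l - rho1 a b N tau G F l) <= tau^-1 * (20 * K ^+ 4 * E).
Proof.
have ec (u U : int -> R[i]) x : nrm N 1 (fun l => u l - U l) <= x -> nrm N 1 (fun l => cj u l - cj U l) <= x.
  move=> h; rewrite (@eq_nrm _ _ _ _ (cj (fun l => u l - U l))); first exact: (cj_le (s := 1) ab N0 Ne).
  by move=> k; rewrite cjB.
have h1 := dstar (cj_le ab N0 Ne bg) bDT edt (ec _ _ _ eg).
rewrite (@eq_nrm _ _ _ _ (fun l => (star (dtpsi g f) (cj g) l - star (dtpsi G F) (cj G) l)
  + (star (cj (dtpsi g f)) g l - star (cj (dtpsi G F)) G l))); last first.
  by move=> k; rewrite /rho1 (starC a b N g) (starC a b N G); ring.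
have h2 := dstar bg (cj_le ab N0 Ne bDT) (ec _ _ _ edt) eg.
apply: (le_trans (nrmD_le h1 h2)).
by rewrite le_eqVlt; apply/orP; left; apply/eqP; ring.
Qed.

(** In the energy norm the forcing coefficients lose their factor [eps^-2]. *)
Lemma coef_forcing l :
  [/\ `|eps ^+ 2 * om l * coef_p a b eps tau l| <= tau,
      `|eps ^+ 2 * om l * coef_q a b eps tau l| <= tau * tau,
      `|eps ^+ 2 * coef_p' a b eps tau l| <= tau &
      `|eps ^+ 2 * coef_q' a b eps tau l| <= tau * tau].
Proof.
have hc (u : R -> R) u' B : 0 <= B -> CD tau (fun s => (u s)%:C) u' -> u 0 = 0 ->
    (forall s, 0 < s < tau -> normc (u' s) <= B) -> `|u tau| <= tau * B.
  by move=> B0 h u0 hb; have := MVT1 t0 B0 h hb; rewrite u0 subr0 normc_real.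
have t1 (s : R) x : 0 < s < tau -> `|x| <= 1 -> normc (s%:C * x%:C) <= tau.
  move=> /andP[s0 st] hx; rewrite normcM !normc_real ger0_norm ?(ltW s0) //.
  by apply: le_trans (ltW st); rewrite ler_piMr // ltW.
split.
- rewrite -[leRHS]mulr1; apply: (hc _ _ _ ler01 (CD_P a b tau eps0 l)) => [|s _].
    by rewrite Rint_00 mulr0.
  by rewrite normc_real sin_max.
- apply: (hc _ _ _ t0 (CD_Q a b tau eps0 l)) => [|s hs].
    by rewrite Rint_00 mulr0.
  by apply: t1 => //; rewrite sin_max.
- rewrite -[leRHS]mulr1; apply: (hc _ _ _ ler01 (CD_P' a b tau eps0 l)) => [|s _].
    by rewrite Rint_00 mulr0.
  by rewrite normc_real cos_max.
- apply: (hc _ _ _ t0 (CD_Q' a b tau eps0 l)) => [|s hs].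
    by rewrite Rint_00 mulr0.
  by apply: t1 => //; rewrite cos_max.
Qed.

Let forcing_le (p q : int -> R) :
  (forall l, `|p l| <= tau) -> (forall l, `|q l| <= tau * tau) ->
  nrm N 1 (fun l => (p l)%:C * (rho0 a b N g l - rho0 a b N G l)
    + (q l)%:C * (rho1 a b N tau g f l - rho1 a b N tau G F l)) <= tau * (23 * K ^+ 4 * E).
Proof.
move=> hp hq.
have k1 : nrm N 1 (fun l => (p l)%:C * (rho0 a b N g l - rho0 a b N G l)) <= tau * (3 * K ^+ 4 * E).
  apply: (@le_trans _ _ (tau * nrm N 1 (fun l => rho0 a b N g l - rho0 a b N G l))); last exact: ler_wpM2l.
  by apply: nrm_mul => // k; rewrite normc_real.
have k2 : nrm N 1 (fun l => (q l)%:C * (rho1 a b N tau g f l - rho1 a b N tau G F l))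
    <= tau * tau * (tau^-1 * (20 * K ^+ 4 * E)).
  apply: (@le_trans _ _ (tau * tau * nrm N 1 (fun l => rho1 a b N tau g f l - rho1 a b N tau G F l)));
    last exact: (ler_wpM2l (mulr_ge0 t0 t0)).
  by apply: nrm_mul => [|k]; [exact: mulr_ge0|rewrite normc_real].
apply: (le_trans (nrmD_le k1 k2)).
by rewrite le_eqVlt; apply/orP; left; apply/eqP; field; rewrite gt_eqF.
Qed.

Lemma kg_stable :
  en N (fun l => (eps ^+ 2 * om l)%:C * (phi_step a b N eps tau g f d l - phi_step a b N eps tau G F D l))
       (fun l => (eps ^+ 2)%:C * (dphi_step a b N eps tau g f d l - dphi_step a b N eps tau G F D l))
  <= en N X Y + tau * (46 * K ^+ 4 * E).
Proof.
pose U l : R[i] := (eps ^+ 2 * om l * coef_p a b eps tau l)%:C * (rho0 a b N g l - rho0 a b N G l)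
    + (eps ^+ 2 * om l * coef_q a b eps tau l)%:C * (rho1 a b N tau g f l - rho1 a b N tau G F l).
pose V l : R[i] := (eps ^+ 2 * coef_p' a b eps tau l)%:C * (rho0 a b N g l - rho0 a b N G l)
    + (eps ^+ 2 * coef_q' a b eps tau l)%:C * (rho1 a b N tau g f l - rho1 a b N tau G F l).
have e1 l : (eps ^+ 2 * om l)%:C * (phi_step a b N eps tau g f d l - phi_step a b N eps tau G F D l)
   = ((cos (om l * tau))%:C * X l + (sin (om l * tau))%:C * Y l) + U l.
  rewrite /phi_step /X /Y /U.
  have -> : (sin (om l * tau))%:C = (om l)%:C * (sin (om l * tau) / om l)%:C :> R[i].
    by rewrite -rcM (mulrC (om l) (_ / _)) divfK // gt_eqF // om_gt0.
  rewrite (rcM (eps ^+ 2 * om l) (coef_p _ _ _ _ _)) (rcM (eps ^+ 2 * om l) (coef_q _ _ _ _ _)) (rcM (eps ^+ 2) (om l)).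
  by move: (om l)%:C (sin _ / _)%:C => o s; ring.
have e2 l : (eps ^+ 2)%:C * (dphi_step a b N eps tau g f d l - dphi_step a b N eps tau G F D l)
   = (- (sin (om l * tau))%:C * X l + (cos (om l * tau))%:C * Y l) + V l.
  rewrite /dphi_step /X /Y /V (rcM (om l) (sin _)) (rcM (eps ^+ 2) (om l)).
  rewrite (rcM (eps ^+ 2) (coef_p' _ _ _ _ _)) (rcM (eps ^+ 2) (coef_q' _ _ _ _ _)).
  by move: (om l)%:C (sin _)%:C => o s; ring.
rewrite (funext e1) (funext e2).
apply: (le_trans (enD _ _ _ _ _)); rewrite en_rot lerD2l.
have hU : nrm N 1 U <= tau * (23 * K ^+ 4 * E).
  by apply: forcing_le => l; have [] := coef_forcing l.
have hV : nrm N 1 V <= tau * (23 * K ^+ 4 * E).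
  by apply: forcing_le => l; have [] := coef_forcing l.
by apply: (le_trans (en_le hU hV)); lra.
Qed.

End Stability.

(** * Accumulation of the errors *)
Section Convergence.
Context {R : realType} (a b : R) (ab : a < b) (N : nat) (N0 : (0 < N)%N) (Ne : ~~ odd N).
Context (T eps tau K eta : R) (K96 : 96 <= K) (tau0 : 0 < tau) (tau1 : tau <= 1)
  (eps0 : 0 < eps) (eps1 : eps <= 1) (eta0 : 0 <= eta)
  (hmu : forall l, mu a b l ^+ 2 <= K * wt l ^+ 2).
Local Notation star := (@star R a b N).
Local Notation cj := (@cj R a b N).
Local Notation mu := (@mu R a b).
Local Notation m2 l := ((mu l ^+ 2)%:C).
Local Notation ie2 := ((eps ^+ 2)^-1).
Local Notation om := (omega a b eps).
Local Notation dft := (@dft R a b N).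
Context (g f d F Q : R -> int -> R[i]).
Context
  (dg : forall k : 'I_N, CD T (fun s => g s (lidx N k))
     (fun s => 'i * (F s (lidx N k) - m2 (lidx N k) * g s (lidx N k))))
  (df : forall k : 'I_N, CD T (fun s => f s (lidx N k)) (fun s => d s (lidx N k)))
  (dd : forall k : 'I_N, CD T (fun s => d s (lidx N k))
     (fun s => ie2%:C * (Q s (lidx N k) - (m2 (lidx N k) + ie2%:C) * f s (lidx N k)))).
Context
  (bg : forall s, 0 <= s <= T -> nrm N 5 (g s) <= K)
  (bf : forall s, 0 <= s <= T -> nrm N 3 (f s) <= K)
  (bd : forall s, 0 <= s <= T -> nrm N 3 (fun l => (eps ^+ 2)%:C * d s l) <= K)
  (bF : forall s, 0 <= s <= T -> nrm N 3 (F s) <= K)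
  (bQ : forall s, 0 <= s <= T -> nrm N 1 (Q s) <= K)
  (aF : forall s, 0 <= s <= T -> nrm N 1 (fun l => F s l - star (f s) (g s) l) <= eta)
  (aQ : forall s, 0 <= s <= T -> nrm N 1 (fun l => Q s l - star (g s) (cj (g s)) l) <= eta).
Context (S0 : @state R N) (r1 : real_grid (s_phi S0)) (r2 : real_grid (s_dphi S0)).

Let K0 : 0 <= K. Proof. exact: le_trans K96. Qed.
Let K1 : 1 <= K. Proof. by apply: le_trans K96; rewrite ler1n. Qed.
Let t0 := ltW tau0.

Definition kappa : R := Num.min (tau ^+ 2 / eps ^+ 2) (eps ^+ 2).

(** The factors [eps^2 omega] and [eps^2] make the linear flow an isometry and
    keep the weights of order one. *)
Definition dist (t : R) (S : @state R N) : R :=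
  nrm N 1 (fun l => g t l - dft (s_psi S) l) +
  en N (fun l => (eps ^+ 2 * om l)%:C * (f t l - dft (s_phi S) l))
       (fun l => (eps ^+ 2)%:C * (d t l - dft (s_dphi S) l)).

Lemma dist_ge0 t S : 0 <= dist t S.
Proof. by rewrite addr_ge0 ?nrm_ge0 ?en_ge0. Qed.

Let kappa_ge0 : 0 <= kappa.
Proof. by rewrite /kappa le_min divr_ge0 ?sqr_ge0. Qed.

(** The local error at the exact solution, plus the stability of the step: the
    numerical step is applied both to the exact and to the numerical data. *)
Lemma dist_step t (S : @state R N) : 0 <= t -> t + tau <= T ->
  real_grid (s_phi S) -> real_grid (s_dphi S) -> dist t S <= 1 ->
  dist (t + tau) (mti_step a b eps tau S) <=
    (1 + tau * (100 * K ^+ 6)) * dist t S + tau * (100 * K ^+ 6) * (eta + kappa).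
Proof.
move=> tge0 tT rP rD d1.
have hs s : 0 <= s <= tau -> 0 <= t + s <= T by move=> /andP[h1 h2]; apply/andP; split; lra.
have hst u u' : CD T u u' -> CD tau (fun s => u (t + s)) (fun s => u' (t + s)) by exact: CD_shift.
pose gs s := g (t + s); pose fs s := f (t + s); pose ds s := d (t + s).
pose Fs s := F (t + s); pose Qs s := Q (t + s).
have cg k := hst _ _ (dg k); have cf k := hst _ _ (df k); have cd k := hst _ _ (dd k).
have bg' s (h : 0 <= s <= tau) := bg (hs s h).
have bf' s (h : 0 <= s <= tau) := bf (hs s h).
have bd' s (h : 0 <= s <= tau) := bd (hs s h).
have bF' s (h : 0 <= s <= tau) := bF (hs s h).
have bQ' s (h : 0 <= s <= tau) := bQ (hs s h).
have aF' s (h : 0 <= s <= tau) := aF (hs s h).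
have aQ' s (h : 0 <= s <= tau) := aQ (hs s h).
have iN s : 0 <= s -> 0 <= 36 * K ^+ 6 * s by move=> h; rewrite mulr_ge0 // mulr_ge0 // exprn_ge0.
have e36 : 36 * K ^+ 6 * eps ^+ 2 + eta <= 36 * K ^+ 6 * (eta + eps ^+ 2).
  rewrite [leRHS]mulrDr addrC lerD2r ler_peMl //.
  have := exprn_ege1 6 K1; lra.
have e17 : 16 * K ^+ 5 * eps ^+ 2 + eta <= 17 * K ^+ 6 * (eta + eps ^+ 2).
  rewrite [leRHS]mulrDr addrC; apply: lerD.
    rewrite ler_peMl //; have := exprn_ege1 6 K1; lra.
  rewrite ler_wpM2r ?sqr_ge0 //; apply: ler_pM => //; first exact: exprn_ge0.
    by lra.
  by rewrite ler_weXn2l.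
have lpsi : nrm N 1 (fun l => gs tau l - psi_step a b N eps tau (gs 0) (fs 0) (ds 0) l) <=
    tau * (36 * K ^+ 6 * (eta + kappa)).
  rewrite /kappa; case: (leP (tau ^+ 2 / eps ^+ 2)) => _.
    exact: local_psi_tau cg cf cd bg' bf' bd' bF' bQ' aF'.
  apply: le_trans (local_psi_eps ab N0 Ne K96 tau0 tau1 eps0 eta0 hmu cg cf cd bg' bf' bd' bF' bQ' aF') _.
  by rewrite ler_wpM2l // addrC.
have lkg : nrm N 1 (Dkg1 a b N eps tau gs fs ds tau) <= tau * (17 * K ^+ 6 * (eta + kappa)) /\
   nrm N 1 (Dkg2 a b N eps tau gs fs ds tau) <= tau * (17 * K ^+ 6 * (eta + kappa)).
  rewrite /kappa; case: (leP (tau ^+ 2 / eps ^+ 2)) => _.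
    exact: local_kg_tau cg cf cd bg' bf' bd' bF' aF' aQ'.
  have [h1 h2] := @local_kg_eps _ _ _ ab _ N0 Ne _ _ _ _ K96 tau0 eps0 eta0 hmu gs fs ds Fs Qs cg cf cd bg' bf' bF' aQ'.
  by split; [apply: le_trans h1 _|apply: le_trans h2 _]; rewrite ler_wpM2l // addrC.
have [l1 l2] := lkg; have lE := en_le l1 l2.
set G := dft (s_psi S); set Fn := dft (s_phi S); set Dn := dft (s_dphi S).
have i0 : 0 <= t <= T by apply/andP; split => //; apply: le_trans tT; rewrite lerDl.
have b1 : nrm N 1 (g t) <= K by apply: le_trans (bg i0); exact: nrm_mono.
have b2 : nrm N 1 (f t) <= K by apply: le_trans (bf i0); exact: nrm_mono.
have b3 : nrm N 1 (fun l => (eps ^+ 2)%:C * d t l) <= K by apply: le_trans (bd i0); exact: nrm_mono.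
have x1 : nrm N 1 (fun l => g t l - G l) <= dist t S by rewrite /dist lerDl en_ge0.
have x2 : en N (fun l => (eps ^+ 2 * om l)%:C * (f t l - Fn l)) (fun l => (eps ^+ 2)%:C * (d t l - Dn l)) <= dist t S.
  by rewrite /dist lerDr nrm_ge0.
have s1 := psi_stable ab N0 Ne K96 tau0 tau1 eps0 b1 b2 b3 d1 x1 x2.
have s2 := kg_stable ab N0 Ne K96 tau0 tau1 eps0 b1 b2 d1 x1 x2.
have gs0 : gs 0 = g t by rewrite /gs addr0.
have fs0 : fs 0 = f t by rewrite /fs addr0.
have ds0 : ds 0 = d t by rewrite /ds addr0.
have P : nrm N 1 (fun l => g (t + tau) l - dft (s_psi (mti_step a b eps tau S)) l) <=
   tau * (36 * K ^+ 6 * (eta + kappa)) + (nrm N 1 (fun l => g t l - G l) + tau * (26 * K ^+ 4 * dist t S)).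
  rewrite (@eq_nrm _ _ _ _ (fun l => (gs tau l - psi_step a b N eps tau (gs 0) (fs 0) (ds 0) l) +
     (psi_step a b N eps tau (g t) (f t) (d t) l - psi_step a b N eps tau G Fn Dn l))); last first.
    by move=> k; rewrite (step_psi ab N0 Ne) // gs0 fs0 ds0 /gs; ring.
  exact: nrmD_le.
have QQ : en N (fun l => (eps ^+ 2 * om l)%:C * (f (t + tau) l - dft (s_phi (mti_step a b eps tau S)) l))
     (fun l => (eps ^+ 2)%:C * (d (t + tau) l - dft (s_dphi (mti_step a b eps tau S)) l)) <=
   (tau * (17 * K ^+ 6 * (eta + kappa)) + tau * (17 * K ^+ 6 * (eta + kappa))) +
   (en N (fun l => (eps ^+ 2 * om l)%:C * (f t l - Fn l)) (fun l => (eps ^+ 2)%:C * (d t l - Dn l)) +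
     tau * (46 * K ^+ 4 * dist t S)).
  apply: le_trans (lerD lE s2); apply: le_trans (enD _ _ _ _ _).
  rewrite /en (@eq_nrm _ _ _ _ (fun l => Dkg1 a b N eps tau gs fs ds tau l +
    (eps ^+ 2 * om l)%:C * (phi_step a b N eps tau (g t) (f t) (d t) l - phi_step a b N eps tau G Fn Dn l))); last first.
    by move=> k; rewrite (step_phi ab N0 Ne) // (Dkg1_tau a b N tau eps0) gs0 fs0 ds0 /fs; ring.
  rewrite (@eq_nrm _ _ _ (fun l => (eps ^+ 2)%:C * (d (t + tau) l - _)) (fun l => Dkg2 a b N eps tau gs fs ds tau l +
    (eps ^+ 2)%:C * (dphi_step a b N eps tau (g t) (f t) (d t) l - dphi_step a b N eps tau G Fn Dn l))) //.
  by move=> k; rewrite (step_dphi ab N0 Ne) // Dkg2_tau gs0 fs0 ds0 /ds; ring.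
apply: (le_trans (lerD P QQ)).
have k46 : tau * (K ^+ 4 * dist t S) <= tau * (K ^+ 6 * dist t S).
  by rewrite ler_wpM2l // ler_wpM2r ?dist_ge0 // ler_weXn2l.
have k6 : 0 <= tau * (K ^+ 6 * dist t S) by rewrite mulr_ge0 // mulr_ge0 ?dist_ge0 // exprn_ge0.
have k6' : 0 <= tau * (K ^+ 6 * (eta + kappa)) by rewrite mulr_ge0 // mulr_ge0 ?addr_ge0 // exprn_ge0.
rewrite {2}/dist -/G -/Fn -/Dn in k46 k6 *.
move: k46 k6 k6'; rewrite /dist -/G -/Fn -/Dn.
by lra.
Qed.

Definition growth : R := expR (100 * K ^+ 6 * T).

Local Notation St n := (ssrnat.iter n (@mti_step R a b eps tau N) S0).

Lemma iter_real n : real_grid (s_phi (St n)) /\ real_grid (s_dphi (St n)).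
Proof. by case: n => [|n] //=; exact: step_real. Qed.

(** Discrete Gronwall inequality.  The bound on the distance required by
    [dist_step] is part of the induction. *)
Lemma dist_iter n : n%:R * tau <= T -> growth * (dist 0 S0 + (eta + kappa)) <= 1 ->
  dist (n%:R * tau) (St n) <= growth * (dist 0 S0 + (eta + kappa)).
Proof.
move=> hn small.
have ek : 0 <= eta + kappa by exact: addr_ge0.
have L0 : 0 <= 100 * K ^+ 6 by rewrite mulr_ge0 // exprn_ge0.
have D0 : 0 <= dist 0 S0 + (eta + kappa) by rewrite addr_ge0 // dist_ge0.
have main : forall m, (m <= n)%N -> dist (m%:R * tau) (St m) + (eta + kappa) <=
    expR (100 * K ^+ 6 * (m%:R * tau)) * (dist 0 S0 + (eta + kappa)).
  elim=> [_|m IH hm]; first by rewrite mul0r mulr0 expR0 mul1r.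
  have mn : m.+1%:R * tau <= T by apply: le_trans hn; rewrite ler_wpM2r // ler_nat.
  have em : m.+1%:R * tau = m%:R * tau + tau by rewrite -natr1 mulrDl mul1r.
  have IHm := IH (ltnW hm).
  have d1 : dist (m%:R * tau) (St m) <= 1.
    apply: le_trans small; apply: (@le_trans _ _ (dist (m%:R * tau) (St m) + (eta + kappa))).
      by rewrite lerDl.
    apply: (le_trans IHm); rewrite ler_wpM2r // ler_expR ler_wpM2l //.
    by rewrite (le_trans _ mn) // em lerDl.
  have [ra rb] := iter_real m.
  have mt0 : 0 <= m%:R * tau by rewrite mulr_ge0.
  have mtT : m%:R * tau + tau <= T by rewrite -em.
  have := dist_step mt0 mtT ra rb d1; rewrite -em iterS => h.
  have h2 : dist (m.+1%:R * tau) (mti_step a b eps tau (St m)) + (eta + kappa) <=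
     (1 + tau * (100 * K ^+ 6)) * (dist (m%:R * tau) (St m) + (eta + kappa)).
    by rewrite mulrDr; move: h; rewrite !mulrDl !mul1r; lra.
  apply: (le_trans h2); rewrite em (mulrDr (100 * K ^+ 6)) expRD (mulrC (expR _)) -[leRHS]mulrA.
  apply: ler_pM => //.
  - by rewrite addr_ge0 // mulr_ge0.
  - by rewrite addr_ge0 // dist_ge0.
  - by rewrite (mulrC tau) expR_ge1Dx.
apply: (@le_trans _ _ (dist (n%:R * tau) (St n) + (eta + kappa))); first by rewrite lerDl.
apply: (le_trans (main n (leqnn n))).
by rewrite ler_wpM2r // ler_expR ler_wpM2l.
Qed.

End Convergence.

(** * Integrals over the period and Fourier coefficients *)
Section RealIntegrals.
Context {R : realType} (D : set (measurableTypeR R)) (mD : measurable D)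
  (fD : (@lebesgue_measure R D < +oo)%E).
Notation mu := (@lebesgue_measure R).
Implicit Types (f g : R -> R).

(** Real-valued form of integrability, closed under the operations below without
    passing through the extended reals. *)
Definition ig f : Prop := mu.-integrable D (EFin \o f).

(** Bounded measurable functions, the multipliers of integrable ones. *)
Definition bm f : Prop := measurable_fun D f /\ exists M : R, forall x, D x -> `|f x| <= M.

Lemma ig_eq f g : (forall x, D x -> f x = g x) -> ig f -> ig g.
Proof.
by move=> h; apply: eq_integrable => // x /set_mem hx; rewrite /= h.
Qed.

Lemma Rint_eq f g : (forall x, D x -> f x = g x) ->
  \int[mu]_(x in D) f x = \int[mu]_(x in D) g x.
Proof. by move=> h; apply: eq_Rintegral => x /set_mem; exact: h. Qed.

Lemma ig_D f g : ig f -> ig g -> ig (fun x => f x + g x).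
Proof.
by move=> hf hg; apply: eq_integrable (integrableD mD hf hg).
Qed.
Lemma ig_Z k f : ig f -> ig (fun x => k * f x).
Proof. by move=> hf; apply: eq_integrable (integrableZl mD k hf). Qed.

Lemma ig_N f : ig f -> ig (fun x => - f x).
Proof. by move=> hf; apply: (ig_eq _ (ig_Z (-1) hf)) => x _; rewrite mulN1r. Qed.
Lemma ig_B f g : ig f -> ig g -> ig (fun x => f x - g x).
Proof. by move=> hf /ig_N; exact: ig_D. Qed.
Lemma ig_bM g f : bm g -> ig f -> ig (fun x => g x * f x).
Proof.
move=> [mg [M hM]] hf; apply: (@eq_integrable _ _ _ mu D mD ((EFin \o g) \* (EFin \o f))%E).
  by move=> x _ /=; rewrite EFinM.
apply: integrableMr => //; exists M; split; first exact: num_real.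
by move=> y My x Dx; apply: (le_trans (hM x Dx)); exact: ltW.
Qed.

Lemma ig_bm f : bm f -> ig f.
Proof.
move=> [mf [M hM]]; apply: measurable_bounded_integrable => //.
exists M; split; first exact: num_real.
by move=> y My x Dx; apply: (le_trans (hM x Dx)); exact: ltW.
Qed.

Lemma bm_cst c : bm (fun _ => c).
Proof. by split; [exact: measurable_cst|exists `|c|]. Qed.

Lemma bm_M f g : bm f -> bm g -> bm (fun x => f x * g x).
Proof.
move=> [mf [M hM]] [mg [M' hM']]; split; first exact: measurable_funM.
exists (M * M') => x Dx; rewrite normrM; apply: ler_pM => //; [exact: hM|exact: hM'].
Qed.

Lemma bm_D f g : bm f -> bm g -> bm (fun x => f x + g x).
Proof.
move=> [mf [M hM]] [mg [M' hM']]; split; first exact: measurable_funD.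
exists (M + M') => x Dx; apply: (le_trans (ler_normD _ _)); apply: lerD; [exact: hM|exact: hM'].
Qed.

Lemma bm_N f : bm f -> bm (fun x => - f x).
Proof.
move=> hf; have := bm_M (bm_cst (-1)) hf.
by rewrite (_ : (fun x => -1 * f x) = (fun x => - f x)) //; apply/funext => x; rewrite mulN1r.
Qed.

Lemma bm_continuous f M : continuous f -> (forall x, D x -> `|f x| <= M) -> bm f.
Proof.
move=> cf hM; split; last by exists M.
by apply: measurable_funTS; exact: continuous_measurable_fun.
Qed.

End RealIntegrals.

Section ComplexIntegrals.
Context {R : realType} (D : set (measurableTypeR R)) (mD : measurable D)
  (fD : (@lebesgue_measure R D < +oo)%E).
Notation mu := (@lebesgue_measure R).
Local Notation ig := (ig D).
Local Notation bm := (bm D).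
Implicit Types (f g : R -> R[i]).

Definition cig f : Prop := ig (fun x => Re (f x)) /\ ig (fun x => Im (f x)).
Definition cbm f : Prop := bm (fun x => Re (f x)) /\ bm (fun x => Im (f x)).

Lemma cint_eq f g : (forall x, D x -> f x = g x) -> cint D f = cint D g.
Proof. by move=> h; congr Complex; apply: Rint_eq => x Dx; rewrite h. Qed.

Lemma cig_eq f g : (forall x, D x -> f x = g x) -> cig f -> cig g.
Proof.
move=> h [h1 h2]; split; [apply: (ig_eq mD) h1|apply: (ig_eq mD) h2] => x Dx; by rewrite h.
Qed.

Lemma cig_D f g : cig f -> cig g -> cig (fun x => f x + g x).
Proof.
move=> [f1 f2] [g1 g2]; split.
  by apply: (ig_eq mD) (ig_D mD f1 g1) => x _; rewrite ReD.
by apply: (ig_eq mD) (ig_D mD f2 g2) => x _; rewrite ImD.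
Qed.

Lemma cint_D f g : cig f -> cig g -> cint D (fun x => f x + g x) = cint D f + cint D g.
Proof.
move=> [f1 f2] [g1 g2]; apply/eqP; rewrite eq_complex ReD ImD /cint /=.
rewrite -(RintegralD mD f1 g1) -(RintegralD mD f2 g2).
by apply/andP; split; apply/eqP; apply: Rint_eq => x _; rewrite ?ReD ?ImD.
Qed.

Lemma cig_bM g f : cbm g -> cig f -> cig (fun x => g x * f x).
Proof.
move=> [g1 g2] [f1 f2]; split.
  apply: (ig_eq mD) (ig_B mD (ig_bM mD g1 f1) (ig_bM mD g2 f2)) => x _; by rewrite ReM.
apply: (ig_eq mD) (ig_D mD (ig_bM mD g1 f2) (ig_bM mD g2 f1)) => x _; by rewrite ImM.
Qed.

Lemma cbm_cst (c : R[i]) : cbm (fun _ => c).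
Proof. by split; exact: bm_cst. Qed.

Lemma cbm_eq f g : (forall x, f x = g x) -> cbm f -> cbm g.
Proof. by move=> /funext ->. Qed.

Lemma cbm_M f g : cbm f -> cbm g -> cbm (fun x => f x * g x).
Proof.
move=> [f1 f2] [g1 g2]; split.
  rewrite (_ : (fun x => _) = fun x => Re (f x) * Re (g x) + - (Im (f x) * Im (g x))).
    by apply: bm_D; [exact: bm_M|apply: bm_N; exact: bm_M].
  by apply/funext => x; rewrite ReM.
rewrite (_ : (fun x => _) = fun x => Re (f x) * Im (g x) + Im (f x) * Re (g x)).
  by apply: bm_D; exact: bm_M.
by apply/funext => x; rewrite ImM.
Qed.

Lemma cbm_D f g : cbm f -> cbm g -> cbm (fun x => f x + g x).
Proof.
move=> [f1 f2] [g1 g2]; split.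
  rewrite (_ : (fun x => _) = fun x => Re (f x) + Re (g x)); first exact: bm_D.
  by apply/funext => x; rewrite ReD.
rewrite (_ : (fun x => _) = fun x => Im (f x) + Im (g x)); first exact: bm_D.
by apply/funext => x; rewrite ImD.
Qed.

Lemma cbm_J f : cbm f -> cbm (fun x => (f x)^*).
Proof.
move=> [f1 f2]; split.
  by rewrite (_ : (fun x => _) = fun x => Re (f x)) //; apply/funext => x; rewrite ReJ.
rewrite (_ : (fun x => _) = fun x => - Im (f x)); first exact: bm_N.
by apply/funext => x; rewrite ImJ.
Qed.

Lemma cbm_sum (I : Type) (s : seq I) (F : I -> R -> R[i]) :
  (forall i, cbm (F i)) -> cbm (fun x => \sum_(i <- s) F i x).
Proof.
move=> h; elim: s => [|i s IH].
  by apply: cbm_eq (cbm_cst 0) => x; rewrite big_nil.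
by apply: cbm_eq (cbm_D (h i) IH) => x; rewrite big_cons.
Qed.

Lemma cig_bm f : cbm f -> cig f.
Proof. by move=> [h1 h2]; split; exact: (ig_bm mD fD). Qed.

Lemma cig_Z (c : R[i]) f : cig f -> cig (fun x => c * f x).
Proof. exact: cig_bM (cbm_cst c). Qed.

Lemma cint_Z (c : R[i]) f : cig f -> cint D (fun x => c * f x) = c * cint D f.
Proof.
move=> [f1 f2]; apply/eqP; rewrite eq_complex ReM ImM /cint /=.
have z k u : ig u -> \int[mu]_(x in D) (k * u x) = k * \int[mu]_(x in D) u x.
  by move=> hu; exact: (RintegralZl k mD hu).
rewrite -(z _ _ f1) -(z _ _ f2) -(z _ _ f1) -(z _ _ f2).
rewrite -(RintegralB mD (ig_Z mD _ f1) (ig_Z mD _ f2)) -(RintegralD mD (ig_Z mD _ f2) (ig_Z mD _ f1)).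
by apply/andP; split; apply/eqP; apply: Rint_eq => x _; rewrite ?ReM ?ImM.
Qed.

Lemma cig_N f : cig f -> cig (fun x => - f x).
Proof. by move=> /(cig_Z (-1)); apply: cig_eq => x _; rewrite mulN1r. Qed.

Lemma cint_N f : cig f -> cint D (fun x => - f x) = - cint D f.
Proof. by move=> /(cint_Z (-1)); rewrite mulN1r => <-; apply: cint_eq => x _; rewrite mulN1r. Qed.

Lemma cig_B f g : cig f -> cig g -> cig (fun x => f x - g x).
Proof. by move=> hf /cig_N; exact: cig_D. Qed.

Lemma cint_B f g : cig f -> cig g -> cint D (fun x => f x - g x) = cint D f - cint D g.
Proof. by move=> hf hg; rewrite -(cint_N hg) -cint_D //; exact: cig_N. Qed.

Lemma cig_J f : cig f -> cig (fun x => (f x)^*).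
Proof.
move=> [f1 f2]; split; first by apply: (ig_eq mD) f1 => x _; rewrite ReJ.
by apply: (ig_eq mD) (ig_N mD f2) => x _; rewrite ImJ.
Qed.

Lemma cint_J f : cig f -> cint D (fun x => (f x)^*) = (cint D f)^*.
Proof.
move=> [f1 f2]; congr Complex; first by apply: Rint_eq => x _; rewrite ReJ.
rewrite -[RHS]mulN1r.
by rewrite -(RintegralZl (-1) mD f2); apply: Rint_eq => x _; rewrite ImJ mulN1r.
Qed.

Lemma cig_sum (I : Type) (s : seq I) (F : I -> R -> R[i]) :
  (forall i, cig (F i)) -> cig (fun x => \sum_(i <- s) F i x).
Proof.
move=> h; elim: s => [|i s IH].
  by apply: cig_eq (cig_bm (cbm_cst 0)) => x _; rewrite big_nil.
by apply: cig_eq (cig_D (h i) IH) => x _; rewrite big_cons.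
Qed.

Lemma cint0 : cint D (fun _ => 0) = 0 :> R[i].
Proof. by have := cint_Z 0 (cig_bm (cbm_cst 0)); rewrite !mul0r. Qed.

Lemma cint_sum (I : Type) (s : seq I) (F : I -> R -> R[i]) :
  (forall i, cig (F i)) -> cint D (fun x => \sum_(i <- s) F i x) = \sum_(i <- s) cint D (F i).
Proof.
move=> h; elim: s => [|i s IH].
  by rewrite big_nil -[RHS]cint0; apply: cint_eq => x _; rewrite big_nil.
rewrite big_cons -IH -cint_D //; last exact: cig_sum.
by apply: cint_eq => x _; rewrite big_cons.
Qed.

Lemma cint_real (u : R -> R) : cint D (fun x => (u x)%:C) = (\int[mu]_(x in D) u x)%:C.
Proof. by congr Complex; rewrite Rintegral_cst // mul0r. Qed.

(** The constant 2 only reflects that real and imaginary parts are integrated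
    separately. *)
Lemma cint_le f M : cig f -> (forall x, D x -> normc (f x) <= M) ->
  normc (cint D f) <= 2 * (M * fine (mu D)).
Proof.
move=> [f1 f2] hM.
have k u : ig u -> (forall x, D x -> `|u x| <= M) -> `|\int[mu]_(x in D) u x| <= M * fine (mu D).
  move=> hu h; apply: (le_trans (le_normr_Rintegral mD hu)).
  rewrite -(Rintegral_cst mu mD); apply: le_Rintegral => //.
    exact: integrable_norm.
  by apply: (ig_bm mD fD); exact: bm_cst.
rewrite (_ : cint D f = (Re (cint D f))%:C + 'i * (Im (cint D f))%:C); last first.
  by case: (cint D f) => x y; apply/eqP; rewrite eq_complex /=; apply/andP; split; apply/eqP; ring.
apply: (le_trans (normcD _ _)); rewrite normcM normc_i mul1r !normc_real mulr_natl mulr2n.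
apply: lerD; apply: k => // x Dx.
  by apply: le_trans (hM x Dx); exact: Re_le_normc.
by apply: le_trans (hM x Dx); exact: Im_le_normc.
Qed.

End ComplexIntegrals.

Section TorusIntegrals.
Context {R : realType} (a b : R) (ab : a < b).
Notation leb := (@lebesgue_measure R).
Local Notation I := (`]a, b[%classic : set (measurableTypeR R)).
Local Notation mu := (@mu R a b).
Local Notation chi := (@chi R a b).

Lemma mI : measurable I. Proof. exact: measurable_itv. Qed.
Lemma fI : (leb I < +oo)%E.
Proof. by rewrite lebesgue_measure_itv /= lte_fin ab -EFinB ltry. Qed.
Lemma length_ab : fine (leb I) = b - a.
Proof. by rewrite lebesgue_measure_itv /= lte_fin ab. Qed.

(** Stated on the open interval because all integrals in space are taken there. *)
Lemma ftc_I (F f : R -> R) : continuous f -> (forall x : R, is_derive x 1 F (f x)) ->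
  \int[leb]_(x in I) f x = F b - F a.
Proof.
move=> cf dF.
have cF : continuous F.
  by move=> x; apply: differentiable_continuous; apply/derivable1_diffP; have [] := dF x.
have h := @continuous_FTC2 R f F a b ab (continuous_subspaceT cf) _ _.
have ii : leb.-integrable `[a, b] (EFin \o f).
  by apply: continuous_compact_integrable; [exact: segment_compact|exact: continuous_subspaceT].
rewrite Rintegral_itv_obnd_cbnd; last first.
  by apply: integrableS ii => //; exact: subset_itv_oo_cc.
rewrite Rintegral_itv_bndo_bndc; last first.
  by apply: integrableS ii => //; apply: subset_itvl; rewrite bnd_simp.
rewrite /Rintegral h //.
- split; first by move=> x _; have [] := dF x.
  + exact/cvg_at_right_filter/cF.
  + exact/cvg_at_left_filter/cF.
- by move=> x _; have [_] := dF x; rewrite derive1E.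
Qed.

Lemma chi_cbm l : cbm I (chi l).
Proof.
have hc : continuous (fun x => cos (mu l * x + (- (mu l * a)))) by exact: continuous_cos_lin.
have hs : continuous (fun x => sin (mu l * x + (- (mu l * a)))) by exact: continuous_sin_lin.
split; apply: (@bm_continuous _ _ _ 1).
- rewrite (_ : (fun x => _) = fun x => cos (mu l * x + (- (mu l * a)))) //; apply/funext => x; rewrite /chi /=; congr cos; ring.
- by move=> x _; exact: cos_max.
- rewrite (_ : (fun x => _) = fun x => sin (mu l * x + (- (mu l * a)))) //; apply/funext => x; rewrite /chi /=; congr sin; ring.
- by move=> x _; exact: sin_max.
Qed.

Lemma mu_eq0 l : l != 0 -> mu l != 0.
Proof.
move=> l0; rewrite /mu mulf_neq0 //; last by rewrite invr_eq0 subr_eq0 gt_eqF.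
by rewrite !mulf_neq0 ?pnatr_eq0 ?intr_eq0 // gt_eqF // pi_gt0.
Qed.

Lemma chi_b l : chi l b = 1.
Proof.
rewrite /chi -(cis_2pi l); congr cis; rewrite /Defs.mu; field.
by rewrite subr_eq0 gt_eqF.
Qed.

Lemma chi_a l : chi l a = 1.
Proof. by rewrite /chi subrr mulr0 cis0. Qed.

Lemma int_chi l : cint I (chi l) = if l == 0 then (b - a)%:C else 0.
Proof.
case: eqP => [->|/eqP l0].
  rewrite (@cint_eq _ _ _ (fun _ => 1%:C)) => [|x _]; last by rewrite chi0.
  by rewrite cint_real // Rintegral_cst ?mul1r ?length_ab.
have m0 := mu_eq0 l0.
have dl (x : R) : is_derive x 1 (fun x => mu l * x + - (mu l * a)) (mu l).
  have := is_deriveD_fun (is_deriveM_fun (is_derive_cst_fun x (mu l)) (is_derive_id x 1)) (is_derive_cst_fun x (- (mu l * a))).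
  by rewrite mul0r !addr0 mulr1.
have e x : mu l * (x - a) = mu l * x + - (mu l * a) by ring.
have hr := @ftc_I (fun x => sin (mu l * x + - (mu l * a)) / mu l) (fun x => cos (mu l * x + - (mu l * a))).
have hi := @ftc_I (fun x => - cos (mu l * x + - (mu l * a)) / mu l) (fun x => sin (mu l * x + - (mu l * a))).
have ea : mu l * a + - (mu l * a) = 0 by ring.
have eb : cis (mu l * b + - (mu l * a)) = cis 0 by rewrite -e cis0 -(chi_b l).
have [eb1 eb2] : cos (mu l * b + - (mu l * a)) = cos 0 /\ sin (mu l * b + - (mu l * a)) = sin 0.
  by move: eb => [] -> ->.
congr Complex.
- rewrite (@Rint_eq _ _ _ (fun x => cos (mu l * x + - (mu l * a)))) => [|x _]; last by rewrite /chi e.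
  have dr (x : R) : is_derive x 1 (fun x => sin (mu l * x + - (mu l * a)) / mu l) (cos (mu l * x + - (mu l * a))).
    have := is_deriveM_fun (is_derive_sin_lin (mu l) (- (mu l * a)) x) (is_derive_cst_fun x (mu l)^-1).
    by rewrite mulr0 add0r (mulrC (mu l) (cos _)) mulfK.
  by rewrite (hr (@continuous_cos_lin R _ _) dr) eb2 ea subrr.
- rewrite (@Rint_eq _ _ _ (fun x => sin (mu l * x + - (mu l * a)))) => [|x _]; last by rewrite /chi e.
  have dr (x : R) : is_derive x 1 (fun x => - cos (mu l * x + - (mu l * a)) / mu l) (sin (mu l * x + - (mu l * a))).
    have := is_deriveM_fun (is_derive_cos_lin (mu l) (- (mu l * a)) x) (is_derive_cst_fun x (- (mu l)^-1)).
    rewrite mulr0 add0r; set d := (X in is_derive _ _ _ X).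
    have -> : d = sin (mu l * x + - (mu l * a)) by rewrite /d; field.
    by rewrite (_ : (fun x => _ * - _) = (fun x0 : R => - cos (mu l * x0 + - (mu l * a)) / mu l)) //; apply/funext => y; ring.
  by rewrite (hi (@continuous_sin_lin R _ _) dr) eb1 ea subrr.
Qed.

(** The coefficients with respect to [chi], with the phase normalized at [a] as in
    the discrete transform. *)
Definition fc (u : R -> R[i]) (l : int) : R[i] :=
  (b - a)^-1%:C * cint I (fun x => u x * chi (- l) x).

Let ba0 : (b - a) != 0. Proof. by rewrite subr_eq0 gt_eqF. Qed.

Let cint_fc u l : cint I (fun x => u x * chi (- l) x) = (b - a)%:C * fc u l.
Proof. by rewrite /fc mulrA -rcM mulfV // mul1r. Qed.

Lemma cig_chi u l : cig I u -> cig I (fun x => u x * chi l x).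
Proof.
move=> hu; apply: (cig_eq mI) (cig_bM mI (chi_cbm l) hu) => x _; exact: mulrC.
Qed.

Lemma fc_eq u v l : (forall x, I x -> u x = v x) -> fc u l = fc v l.
Proof. by move=> h; congr (_ * _); apply: cint_eq => x Ix; rewrite h. Qed.

Lemma fcD u v l : cig I u -> cig I v -> fc (fun x => u x + v x) l = fc u l + fc v l.
Proof.
move=> hu hv; rewrite /fc -mulrDr -(cint_D mI (cig_chi _ hu) (cig_chi _ hv)); congr (_ * _).
by apply: cint_eq => x _; rewrite mulrDl.
Qed.

Lemma fcZ c u l : cig I u -> fc (fun x => c * u x) l = c * fc u l.
Proof.
move=> hu; rewrite /fc mulrCA -(cint_Z mI _ (cig_chi _ hu)); congr (_ * _).
by apply: cint_eq => x _; rewrite mulrA.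
Qed.

Lemma fcB u v l : cig I u -> cig I v -> fc (fun x => u x - v x) l = fc u l - fc v l.
Proof.
move=> hu hv; rewrite -[- fc v l]mulN1r -(fcZ _ l hv) -fcD //; last exact: cig_Z.
by apply: fc_eq => x _; rewrite mulN1r.
Qed.

Lemma fc_conj u l : cig I u -> fc (fun x => (u x)^*) l = (fc u (- l))^*.
Proof.
move=> hu; rewrite /fc conjcM conjc_real -(cint_J mI (cig_chi _ hu)); congr (_ * _).
by apply: cint_eq => x _; rewrite conjcM opprK chiN.
Qed.

Lemma fc_le u l M : cig I u -> (forall x, I x -> normc (u x) <= M) -> normc (fc u l) <= 2 * M.
Proof.
move=> hu hM; rewrite /fc normcM normc_real ger0_norm; last by rewrite invr_ge0 subr_ge0 ltW.
rewrite ler_pdivrMl ?subr_gt0 //.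
have := @cint_le _ _ mI fI (fun x => u x * chi (- l) x) M (cig_chi _ hu); rewrite length_ab.
rewrite (_ : (b - a) * (2 * M) = 2 * (M * (b - a))); last by ring.
by apply => x Ix; rewrite normcM normc_chi mulr1; exact: hM.
Qed.

(** Convertible to [trig_poly]; written with [chi] so that the lemmas on characters
    apply. *)
Definition tp (n : nat) (c : int -> R[i]) (x : R) : R[i] := \sum_(k < n) c (lidx n k) * chi (lidx n k) x.

Lemma tp_cbm n c : cbm I (tp n c).
Proof. by apply: cbm_sum => // i; apply: cbm_M; [exact: cbm_cst|exact: chi_cbm]. Qed.

(** Together with integrability of the parts, membership in L^2. *)
Definition sqi (u : R -> R[i]) : Prop := ig I (fun x => normc (u x) ^+ 2).

(** Orthogonality of the characters.  With [c] the coefficients of [v] it is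
    Bessel's identity; with [v = 0], the norm of a trigonometric polynomial. *)
Lemma pythagoras n c v : cig I v -> sqi v ->
  \int[leb]_(x in I) (normc (v x - tp n c x) ^+ 2) =
  \int[leb]_(x in I) (normc (v x) ^+ 2)
  - (b - a) * \sum_(k < n) normc (fc v (lidx n k)) ^+ 2
  + (b - a) * \sum_(k < n) normc (fc v (lidx n k) - c (lidx n k)) ^+ 2.
Proof.
move=> hv h2.
pose P := tp n c.
have cP : cbm I P by exact: tp_cbm.
have cv2 : cig I (fun x => (normc (v x) ^+ 2)%:C).
  split; first exact: h2.
  by apply: (ig_bm mI fI); exact: bm_cst.
have cvP : cig I (fun x => (P x)^* * v x) by apply: (cig_bM mI) hv; exact: cbm_J.
have cPP : cig I (fun x => (P x)^* * P x).
  by apply: (cig_bM mI) (cig_bm mI fI cP); exact: cbm_J.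
have conjP x : (P x)^* = \sum_(k < n) (c (lidx n k))^* * chi (- lidx n k) x.
  by rewrite /P /tp conjc_sum; apply: eq_bigr => k _; rewrite conjcM chiN.
have IvP : cint I (fun x => (P x)^* * v x) = (b - a)%:C * \sum_(k < n) (c (lidx n k))^* * fc v (lidx n k).
  rewrite mulr_sumr (@cint_eq _ _ _ (fun x => \sum_(k < n) (c (lidx n k))^* * (v x * chi (- lidx n k) x))).
    rewrite (cint_sum mI fI) => [|k]; last by apply: (cig_Z mI); exact: cig_chi.
    apply: eq_bigr => k _; rewrite (cint_Z mI _ (cig_chi _ hv)) cint_fc; ring.
  by move=> x _; rewrite conjP mulr_suml; apply: eq_bigr => k _; ring.
have IPP : cint I (fun x => (P x)^* * P x) = (b - a)%:C * \sum_(k < n) (c (lidx n k))^* * c (lidx n k).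
  rewrite mulr_sumr (@cint_eq _ _ _ (fun x => \sum_(k < n) \sum_(j < n)
     ((c (lidx n k))^* * c (lidx n j)) * chi (lidx n j - lidx n k) x)).
    rewrite (cint_sum mI fI) => [|k]; last first.
      by apply: (cig_sum mI fI) => j; apply: (cig_Z mI); apply: (cig_bm mI fI); exact: chi_cbm.
    apply: eq_bigr => k _; rewrite (cint_sum mI fI) => [|j]; last first.
      by apply: (cig_Z mI); apply: (cig_bm mI fI); exact: chi_cbm.
    rewrite (bigD1 k) //= big1 ?addr0 => [|j jk]; rewrite (cint_Z mI); try by apply: (cig_bm mI fI); exact: chi_cbm.
      by rewrite subrr int_chi eqxx mulrC.
    rewrite int_chi subr_eq0 (inj_eq (@lidx_inj n)) ifN ?mulr0 //.
  move=> x _; rewrite conjP mulr_suml; apply: eq_bigr => k _.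
  by rewrite /P /tp mulr_sumr; apply: eq_bigr => j _; rewrite chiD; ring.
have key x : (normc (v x - P x) ^+ 2)%:C =
    (normc (v x) ^+ 2)%:C - ((P x)^* * v x + ((P x)^* * v x)^*) + (P x)^* * P x.
  by rewrite !sqr_normcE conjcB conjcM conjcK; ring.
suff : (\int[leb]_(x in I) (normc (v x - P x) ^+ 2))%:C =
  (\int[leb]_(x in I) (normc (v x) ^+ 2)
  - (b - a) * \sum_(k < n) normc (fc v (lidx n k)) ^+ 2
  + (b - a) * \sum_(k < n) normc (fc v (lidx n k) - c (lidx n k)) ^+ 2)%:C :> R[i] by move=> [].
rewrite -(cint_real mI) (@cint_eq _ _ _ _ (fun x _ => key x)).
rewrite (cint_D mI) //; last by apply: (cig_B mI) => //; apply: (cig_D mI) => //; exact: (cig_J mI).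
rewrite (cint_B mI) //; last by apply: (cig_D mI) => //; exact: (cig_J mI).
rewrite (cint_D mI) //; last exact: (cig_J mI).
rewrite (cint_J mI) // IvP IPP (cint_real mI) conjcM conjc_real conjc_sum.
rewrite [RHS]rcD [X in _ = X + _]rcB !(rcM (b - a)) -!addrA; congr (_ + _).
rewrite !rmorph_sum.
set B := (b - a)%:C; set s1 := \sum_(i < n) _ * fc _ _; set s2 := \sum_(i < n) _^*; set s3 := \sum_(i < n) _ * c _.
set s4 := \sum_(i < n) _; set s5 := \sum_(i < n) _.
transitivity (B * (- (s1 + s2) + s3)); first by ring.
transitivity (B * (- s4 + s5)); last by ring.
congr (_ * _); rewrite /s1 /s2 /s3 /s4 /s5.
rewrite -big_split -sumrN -big_split -sumrN -big_split; apply: eq_bigr => k _.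
move: (fc v (lidx n k)) (c (lidx n k)) => z w.
change (- (w^* * z + (w^* * z)^*) + w^* * w = - (normc z ^+ 2)%:C + (normc (z - w) ^+ 2)%:C).
by rewrite !sqr_normcE conjcB !conjcM conjcK; ring.
Qed.

Lemma bessel n v : cig I v -> sqi v ->
  (b - a) * \sum_(k < n) normc (fc v (lidx n k)) ^+ 2 <= \int[leb]_(x in I) (normc (v x) ^+ 2).
Proof.
move=> h1 h2; rewrite -subr_ge0; have := pythagoras n (fc v) h1 h2.
rewrite [X in _ + _ * X]big1 ?mulr0 ?addr0 => [<-|k _]; last by rewrite subrr ComplexField.Normc.normc0 expr0n.
by apply: Rintegral_ge0 => x _; exact: sqr_ge0.
Qed.

Lemma tp_norm n c : \int[leb]_(x in I) (normc (tp n c x) ^+ 2) =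
  (b - a) * \sum_(k < n) normc (c (lidx n k)) ^+ 2.
Proof.
have z0 (x : R) : normc (0 : R[i]) ^+ 2 = 0 by rewrite ComplexField.Normc.normc0 expr0n.
have i0 : cig I (fun _ => 0 : R[i]) by apply: (cig_bm mI fI); exact: cbm_cst.
have s0 : sqi (fun _ => 0 : R[i]) by apply: (ig_bm mI fI); apply: bm_cst.
have f0 l : fc (fun _ => 0) l = 0.
  rewrite /fc (@cint_eq _ _ _ (fun _ => 0)); first by rewrite (cint0 mI fI) mulr0.
  by move=> x _; rewrite mul0r.
have := pythagoras n c i0 s0.
rewrite [X in _ = X - _ + _](_ : _ = 0); last first.
  by rewrite (@Rint_eq _ _ _ (fun _ => 0)) ?Rintegral_cst ?mul0r // => x _; exact: z0.
rewrite [X in _ - _ * X + _]big1 => [|k _]; last by rewrite f0 (z0 0).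
rewrite mulr0 subr0 add0r => h.
transitivity (\int[leb]_(x in I) (normc (0 - tp n c x) ^+ 2)).
  by apply: Rint_eq => x _; rewrite sub0r normcN.
by rewrite h; congr (_ * _); apply: eq_bigr => k _; rewrite f0 sub0r normcN.
Qed.

End TorusIntegrals.

(** * Cut-off functions *)
Section Calculus.
Context {R : realType}.
Notation leb := (@lebesgue_measure R).

(** A quadratic remainder gives the derivative; it serves for [y |y|], which is not
    twice differentiable at 0. *)
Lemma is_derive_quad (f : R -> R) x d C :
  (forall h, `|f (h + x) - f x - h * d| <= C * h ^+ 2) -> is_derive x 1 f d.
Proof.
move=> hC.
have C0 : 0 <= C by have := hC 1; rewrite expr1n mulr1; apply: le_trans.
have lim : h^-1 *: (f (h *: (1 : R) + x) - f x) @[h --> 0^'] --> d.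
  apply/cvgrPdist_le => /= e e0.
  near=> h.
  have h0 : h != 0 by near: h; exact: nbhs_dnbhs_neq.
  have hn : 0 < `|h| by rewrite normr_gt0.
  rewrite -(@ler_pM2l _ `|h|) // -normrM mulrBr [h * (_ *: _)]mulrA mulfV // mul1r.
  rewrite distrC [h *: 1]mulr1; apply: (le_trans (hC h)).
  rewrite -(ger0_norm (sqr_ge0 h)) normrX expr2 mulrCA ler_pM2l //.
  have : `|h| <= e / (C + 1).
    near: h; apply: dnbhs0_le; apply: divr_gt0 => //; exact: ltr_wpDl.
  rewrite ler_pdivlMr; last exact: ltr_wpDl.
  by apply: le_trans; rewrite mulrC ler_wpM2l // lerDl.
apply: DeriveDef; first by apply/cvg_ex; exists d.
exact/cvg_lim.
Unshelve. all: by end_near.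
Qed.

Lemma is_derive_sqabs (x : R) : is_derive x 1 (fun y => y * `|y|) (2 * `|x|).
Proof.
apply: (@is_derive_quad _ _ _ 1) => h; rewrite mul1r ler_norml.
have [h1|h1] := leP 0 x; have [h2|h2] := leP 0 (h + x);
  rewrite ?(ger0_norm h1) ?(ltr0_norm h1) ?(ger0_norm h2) ?(ltr0_norm h2); apply/andP; split; nra.
Qed.

(** A C^1 step from 0 to 1 on [0, 1]; it is a combination of the functions
    y |y|, which are C^1. *)
Definition step (y : R) : R :=
  y * `|y| - 2 * ((y - 2^-1) * `|y - 2^-1|) + (y - 1) * `|y - 1| + 2^-1.
(** The derivative of [step], a tent on [[0, 1]] of total mass 1. *)
Definition bump (y : R) : R := 2 * (`|y| - 2 * `|y - 2^-1| + `|y - 1|).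

Lemma is_derive_shift (f : R -> R) (x c d : R) : is_derive (x - c) 1 f d ->
  is_derive x 1 (fun y => f (y - c)) d.
Proof.
move=> h.
have hs1 : is_derive x 1 (fun y => y - c) 1.
  by have := is_deriveB_fun (is_derive_id x 1) (is_derive_cst_fun x c); rewrite subr0.
by have := @is_derive1_comp R f (fun y => y - c) x d 1 h hs1; rewrite mulr1.
Qed.

Lemma is_derive_step (x : R) : is_derive x 1 step (bump x).
Proof.
have h0 := is_derive_sqabs x.
have h1 := is_derive_shift (is_derive_sqabs (x - 2^-1)).
have h2 := is_derive_shift (is_derive_sqabs (x - 1)).
have := is_deriveD_fun (is_deriveD_fun (is_deriveB_fun h0
  (is_deriveM_fun (is_derive_cst_fun x 2) h1)) h2) (is_derive_cst_fun x 2^-1).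
set d := (X in is_derive _ _ _ X -> _); have -> // : d = bump x.
rewrite /d /bump; ring.
Qed.

Lemma step_le0 y : y <= 0 -> step y = 0.
Proof.
move=> h; rewrite /step !ler0_norm; [by field|lra..].
Qed.
Lemma step_ge1 y : 1 <= y -> step y = 1.
Proof.
move=> h; rewrite /step !ger0_norm; [by field|lra..].
Qed.
Lemma bump_le0 y : y <= 0 -> bump y = 0.
Proof. move=> h; rewrite /bump !ler0_norm; [by field|lra..]. Qed.
Lemma bump_ge1 y : 1 <= y -> bump y = 0.
Proof. move=> h; rewrite /bump !ger0_norm; [by field|lra..]. Qed.

Lemma bump_ge0 y : 0 <= bump y.
Proof.
rewrite /bump; have := ler_normD (y - 1) y.
have -> : y - 1 + y = 2 * (y - 2^-1) by field.
by rewrite normrM ger0_norm // => h; lra.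
Qed.

Lemma step01 y : 0 <= step y <= 1.
Proof.
have [h|h] := leP y 0; first by rewrite step_le0 // lexx ler01.
have [h1|h1] := leP 1 y; first by rewrite step_ge1 // lexx ler01.
rewrite /step (gtr0_norm h) (ltr0_norm (_ : y - 1 < 0)); last by lra.
have [h2|h2] := leP 0 (y - 2^-1); rewrite ?(ger0_norm h2) ?(ltr0_norm h2); apply/andP; split; nra.
Qed.

Lemma continuous_bump : continuous bump.
Proof.
move=> x; rewrite /bump; apply: cvgM; first exact: cvg_cst.
have hn c : (fun y : R => `|y - c|) y @[y --> x] --> `|x - c|.
  by apply: cvg_norm; apply: cvgB; [exact: cvg_id|exact: cvg_cst].
apply: cvgD; last exact: hn.
apply: cvgB; first by apply: cvg_norm; exact: cvg_id.
by apply: cvgM; [exact: cvg_cst|exact: hn].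
Qed.

End Calculus.

Section Cutoff.
Context {R : realType} (c d : R) (n : R) (n0 : 0 < n).

(** Cut-off functions: 1 on [c + 2/n, d - 2/n], supported in
    [c + 1/n, d - 1/n]; their derivative is a difference of two approximate
    identities, at c and at d. *)
Definition cutoff (x : R) : R := step (n * (x - c) - 1) - step (n * (x - d) + 2).
(** Approximate identities, concentrated inside [[c, c + 2/n]] and [[d - 2/n, d]]. *)
Definition rho_l (x : R) : R := n * bump (n * (x - c) - 1).
Definition rho_r (x : R) : R := n * bump (n * (x - d) + 2).

Let comp (f f' : R -> R) k m x : (forall y : R, is_derive y 1 f (f' y)) ->
  is_derive (x : R) 1 (fun x => f (n * (x - k) + m)) (n * f' (n * (x - k) + m)).
Proof.
move=> h.
have hl : is_derive x 1 (fun x => n * (x - k) + m) n.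
  have := is_deriveD_fun (is_deriveM_fun (is_derive_cst_fun x n)
    (is_deriveB_fun (is_derive_id x 1) (is_derive_cst_fun x k))) (is_derive_cst_fun x m).
  by rewrite subr0 mulr1 mul0r !addr0.
by rewrite mulrC; exact: (@is_derive1_comp R f (fun x => n * (x - k) + m) x _ _ (h _) hl).
Qed.

Lemma is_derive_cutoff_l (x : R) : is_derive x 1 (fun x => step (n * (x - c) - 1)) (rho_l x).
Proof. exact: comp is_derive_step. Qed.
Lemma is_derive_cutoff_r (x : R) : is_derive x 1 (fun x => step (n * (x - d) + 2)) (rho_r x).
Proof. exact: comp is_derive_step. Qed.

Lemma is_derive_cutoff (x : R) : is_derive x 1 cutoff (rho_l x - rho_r x).
Proof. exact: is_deriveB_fun (is_derive_cutoff_l x) (is_derive_cutoff_r x). Qed.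

Let cont_comp k m : continuous (fun x : R => n * bump (n * (x - k) + m)).
Proof.
move=> x; apply: cvgM; first exact: cvg_cst.
have hc : (fun y : R => n * (y - k) + m) y @[y --> x] --> n * (x - k) + m.
  apply: cvgD; last exact: cvg_cst.
  by apply: cvgM; [exact: cvg_cst|apply: cvgB; [exact: cvg_id|exact: cvg_cst]].
exact: (cvg_comp _ _ hc (@continuous_bump R _)).
Qed.

Lemma continuous_rho_l : continuous rho_l. Proof. exact: cont_comp. Qed.
Lemma continuous_rho_r : continuous rho_r. Proof. exact: cont_comp. Qed.

Lemma rho_l_ge0 x : 0 <= rho_l x. Proof. by rewrite mulr_ge0 ?bump_ge0 // ltW. Qed.
Lemma rho_r_ge0 x : 0 <= rho_r x. Proof. by rewrite mulr_ge0 ?bump_ge0 // ltW. Qed.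

Lemma rho_l_supp x : rho_l x != 0 -> c < x < c + 2 / n.
Proof.
rewrite /rho_l mulf_eq0 negb_or => /andP[_ h]; apply/andP.
have h1 : 0 < n * (x - c) - 1.
  by rewrite ltNge; apply: contra h => /bump_le0 ->.
have h2 : n * (x - c) - 1 < 1.
  by rewrite ltNge; apply: contra h => /bump_ge1 ->.
split; first by rewrite -subr_gt0 -(pmulr_rgt0 _ n0); lra.
by rewrite -ltrBlDl ltr_pdivlMr //; lra.
Qed.

Lemma rho_r_supp x : rho_r x != 0 -> d - 2 / n < x < d.
Proof.
rewrite /rho_r mulf_eq0 negb_or => /andP[_ h]; apply/andP.
have h1 : 0 < n * (x - d) + 2.
  by rewrite ltNge; apply: contra h => /bump_le0 ->.
have h2 : n * (x - d) + 2 < 1.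
  by rewrite ltNge; apply: contra h => /bump_ge1 ->.
split; last by rewrite -subr_gt0 -(pmulr_rgt0 _ n0); lra.
rewrite ltrBlDr -ltrBlDl ltr_pdivlMr //; first by lra.
Qed.

Lemma cutoff_le1 x : `|cutoff x| <= 1.
Proof.
rewrite /cutoff; have /andP[h1 h2] := step01 (n * (x - c) - 1).
have /andP[h3 h4] := step01 (n * (x - d) + 2).
by rewrite ler_norml; apply/andP; split; lra.
Qed.

Context (n3 : 3 <= n * (d - c)).

Lemma cutoff_supp x : ~~ (c + n^-1 <= x <= d - n^-1) -> cutoff x = 0.
Proof.
have h3 := n3.
have iV : n * n^-1 = 1 by rewrite mulfV // gt_eqF.
rewrite negb_and -!ltNge /cutoff => /orP[h|h].
  have h' : n * x < n * c + 1 by rewrite -iV -mulrDr ltr_pM2l.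
  rewrite !step_le0 ?subrr //; lra.
have h' : n * d - 1 < n * x by rewrite -iV -mulrBr ltr_pM2l.
rewrite !step_ge1 ?subrr //; lra.
Qed.

Lemma cutoff_in x : c + 2 / n <= x <= d - 2 / n -> cutoff x = 1.
Proof.
have iV : n * (2 / n) = 2 by rewrite mulrCA mulfV ?mulr1 // gt_eqF.
move=> /andP[h1 h2]; rewrite /cutoff.
have h1' : n * c + 2 <= n * x by rewrite -iV -mulrDr ler_pM2l.
have h2' : n * x <= n * d - 2 by rewrite -iV -mulrBr ler_pM2l.
by rewrite step_ge1 ?step_le0 ?subr0 //; lra.
Qed.

Lemma cutoff_out x : ~~ (c < x < d) -> cutoff x = 0.
Proof.
move=> h; apply: cutoff_supp; apply: contra h => /andP[h1 h2].
by rewrite (lt_le_trans _ h1) ?(le_lt_trans h2) // ?ltrDl ?gtrDl ?oppr_lt0 invr_gt0.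
Qed.

End Cutoff.

(** * Weak derivatives in one dimension *)
Section WeakDerivatives.
Context {R : realType} (a b : R) (ab : a < b).
Notation leb := (@lebesgue_measure R).
Local Notation I := (`]a, b[%classic : set (measurableTypeR R)).
Let mI' : measurable I := mI a b.
Let fI' : (leb I < +oo)%E := fI ab.

Lemma within_eps (f : R -> R) (x : R) : {within `[a, b], continuous f} -> a <= x <= b ->
  forall e, 0 < e -> exists2 dl : R, 0 < dl & forall y, a <= y <= b -> `|y - x| < dl -> `|f y - f x| <= e.
Proof.
move=> /subspace_continuousP hf hx e e0.
have hx' : `[a, b]%classic x by rewrite /= in_itv.
have /cvgrPdist_le/(_ _ e0) h := hf x hx'.
have : nbhs x (fun y => `[a, b]%classic y -> `|f x - f y| <= e) by exact: h.
move=> /nbhs_ballP[dl /= dl0 hd]; exists dl => // y hy yx.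
rewrite distrC; apply: hd; last by rewrite in_itv.
by rewrite /ball /= distrC.
Qed.

Lemma within_bm (f : R -> R) : {within `[a, b], continuous f} -> bm I f.
Proof.
move=> cf.
have [M hM] : exists M : R, forall x, a <= x <= b -> `|f x| <= M.
  have cn : {within `[a, b], continuous (fun x => `|f x|)}.
    by move=> x; apply: cvg_norm; exact: cf.
  have [x _ hx] := @EVT_max R (fun x => `|f x|) a b (ltW ab) cn.
  by exists `|f x| => y hy; apply: hx; rewrite in_itv.
split; last by exists M => x /=; rewrite in_itv /= => /andP[h1 h2]; apply: hM; rewrite !ltW.
have mf : measurable_fun (`[a, b]%classic : set (measurableTypeR R)) f.
  by apply: subspace_continuous_measurable_fun => //; exact: measurable_itv.
by apply: measurable_funS mf => //; exact: subset_itv_oo_cc.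
Qed.

(** Dominated convergence without the extended reals. *)
Lemma Rint_dominated (u : nat -> R -> R) (v g : R -> R) :
  (forall n, ig I (u n)) -> ig I g -> (forall n x, I x -> `|u n x| <= g x) ->
  (forall x, I x -> u n x @[n --> \oo] --> v x) ->
  \int[leb]_(x in I) u n x @[n --> \oo] --> \int[leb]_(x in I) v x.
Proof.
move=> iu ig0 ug uv.
have iv : leb.-integrable I (EFin \o v).
  have h : forall x, I x -> ((u n x)%:E @[n --> \oo] --> (v x)%:E)%E.
    by move=> x Ix; apply: cvg_EFin; [exact: nearW|exact: uv].
  have mv : measurable_fun I (EFin \o v).
    by apply: (@emeasurable_fun_cvg _ _ _ _ (fun n x => (u n x)%:E)) => // n; have /integrableP[] := iu n.
  apply/integrableP; split => //.
  have /integrableP[mg] := ig0; apply: le_lt_trans; apply: ge0_le_integral => //.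
  - exact: measurableT_comp.
  - exact: measurableT_comp.
  - move=> x Ix /=; rewrite lee_fin; apply: le_trans (ler_norm _).
    have h1 : `|u n x| @[n --> \oo] --> `|v x| by apply: cvg_norm; exact: uv.
    rewrite -(cvg_lim _ h1) //; apply: limr_le; first by apply/cvg_ex; exists `|v x|.
    by apply: nearW => n; exact: ug.
apply: fine_cvg; rewrite fineK; last exact: integrable_fin_num.
apply: (@dominated_cvg _ _ _ leb I mI' (fun n x => (u n x)%:E) (fun x => (v x)%:E) (fun x => (g x)%:E)) => //.
- by move=> n; have /integrableP[] := iu n.
- by move=> x Ix; apply: cvg_EFin; [exact: nearW|exact: uv].
Qed.

Lemma approx_identity (k r : R -> R) (v e : R) : 0 <= e -> ig I r -> ig I (fun x => k x * r x) ->
  (forall x, 0 <= r x) -> \int[leb]_(x in I) r x = 1 ->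
  (forall x, I x -> r x != 0 -> `|k x - v| <= e) ->
  `|\int[leb]_(x in I) (k x * r x) - v| <= e.
Proof.
move=> e0 ir ikr r0 r1 h.
have -> : \int[leb]_(x in I) (k x * r x) - v = \int[leb]_(x in I) (k x * r x - v * r x).
  by rewrite (RintegralB mI' ikr (ig_Z mI' v ir)) (RintegralZl v mI' ir) r1 mulr1.
have i1 : ig I (fun x => k x * r x - v * r x) by apply: ig_B => //; exact: ig_Z.
apply: (le_trans (le_normr_Rintegral mI' i1)).
rewrite -[leRHS]mulr1 -r1 -(RintegralZl e mI' ir); apply: (le_Rintegral mI').
- exact: integrable_norm.
- exact: ig_Z.
- move=> x Ix; rewrite -mulrBl normrM (ger0_norm (r0 x)).
  have [->|rx] := eqVneq (r x) 0; first by rewrite !mulr0.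
  by rewrite ler_wpM2r //; exact: h.
Qed.

Lemma test_functionE (w w' : R -> R) : (forall x : R, is_derive x 1 w (w' x)) -> continuous w' ->
  (exists c d : R, [/\ a < c, d < b & forall x, ~~ (c <= x <= d) -> w x = 0]) ->
  test_function a b w /\ derive1 w = w'.
Proof.
move=> hw cw hs.
have e : derive1 w = w' by apply/funext => x; rewrite derive1E; apply: derive_val.
by split => //; split; [move=> x; have [] := hw x|rewrite e|].
Qed.

(** A function with a weak derivative satisfies the fundamental theorem of
    calculus: the defining identity is tested with a cut-off of [c, d] and the
    cut-off is removed by dominated convergence. *)
Lemma weak_ftc (f g e e' : R -> R) (c d : R) :
  {within `[a, b], continuous f} -> ig I g ->
  (forall w, test_function a b w ->
     \int[leb]_(x in I) (f x * derive1 w x) = - \int[leb]_(x in I) (g x * w x)) ->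
  (forall x : R, is_derive x 1 e (e' x)) -> continuous e' ->
  a <= c -> c < d -> d <= b ->
  f d * e d - f c * e c = \int[leb]_(x in I) (\1_`]c, d[ x * (g x * e x + f x * e' x)).
Proof.
move=> cf igg hw he ce' ac cd db.
have ce : continuous e.
  by move=> x; apply: differentiable_continuous; apply/derivable1_diffP; have [] := he x.
have bf := within_bm cf.
have be : bm I e by apply: within_bm; exact: continuous_subspaceT.
have be' : bm I e' by apply: within_bm; exact: continuous_subspaceT.
pose k x := f x * e x.
have ck : {within `[a, b], continuous k}.
  by move=> x; apply: cvgM; [exact: cf|exact: continuous_subspaceT].
have bk := within_bm ck.
pose G x := g x * e x + f x * e' x.
have iG : ig I G.
  apply: (ig_D mI'); last by apply: (ig_bm mI' fI'); exact: bm_M.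
  by apply: (ig_eq mI') (ig_bM mI' be igg) => x _; exact: mulrC.
have dc0 : 0 < d - c by rewrite subr_gt0.
pose nn (n : nat) : R := n%:R + 3 / (d - c).
have nn0 n : 0 < nn n by apply: ltr_wpDl => //; exact: divr_gt0.
have nn3 n : 3 <= nn n * (d - c).
  by rewrite /nn mulrDl divfK ?gt_eqF // lerDr mulr_ge0 // ltW.
have cl n : continuous (rho_l c (nn n)) by exact: continuous_rho_l.
have cr n : continuous (rho_r d (nn n)) by exact: continuous_rho_r.
have bl n : bm I (rho_l c (nn n)) by apply: within_bm; exact: continuous_subspaceT.
have br n : bm I (rho_r d (nn n)) by apply: within_bm; exact: continuous_subspaceT.
have cc n : continuous (cutoff c d (nn n)).
  by move=> x; apply: differentiable_continuous; apply/derivable1_diffP; have [] := is_derive_cutoff c d (nn n) x.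
have bc n : bm I (cutoff c d (nn n)) by apply: within_bm; exact: continuous_subspaceT.
have id n : \int[leb]_(x in I) (k x * rho_l c (nn n) x) - \int[leb]_(x in I) (k x * rho_r d (nn n) x) =
   - \int[leb]_(x in I) (cutoff c d (nn n) x * G x).
  have dw (x : R) := is_deriveM_fun (is_derive_cutoff c d (nn n) x) (he x).
  have cw : continuous (fun x => cutoff c d (nn n) x * e' x + (rho_l c (nn n) x - rho_r d (nn n) x) * e x).
    move=> x; apply: cvgD; apply: cvgM; [exact: cc|exact: ce'| |exact: ce].
    by apply: cvgB; [exact: cl|exact: cr].
  have [|tw ew] := test_functionE dw cw.
    exists (c + (nn n)^-1), (d - (nn n)^-1); split.
    + by rewrite (le_lt_trans ac) // ltrDl invr_gt0.
    + by apply: lt_le_trans db; rewrite gtrDl oppr_lt0 invr_gt0.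
    + by move=> x hx; rewrite (cutoff_supp (nn0 n) (nn3 n) hx) mul0r.
  have h1 := hw _ tw; rewrite ew in h1.
  have i1 : ig I (fun x => k x * rho_l c (nn n) x) by apply: (ig_bm mI' fI'); exact: bm_M.
  have i2 : ig I (fun x => k x * rho_r d (nn n) x) by apply: (ig_bm mI' fI'); exact: bm_M.
  have i3 : ig I (fun x => cutoff c d (nn n) x * G x) by exact: ig_bM.
  have i4 : ig I (fun x => g x * (cutoff c d (nn n) x * e x)).
    by apply: (ig_eq mI') (ig_bM mI' (bm_M (bc n) be) igg) => x _; exact: mulrC.
  have i5 : ig I (fun x => f x * (cutoff c d (nn n) x * e' x + (rho_l c (nn n) x - rho_r d (nn n) x) * e x)).
    apply: (ig_bm mI' fI'); apply: bm_M => //; apply: bm_D; first exact: bm_M.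
    by apply: bm_M => //; apply: bm_D => //; exact: bm_N.
  apply/eqP; rewrite -subr_eq0 opprK -(RintegralB mI' i1 i2) -(RintegralD mI' (ig_B mI' i1 i2) i3); apply/eqP.
  transitivity (\int[leb]_(x in I) (f x * (cutoff c d (nn n) x * e' x + (rho_l c (nn n) x - rho_r d (nn n) x) * e x) +
     g x * (cutoff c d (nn n) x * e x))).
    by apply: Rint_eq => x _; rewrite /k /G; ring.
  by rewrite (RintegralD mI' i5 i4) h1 addNr.
have nge (dl : R) : 0 < dl -> \forall n \near \oo, 2 / nn n <= dl.
  move=> dl0; near=> n.
  have h : 2 / dl <= n%:R by near: n; exact: nbhs_infty_ger.
  rewrite ler_pdivrMr // mulrC -ler_pdivrMr //; apply: (le_trans h).
  by rewrite lerDl ltW // divr_gt0.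
have dnn n : 3 / nn n <= d - c by rewrite ler_pdivrMr // mulrC.
have A : \int[leb]_(x in I) (k x * rho_l c (nn n) x) @[n --> \oo] --> k c.
  have cab : a <= c <= b by rewrite ac (le_trans (ltW cd)).
  apply/cvgrPdist_le => eps eps0; have [dl dl0 hdl] := within_eps ck cab eps0.
  near=> n; have h2 : 2 / nn n <= dl by near: n; exact: nge.
  rewrite distrC; apply: approx_identity => //; [exact: ltW|exact: (ig_bm mI' fI')|by apply: (ig_bm mI' fI'); exact: bm_M|exact: rho_l_ge0| |].
    rewrite (ftc_I ab (cl n) (is_derive_cutoff_l c (nn n))).
    rewrite step_ge1 ?step_le0 ?subr0 //.
      have : nn n * (a - c) <= 0 by rewrite mulr_ge0_le0 // ?subr_le0 // ltW.
      by move=> h; apply: (le_trans (lerB h ler01)); rewrite subr0.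
    have : 3 <= nn n * (b - c) by apply: (le_trans (nn3 n)); rewrite ler_pM2l // lerB.
    lra.
  move=> x /=; rewrite in_itv /= => /andP[ax xb] rx; have /andP[x1 x2] := rho_l_supp (nn0 n) rx.
  apply: hdl; first by rewrite !ltW.
  by rewrite ger0_norm ?subr_ge0 ?(ltW x1) // ltrBlDl (lt_le_trans x2) // lerD2l.
have B : \int[leb]_(x in I) (k x * rho_r d (nn n) x) @[n --> \oo] --> k d.
  have dab : a <= d <= b by rewrite db (le_trans ac (ltW cd)).
  apply/cvgrPdist_le => eps eps0; have [dl dl0 hdl] := within_eps ck dab eps0.
  near=> n; have h2 : 2 / nn n <= dl by near: n; exact: nge.
  rewrite distrC; apply: approx_identity => //; [exact: ltW|exact: (ig_bm mI' fI')|by apply: (ig_bm mI' fI'); exact: bm_M|exact: rho_r_ge0| |].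
    rewrite (ftc_I ab (cr n) (is_derive_cutoff_r d (nn n))).
    rewrite step_ge1 ?step_le0 ?subr0 //.
      have : nn n * (c - d) <= -3 by have := nn3 n; lra.
      have : nn n * (a - d) <= nn n * (c - d) by rewrite ler_pM2l // lerB.
      lra.
    have : 0 <= nn n * (b - d) by rewrite mulr_ge0 // ?subr_ge0 // ltW.
    lra.
  move=> x /=; rewrite in_itv /= => /andP[ax xb] rx; have /andP[x1 x2] := rho_r_supp (nn0 n) rx.
  apply: hdl; first by rewrite !ltW.
  by rewrite distrC ger0_norm ?subr_ge0 ?(ltW x2) // ltrBlDl -ltrBlDr (le_lt_trans _ x1) // lerB.
have C : \int[leb]_(x in I) (cutoff c d (nn n) x * G x) @[n --> \oo] --> \int[leb]_(x in I) (\1_`]c, d[ x * G x).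
  apply: (@Rint_dominated _ _ (fun x => `|G x|)).
  - by move=> n; exact: ig_bM.
  - exact: integrable_norm.
  - by move=> n x _; rewrite normrM ler_piMl // cutoff_le1.
  - move=> x _; apply: cvgM; last exact: cvg_cst.
    have [hx|hx] := boolP (c < x < d); last first.
      rewrite indicE memNset; last by rewrite /= in_itv /=; apply/negP.
      by apply: cvg_near_cst; apply: nearW => n; exact: (cutoff_out (nn0 n) (nn3 n)).
    rewrite indicE mem_set ?in_itv //=.
    have /andP[x1 x2] := hx.
    apply: cvg_near_cst; near=> n.
    have h1 : 2 / nn n <= x - c by near: n; apply: nge; rewrite subr_gt0.
    have h2 : 2 / nn n <= d - x by near: n; apply: nge; rewrite subr_gt0.
    by apply: (cutoff_in (nn0 n)); apply/andP; split; lra.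
have L : (- \int[leb]_(x in I) (cutoff c d (nn n) x * G x)) @[n --> \oo] --> k c - k d.
  rewrite (_ : (fun n => _) = fun n => \int[leb]_(x in I) (k x * rho_l c (nn n) x) - \int[leb]_(x in I) (k x * rho_r d (nn n) x)).
    exact: cvgB.
  by apply/funext => n; rewrite id.
have C' : (- \int[leb]_(x in I) (cutoff c d (nn n) x * G x)) @[n --> \oo] --> - \int[leb]_(x in I) (\1_`]c, d[ x * G x) by exact: cvgN.
have e1 : k c - k d = _ := cvg_unique (@Rhausdorff R) L C'.
apply: oppr_inj; rewrite -[RHS]e1 -/(k d) -/(k c); ring.
Unshelve. all: by end_near.
Qed.

Lemma Rint_indic (J : set (measurableTypeR R)) (h : R -> R) : J `<=` I ->
  \int[leb]_(x in I) (\1_J x * h x) = \int[leb]_(x in J) h x.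
Proof.
move=> JI; rewrite -[in RHS](setIidr JI) Rintegral_mkcondr; apply: Rint_eq => x _.
by rewrite patchE indicE; case: (x \in J); rewrite ?mul1r ?mul0r.
Qed.

Lemma weak_derivative_parts (f g : R -> R[i]) : weak_derivative a b f g ->
  (forall w, test_function a b w ->
     \int[leb]_(x in I) (Re (f x) * derive1 w x) = - \int[leb]_(x in I) (Re (g x) * w x)) /\
  (forall w, test_function a b w ->
     \int[leb]_(x in I) (Im (f x) * derive1 w x) = - \int[leb]_(x in I) (Im (g x) * w x)).
Proof.
move=> h; split=> w /h; rewrite /cint => -[h1 h2].
  transitivity (\int[leb]_(x in I) Re (f x * (derive1 w x)%:C)).
    by apply: Rint_eq => x _; rewrite ReM /= mulr0 subr0.
  by rewrite h1; congr (- _); apply: Rint_eq => x _; rewrite ReM /= mulr0 subr0.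
transitivity (\int[leb]_(x in I) Im (f x * (derive1 w x)%:C)).
  by apply: Rint_eq => x _; rewrite ImM /= mulr0 add0r.
by rewrite h2; congr (- _); apply: Rint_eq => x _; rewrite ImM /= mulr0 add0r.
Qed.

(** The case of a complex multiplier [e] contains the fundamental theorem ([e = 1])
    and the integration by parts against a character. *)
Lemma cweak_ftc (f g e e' : R -> R[i]) (c d : R) :
  ccontinuous_on `[a, b] f -> cig I g -> weak_derivative a b f g ->
  (forall x : R, cder e x (e' x)) -> continuous (fun x => Re (e' x)) -> continuous (fun x => Im (e' x)) ->
  a <= c -> c < d -> d <= b ->
  f d * e d - f c * e c = cint I (fun x => (\1_`]c, d[ x)%:C * (g x * e x + f x * e' x)).
Proof.
move=> [cf1 cf2] [ig1 ig2] /weak_derivative_parts[w1 w2] de ce1 ce2 ac cd db.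
have de1 x : is_derive (x : R) 1 (fun x => Re (e x)) (Re (e' x)) := (de x).1.
have de2 x : is_derive (x : R) 1 (fun x => Im (e x)) (Im (e' x)) := (de x).2.
have cE (f0 f0' : R -> R) : (forall x : R, is_derive x 1 f0 (f0' x)) -> continuous f0.
  by move=> h x; apply: differentiable_continuous; apply/derivable1_diffP; have [] := h x.
have ib (g0 f0 e0 e0' : R -> R) : ig I g0 -> {within `[a, b], continuous f0} -> continuous e0 -> continuous e0' ->
    ig I (fun x => \1_`]c, d[ x * (g0 x * e0 x + f0 x * e0' x)).
  move=> h1 h2 h3 h4; apply: ig_bM => //.
    split; first by apply: measurable_funTS; apply: measurable_indic; exact: measurable_itv.
    by exists 1 => x _; rewrite indicE; case: (_ \in _) => /=; rewrite ?normr1 ?normr0.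
  apply: ig_D => //.
    by apply: (ig_eq mI') (ig_bM mI' (within_bm (continuous_subspaceT h3)) h1) => x _; exact: mulrC.
  by apply: (ig_bm mI' fI'); apply: bm_M; apply: within_bm => //; exact: continuous_subspaceT.
have E11 := weak_ftc cf1 ig1 w1 de1 ce1 ac cd db.
have E12 := weak_ftc cf1 ig1 w1 de2 ce2 ac cd db.
have E21 := weak_ftc cf2 ig2 w2 de1 ce1 ac cd db.
have E22 := weak_ftc cf2 ig2 w2 de2 ce2 ac cd db.
have i11 := ib _ _ _ _ ig1 cf1 (cE _ _ de1) ce1.
have i12 := ib _ _ _ _ ig1 cf1 (cE _ _ de2) ce2.
have i21 := ib _ _ _ _ ig2 cf2 (cE _ _ de1) ce1.
have i22 := ib _ _ _ _ ig2 cf2 (cE _ _ de2) ce2.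
apply/eqP; rewrite eq_complex ReB ImB !ReM !ImM; apply/andP; split; apply/eqP.
  transitivity ((Re (f d) * Re (e d) - Re (f c) * Re (e c)) - (Im (f d) * Im (e d) - Im (f c) * Im (e c))); first by ring.
  rewrite E11 E22 -(RintegralB mI' i11 i22); apply: Rint_eq => x _.
  by rewrite !(ReM, ImM, ReD, ImD) /=; ring.
transitivity ((Re (f d) * Im (e d) - Re (f c) * Im (e c)) + (Im (f d) * Re (e d) - Im (f c) * Re (e c))); first by ring.
rewrite E12 E21 -(RintegralD mI' i12 i21); apply: Rint_eq => x _.
by rewrite !(ReM, ImM, ReD, ImD) /=; ring.
Qed.

Lemma cder_chi l x : cder (chi a b l) x ('i * (mu a b l)%:C * chi a b l x).
Proof.
have h1 := is_derive_cos_lin (mu a b l) (- (mu a b l * a)) x.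
have h2 := is_derive_sin_lin (mu a b l) (- (mu a b l * a)) x.
have e y : mu a b l * (y - a) = mu a b l * y + - (mu a b l * a) by ring.
split.
  rewrite (_ : (fun x => _) = (fun x => cos (mu a b l * x + - (mu a b l * a)))); last first.
    by apply/funext => y; rewrite /chi /= e.
  by rewrite (_ : Re _ = - (mu a b l * sin (mu a b l * x + - (mu a b l * a)))) // !(ReM, ImM) /= e; ring.
rewrite (_ : (fun x => _) = (fun x => sin (mu a b l * x + - (mu a b l * a)))); last first.
  by apply/funext => y; rewrite /chi /= e.
by rewrite (_ : Im _ = (mu a b l * cos (mu a b l * x + - (mu a b l * a)))) // !(ReM, ImM) /= e; ring.
Qed.

Lemma continuous_chi l : continuous (fun x => Re (chi a b l x)) /\ continuous (fun x => Im (chi a b l x)).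
Proof.
split=> x; apply: differentiable_continuous; apply/derivable1_diffP.
  by have [[]] := cder_chi l x.
by have [_ []] := cder_chi l x.
Qed.

(** The boundary terms of the integration by parts cancel by periodicity, of the
    function and of the character. *)
Lemma fc_deriv (f g : R -> R[i]) l : ccontinuous_on `[a, b] f -> f a = f b ->
  cig I g -> weak_derivative a b f g -> fc a b g l = 'i * (mu a b l)%:C * fc a b f l.
Proof.
move=> cf fab igg fg.
have [cr ci] := continuous_chi (- l).
have cmulr (k : R) (u : R -> R) : continuous u -> continuous (fun x => k * u x).
  by move=> h x; apply: cvgM; [exact: cvg_cst|exact: h].
have := cweak_ftc cf igg fg (cder_chi (- l)) _ _ (lexx a) ab (lexx b).
rewrite (chi_a a b) (chi_b ab) fab subrr => H.
have bf : cig I f by apply: (cig_bm mI' fI'); split; apply: within_bm; case: cf.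
have : 0 = cint I (fun x => g x * chi a b (- l) x + ('i * (mu a b (- l))%:C) * (f x * chi a b (- l) x)).
  rewrite H; first by apply: cint_eq => x Ix; rewrite indicE mem_set // mul1r; ring.
    rewrite (_ : (fun x => _) = (fun x => - mu a b (- l) * Im (chi a b (- l) x))); first exact: cmulr.
    by apply/funext => x; rewrite !(ReM, ImM) /=; ring.
  rewrite (_ : (fun x => _) = (fun x => mu a b (- l) * Re (chi a b (- l) x))); first exact: cmulr.
  by apply/funext => x; rewrite !(ReM, ImM) /=; ring.
have i1 : cig I (fun x => f x * chi a b (- l) x) by exact: cig_chi.
rewrite (cint_D mI') ?(cint_Z mI') //; [|exact: cig_chi|exact: cig_Z].
move=> h; rewrite /fc muN rcN in h *.
have -> : cint I (fun x => g x * chi a b (- l) x) =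
  'i * (mu a b l)%:C * cint I (fun x => f x * chi a b (- l) x).
  by apply/eqP; rewrite -subr_eq0 h; apply/eqP; ring.
by ring.
Qed.

(** The factor 2 comes from integrating real and imaginary parts separately. *)
Lemma weak_lipschitz (f g : R -> R[i]) M : ccontinuous_on `[a, b] f -> cig I g -> weak_derivative a b f g ->
  (forall x, I x -> normc (g x) <= M) ->
  forall c d, a <= c -> c < d -> d <= b -> normc (f d - f c) <= 2 * M * (d - c).
Proof.
move=> cf igg fg hM c d ac cd db.
have d1 (x : R) : cder (fun _ => 1 : R[i]) x 0 by split; exact: is_derive_cst_fun.
have c0 : continuous (fun _ : R => 0 : R) by move=> x; exact: cvg_cst.
have := cweak_ftc cf igg fg d1 c0 c0 ac cd db; rewrite !mulr1 => ->.
have mJ : measurable (`]c, d[%classic : set (measurableTypeR R)) by exact: measurable_itv.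
have JI : `]c, d[%classic `<=` I.
  by move=> x /=; rewrite !in_itv /= => /andP[h1 h2]; rewrite (le_lt_trans ac h1) (lt_le_trans h2 db).
have igJ : cig (`]c, d[%classic : set (measurableTypeR R)) g.
  by case: igg => g1 g2; split; apply: (integrableS mI' mJ JI).
have -> : cint I (fun x => (\1_`]c, d[ x)%:C * (g x * 1 + f x * 0)) = cint (`]c, d[%classic : set (measurableTypeR R)) g.
  congr Complex.
    by rewrite -(Rint_indic _ JI); apply: Rint_eq => x _; rewrite mulr0 mulr1 addr0 !ReM /=; ring.
  by rewrite -(Rint_indic _ JI); apply: Rint_eq => x _; rewrite mulr0 mulr1 addr0 !ImM /=; ring.
have := @cint_le _ _ mJ (fI cd) g M igJ (fun x Jx => hM x (JI _ Jx)).
by rewrite (length_ab cd) mulrA.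
Qed.

(** Where the weak derivative is continuous, it is the classical one. *)
Lemma weak_classical (f g : R -> R[i]) : ccontinuous_on `[a, b] f -> ccontinuous_on `[a, b] g ->
  weak_derivative a b f g -> forall x, a < x < b -> cder f x (g x).
Proof.
move=> [cf1 cf2] [cg1 cg2] /weak_derivative_parts[w1 w2] x hx.
suff h (u v : R -> R) : {within `[a, b], continuous u} -> {within `[a, b], continuous v} ->
    (forall w, test_function a b w ->
     \int[leb]_(x in I) (u x * derive1 w x) = - \int[leb]_(x in I) (v x * w x)) -> is_derive x 1 u (v x).
  split; first exact: (h (fun x => Re (f x)) (fun x => Re (g x))).
  exact: (h (fun x => Im (f x)) (fun x => Im (g x))).
move=> cu cv hw; have /andP[ax xb] := hx.
have c0 : continuous (fun _ : R => 0 : R) by move=> y; exact: cvg_cst.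
have iv : ig I v by apply: (ig_bm mI' fI'); exact: within_bm.
have iab : leb.-integrable `[a, b] (EFin \o v).
  by apply: continuous_compact_integrable; [exact: segment_compact|exact: cv].
pose Fv y := \int[leb]_(z in `[a, y]) v z.
have hF y : a < y < b -> u y = u a + Fv y.
  move=> /andP[ay yb].
  have := weak_ftc cu iv hw (fun x => is_derive_cst_fun x 1) c0 (lexx a) ay (ltW yb); rewrite !mulr1 => h.
  apply/eqP; rewrite addrC -subr_eq h; apply/eqP; rewrite /Fv.
  have JI : `]a, y[%classic `<=` I.
    by move=> z /=; rewrite !in_itv /= => /andP[h1 h2]; rewrite h1 (lt_trans h2 yb).
  rewrite -(@Rintegral_itv_obnd_cbnd R a (BRight y)); last first.
    apply: integrableS iab => //; move=> z /=; rewrite !in_itv /= => /andP[h1 h2].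
    by rewrite (ltW h1) (le_trans h2 (ltW yb)).
  rewrite -(@Rintegral_itv_bndo_bndc R (BRight a) y); last first.
    apply: integrableS iab => //; move=> z /=; rewrite !in_itv /= => /andP[h1 h2].
    by rewrite (ltW h1) (le_trans (ltW h2) (ltW yb)).
  by rewrite -(Rint_indic _ JI); apply: Rint_eq => z _; rewrite mulr0 mulr1 addr0.
have cvx : {for x, continuous v} by apply: (within_continuous_continuous ab cv); rewrite in_itv.
have axF : (BLeft a < BRight x)%E by rewrite /= lte_fin.
have [dF eF] := @continuous_FTC1 R v (BLeft a) x b xb iab axF cvx.
have hd : is_derive x 1 (fun y => u a + Fv y) (v x).
  have hFd : is_derive x 1 Fv (v x) by apply: DeriveDef; [exact: dF|rewrite -derive1E; exact: eF].
  by have := is_deriveD_fun (is_derive_cst_fun x (u a)) hFd; rewrite add0r.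
have near : {near x, (fun y => u a + Fv y) =1 u}.
  have xI : x \in `]a, b[ by rewrite in_itv.
  have := near_in_itvoo xI; apply: filterS => y hy.
  by rewrite (hF y) //; move: hy; rewrite in_itv.
have [h1 h2] := hd.
apply: DeriveDef; first exact: near_eq_derivable near h1.
by rewrite -h2; apply/esym; apply: near_eq_derive.
Qed.

(** Weak derivatives are determined only up to null sets. *)
Definition aeq (u v : R -> R[i]) : Prop := {ae leb, forall x, I x -> u x = v x}.

(** An integrable function orthogonal to all test functions vanishes almost
    everywhere: its integral over every interval is zero. *)
Lemma ae_zero (h : R -> R) : ig I h ->
  (forall w, test_function a b w -> \int[leb]_(x in I) (h x * w x) = 0) ->
  {ae leb, forall x, I x -> h x = 0}.
Proof.
move=> ih hw.
have c0 : continuous (fun _ : R => 0 : R) by move=> x; exact: cvg_cst.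
have Iw c d : a <= c -> c < d -> d <= b -> \int[leb]_(x in I) (\1_`]c, d[ x * h x) = 0.
  move=> ac cd db.
  have hw0 w : test_function a b w -> \int[leb]_(x in I) (0 * derive1 w x) = - \int[leb]_(x in I) (h x * w x).
    move=> /hw ->; rewrite oppr0 (@Rint_eq _ _ _ (fun _ => 0)); first by rewrite Rintegral_cst ?mul0r //; exact: mI.
    by move=> x _; rewrite mul0r.
  have cz : {within `[a, b], continuous (fun _ : R => 0 : R)} by exact: continuous_subspaceT.
  have := weak_ftc cz ih hw0 (fun x => is_derive_cst_fun x 1) c0 ac cd db.
  rewrite !mul0r subrr => e; rewrite [RHS]e; apply: Rint_eq => x _; ring.
pose ht := h \_ I.
have iht : leb.-integrable setT (EFin \o ht).
  by rewrite /ht -restrict_EFin; apply/(integrable_mkcond _ mI').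
have intf y : leb.-integrable `]-oo, y] (EFin \o ht).
  by apply: integrableS iht.
have := FTC1Ny intf (open_integrable_locally openT iht).
have F0 : (fun x => \int[leb]_(t in `]-oo, x]) ht t) = (fun _ => 0).
  apply/funext => x; rewrite /ht -Rintegral_mkcondr setIC Rintegral_mkcondr.
  have [xa|ax] := leP x a.
    rewrite (@Rint_eq _ _ _ (fun _ => 0)); first by rewrite Rintegral_cst ?mul0r //; exact: mI.
    move=> t /=; rewrite patchE in_itv /= => /andP[h1 h2]; rewrite memNset // => /=.
    by rewrite in_itv /= leNgt (le_lt_trans xa h1).
  have [bx|xb] := leP b x.
    rewrite (@Rint_eq _ _ _ (fun t => \1_`]a, b[ t * h t)); first exact: Iw.
    move=> t It; rewrite patchE indicE (mem_set It) mul1r mem_set //.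
    by move: It; rewrite /= !in_itv /= => /andP[h1 h2]; rewrite (le_trans (ltW h2)).
  have JI : `]a, x]%classic `<=` I.
    by move=> z /=; rewrite !in_itv /= => /andP[h1 h2]; rewrite h1 (le_lt_trans h2 xb).
  have JI' : `]a, x[%classic `<=` I.
    by move=> z /=; rewrite !in_itv /= => /andP[h1 h2]; rewrite h1 (lt_trans h2 xb).
  transitivity (\int[leb]_(t in `]a, x]) h t).
    rewrite -[in RHS](setIidr JI) Rintegral_mkcondr; apply: Rint_eq => z /=; rewrite in_itv /= => /andP[h1 h2].
    by rewrite !patchE !mem_setE !in_itv /= h1.
  rewrite -Rintegral_itv_bndo_bndc; last exact: (integrableS mI' _ JI').
  by rewrite -(Rint_indic _ JI') Iw // ltW.
rewrite /= F0; apply: filterS; first exact: (ae_filter_ringOfSetsType leb).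
move=> x [_ e] Ix.
by move: e; rewrite derive1_cst /ht patchE mem_set.
Qed.

Lemma Rint_ae (u v : R -> R) : ig I u -> ig I v -> {ae leb, forall x, I x -> u x = v x} ->
  \int[leb]_(x in I) u x = \int[leb]_(x in I) v x.
Proof.
move=> /integrableP[mu _] /integrableP[mv _] h; congr fine; apply: ae_eq_integral => //.
by apply: filterS h => x hx Ix; rewrite /= hx.
Qed.

Lemma sq_integrable_parts (u : R -> R[i]) : square_integrable a b u -> cig I u /\ sqi a b u.
Proof.
move=> [m1 m2 i2]; split => //.
have h (f : R -> R) : measurable_fun I f -> (forall x, `|f x| <= normc (u x)) -> ig I f.
  move=> mf hf; apply: (@le_integrable _ _ _ _ I mI' (EFin \o f) (fun x => (1 + normc (u x) ^+ 2)%:E)).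
  - exact/measurable_EFinP.
  - move=> x _ /=; rewrite lee_fin; apply: (le_trans (hf x)).
    rewrite ger0_norm; last by rewrite addr_ge0 ?sqr_ge0.
    by have := normc_ge0 (u x); nra.
  - apply: (ig_D mI' (f := fun _ => 1)); last exact: i2.
    by apply: (ig_bm mI' fI'); exact: bm_cst.
by split; apply: h => // x; [exact: Re_le_normc|exact: Im_le_normc].
Qed.

(** The difference of two weak derivatives is orthogonal to all test functions. *)
Lemma weak_unique (f f1 g g1 : R -> R[i]) : cig I f -> cig I f1 -> cig I g -> cig I g1 ->
  aeq f f1 -> weak_derivative a b f g -> weak_derivative a b f1 g1 -> aeq g g1.
Proof.
move=> [if1 if2] [jf1 jf2] [ig1 ig2] [jg1 jg2] hf /weak_derivative_parts[w1 w2] /weak_derivative_parts[w3 w4].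
have bw (w : R -> R) : test_function a b w -> bm I w /\ bm I (derive1 w).
  move=> [dw cw _]; split; apply: within_bm; apply: continuous_subspaceT => // x.
  by apply: differentiable_continuous; apply/derivable1_diffP.
have main (u u1 v v1 : R -> R) : ig I u -> ig I u1 -> ig I v -> ig I v1 ->
   {ae leb, forall x, I x -> u x = u1 x} ->
   (forall w, test_function a b w -> \int[leb]_(x in I) (u x * derive1 w x) = - \int[leb]_(x in I) (v x * w x)) ->
   (forall w, test_function a b w -> \int[leb]_(x in I) (u1 x * derive1 w x) = - \int[leb]_(x in I) (v1 x * w x)) ->
   {ae leb, forall x, I x -> v x - v1 x = 0}.
  move=> iu iu1 iv iv1 uu h h1; apply: ae_zero; first exact: ig_B.
  move=> w tw; have [b1 b2] := bw w tw.
  have im (z k : R -> R) : ig I z -> bm I k -> ig I (fun x => z x * k x).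
    by move=> h2 h3; apply: (ig_eq mI') (ig_bM mI' h3 h2) => x _; exact: mulrC.
  rewrite (@Rint_eq _ _ _ (fun x => v x * w x - v1 x * w x)); last by move=> x _; ring.
  rewrite (RintegralB mI' (im _ _ iv b1) (im _ _ iv1 b1)).
  have := h w tw; have := h1 w tw.
  rewrite (@Rint_ae (fun x => u x * derive1 w x) (fun x => u1 x * derive1 w x)); [|exact: im|exact: im|].
    by move=> -> /oppr_inj ->; rewrite subrr.
  by apply: filterS uu => x hx Ix; rewrite hx.
have a1 := main _ _ _ _ if1 jf1 ig1 jg1 _ w1 w3.
have a2 := main _ _ _ _ if2 jf2 ig2 jg2 _ w2 w4.
have /a1 A1 : {ae leb, forall x, I x -> Re (f x) = Re (f1 x)} by apply: filterS hf => x hx Ix; rewrite hx.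
have /a2 A2 : {ae leb, forall x, I x -> Im (f x) = Im (f1 x)} by apply: filterS hf => x hx Ix; rewrite hx.
apply: filterS2 A1 A2 => x h1 h2 Ix.
apply/eqP; rewrite eq_complex -[_ == Re _]subr_eq0 -[_ == Im _]subr_eq0.
by rewrite (h1 Ix) (h2 Ix) eqxx.
Qed.

(** All families of weak derivatives of [u] agree almost everywhere, so the infimum in
    the definition of the norm is attained by any of them. *)
Lemma sobolev_normE m u V : sobolev_derivatives a b m u V ->
  sobolev_norm a b m u = (Num.sqrt (\sum_(k < m.+1) \int[leb]_(x in I) (normc (V k x) ^+ 2)))%:E.
Proof.
move=> hV; rewrite /sobolev_norm; set S := image _ _.
suff -> : S = [set (Num.sqrt (\sum_(k < m.+1) \int[leb]_(x in I) (normc (V k x) ^+ 2)))%:E] by rewrite ereal_inf1.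
apply/seteqP; split => [y [U hU <-]|y ->]; last by exists V.
have [V0 Vw Vs] := hV; have [U0 Uw Us] := hU.
have E k : (k <= m)%N -> aeq (U k) (V k).
  elim: k => [_|k IH km]; first by rewrite U0 V0; apply: aeW => x _.
  have [s1 _] := sq_integrable_parts (Us _ (ltnW km)); have [s2 _] := sq_integrable_parts (Us _ km).
  have [s3 _] := sq_integrable_parts (Vs _ (ltnW km)); have [s4 _] := sq_integrable_parts (Vs _ km).
  exact: weak_unique (IH (ltnW km)) (Uw _ km) (Vw _ km).
congr (Num.sqrt _)%:E; apply: eq_bigr => k _.
have km : (k <= m)%N by rewrite -ltnS.
have [_ s1] := sq_integrable_parts (Us _ km); have [_ s2] := sq_integrable_parts (Vs _ km).
by apply: Rint_ae => //; apply: filterS (E k km) => x hx Ix; rewrite hx.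
Qed.

End WeakDerivatives.

(** * Pointwise convergence of Fourier series *)
Section SineBound.
Context {R : realType}.

Lemma sin_ge_half (z : R) : 0 <= z <= pi / 2 -> z / 2 <= sin z.
Proof.
move=> /andP[z0 zp]; have pi0 := @pi_gt0 R.
pose c := cos (pi / 4 : R).
have c2 : c ^+ 2 = 2^-1.
  have := cos2Dsin2 (pi / 4 : R); have := @cos_pihalf R.
  have -> : pi / 2 = pi / 4 + pi / 4 :> R by field.
  by rewrite cosD -!expr2 -/c; set s2 := sin _ ^+ 2 => h1 h2; lra.
have c0 : 0 <= c by apply: cos_ge0_pihalf; apply/andP; split; lra.
have hc y : 0 <= y <= pi / 4 -> c <= cos y.
  move=> /andP[y0 yp]; rewrite /c leNgt ltr_cos ?in_itv /=; [by rewrite -leNgt| |]; apply/andP; split; lra.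
have w4 : 0 <= z / 2 <= pi / 4 by apply/andP; split; lra.
have hs : c * (z / 2) <= sin (z / 2).
  have [z00|zp0] := eqVneq z 0; first by rewrite z00 !mul0r sin0 mulr0.
  have z20 : 0 < z / 2 by rewrite divr_gt0 // lt_def zp0.
  have cs : {within `[0, z / 2], continuous (@sin R)} by apply: continuous_subspaceT; exact: continuous_sin.
  have [x hx] := @MVT R sin cos 0 (z / 2) z20 (fun x _ => is_derive_sin x) cs.
  rewrite sin0 !subr0 => ->; rewrite ler_wpM2r ?(ltW z20) //; apply: hc.
  by move: hx; rewrite in_itv /= => /andP[h1 h2]; case/andP: w4 => _ h3; rewrite (ltW h1) (le_trans (ltW h2)).
have -> : z = z / 2 + z / 2 by field.
rewrite sinD; have h1 := hc _ w4; have w0 : 0 <= z / 2 by case/andP: w4.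
have : c * (z / 2) * c <= sin (z / 2) * cos (z / 2).
  by apply: ler_pM => //; rewrite mulr_ge0.
have -> : c * (z / 2) * c = c ^+ 2 * (z / 2) by ring.
rewrite c2; lra.
Qed.

(** [min s (1 - s)] is the distance to the nearest integer: the bound controls both
    ends of the period. *)
Lemma sin_pi_ge (s : R) : 0 <= s <= 1 -> Num.min s (1 - s) <= sin (pi * s).
Proof.
move=> /andP[s0 s1]; have pi0 := @pi_gt0 R; have pi2 := @pi_ge2 R.
have main (x : R) : 0 <= x <= 2^-1 -> x <= sin (pi * x).
  move=> /andP[x0 x1]; have := @sin_ge_half (pi * x); rewrite mulr_ge0 ?(ltW pi0) //= ler_wpM2l ?(ltW pi0) //.
  by move=> /(_ isT); apply: le_trans; nra.
have [h|h] := leP s (1 - s); first by apply: main; apply/andP; split; lra.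
have := main (1 - s); rewrite mulrBr mulr1 sinB sinpi cospi => hh.
by apply: (le_trans (hh _)); [apply/andP; split; lra|lra].
Qed.

Lemma normc_cis_sub1 (t : R) : normc (cis t - 1) = 2 * `|sin (t / 2)|.
Proof.
apply/eqP; rewrite -(eqrXn2 (n := 2)) ?normc_ge0 ?mulr_ge0 //; apply/eqP.
rewrite exprMn real_normK ?num_real // normcE2 ReB ImB /=.
have -> : t = t / 2 + t / 2 by field.
rewrite cosD sinD; have -> : (t / 2 + t / 2) / 2 = t / 2 by field.
have := cos2Dsin2 (t / 2); set c := cos _; set s := sin _ => h.
have hc : c ^+ 2 = 1 - s ^+ 2 by lra.
transitivity ((c ^+ 2 - s ^+ 2 - 1) ^+ 2 + 4 * c ^+ 2 * s ^+ 2); first by ring.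
by rewrite hc; ring.
Qed.

End SineBound.

Section Chernoff.
Context {R : realType} (a b : R) (ab : a < b).
Notation leb := (@lebesgue_measure R).
Local Notation I := (`]a, b[%classic : set (measurableTypeR R)).
Let mI' : measurable I := mI a b.
Let fI' : (leb I < +oo)%E := fI ab.
Local Notation chi := (@chi R a b).
Local Notation fc := (@fc R a b).
Local Notation tp := (@tp R a b).

(** Inversion is not continuous at 0: the quotient is the limit of quotients with a
    positive denominator. *)
Lemma measurable_ratio (f D : R -> R) : measurable_fun I f -> continuous D -> (forall y, 0 <= D y) ->
  (forall y, I y -> D y = 0 -> f y = 0) -> measurable_fun I (fun y => f y / D y).
Proof.
move=> mf cD D0 hf.
apply: (@measurable_fun_cvg _ _ _ I (fun n y => f y * (D y + n.+1%:R^-1)^-1)).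
  move=> n; apply: measurable_funM => //; apply: measurable_funTS; apply: continuous_measurable_fun.
  move=> y; apply: cvgV; first by rewrite gt_eqF // ltr_wpDl // invr_gt0.
  by apply: cvgD; [exact: cD|exact: cvg_cst].
move=> y Iy; have [Dy|Dy] := eqVneq (D y) 0.
  by rewrite (hf y Iy Dy) mul0r; apply: cvg_near_cst; apply: nearW => n; rewrite mul0r.
apply: cvgM; first exact: cvg_cst.
apply: cvgV => //; rewrite -[X in _ --> X]addr0; apply: cvgD; first exact: cvg_cst.
exact: cvg_harmonic.
Qed.

Lemma shift_fc (g : R -> R[i]) l : fc (fun y => g y * chi 1 y) l = fc g (l - 1).
Proof.
congr (_ * _); apply: cint_eq => y _; rewrite -mulrA -chiD; congr (_ * chi _ _); lia.
Qed.

Context (u : R -> R[i]) (L : R) (cu : ccontinuous_on `[a, b] u) (uab : u a = u b) (L0 : 0 <= L)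
  (uL : forall c d, a <= c -> c < d -> d <= b -> normc (u d - u c) <= L * (d - c)).

Let bu : cbm I u. Proof. by split; apply: (within_bm ab); case: cu. Qed.

(** Chernoff's proof of the pointwise convergence of Fourier series: the difference
    [u - u x] is divisible by [q - 1], where [q] is the first character centred at
    [x], with a bounded quotient [g] because [u] is Lipschitz and periodic.  As
    multiplication by [q] shifts the coefficients, the partial sums of [u] at [x]
    telescope to two coefficients of [g], which tend to 0 by Bessel's
    inequality. *)
Section Point.
Context (x : R) (hx : a <= x <= b).
Let q (y : R) : R[i] := chi 1 y * chi (-1) x.
Let g (y : R) : R[i] := (u y - u x) / (q y - 1).

Let qE y : q y = cis (2 * pi * ((y - x) / (b - a))).
Proof.
rewrite /q /chi -cisD; congr cis; rewrite /mu; field.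
by rewrite subr_eq0 gt_eqF.
Qed.

Let per_lip y : a < y < b -> normc (u y - u x) <= L * (b - a) / 2 * normc (q y - 1).
Proof.
move=> /andP[ay yb]; have /andP[ax xb] := hx.
have lip c d : a <= c -> c <= d -> d <= b -> normc (u d - u c) <= L * (d - c).
  rewrite [_ <= d]le_eqVlt => h1 /orP[/eqP <- _|h2 h3]; last exact: uL.
  by rewrite !subrr ComplexField.Normc.normc0 mulr0.
have ba0 : 0 < b - a by rewrite subr_gt0.
rewrite qE normc_cis_sub1.
have -> : 2 * pi * ((y - x) / (b - a)) / 2 = pi * ((y - x) / (b - a)) by field; rewrite gt_eqF.
have key c d : a <= c -> c <= d -> d <= b -> d - c < b - a -> normc (u d - u c) <= L * (b - a) * `|sin (pi * ((d - c) / (b - a)))|.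
  move=> ac cd db dcba; set s := (d - c) / (b - a).
  have s01 : 0 <= s <= 1 by rewrite divr_ge0 ?subr_ge0 ?(ltW ab) //= ler_pdivrMr // mul1r ltW.
  have h1 := sin_pi_ge s01.
  apply: (@le_trans _ _ (L * (b - a) * Num.min s (1 - s))); last first.
    rewrite ler_wpM2l ?mulr_ge0 ?(ltW ba0) //; apply: (le_trans h1); exact: ler_norm.
  have -> : L * (b - a) * Num.min s (1 - s) = L * Num.min (d - c) (b - a - (d - c)).
    rewrite -mulrA; congr (_ * _); rewrite minr_pMr ?(ltW ba0) //.
    by congr Num.min; rewrite /s; field; rewrite gt_eqF.
  rewrite /Num.min; case: ifP => _; first exact: lip.
  have -> : u d - u c = (u d - u b) + (u a - u c) by rewrite uab; ring.
  apply: (le_trans (normcD _ _)); rewrite normc_distC (normc_distC (u a)).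
  have -> : L * (b - a - (d - c)) = L * (b - d) + L * (c - a) by ring.
  by apply: lerD; apply: lip; lra.
have -> : L * (b - a) / 2 * (2 * `|sin (pi * ((y - x) / (b - a)))|) = L * (b - a) * `|sin (pi * ((y - x) / (b - a)))| by field.
have [xy|yx] := leP x y; first by apply: key => //; [exact: ltW|lra].
rewrite normc_distC; have -> : sin (pi * ((y - x) / (b - a))) = - sin (pi * ((x - y) / (b - a))).
  by rewrite -sinN; congr sin; ring.
by rewrite normrN; apply: key => //; try exact: ltW; lra.
Qed.

Let gE y : I y -> u y - u x = g y * (q y - 1).
Proof.
rewrite /= in_itv /= => hy; have [h|h] := eqVneq (q y - 1) 0; last by rewrite /g divfK.
have := per_lip hy; rewrite h ComplexField.Normc.normc0 mulr0 => h2.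
by rewrite mulr0; apply: normc_eq0; apply: le_anti; rewrite h2 normc_ge0.
Qed.

Let g_le y : I y -> normc (g y) <= L * (b - a) / 2.
Proof.
have C0 : 0 <= L * (b - a) / 2 by rewrite divr_ge0 // mulr_ge0 // subr_ge0 ltW.
move=> Iy; have := per_lip; rewrite /g normcM ComplexField.Normc.normcV => h.
have [->|h0] := eqVneq (normc (q y - 1)) 0; first by rewrite invr0 mulr0.
rewrite ler_pdivrMr; last by rewrite lt_def h0 normc_ge0.
by apply: h; move: Iy; rewrite /= in_itv.
Qed.

Let cq : continuous (fun y => Re (q y - 1)) /\ continuous (fun y => Im (q y - 1)).
Proof.
have [c1 c2] := continuous_chi a b 1.
have h (k1 k2 k3 : R) : continuous (fun y => Re (chi 1 y) * k1 + Im (chi 1 y) * k2 + k3).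
  move=> y; apply: cvgD; last exact: cvg_cst.
  by apply: cvgD; apply: cvgM; [exact: c1|exact: cvg_cst|exact: c2|exact: cvg_cst].
split.
  rewrite (_ : (fun y => _) = (fun y => Re (chi 1 y) * Re (chi (-1) x) + Im (chi 1 y) * - Im (chi (-1) x) + -1)) //.
  by apply/funext => y; rewrite ReB ReM /=; ring.
rewrite (_ : (fun y => _) = (fun y => Re (chi 1 y) * Im (chi (-1) x) + Im (chi 1 y) * Re (chi (-1) x) + 0)) //.
by apply/funext => y; rewrite ImB ImM /=; ring.
Qed.

Let bg : cbm I g.
Proof.
have [c1 c2] := cq.
pose D y := Re (q y - 1) ^+ 2 + Im (q y - 1) ^+ 2.
have cD : continuous D.
  by move=> y; apply: cvgD; rewrite /D; apply: cvgM; [exact: c1|exact: c1|exact: c2|exact: c2].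
have D0 y : 0 <= D y by rewrite addr_ge0 ?sqr_ge0.
have gD y : g y = (u y - u x) * (q y - 1)^* / (D y)%:C.
  rewrite /g /D -normcE2 sqr_normcE; set z := q y - 1.
  have [->|z0] := eqVneq z 0; first by rewrite mul0r invr0 !mulr0.
  have zc : z^* != 0 by apply/eqP => hz; move/eqP: z0; apply; rewrite -(conjcK z) hz conjc0.
  transitivity ((u y - u x) / z * (z^* / z^*)); first by rewrite mulfV // mulr1.
  by rewrite invfM; ring.
have hz y : I y -> D y = 0 -> u y - u x = 0.
  move=> Iy h; rewrite (gE Iy); have -> : q y - 1 = 0; last by rewrite mulr0.
  by apply: normc_eq0; apply/eqP; rewrite -sqrf_eq0 normcE2; apply/eqP.
have bq : cbm I (fun y => q y - 1) by split; apply: (within_bm ab); exact: continuous_subspaceT.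
have [[m1 _] [m2 _]] : cbm I (fun y => (u y - u x) * (q y - 1)^*).
  by apply: cbm_M; [apply: cbm_D => //; exact: cbm_cst|exact: cbm_J].
split; split.
- rewrite (_ : (fun y => _) = (fun y => Re ((u y - u x) * (q y - 1)^*) / D y)); last first.
    by apply/funext => y; rewrite gD -rcV; move: (_ * _^*) (D y)^-1 => w r; rewrite ReM /=; ring.
  by apply: measurable_ratio => // y Iy h; rewrite (hz y Iy h) mul0r.
- by exists (L * (b - a) / 2) => y Iy; apply: le_trans (g_le Iy); exact: Re_le_normc.
- rewrite (_ : (fun y => _) = (fun y => Im ((u y - u x) * (q y - 1)^*) / D y)); last first.
    by apply/funext => y; rewrite gD -rcV; move: (_ * _^*) (D y)^-1 => w r; rewrite ImM /=; ring.
  by apply: measurable_ratio => // y Iy h; rewrite (hz y Iy h) mul0r.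
- by exists (L * (b - a) / 2) => y Iy; apply: le_trans (g_le Iy); exact: Im_le_normc.
Qed.

Let cg : cig I g. Proof. exact: (cig_bm mI' fI'). Qed.

Let sg : sqi a b g.
Proof.
apply: (ig_eq mI' (f := fun y => Re (g y) * Re (g y) + Im (g y) * Im (g y))).
  by move=> y _; rewrite normcE2 !expr2.
by have [h1 h2] := bg; apply: (ig_bm mI' fI'); apply: bm_D; exact: bm_M.
Qed.

Let h (l : int) : R[i] := fc g l * chi l x.

Let fc1 l : fc (fun _ => 1) l = if l == 0 then 1 else 0.
Proof.
rewrite /fc (@cint_eq _ _ _ (chi (- l))) => [|y _]; last by rewrite mul1r.
rewrite (int_chi ab) oppr_eq0; case: ifP => _; rewrite ?mulr0 //.
by rewrite -rcM mulVf // subr_eq0 gt_eqF.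
Qed.

Let fc_tele l : fc u l * chi l x = (if l == 0 then u x else 0) + (h (l - 1) - h l).
Proof.
have c1 : cig I (fun _ => 1 : R[i]) by apply: (cig_bm mI' fI'); exact: cbm_cst.
have cu' : cig I u by exact: (cig_bm mI' fI').
have e1 : fc (fun y => u y - u x * 1) l = fc (fun y => chi (-1) x * (g y * chi 1 y) - g y) l.
  by apply: fc_eq => y Iy; rewrite mulr1 (gE Iy) /q; ring.
have c2 : cig I (fun y => g y * chi 1 y) by exact: cig_chi.
move: e1; rewrite (fcB _ cu' (cig_Z mI' _ c1)) (fcZ _ _ c1) fc1.
rewrite (fcB _ (cig_Z mI' _ c2) cg) (fcZ _ _ c2) shift_fc => e1.
have -> : fc u l = u x * (if l == 0 then 1 else 0) + (chi (-1) x * fc g (l - 1) - fc g l).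
  by rewrite -e1; ring.
rewrite /h; have -> : chi (l - 1) x = chi l x * chi (-1) x by rewrite -chiD.
by case: eqP => [->|_]; rewrite ?chi0; ring.
Qed.

Let partial (M : nat) : (0 < M)%N -> tp M.*2 (fc u) x - u x = h (- M%:Z - 1) - h (M%:Z - 1).
Proof.
have e (f : int -> R[i]) n : \sum_(k < n.+1.*2) f (lidx n.+1.*2 k) =
    f (- n.+1%:Z) + \sum_(k < n.*2) f (lidx n.*2 k) + f n%:Z.
  by apply/eqP; rewrite eq_complex !ReD !ImD !Re_sum !Im_sum
    (sum_range_recr (fun l => Re (f l))) (sum_range_recr (fun l => Im (f l))) !eqxx.
case: M => // M _; rewrite /tp (e (fun l => fc u l * chi l x)).
elim: M => [|M IH].
  rewrite big_ord0 !fc_tele /= addr0.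
  by rewrite (_ : - (1 : int) - 1 = -1 - 1) // (_ : (0 : int) - 1 = 1%:Z - 1 - 1) //; ring.
rewrite (e (fun l => fc u l * chi l x)).
move: IH; set S := _ * chi (- M.+1%:Z) x + _ + _ => IH.
rewrite !fc_tele.
have -> : (- M.+2%:Z == 0) = false by apply/eqP; lia.
have -> : (M.+1%:Z == 0) = false by apply/eqP; lia.
have -> : S = u x + (h (- M.+1%:Z - 1) - h (M.+1%:Z - 1)) by rewrite -IH; ring.
have -> : - M.+2%:Z = - M.+1%:Z - 1 by lia.
have -> : M.+2%:Z - 1 = M.+1%:Z by lia.
by ring.
Qed.

Let S_ (M : nat) : R := \sum_(k < M.*2) normc (fc g (lidx M.*2 k)) ^+ 2.

Let S_inc : nondecreasing_seq S_.
Proof.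
apply/nondecreasing_seqP => M; rewrite /S_ (sum_range_recr (fun l => normc (fc g l) ^+ 2)).
by rewrite -[leLHS]add0r -addrA lerD ?sqr_ge0 // lerDl sqr_ge0.
Qed.

(* a bounded increasing sequence is Cauchy, so the outermost coefficients are small *)
Let S_cauchy e : 0 < e -> exists M0 : nat, forall M, (M0 <= M)%N -> S_ M.+2 - S_ M <= e.
Proof.
move=> e0.
have ub : has_ubound (range S_).
  exists ((b - a)^-1 * \int[leb]_(y in I) (normc (g y) ^+ 2)) => _ [M _ <-].
  by rewrite ler_pdivlMl ?subr_gt0 //; exact: (bessel ab).
have /cvgrPdist_le/(_ (e / 2)) := nondecreasing_cvgn S_inc ub.
rewrite divr_gt0 // => /(_ isT)[M0 _ hM]; exists M0 => M M0M.
have h1 := hM M M0M; have h2 := hM M.+2 (leq_trans M0M (leqW (leqnSn M))).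
move: h1 h2; rewrite !ler_norml => /andP[_ h1] /andP[h2 _]; lra.
Qed.

Lemma fourier_pointwise e : 0 < e -> exists M0 : nat, forall M, (M0 <= M)%N ->
  normc (tp M.*2 (fc u) x - u x) <= e.
Proof.
move=> e0.
have e20 : 0 < (e / 2) ^+ 2 by rewrite exprn_gt0 // divr_gt0.
have [M0 hM0] := S_cauchy e20; exists M0.+1 => -[//|M] M0M.
have := hM0 M M0M; rewrite {1}/S_ !(sum_range_recr (fun l => normc (fc g l) ^+ 2)) -/(S_ M) => hS.
rewrite partial //.
have nh l : normc (h l) = normc (fc g l) by rewrite /h normcM normc_chi mulr1.
have p1 : normc (fc g (- M.+2%:Z)) <= e / 2.
  apply: ler_sqr2; first by rewrite divr_ge0 // ltW.
  apply: le_trans hS; move: (sqr_ge0 (normc (fc g (- M.+1%:Z)))) (sqr_ge0 (normc (fc g M))) (sqr_ge0 (normc (fc g M.+1))).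
  lra.
have p2 : normc (fc g M%:Z) <= e / 2.
  apply: ler_sqr2; first by rewrite divr_ge0 // ltW.
  apply: le_trans hS; move: (sqr_ge0 (normc (fc g (- M.+1%:Z)))) (sqr_ge0 (normc (fc g (- M.+2%:Z)))) (sqr_ge0 (normc (fc g M.+1))).
  lra.
apply: (le_trans (normcB _ _)); rewrite !nh.
have -> : - M.+1%:Z - 1 = - M.+2%:Z by rewrite -opprD -[1]/(1%:Z) -PoszD addn1.
have -> : M.+1%:Z - 1 = M%:Z by rewrite -addn1 PoszD addrK.
by rewrite [leRHS]splitr addrC; apply: lerD.
Qed.

End Point.

End Chernoff.

(** * Sobolev functions and their coefficients *)
Section UniformFourier.
Context {R : realType} (a b : R) (ab : a < b).
Notation leb := (@lebesgue_measure R).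
Local Notation I := (`]a, b[%classic : set (measurableTypeR R)).
Let mI' : measurable I := mI a b.
Let fI' : (leb I < +oo)%E := fI ab.
Local Notation chi := (@chi R a b).
Local Notation fc := (@fc R a b).
Local Notation tp := (@tp R a b).
Local Notation mu := (@mu R a b).

(** The class in which Fourier series are summed pointwise. *)
Definition perlip (u : R -> R[i]) : Prop :=
  [/\ ccontinuous_on `[a, b] u, u a = u b & exists2 L : R, 0 <= L &
    forall c d, a <= c -> c < d -> d <= b -> normc (u d - u c) <= L * (d - c)].

Lemma perlip_cbm u : perlip u -> cbm I u.
Proof. by move=> [[c1 c2] _ _]; split; exact: within_bm. Qed.

Lemma csum_range_recr (f : int -> R[i]) n : \sum_(k < n.+1.*2) f (lidx n.+1.*2 k) =
    f (- n.+1%:Z) + \sum_(k < n.*2) f (lidx n.*2 k) + f n%:Z.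
Proof.
by apply/eqP; rewrite eq_complex !ReD !ImD !Re_sum !Im_sum
  (sum_range_recr (fun l => Re (f l))) (sum_range_recr (fun l => Im (f l))) !eqxx.
Qed.

Lemma tp_lo (c : int -> R[i]) M M' x : (M <= M')%N -> tp M'.*2 (lo M.*2 c) x = tp M.*2 c x.
Proof.
elim: M' => [|M' IH].
  by rewrite leqn0 => /eqP ->; rewrite /tp !big_ord0.
rewrite leq_eqVlt => /orP[/eqP <-|MM'].
  by apply: eq_bigr => k _; rewrite lo_idx.
move: (IH MM'); rewrite /tp => IH'.
rewrite (csum_range_recr (fun l => lo M.*2 c l * chi l x)) IH'.
have z l : (l = - M'.+1%:Z) \/ (l = M'%:Z) -> lo M.*2 c l = 0.
  move=> hl; rewrite /lo doubleK ifF //; apply/negP => /andP[h1 h2].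
  by case: hl h1 h2 => ->; move: MM'; rewrite -addnn; clear; lia.
by rewrite (z _ (or_introl (erefl _))) (z _ (or_intror (erefl _))) !mul0r add0r addr0.
Qed.

Lemma tp_le (c : int -> R[i]) n al x : bnd 1 c al -> normc (tp n c x) <= 2 * al.
Proof.
move=> h; apply: (le_trans (normc_sum _ _ _)).
rewrite (eq_bigr (fun k : 'I_n => normc (c (lidx n k)))); last first.
  by move=> k _; rewrite normcM normc_chi mulr1.
apply: (bnd_sum1 (P := xpredT) (e := fun k : 'I_n => lidx n k)) => //.
by move=> k k' _ _ /lidx_inj /ord_inj.
Qed.

Lemma fourier_sup u al x : perlip u -> bnd 1 (fc u) al -> a <= x <= b -> normc (u x) <= 2 * al.
Proof.
move=> [cu uab [L L0 uL]] hb hx; apply/ler_addgt0Pr => e e0.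
have [M0 hM] := fourier_pointwise ab cu uab L0 uL hx e0.
have := hM M0 (leqnn _); set P := tp _ _ _ => h.
have -> : u x = P - (P - u x) by ring.
by apply: (le_trans (normcB _ _)); apply: lerD => //; exact: tp_le.
Qed.

(** With two orders of decay the convergence has a rate, which serves to exchange
    limits with sampling and with products. *)
Lemma fourier_uniform u al M x : perlip u -> bnd 2 (fc u) al -> (0 < M)%N -> a <= x <= b ->
  normc (u x - tp M.*2 (fc u) x) <= 2 * (al * (2 / M.*2%:R)).
Proof.
move=> [cu uab [L L0 uL]] hb M0 hx; apply/ler_addgt0Pr => e e0.
have [M1 hM] := fourier_pointwise ab cu uab L0 uL hx e0.
pose M' := maxn M M1.
have := hM M' (leq_maxr _ _).
have E : tp M'.*2 (fc u) x = tp M.*2 (fc u) x + tp M'.*2 (hi M.*2 (fc u)) x.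
  rewrite -(tp_lo _ _ (leq_maxl M M1)) /tp -big_split; apply: eq_bigr => k _.
  by rewrite /= /hi -/M'; ring.
have hh : bnd 1 (hi M.*2 (fc u)) (al * (2 / M.*2%:R)).
  have := @hi_bnd R M.*2 2 1 (fc u) al; rewrite expr1; apply => //.
    by rewrite odd_double.
  by rewrite double_gt0.
have := tp_le M'.*2 x hh; rewrite E; set P := tp M.*2 _ _; set Q := tp _ _ _ => h1 h2.
have -> : u x - P = Q - (P + Q - u x) by ring.
by apply: (le_trans (normcB _ _)); apply: lerD.
Qed.

Lemma fc_tp_mul c n v l : cig I v -> fc (fun x => tp n c x * v x) l =
  \sum_(j < n) c (lidx n j) * fc v (l - lidx n j).
Proof.
move=> hv.
have e j : fc v (l - j) = fc (fun x => v x * chi j x) l.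
  by congr (_ * _); apply: cint_eq => x _; rewrite -mulrA -chiD; congr (_ * chi _ _); ring.
transitivity (\sum_(j < n) c (lidx n j) * fc (fun x => v x * chi (lidx n j) x) l); last first.
  by apply: eq_bigr => j _; rewrite e.
rewrite /fc (@cint_eq _ _ _ (fun x => \sum_(j < n) c (lidx n j) * (v x * chi (lidx n j) x * chi (- l) x))).
  rewrite (cint_sum mI' fI') => [|j]; last by apply: (cig_Z mI'); do 2 apply: cig_chi.
  rewrite mulr_sumr; apply: eq_bigr => j _; rewrite (cint_Z mI'); last by do 2 apply: cig_chi.
  by ring.
by move=> x _; rewrite /tp !mulr_suml; apply: eq_bigr => j _; ring.
Qed.

(** For a trigonometric polynomial in place of [u] the convolution is finite and
    exact; [u] is the uniform limit of its partial sums. *)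
Lemma fc_product u v al : perlip u -> bnd 2 (fc u) al -> cbm I v ->
  clim (fun M => conv M (fc u) (fc v)) (fc (fun x => u x * v x)).
Proof.
move=> pu hb bv l de de0.
have [B hB] : exists B : R, forall x, I x -> normc (v x) <= B.
  have [[_ [B1 h1]] [_ [B2 h2]]] := bv; exists (B1 + B2) => x Ix.
  have -> : v x = (Re (v x))%:C + 'i * (Im (v x))%:C.
    by case: (v x) => p q; apply/eqP; rewrite eq_complex /=; apply/andP; split; apply/eqP; ring.
  apply: (le_trans (normcD _ _)); rewrite normcM normc_i mul1r !normc_real.
  by apply: lerD; [exact: h1|exact: h2].
have cv : cig I v by exact: (cig_bm mI' fI').
have bu := perlip_cbm pu.
have al0 := bnd_ge0 hb.
pose C := 2 * (2 * al * `|B|).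
have C0 : 0 <= C by rewrite !mulr_ge0.
have [M0 hM0] : exists M0 : nat, C / de <= M0%:R.
  by exists (Num.truncn (C / de)).+1; apply: ltW; exact: truncnS_gt.
exists M0.+1 => M hM; have M1 : (0 < M)%N by exact: leq_trans hM.
have bt : cbm I (tp M.*2 (fc u)) by exact: tp_cbm.
have -> : conv M (fc u) (fc v) l = fc (fun x => tp M.*2 (fc u) x * v x) l by rewrite fc_tp_mul.
have c1 : cig I (fun x => u x * v x) by exact: cig_bM.
have c2 : cig I (fun x => tp M.*2 (fc u) x * v x) by exact: cig_bM.
rewrite -(fcB _ c1 c2).
have hx x : I x -> normc (u x * v x - tp M.*2 (fc u) x * v x) <= 2 * (al * (2 / M.*2%:R)) * `|B|.
  move=> Ix; rewrite -mulrBl normcM; apply: ler_pM; rewrite ?normc_ge0 //.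
    by apply: fourier_uniform => //; move: Ix; rewrite /= in_itv /= => /andP[h1 h2]; rewrite !ltW.
  by apply: le_trans (ler_norm _); exact: hB.
apply: (le_trans (fc_le ab _ (cig_B mI' c1 c2) hx)).
have MR : 0 < M%:R :> R by rewrite ltr0n.
apply: (@le_trans _ _ (C / M%:R)).
  rewrite /C -[M.*2]muln2 natrM le_eqVlt; apply/orP; left; apply/eqP; field.
  by rewrite gt_eqF.
rewrite ler_pdivrMr // mulrC -ler_pdivrMr //; apply: (le_trans hM0).
by rewrite ler_nat ltnW.
Qed.

(** The missing half of Parseval's identity: [u] is the uniform limit of its
    partial sums, and their norms are known exactly. *)
Lemma parseval_tail u al be n : perlip u -> bnd 2 (fc u) al -> ~~ odd n ->
  bnd 0 (hi n (fc u)) be ->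
  \int[leb]_(x in I) (normc (u x) ^+ 2) - (b - a) * \sum_(k < n) normc (fc u (lidx n k)) ^+ 2
    <= (b - a) * be ^+ 2.
Proof.
move=> pu hb ne hbe; apply/ler_addgt0Pr => e e0.
have bu := perlip_cbm pu; have cu : cig I u := cig_bm mI' fI' bu.
have su : sqi a b u.
  apply: (ig_eq mI' (f := fun y => Re (u y) * Re (u y) + Im (u y) * Im (u y))).
    by move=> y _; rewrite normcE2 !expr2.
  by have [h1 h2] := bu; apply: (ig_bm mI' fI'); apply: bm_D; exact: bm_M.
have ba0 : 0 < b - a by rewrite subr_gt0.
have al0 := bnd_ge0 hb.
pose C := (2 * (al * 2)) ^+ 2 * (b - a).
have C0 : 0 <= C by rewrite mulr_ge0 ?sqr_ge0 // ltW.
have [M0 hM0] : exists M0 : nat, C / e <= M0%:R.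
  by exists (Num.truncn (C / e)).+1; apply: ltW; exact: truncnS_gt.
pose M := maxn M0.+1 (n./2).
have M1 : (0 < M)%N by rewrite /M leq_max.
have MR : 0 < M%:R :> R by rewrite ltr0n.
have := pythagoras ab M.*2 (fc u) cu su.
rewrite [X in _ = _ + _ * X]big1 ?mulr0 ?addr0 => [P|k _]; last by rewrite subrr ComplexField.Normc.normc0 expr0n.
have hP : \int[leb]_(x in I) (normc (u x - tp M.*2 (fc u) x) ^+ 2) <= e.
  apply: (@le_trans _ _ ((2 * (al * (2 / M.*2%:R))) ^+ 2 * (b - a))).
    rewrite -(length_ab ab) -(Rintegral_cst leb mI'); apply: (le_Rintegral mI').
    - have bt : cbm I (fun x => u x - tp M.*2 (fc u) x).
        apply: cbm_D => //; apply: (@cbm_eq _ _ (fun x => -1 * tp M.*2 (fc u) x)) => [x|]; first by rewrite mulN1r.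
        by apply: cbm_M; [exact: cbm_cst|exact: tp_cbm].
      apply: (ig_eq mI' (f := fun y => Re (u y - tp M.*2 (fc u) y) * Re (u y - tp M.*2 (fc u) y) + Im (u y - tp M.*2 (fc u) y) * Im (u y - tp M.*2 (fc u) y))).
        by move=> y _; rewrite normcE2 !expr2.
      by have [h1 h2] := bt; apply: (ig_bm mI' fI'); apply: bm_D; exact: bm_M.
    - by apply: (ig_bm mI' fI'); exact: bm_cst.
    - move=> x Ix; rewrite lerXn2r ?nnegrE ?normc_ge0 ?mulr_ge0 ?divr_ge0 //.
      by apply: fourier_uniform => //; move: Ix; rewrite /= in_itv /= => /andP[h1 h2]; rewrite !ltW.
  apply: (@le_trans _ _ (C / M%:R)).
    rewrite /C -[M.*2]muln2 natrM.
    have -> : (2 * (al * (2 / (M%:R * 2)))) ^+ 2 * (b - a) = (2 * al) ^+ 2 * (b - a) / M%:R * M%:R^-1 by field; rewrite gt_eqF.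
    have -> : (2 * (al * 2)) ^+ 2 * (b - a) / M%:R = (2 * al) ^+ 2 * (b - a) / M%:R * 4 by field; rewrite gt_eqF.
    rewrite ler_wpM2l // ?divr_ge0 ?mulr_ge0 ?sqr_ge0 // ?(ltW ba0) //.
    by rewrite (le_trans (_ : _ <= 1)) ?ler1n // invf_le1 // ler1n.
  rewrite ler_pdivrMr // mulrC -ler_pdivrMr //; apply: (le_trans hM0).
  by rewrite ler_nat /M (leq_trans (leqnSn _)) // leq_maxl.
have S2 : \sum_(k < M.*2) normc (fc u (lidx M.*2 k)) ^+ 2 <=
    \sum_(k < n) normc (fc u (lidx n k)) ^+ 2 + be ^+ 2.
  have h := hbe M; have h2 : nrm M.*2 0 (hi n (fc u)) ^+ 2 <= be ^+ 2.
    by rewrite lerXn2r ?nnegrE ?nrm_ge0 // (le_trans _ h) // nrm_ge0.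
  apply: le_trans (lerD (lexx _) h2).
  have nE : n = (n./2).*2 by rewrite halfK (negbTE ne) subn0.
  have lo2 : nrm M.*2 0 (lo n (fc u)) ^+ 2 <= \sum_(k < n) normc (fc u (lidx n k)) ^+ 2.
    have := @lo_bnd R n 0 (fc u) ne M => h3.
    apply: (@le_trans _ _ (nrm n 0 (fc u) ^+ 2)).
      by rewrite lerXn2r ?nnegrE ?nrm_ge0.
    by rewrite l2_sq; apply: ler_sum => k _; rewrite expr0 mul1r.
  apply: le_trans (lerD lo2 (lexx _)).
  rewrite !l2_sq -big_split; apply: ler_sum => k _; rewrite expr0 !mul1r /hi /lo.
  set z := fc u _; have n0 : normc (0 : R[i]) ^+ 2 = 0 by rewrite ComplexField.Normc.normc0 expr0n.
  case: ifP => _; rewrite ?subrr ?subr0 n0.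
    by change (normc z ^+ 2 <= normc z ^+ 2 + 0); rewrite addr0.
  by change (normc z ^+ 2 <= 0 + normc z ^+ 2); rewrite add0r.
rewrite P in hP; have : (b - a) * \sum_(k < M.*2) normc (fc u (lidx M.*2 k)) ^+ 2 <=
   (b - a) * (\sum_(k < n) normc (fc u (lidx n k)) ^+ 2 + be ^+ 2) by rewrite ler_wpM2l // ltW.
by rewrite mulrDr; lra.
Qed.

(** The witness of [sobolev_periodic], kept explicit because the derivatives enter
    the estimates. *)
Definition per_family (m : nat) (u : R -> R[i]) (V : nat -> R -> R[i]) : Prop :=
  sobolev_derivatives a b m u V /\
  (forall k, (k < m)%N -> ccontinuous_on `[a, b] (V k) /\ V k a = V k b).

Lemma sobolev_periodicP m u : sobolev_periodic a b m u -> exists V, per_family m u V.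
Proof. by move=> [V h1 h2]; exists V. Qed.

Section Family.
Context (m : nat) (u : R -> R[i]) (V : nat -> R -> R[i]) (hV : per_family m u V).

Lemma fam_cig k : (k <= m)%N -> cig I (V k).
Proof. by move=> km; have [[_ _ s] _] := hV; have [] := sq_integrable_parts ab (s k km). Qed.

Lemma fam_sqi k : (k <= m)%N -> sqi a b (V k).
Proof. by move=> km; have [[_ _ s] _] := hV; have [] := sq_integrable_parts ab (s k km). Qed.

Lemma fam0 : V 0%N = u. Proof. by have [[]] := hV. Qed.

Lemma fam_fc k l : (k <= m)%N -> fc (V k) l = ('i * (mu l)%:C) ^+ k * fc u l.
Proof.
have [[_ w _] c] := hV.
elim: k => [_|k IH km]; first by rewrite fam0 expr0 mul1r.
have [c1 c2] := c k km.
by rewrite (fc_deriv ab l c1 c2 (fam_cig km) (w k km)) IH 1?ltnW // exprS mulrA.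
Qed.

Lemma fam_perlip k : (k.+1 < m)%N -> perlip (V k).
Proof.
move=> km; have [[_ w _] c] := hV.
have [c1 c2] := c k (ltnW km); have [[c3 c4] _] := c _ km.
split => //.
have [_ [B1 h1]] := within_bm ab c3; have [_ [B2 h2]] := within_bm ab c4.
have hB x : I x -> normc (V k.+1 x) <= `|B1| + `|B2|.
  move=> Ix; rewrite (_ : V k.+1 x = (Re (V k.+1 x))%:C + 'i * (Im (V k.+1 x))%:C); last first.
    by case: (V k.+1 x) => p q; apply/eqP; rewrite eq_complex /=; apply/andP; split; apply/eqP; ring.
  apply: (le_trans (normcD _ _)); rewrite normcM normc_i mul1r !normc_real.
  by apply: lerD; [apply: le_trans (h1 x Ix) (ler_norm _)|apply: le_trans (h2 x Ix) (ler_norm _)].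
exists (2 * (`|B1| + `|B2|)); first by rewrite mulr_ge0 // addr_ge0.
move=> x y; exact: (weak_lipschitz ab c1 (fam_cig (ltnW km)) (w k (ltnW km)) hB).
Qed.

Lemma fam_norm : sobolev_norm a b m u =
  (Num.sqrt (\sum_(k < m.+1) \int[leb]_(x in I) (normc (V k x) ^+ 2)))%:E.
Proof. by have [h _] := hV; exact: sobolev_normE. Qed.

Lemma fam_term B k : (sobolev_norm a b m u <= B%:E)%E -> (k <= m)%N ->
  \int[leb]_(x in I) (normc (V k x) ^+ 2) <= B ^+ 2.
Proof.
rewrite fam_norm lee_fin => hB km.
have P j : 0 <= \int[leb]_(x in I) (normc (V j x) ^+ 2) by apply: Rintegral_ge0 => x _; exact: sqr_ge0.
have S0 : 0 <= \sum_(k < m.+1) \int[leb]_(x in I) (normc (V k x) ^+ 2) by apply: sumr_ge0.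
apply: (@le_trans _ _ (\sum_(k < m.+1) \int[leb]_(x in I) (normc (V k x) ^+ 2))).
  have km' : (k < m.+1)%N by [].
  by rewrite (bigD1 (Ordinal km')) //= lerDl sumr_ge0.
by rewrite -(sqr_sqrtr S0) lerXn2r ?nnegrE ?sqrtr_ge0 // (le_trans _ hB) // sqrtr_ge0.
Qed.

Lemma fam_bessel B n k : (sobolev_norm a b m u <= B%:E)%E -> (k <= m)%N ->
  (b - a) * \sum_(j < n) (mu (lidx n j) ^+ k) ^+ 2 * normc (fc u (lidx n j)) ^+ 2 <= B ^+ 2.
Proof.
move=> hB km; apply: le_trans (fam_term hB km).
apply: le_trans (bessel ab n (fam_cig km) (fam_sqi km)).
rewrite ler_wpM2l ?subr_ge0 ?(ltW ab) //; apply: ler_sum => j _.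
rewrite fam_fc // normcM normcX normcM normc_i mul1r normc_real [leRHS]exprMn -normrX.
by rewrite real_normK ?num_real.
Qed.

End Family.

(** [1 + |l| <= cwt |mu l|] for [l <> 0]. *)
Definition cwt : R := (b - a) / pi + 2.
Definition decay_const (m : nat) : R := Num.sqrt ((1 + cwt ^+ m ^+ 2) / (b - a)).

Lemma wt_mu m l : wt l ^+ m ^+ 2 <= 1 + cwt ^+ m ^+ 2 * (mu l ^+ m) ^+ 2.
Proof.
have [->|l0] := eqVneq l 0; first by rewrite /wt /= !expr1n lerDl -exprMn sqr_ge0.
have pi0 := @pi_gt0 R.
have ba0 : 0 < b - a by rewrite subr_gt0.
have h1 : wt l <= cwt * `|mu l|.
  have e : `|mu l| = 2 * pi * `|l|%N%:R / (b - a).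
    rewrite /mu !normrM (ger0_norm (x := 2)) // (ger0_norm (x := pi)) ?(ltW pi0) //.
    by rewrite (ger0_norm (x := (b - a)^-1)) ?invr_ge0 ?(ltW ba0) // -intr_norm -abszE.
  have l1 : 1 <= `|l|%N%:R :> R by rewrite ler1n absz_gt0.
  apply: (@le_trans _ _ ((b - a) / pi * `|mu l|)); last by rewrite ler_wpM2r // /cwt lerDl.
  rewrite e; have -> : (b - a) / pi * (2 * pi * `|l|%N%:R / (b - a)) = 2 * `|l|%N%:R.
    by move: (b - a) pi ba0 pi0 => d p d0 p0; field; rewrite gt_eqF //= gt_eqF.
  by rewrite /wt -natr1; lra.
apply: (@le_trans _ _ ((cwt * `|mu l|) ^+ m ^+ 2)).
  by rewrite -!exprM lerXn2r ?nnegrE ?wt_ge0 // (le_trans (wt_ge0 _) h1).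
by rewrite (exprMn m cwt) (exprMn 2 (cwt ^+ m)) -normrX real_normK ?num_real // lerDr.
Qed.

Lemma mu_wt l : mu l ^+ 2 <= ((2 * pi) / (b - a)) ^+ 2 * wt l ^+ 2.
Proof.
rewrite /mu; have -> : 2 * pi * l%:~R / (b - a) = (2 * pi / (b - a)) * l%:~R by ring.
rewrite exprMn ler_wpM2l ?sqr_ge0 // -(real_normK (num_real l%:~R)) -intr_norm -abszE.
by rewrite lerXn2r ?nnegrE ?wt_ge0 // /wt ler_nat.
Qed.

(** Sobolev regularity is decay of the coefficients, by Bessel's inequality for the
    function and for its last derivative. *)
Lemma fam_bnd m u V B : per_family m u V -> 0 <= B -> (sobolev_norm a b m u <= B%:E)%E ->
  bnd m (fc u) (decay_const m * B).
Proof.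
move=> hV B0 hB L.
have ba0 : 0 < b - a by rewrite subr_gt0.
have cw0 : 0 <= cwt by rewrite addr_ge0 // divr_ge0 ?pi_ge0 ?ltW.
apply: l2_le; first by rewrite mulr_ge0 ?sqrtr_ge0.
rewrite exprMn sqr_sqrtr; last first.
  by apply: divr_ge0; [apply: addr_ge0 => //; exact: sqr_ge0|exact: ltW].
have h0 := fam_bessel hV L.*2 hB (leq0n m); have hm := fam_bessel hV L.*2 hB (leqnn m).
have -> : (1 + cwt ^+ m ^+ 2) / (b - a) * B ^+ 2 = (b - a)^-1 * B ^+ 2 + cwt ^+ m ^+ 2 * ((b - a)^-1 * B ^+ 2) by ring.
have k0 : \sum_(j < L.*2) normc (fc u (lidx L.*2 j)) ^+ 2 <= (b - a)^-1 * B ^+ 2.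
  rewrite ler_pdivlMl //; apply: le_trans h0; rewrite ler_wpM2l ?(ltW ba0) //.
  by apply: ler_sum => j _; rewrite expr0 expr1n mul1r.
have km : \sum_(j < L.*2) (mu (lidx L.*2 j) ^+ m) ^+ 2 * normc (fc u (lidx L.*2 j)) ^+ 2 <= (b - a)^-1 * B ^+ 2.
  by rewrite ler_pdivlMl.
apply: le_trans (lerD k0 (ler_wpM2l (sqr_ge0 _) km)).
rewrite mulr_sumr -big_split; apply: ler_sum => j _.
set z := fc u _; set w := wt _; set v := mu _.
change ((w ^+ m * normc z) ^+ 2 <= normc z ^+ 2 + cwt ^+ m ^+ 2 * ((v ^+ m) ^+ 2 * normc z ^+ 2)).
rewrite mulrA -[X in _ <= X + _]mul1r -mulrDl exprMn ler_wpM2r ?sqr_ge0 //.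
exact: wt_mu.
Qed.

(** [|mu l| = kmu |l|]. *)
Definition kmu : R := (2 * pi) / (b - a).

Lemma kmu_ge0 : 0 <= kmu.
Proof. by rewrite divr_ge0 ?mulr_ge0 ?pi_ge0 // subr_ge0 ltW. Qed.

Lemma mu_norm_wt l : `|mu l| <= kmu * wt l.
Proof.
rewrite -(@ler_pXn2r _ 2) ?nnegrE ?(mulr_ge0 kmu_ge0 (wt_ge0 _)) //.
by rewrite real_normK ?num_real // [leRHS]exprMn; exact: mu_wt.
Qed.

Lemma fam_bnd_deriv m u V al k s : per_family m u V -> (k <= m)%N -> bnd (s + k) (fc u) al ->
  bnd s (fc (V k)) (kmu ^+ k * al).
Proof.
move=> hV km hb L; have k0 := kmu_ge0.
apply: (@le_trans _ _ (kmu ^+ k * nrm L.*2 (s + k) (fc u))); last by rewrite ler_wpM2l // exprn_ge0.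
apply: nrm_le; first by rewrite exprn_ge0.
move=> j; rewrite (fam_fc hV _ km) normcM normcX normcM normc_i mul1r normc_real ler_wpM2r ?normc_ge0 //.
by rewrite -exprMn lerXn2r ?nnegrE ?(mulr_ge0 k0 (wt_ge0 _)) //; exact: mu_norm_wt.
Qed.

Lemma fam_sup m u V al k x : per_family m u V -> (k.+1 < m)%N -> bnd m (fc u) al ->
  a <= x <= b -> normc (V k x) <= 2 * (kmu ^+ k * al).
Proof.
move=> hV km hb hx; apply: (fourier_sup (fam_perlip hV km)) => //.
apply: (fam_bnd_deriv hV); first exact: (leq_trans (leqW (leqnSn k))).
by apply: bnd_mono hb; rewrite addnC addn1 ltnW.
Qed.

(** Applied to trigonometric polynomials, it makes the interpolants elements of the
    Sobolev spaces, with known norms. *)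
Lemma classical_weak (e e' : R -> R[i]) : (forall x, cder e x (e' x)) ->
  continuous (fun x => Re (e' x)) -> continuous (fun x => Im (e' x)) -> weak_derivative a b e e'.
Proof.
move=> de c1 c2 w [dw cw [c [d [ac db hs]]]].
have wd (x : R) : is_derive x 1 w (derive1 w x) by rewrite derive1E; exact: derivableP.
have cE (f0 f0' : R -> R) : (forall x : R, is_derive x 1 f0 (f0' x)) -> continuous f0.
  by move=> h x; apply: differentiable_continuous; apply/derivable1_diffP; have [] := h x.
have wa : w a = 0 by apply: hs; rewrite negb_and -ltNge ac.
have wb : w b = 0 by apply: hs; rewrite negb_and -!ltNge db orbT.
have main (f f' : R -> R) : (forall x : R, is_derive x 1 f (f' x)) -> continuous f' ->
    \int[leb]_(x in I) (f x * derive1 w x) = - \int[leb]_(x in I) (f' x * w x).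
  move=> df cf'.
  have dp (x : R) := is_deriveM_fun (df x) (wd x).
  have cc : continuous (fun x => f x * derive1 w x + f' x * w x).
    by move=> x; apply: cvgD; apply: cvgM; [exact: (cE _ _ df)|exact: cw|exact: cf'|exact: (cE _ _ wd)].
  have := ftc_I ab cc dp; rewrite wa wb !mulr0 subrr => h.
  have cI (g : R -> R) : continuous g -> ig I g by move=> cg; apply: (ig_bm mI' fI'); apply: (within_bm ab); exact: continuous_subspaceT.
  apply/eqP; rewrite -subr_eq0 opprK -RintegralD; [by rewrite h|by []| |].
    by apply: cI => x; apply: cvgM; [exact: (cE _ _ df)|exact: cw].
  by apply: cI => x; apply: cvgM; [exact: cf'|exact: (cE _ _ wd)].
have m1 := main _ _ (fun x => (de x).1) c1; have m2 := main _ _ (fun x => (de x).2) c2.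
apply/eqP; rewrite eq_complex ReN ImN /cint /=; apply/andP; split; apply/eqP.
  transitivity (\int[leb]_(x in I) (Re (e x) * derive1 w x)).
    by apply: Rint_eq => x _; rewrite ReM /= mulr0 subr0.
  by rewrite m1; congr (- _); apply: Rint_eq => x _; rewrite ReM /= mulr0 subr0.
transitivity (\int[leb]_(x in I) (Im (e x) * derive1 w x)).
  by apply: Rint_eq => x _; rewrite ImM /= mulr0 add0r.
by rewrite m2; congr (- _); apply: Rint_eq => x _; rewrite ImM /= mulr0 add0r.
Qed.

Definition dtp n c := tp n (fun l => 'i * (mu l)%:C * c l).

Lemma cder_D (f g : R -> R[i]) x f' g' : cder f x f' -> cder g x g' -> cder (fun y => f y + g y) x (f' + g').
Proof.
move=> [f1 f2] [g1 g2]; split.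
  rewrite ReD (_ : (fun y => _) = (fun y => Re (f y) + Re (g y))); first exact: is_deriveD_fun.
  by apply/funext => y; rewrite ReD.
rewrite ImD (_ : (fun y => _) = (fun y => Im (f y) + Im (g y))); first exact: is_deriveD_fun.
by apply/funext => y; rewrite ImD.
Qed.

Lemma cder_Z (k : R[i]) (f : R -> R[i]) x f' : cder f x f' -> cder (fun y => k * f y) x (k * f').
Proof.
move=> [f1 f2]; split.
  rewrite (_ : (fun y => _) = (fun y => Re k * Re (f y) - Im k * Im (f y))); last first.
    by apply/funext => y; rewrite ReM.
  have := is_deriveB_fun (is_deriveM_fun (is_derive_cst_fun x (Re k)) f1) (is_deriveM_fun (is_derive_cst_fun x (Im k)) f2).
  by rewrite ReM !mul0r !addr0.
rewrite (_ : (fun y => _) = (fun y => Re k * Im (f y) + Im k * Re (f y))); last first.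
  by apply/funext => y; rewrite ImM.
have := is_deriveD_fun (is_deriveM_fun (is_derive_cst_fun x (Re k)) f2) (is_deriveM_fun (is_derive_cst_fun x (Im k)) f1).
by rewrite ImM !mul0r !addr0.
Qed.

Lemma cder_sum (J : Type) (s : seq J) (F F' : J -> R -> R[i]) x : (forall i, cder (F i) x (F' i x)) ->
  cder (fun y => \sum_(i <- s) F i y) x (\sum_(i <- s) F' i x).
Proof.
move=> h; elim: s => [|i s IH].
  rewrite big_nil (_ : (fun y => _) = fun _ => 0); first by split; exact: is_derive_cst_fun.
  by apply/funext => y; rewrite big_nil.
rewrite big_cons (_ : (fun y => _) = (fun y => F i y + \sum_(j <- s) F j y)); first exact: cder_D.
by apply/funext => y; rewrite big_cons.
Qed.

Lemma cder_tp n c x : cder (tp n c) x (dtp n c x).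
Proof.
have h (k : 'I_n) := cder_Z (c (lidx n k)) (cder_chi a b (lidx n k) x).
have := cder_sum (index_enum 'I_n) (F' := fun k y => c (lidx n k) * ('i * (mu (lidx n k))%:C * chi (lidx n k) y)) h.
by rewrite (_ : \sum_(i <- _) _ = dtp n c x) //; apply: eq_bigr => k _; ring.
Qed.

Lemma continuous_tp n c : continuous (fun x => Re (tp n c x)) /\ continuous (fun x => Im (tp n c x)).
Proof.
split=> x; apply: differentiable_continuous; apply/derivable1_diffP.
  by have [[]] := cder_tp n c x.
by have [_ []] := cder_tp n c x.
Qed.

Lemma tp_weak n c : weak_derivative a b (tp n c) (dtp n c).
Proof. by have [c1 c2] := continuous_tp n (fun l => 'i * (mu l)%:C * c l); exact: classical_weak (cder_tp n c) c1 c2. Qed.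

Lemma weak_B f g f1 g1 : cig I f -> cig I g -> cig I f1 -> cig I g1 ->
  weak_derivative a b f f1 -> weak_derivative a b g g1 ->
  weak_derivative a b (fun x => f x - g x) (fun x => f1 x - g1 x).
Proof.
move=> if0 ig0 if1 ig1 hf hg w tw.
have bw (w0 : R -> R) : continuous w0 -> cbm I (fun x => (w0 x)%:C).
  by move=> h; split; [apply: (within_bm ab); exact: continuous_subspaceT|exact: bm_cst].
have [dw cw _] := tw.
have b1 : cbm I (fun x => (w x)%:C).
  by apply: bw => x; apply: differentiable_continuous; apply/derivable1_diffP; exact: dw.
have b2 : cbm I (fun x => (derive1 w x)%:C) by exact: bw.
have im (z k : R -> R[i]) : cig I z -> cbm I k -> cig I (fun x => z x * k x).
  by move=> h2 h3; apply: (cig_eq mI') (cig_bM mI' h3 h2) => x _; exact: mulrC.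
rewrite (@cint_eq _ _ _ (fun x => f x * (derive1 w x)%:C - g x * (derive1 w x)%:C)); last by move=> x _; ring.
rewrite (@cint_eq _ _ (fun x => (f1 x - g1 x) * (w x)%:C) (fun x => f1 x * (w x)%:C - g1 x * (w x)%:C)); last by move=> x _; ring.
rewrite (cint_B mI' (im _ _ if0 b2) (im _ _ ig0 b2)) (cint_B mI' (im _ _ if1 b1) (im _ _ ig1 b1)).
by rewrite hf // hg //; ring.
Qed.

Lemma sq_int_of u : cig I u -> sqi a b u -> square_integrable a b u.
Proof. by move=> [/integrableP[m1 _] /integrableP[m2 _]] s; split => //; exact/measurable_EFinP. Qed.

Lemma cig_sqi_B u v : cig I u -> sqi a b u -> cbm I v -> cig I (fun x => u x - v x) /\ sqi a b (fun x => u x - v x).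
Proof.
move=> cu su bv; have cv : cig I v := cig_bm mI' fI' bv.
split; first exact: cig_B.
have c1 : ig I (fun x => Re (u x * (v x)^*)).
  have [] : cig I (fun x => u x * (v x)^*) => //.
  by apply: (cig_eq mI') (cig_bM mI' (cbm_J bv) cu) => x _; exact: mulrC.
have [b1 b2] := bv.
apply: (ig_eq mI' (f := fun x => normc (u x) ^+ 2 - 2 * Re (u x * (v x)^*) + (Re (v x) * Re (v x) + Im (v x) * Im (v x)))).
  by move=> x _; rewrite !normcE2 ReM ReJ ImJ ReB ImB; ring.
apply: (ig_D mI'); first by apply: (ig_B mI') => //; exact: ig_Z.
by apply: (ig_bm mI' fI'); apply: bm_D; exact: bm_M.
Qed.

(** Indexed like the families of weak derivatives, for the H^1 norm. *)
Definition one_family (U0 U1 : R -> R[i]) (k : nat) : R -> R[i] := if k is 0%N then U0 else U1.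

(** The tail of the Fourier series of [u], of order [m], plus the error on the
    coefficients of the window. *)
Lemma sobolev_error m u V al d n : per_family m u V -> (2 < m)%N -> bnd m (fc u) al ->
  (0 < n)%N -> ~~ odd n ->
  (sobolev_norm a b 1 (fun x => (u x - tp n d x)%R) <=
    (Num.sqrt ((b - a) * (1 + kmu ^+ 2)) * (al * (2 / n%:R) ^+ (m - 1) + nrm n 1 (fun l => fc u l - d l)))%:E)%E.
Proof.
move=> hV m2 hb n0 ne.
have m1 : (1 < m)%N by exact: ltnW.
have ba0 : 0 < b - a by rewrite subr_gt0.
have bd : cbm I (tp n d) by exact: tp_cbm.
have bd' : cbm I (dtp n d) by exact: tp_cbm.
have c0 := fam_cig hV (leq0n m); have s0 := fam_sqi hV (leq0n m); rewrite (fam0 hV) in c0 s0.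
have c1 := fam_cig hV (ltnW m1); have s1 := fam_sqi hV (ltnW m1).
pose W := one_family (fun x => u x - tp n d x) (fun x => V 1%N x - dtp n d x).
have [[V0 Vw _] _] := hV.
have hW : sobolev_derivatives a b 1 (fun x => u x - tp n d x) W.
  split=> // [[|//] _|[|[|//]] _].
  - apply: weak_B => //; [exact: (cig_bm mI' fI')|exact: (cig_bm mI' fI')| |exact: tp_weak].
    by rewrite -[u]V0; exact: Vw (ltnW m1).
  - by have [x1 x2] := cig_sqi_B c0 s0 bd; exact: sq_int_of.
  - by have [x1 x2] := cig_sqi_B c1 s1 bd'; exact: sq_int_of.
rewrite (sobolev_normE ab hW) lee_fin big_ord_recl big_ord1 /=.
pose be := al * (2 / n%:R) ^+ (m - 1); pose E := nrm n 1 (fun l => fc u l - d l).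
have al0 := bnd_ge0 hb.
have be0 : 0 <= be by rewrite mulr_ge0 // exprn_ge0 // divr_ge0.
have E0 : 0 <= E by exact: nrm_ge0.
have h1 : bnd 1 (hi n (fc u)) be by apply: hi_bnd hb => //; exact: ltnW.
have h0 : bnd 0 (hi n (fc u)) be by exact: bnd_mono h1.
have k0 := kmu_ge0.
have h1' : bnd 0 (hi n (fc (V 1%N))) (kmu * be).
  move=> L; apply: (@le_trans _ _ (kmu * nrm L.*2 (0 + 1) (hi n (fc u)))); last by rewrite ler_wpM2l.
  apply: nrm_le => // j; rewrite expr1 /hi /lo; case: ifP => _.
    by rewrite !subrr ComplexField.Normc.normc0 mulr0.
  rewrite !subr0 (fam_fc hV _ (ltnW m1)) expr1 normcM (normcM 'i) normc_i mul1r normc_real ler_wpM2r ?normc_ge0 //.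
  exact: mu_norm_wt.
have b2 : bnd 2 (fc u) al by exact: bnd_mono hb.
have b2' : bnd 2 (fc (V 1%N)) (kmu ^+ 1 * al).
  by apply: (fam_bnd_deriv hV); [exact: ltnW|exact: bnd_mono hb].
have P0 := pythagoras ab n d c0 s0.
have P1 := pythagoras ab n (fun l => 'i * (mu l)%:C * d l) c1 s1.
have pl0 : perlip u by have := fam_perlip hV m1; rewrite (fam0 hV).
have T0 := parseval_tail pl0 b2 ne h0.
have T1 := parseval_tail (fam_perlip hV m2) b2' ne h1'.
have S0 : \sum_(k < n) normc (fc u (lidx n k) - d (lidx n k)) ^+ 2 <= E ^+ 2.
  rewrite l2_sq; apply: ler_sum => k _; rewrite lerXn2r ?nnegrE ?mulr_ge0 ?normc_ge0 ?wtX_ge0 //.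
  by rewrite ler_peMl ?normc_ge0 // wtX_ge1.
have S1 : \sum_(k < n) normc (fc (V 1%N) (lidx n k) - 'i * (mu (lidx n k))%:C * d (lidx n k)) ^+ 2 <= kmu ^+ 2 * E ^+ 2.
  rewrite l2_sq mulr_sumr; apply: ler_sum => k _; rewrite -exprMn lerXn2r ?nnegrE ?normc_ge0 ?(mulr_ge0 k0 (mulr_ge0 (wtX_ge0 _ _) (normc_ge0 _))) //.
  rewrite (fam_fc hV _ (ltnW m1)) expr1 -mulrBr !normcM normc_i mul1r normc_real mulrA ler_wpM2r ?normc_ge0 //.
  by rewrite expr1; exact: mu_norm_wt.
rewrite -(ger0_norm (addr_ge0 be0 E0)) -sqrtr_sqr -sqrtrM; last first.
  by rewrite mulr_ge0 ?(ltW ba0) // addr_ge0 // sqr_ge0.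
rewrite ler_wsqrtr //.
have q0 : \int[leb]_(x in I) (normc (u x - tp n d x) ^+ 2) <= (b - a) * (be ^+ 2 + E ^+ 2).
  by rewrite P0 mulrDr; apply: lerD => //; rewrite ler_wpM2l // ltW.
have q1 : \int[leb]_(x in I) (normc (V 1%N x - dtp n d x) ^+ 2) <= (b - a) * (kmu ^+ 2 * (be ^+ 2 + E ^+ 2)).
  rewrite P1 mulrDr mulrDr; apply: lerD; last by rewrite ler_wpM2l // ltW.
  by apply: le_trans T1 _; rewrite exprMn.
apply: (le_trans (lerD q0 q1)).
have -> : (b - a) * (be ^+ 2 + E ^+ 2) + (b - a) * (kmu ^+ 2 * (be ^+ 2 + E ^+ 2)) = (b - a) * (1 + kmu ^+ 2) * (be ^+ 2 + E ^+ 2) by ring.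
apply: ler_wpM2l; first by apply: mulr_ge0; [exact: ltW|apply: addr_ge0 => //; exact: sqr_ge0].
have -> : (be + E) ^+ 2 = be ^+ 2 + E ^+ 2 + 2 * (be * E) by ring.
by rewrite lerDl; apply: mulr_ge0 => //; exact: mulr_ge0.
Qed.

(** The truncation of [u] has a smaller norm than [u], by Bessel's inequality, so the
    constant in front of [B] is exactly 1; this gives the bounds [C_psi + 1] and
    [C_phi + 1]. *)
Lemma sobolev_tp m u V B d n : per_family m u V -> (0 < m)%N -> 0 <= B -> (sobolev_norm a b m u <= B%:E)%E ->
  (sobolev_norm a b 1 (tp n d) <=
    (B + Num.sqrt ((b - a) * (1 + kmu ^+ 2)) * nrm n 1 (fun l => fc u l - d l))%:E)%E.
Proof.
move=> hV m1 B0 hB.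
have ba0 : 0 < b - a by rewrite subr_gt0.
have bd : cbm I (tp n d) by exact: tp_cbm.
have bd' : cbm I (dtp n d) by exact: tp_cbm.
have sq (v : R -> R[i]) : cbm I v -> square_integrable a b v.
  move=> bv; apply: sq_int_of; first exact: (cig_bm mI' fI').
  have [h1 h2] := bv.
  apply: (ig_eq mI' (f := fun x => (Re (v x) * Re (v x) + Im (v x) * Im (v x)))).
    by move=> x _; rewrite normcE2; ring.
  by apply: (ig_bm mI' fI'); apply: bm_D; exact: bm_M.
have hW : sobolev_derivatives a b 1 (tp n d) (one_family (tp n d) (dtp n d)).
  split=> // [[|//] _|[|[|//]] _]; [exact: tp_weak|exact: sq|exact: sq].
rewrite (sobolev_normE ab hW) lee_fin big_ord_recl big_ord1 /= !(tp_norm ab).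
pose g (c : int -> R[i]) := Num.sqrt (b - a) * l2 (fun k : 'I_n => Num.sqrt (1 + mu (lidx n k) ^+ 2) * normc (c (lidx n k))).
have gE c : g c ^+ 2 = (b - a) * \sum_(k < n) normc (c (lidx n k)) ^+ 2 +
   (b - a) * \sum_(k < n) normc ('i * (mu (lidx n k))%:C * c (lidx n k)) ^+ 2.
  rewrite /g exprMn sqr_sqrtr ?(ltW ba0) // l2_sq -mulrDr -big_split; congr (_ * _); apply: eq_bigr => k _.
  rewrite !normcM normc_i mul1r normc_real; move: (normc _) (mu _) => z v.
  change ((Num.sqrt (1 + v ^+ 2) * z) ^+ 2 = z ^+ 2 + (`|v| * z) ^+ 2).
  rewrite !exprMn sqr_sqrtr ?addr_ge0 ?sqr_ge0 // real_normK ?num_real //; ring.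
rewrite -gE sqrtr_sqr ger0_norm; last by rewrite mulr_ge0 ?sqrtr_ge0 ?l2_ge0.
have gD : g d <= g (fc u) + g (fun l => fc u l - d l).
  rewrite /g -mulrDr ler_wpM2l ?sqrtr_ge0 //; apply: le_trans (l2D _ _); apply: l2_mono => k.
  rewrite mulr_ge0 ?sqrtr_ge0 ?normc_ge0 //= -mulrDr ler_wpM2l ?sqrtr_ge0 //.
  have {1}-> : d (lidx n k) = fc u (lidx n k) - (fc u (lidx n k) - d (lidx n k)) by ring.
  exact: normcB.
apply: (le_trans gD); apply: lerD.
  apply: ler_sqr2 => //; rewrite gE.
  have hn := hB; rewrite (fam_norm hV) lee_fin in hn.
  have Sge (j : nat) : 0 <= \int[leb]_(x in I) (normc (V j x) ^+ 2) by apply: Rintegral_ge0 => x _; exact: sqr_ge0.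
  have S0 : 0 <= \sum_(k < m.+1) \int[leb]_(x in I) (normc (V k x) ^+ 2) by apply: sumr_ge0.
  apply: (@le_trans _ _ (\sum_(k < m.+1) \int[leb]_(x in I) (normc (V k x) ^+ 2))); last first.
    by rewrite -(sqr_sqrtr S0) lerXn2r ?nnegrE ?sqrtr_ge0.
  case: m hV m1 {hB hn S0} => // m hV _.
  rewrite 2!big_ord_recl /= addrA; apply: ler_wpDr; first by apply: sumr_ge0.
  apply: lerD.
    by have := bessel ab n (fam_cig hV (leq0n m.+1)) (fam_sqi hV (leq0n m.+1)); rewrite (fam0 hV).
  have := bessel ab n (fam_cig hV (isT : 0 < m.+1)%N) (fam_sqi hV (isT : 0 < m.+1)%N).
  rewrite (eq_bigr (fun k : 'I_n => normc ('i * (mu (lidx n k))%:C * fc u (lidx n k)) ^+ 2)) // => k _.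
  by rewrite (fam_fc hV _ (isT : 0 < m.+1)%N) expr1.
rewrite sqrtrM ?(ltW ba0) // -mulrA /g ler_wpM2l ?sqrtr_ge0 //.
rewrite /nrm -l2Z ?sqrtr_ge0 //; apply: l2_mono => k; rewrite mulr_ge0 ?sqrtr_ge0 ?normc_ge0 //=.
rewrite mulrA ler_wpM2r ?normc_ge0 // -(ger0_norm (wtX_ge0 _ _)) -sqrtr_sqr -sqrtrM ?addr_ge0 ?sqr_ge0 //.
rewrite ler_wsqrtr // expr1 mulrDl mul1r lerD //; last exact: mu_wt.
by rewrite -[leLHS](expr1n _ 2) lerXn2r ?nnegrE ?wt_ge0 ?wt_ge1.
Qed.

End UniformFourier.

(** * Coefficients as functions of time *)
Section TimeDependence.
Context {R : realType} (a b : R) (ab : a < b).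
Notation leb := (@lebesgue_measure R).
Local Notation I := (`]a, b[%classic : set (measurableTypeR R)).
Let mI' : measurable I := mI a b.
Let fI' : (leb I < +oo)%E := fI ab.
Local Notation chi := (@chi R a b).
Local Notation fc := (@fc R a b).
Local Notation mu := (@mu R a b).

Lemma weak_Z (c : R[i]) f f1 : cig I f -> cig I f1 -> weak_derivative a b f f1 ->
  weak_derivative a b (fun x => c * f x) (fun x => c * f1 x).
Proof.
move=> if0 if1 hf w tw.
have bw (w0 : R -> R) : continuous w0 -> cbm I (fun x => (w0 x)%:C).
  by move=> h; split; [apply: (within_bm ab); exact: continuous_subspaceT|exact: bm_cst].
have [dw cw _] := tw.
have b1 : cbm I (fun x => (w x)%:C).
  by apply: bw => x; apply: differentiable_continuous; apply/derivable1_diffP; exact: dw.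
have b2 : cbm I (fun x => (derive1 w x)%:C) by exact: bw.
have im (z k : R -> R[i]) : cig I z -> cbm I k -> cig I (fun x => z x * k x).
  by move=> h2 h3; apply: (cig_eq mI') (cig_bM mI' h3 h2) => x _; exact: mulrC.
rewrite (@cint_eq _ _ _ (fun x => c * (f x * (derive1 w x)%:C))); last by move=> x _; ring.
rewrite (@cint_eq _ _ (fun x => c * f1 x * (w x)%:C) (fun x => c * (f1 x * (w x)%:C))); last by move=> x _; ring.
by rewrite (cint_Z mI' _ (im _ _ if0 b2)) (cint_Z mI' _ (im _ _ if1 b1)) hf // mulrN.
Qed.

Lemma sq_Z (c : R[i]) u : square_integrable a b u -> square_integrable a b (fun x => c * u x).
Proof.
move=> hu; have [cu su] := sq_integrable_parts ab hu; apply: sq_int_of; first exact: (cig_Z mI').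
by apply: (ig_eq mI') (ig_Z mI' (normc c ^+ 2) su) => x _; rewrite normcM exprMn.
Qed.

Lemma sq_B u v : square_integrable a b u -> square_integrable a b v ->
  square_integrable a b (fun x => u x - v x).
Proof.
move=> hu hv; have [cu su] := sq_integrable_parts ab hu; have [cv sv] := sq_integrable_parts ab hv.
have cw := cig_B mI' cu cv; apply: sq_int_of => //.
have [/integrableP[m1 _] /integrableP[m2 _]] := cw.
have mn : measurable_fun I (fun x => normc (u x - v x) ^+ 2).
  rewrite (_ : (fun x => _) = (fun x => Re (u x - v x) ^+ 2 + Im (u x - v x) ^+ 2)); last first.
    by apply/funext => x; rewrite normcE2.
  by apply: measurable_funD; apply: measurable_funX; exact/measurable_EFinP.
apply: (@le_integrable _ _ _ _ I mI' _ (fun x => (2 * normc (u x) ^+ 2 + 2 * normc (v x) ^+ 2)%:E)).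
- exact/measurable_EFinP.
- move=> x _ /=; rewrite lee_fin ger0_norm ?sqr_ge0 // ger0_norm; last first.
    by apply: addr_ge0; apply: mulr_ge0 => //; exact: sqr_ge0.
  have := normcB (u x) (v x); have := normc_ge0 (u x - v x); have := normc_ge0 (u x); have := normc_ge0 (v x).
  move: (normc _) (normc _) (normc _) => p q r hp hq hr h.
  by have := sqr_ge0 (q - r); nra.
- by apply: (ig_D mI'); exact: (ig_Z mI').
Qed.

Lemma sder_B m u v U V : sobolev_derivatives a b m u U -> sobolev_derivatives a b m v V ->
  sobolev_derivatives a b m (fun x => u x - v x) (fun k x => U k x - V k x).
Proof.
move=> [u0 uw us] [v0 vw vs]; split; first by rewrite u0 v0.
  move=> k km; have [c1 _] := sq_integrable_parts ab (us k (ltnW km)); have [c2 _] := sq_integrable_parts ab (us _ km).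
  have [c3 _] := sq_integrable_parts ab (vs k (ltnW km)); have [c4 _] := sq_integrable_parts ab (vs _ km).
  exact: (weak_B ab c1 c3 c2 c4 (uw k km) (vw k km)).
by move=> k km; apply: sq_B; [exact: us|exact: vs].
Qed.

Lemma sder_Z m (c : R[i]) u U : sobolev_derivatives a b m u U ->
  sobolev_derivatives a b m (fun x => c * u x) (fun k x => c * U k x).
Proof.
move=> [u0 uw us]; split; first by rewrite u0.
  move=> k km; have [c1 _] := sq_integrable_parts ab (us k (ltnW km)); have [c2 _] := sq_integrable_parts ab (us _ km).
  exact: (weak_Z c c1 c2 (uw k km)).
by move=> k km; apply: sq_Z; exact: us.
Qed.

Lemma sder_cig m u U : sobolev_derivatives a b m u U -> cig I u.
Proof. by move=> [u0 _ us]; have [] := sq_integrable_parts ab (us 0%N (leq0n m)); rewrite u0. Qed.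

(** A single coefficient is a bounded linear functional on H^m; this transfers
    continuity and differentiability in time to the coefficients. *)
Lemma fc_mode m w W l e : sobolev_derivatives a b m w W -> 0 <= e -> (sobolev_norm a b m w <= e%:E)%E ->
  normc (fc w l) <= Num.sqrt (b - a)^-1 * e.
Proof.
move=> hW e0 he; have ba0 : 0 < b - a by rewrite subr_gt0.
have [w0 _ ws] := hW; have [c0 s0] := sq_integrable_parts ab (ws 0%N (leq0n m)); rewrite w0 in c0 s0.
apply: ler_sqr2; first by rewrite mulr_ge0 ?sqrtr_ge0.
have -> : (Num.sqrt (b - a)^-1 * e) ^+ 2 = (b - a)^-1 * e ^+ 2 by rewrite [LHS]exprMn sqr_sqrtr // invr_ge0 ltW.
rewrite ler_pdivlMl //.
have P j : 0 <= \int[leb]_(x in I) (normc (W j x) ^+ 2) by apply: Rintegral_ge0 => x _; exact: sqr_ge0.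
have S0 : 0 <= \sum_(k < m.+1) \int[leb]_(x in I) (normc (W k x) ^+ 2) by apply: sumr_ge0.
apply: (@le_trans _ _ (\int[leb]_(x in I) (normc (w x) ^+ 2))); last first.
  apply: (@le_trans _ _ (\sum_(k < m.+1) \int[leb]_(x in I) (normc (W k x) ^+ 2))).
    by rewrite big_ord_recl /= w0 lerDl sumr_ge0.
  by move: he; rewrite (sobolev_normE ab hW) lee_fin => he; rewrite -(sqr_sqrtr S0) lerXn2r ?nnegrE ?sqrtr_ge0.
pose L := (absz l).+1.
apply: le_trans (bessel ab L.*2 c0 s0); rewrite ler_wpM2l ?(ltW ba0) //.
have := @sum_inj R 'I_1 xpredT (fun _ => l) (fun l => normc (fc w l) ^+ 2) L.
rewrite big_ord1; apply.
- by move=> i j _ _ _; rewrite !ord1.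
- by move=> _ _; rewrite /L; clear; lia.
- by move=> ?; exact: sqr_ge0.
Qed.

Context (T : R) (T0 : 0 < T) (m : nat).

Lemma ereal_small (F : set_system R) (FF : Filter F) (f : R -> \bar R) e :
  f t @[t --> F] --> (0%E : \bar R) -> 0 < e -> F [set t | (f t <= e%:E)%E].
Proof.
move=> h e0; have n0 : nbhs (0%E : \bar R) [set y | (y < e%:E)%E].
  by apply: open_nbhs_nbhs; split; [exact: open_ereal_lt_ereal|rewrite /= lte_fin].
by have := h _ n0; apply: (@filterS _ F FF) => t /=; exact: ltW.
Qed.

Lemma sob_of u t : sobolev_C0 a b T m u -> 0 <= t <= T -> exists V, per_family a b m (u t) V.
Proof. by move=> [h _] /h /sobolev_periodicP. Qed.

Lemma fc_continuous u l : sobolev_C0 a b T m u ->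
  {within `[0, T], continuous (fun t => Re (fc (u t) l))} /\
  {within `[0, T], continuous (fun t => Im (fc (u t) l))}.
Proof.
move=> hu; have sq0 : 0 <= Num.sqrt (b - a)^-1 by exact: sqrtr_ge0.
have key t0 e : 0 <= t0 <= T -> 0 < e ->
    \forall t \near within `[0, T] (nbhs t0), normc (fc (u t) l - fc (u t0) l) <= e.
  move=> ht0 e0; pose e1 := e / (Num.sqrt (b - a)^-1 + 1).
  have e10 : 0 < e1 by rewrite divr_gt0 // ltr_wpDl.
  have [_ /(_ t0 ht0) hc] := hu.
  have := ereal_small (within_filter _ (nbhs_filter t0)) hc e10 => hs.
  have hT : within `[0, T] (nbhs t0) `[0, T]%classic by apply: withinT.
  apply: filterS2 hs hT => t ht tI; have tT : 0 <= t <= T by move: tI; rewrite /= in_itv.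
  have [V [hV _]] := sob_of hu tT; have [V0 [hV0 _]] := sob_of hu ht0.
  rewrite -(fcB _ (sder_cig hV) (sder_cig hV0)).
  apply: (le_trans (fc_mode l (sder_B hV hV0) (ltW e10) ht)).
  rewrite /e1 mulrA ler_pdivrMr ?ltr_wpDl // mulrC ler_wpM2l ?(ltW e0) // lerDl //.
split; apply/subspace_continuousP => t0 /=; rewrite in_itv /= => ht0; apply/cvgrPdist_le => e e0.
  apply: filterS (key t0 e ht0 e0) => t; apply: le_trans.
  by rewrite normc_distC; change (`|Re (fc (u t0) l) - Re (fc (u t) l)| <= normc (fc (u t0) l - fc (u t) l)); rewrite -ReB; exact: Re_le_normc.
apply: filterS (key t0 e ht0 e0) => t; apply: le_trans.
by rewrite normc_distC; change (`|Im (fc (u t0) l) - Im (fc (u t) l)| <= normc (fc (u t0) l - fc (u t) l)); rewrite -ImB; exact: Im_le_normc.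
Qed.

(** For the field, the difference quotient converges in H^m. *)
Lemma fc_derivative u ut l t0 : sobolev_C1 a b T m u ut -> 0 < t0 < T ->
  cder (fun t => fc (u t) l) t0 (fc (ut t0) l).
Proof.
move=> [hu hut hd] ht0; have sq0 : 0 <= Num.sqrt (b - a)^-1 by exact: sqrtr_ge0.
have /andP[t00 t0T] := ht0; have ht0' : 0 <= t0 <= T by rewrite !ltW.
have key e : 0 < e ->
    \forall h \near 0^', normc (h^-1%:C * (fc (u (h + t0)) l - fc (u t0) l) - fc (ut t0) l) <= e.
  move=> e0; pose e1 := e / (Num.sqrt (b - a)^-1 + 1).
  have e10 : 0 < e1 by rewrite divr_gt0 // ltr_wpDl.
  have := ereal_small (within_filter _ (within_filter _ (nbhs_filter t0))) (hd t0 ht0') e10 => hs.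
  have hs' : nbhs t0 (fun t => t != t0 -> `[0, T]%classic t ->
     (sobolev_norm a b m (fun x => ((u t x - u t0 x) / (t - t0)%:C - ut t0 x)%R) <= e1%:E)%E).
    exact: hs.
  move: hs' => /nbhs_ballP[dl /= dl0 hdl].
  near=> h.
  have h0 : h != 0 by near: h; exact: nbhs_dnbhs_neq.
  have hd1 : `|h| < dl by near: h; exact: dnbhs0_lt.
  have hd2 : `|h| < t0 by near: h; exact: dnbhs0_lt.
  have hd3 : `|h| < T - t0 by near: h; apply: dnbhs0_lt; rewrite subr_gt0.
  have tT : 0 <= h + t0 <= T by move: hd2 hd3; rewrite !ltr_norml => /andP[? ?] /andP[? ?]; apply/andP; split; lra.
  have ht : (sobolev_norm a b m (fun x => ((u (h + t0)%R x - u t0 x) / (h + t0 - t0)%:C - ut t0 x)%R) <= e1%:E)%E.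
    apply: hdl; first by rewrite /ball /= opprD addrCA subrr addr0 normrN.
      by rewrite -subr_eq0 addrK.
    by rewrite /= in_itv.
  rewrite addrK in ht.
  have [V [hV _]] := sob_of hu tT; have [V0 [hV0 _]] := sob_of hu ht0'; have [W [hW _]] := sob_of hut ht0'.
  have hZ := sder_Z h^-1%:C (sder_B hV hV0).
  have eq1 : (fun x => (u (h + t0) x - u t0 x) / h%:C - ut t0 x) = (fun x => h^-1%:C * (u (h + t0) x - u t0 x) - ut t0 x).
    by apply/funext => x; rewrite rcV mulrC.
  rewrite eq1 in ht.
  have := fc_mode l (sder_B hZ hW) (ltW e10) ht.
  rewrite (fcB _ (sder_cig hZ) (sder_cig hW)) (fcZ _ _ (sder_cig (sder_B hV hV0))) (fcB _ (sder_cig hV) (sder_cig hV0)).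
  move/le_trans; apply.
  rewrite /e1 mulrA ler_pdivrMr ?ltr_wpDl // mulrC ler_wpM2l ?(ltW e0) // lerDl //.
have dv (f : R -> R) (d : R) : (forall e, 0 < e -> \forall h \near 0^', `|h^-1 * (f (h + t0) - f t0) - d| <= e) -> is_derive t0 1 f d.
  move=> hf.
  have lim : h^-1 *: (f (h *: (1 : R) + t0) - f t0) @[h --> 0^'] --> d.
    apply/cvgrPdist_le => e /hf; apply: filterS => h.
    by rewrite distrC [h *: 1]mulr1.
  by apply: DeriveDef; [apply/cvg_ex; exists d|exact/cvg_lim].
split; apply: dv => e /key; apply: filterS => h; apply: le_trans.
  set z := _ - fc (ut t0) l; rewrite (_ : _ - _ = Re z); first exact: Re_le_normc.
  rewrite /z; move: (fc (u (h + t0)) l) (fc (u t0) l) (fc (ut t0) l) => [? ?] [? ?] [? ?] /=; ring.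
set z := _ - fc (ut t0) l; rewrite (_ : _ - _ = Im z); first exact: Im_le_normc.
rewrite /z; move: (fc (u (h + t0)) l) (fc (u t0) l) (fc (ut t0) l) => [? ?] [? ?] [? ?] /=; ring.
Unshelve. all: by end_near.
Qed.

(** For [psi] and for the time derivative of the field only pointwise derivatives in
    time are given; the equations bound them uniformly, which allows differentiation
    under the integral sign. *)
Lemma fc_under (u ut : R -> R -> R[i]) l G :
  (forall t, 0 < t < T -> cig I (u t)) ->
  (forall t x, 0 < t < T -> a < x < b -> cder (u^~ x) t (ut t x)) ->
  (forall t x, 0 < t < T -> a < x < b -> normc (ut t x) <= G) ->
  forall t, 0 < t < T -> cder (fun t => fc (u t) l) t (fc (ut t) l).
Proof.
move=> hu hd hG t ht.
have ItT s : `]0, T[%classic s -> 0 < s < T by rewrite /= in_itv.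
have Iab x : I x -> a < x < b by rewrite /= in_itv.
have tI : `]0, T[%classic t by rewrite /= in_itv.
have G0 : 0 <= `|G| by [].
have iG : leb.-integrable I (EFin \o (fun _ => `|G|)) by apply: (ig_bm mI' fI'); exact: bm_cst.
have main (f f' : R -> R -> R) : (forall s, 0 < s < T -> ig I (f s)) ->
    (forall s x, 0 < s < T -> a < x < b -> is_derive s 1 (f^~ x) (f' s x)) ->
    (forall s x, 0 < s < T -> a < x < b -> `|f' s x| <= `|G|) ->
    is_derive t 1 (fun s => \int[leb]_(x in I) f s x) (\int[leb]_(x in I) f' t x).
  move=> h1 h2 h3.
  have d1 s x : `]0, T[%classic s -> I x -> derivable (f^~ x) s 1.
    by move=> /ItT hs /Iab hx; have [] := h2 s x hs hx.
  have e1 s x : 0 < s < T -> a < x < b -> partial1of2 f s x = f' s x.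
    by move=> hs hx; rewrite partial1of2E; have [_] := h2 s x hs hx.
  have b1 s x : `]0, T[%classic s -> I x -> `|partial1of2 f s x| <= `|G|.
    by move=> /ItT hs /Iab hx; rewrite e1 //; exact: h3.
  have ii s : `]0, T[%classic s -> leb.-integrable I (EFin \o f s) by move=> /ItT; exact: h1.
  apply: DeriveDef.
    exact: (@derivable_under_integral _ _ _ _ _ _ mI' _ _ _ tI ii d1 _ (fun _ => G0) iG b1).
  rewrite -derive1E (@differentiation_under_integral _ _ _ _ _ _ mI' _ _ _ tI ii d1 _ (fun _ => G0) iG b1).
  by apply: Rint_eq => x /Iab hx; exact: e1.
have cu s : 0 < s < T -> cig I (fun x => u s x * chi (- l) x) by move=> /hu; exact: cig_chi.
have dch s x : 0 < s < T -> a < x < b -> cder (fun s => u s x * chi (- l) x) s (ut s x * chi (- l) x).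
  move=> hs hx; have := cder_Z (chi (- l) x) (hd s x hs hx); rewrite mulrC.
  by rewrite (_ : (fun y => _ * _) = (fun s => u s x * chi (- l) x)) //; apply/funext => y; exact: mulrC.
have bch s x : 0 < s < T -> a < x < b -> normc (ut s x * chi (- l) x) <= `|G|.
  by move=> hs hx; rewrite normcM normc_chi mulr1; apply: le_trans (ler_norm _); exact: hG.
have M1 := main (fun s x => Re (u s x * chi (- l) x)) (fun s x => Re (ut s x * chi (- l) x))
  (fun s hs => (cu s hs).1) (fun s x hs hx => (dch s x hs hx).1)
  (fun s x hs hx => le_trans (Re_le_normc _) (bch s x hs hx)).
have M2 := main (fun s x => Im (u s x * chi (- l) x)) (fun s x => Im (ut s x * chi (- l) x))
  (fun s hs => (cu s hs).2) (fun s x hs hx => (dch s x hs hx).2)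
  (fun s x hs hx => le_trans (Im_le_normc _) (bch s x hs hx)).
by apply: cder_Z; split; [exact: M1|exact: M2].
Qed.

End TimeDependence.

(** * The equations on Fourier coefficients *)
Section ExactSolution.
Context {R : realType} (a b : R) (ab : a < b).
Notation leb := (@lebesgue_measure R).
Local Notation I := (`]a, b[%classic : set (measurableTypeR R)).
Let mI' : measurable I := mI a b.
Let fI' : (leb I < +oo)%E := fI ab.
Local Notation chi := (@chi R a b).
Local Notation fc := (@fc R a b).
Local Notation mu := (@mu R a b).
Local Notation kmu := (@kmu R a b).

Lemma open_near (P : R -> Prop) x : a < x < b -> (forall y, a < y < b -> P y) -> \forall y \near x, P y.
Proof.
move=> hx hP; have : nbhs x `]a, b[%classic by apply: open_nbhs_nbhs; split; [exact: itv_open|rewrite /= in_itv].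
by apply: filterS => y; rewrite /= in_itv /=; exact: hP.
Qed.

(** The equations constrain the functions inside the interval only. *)
Lemma cder_near (f g : R -> R[i]) x d : a < x < b -> (forall y, a < y < b -> f y = g y) ->
  cder f x d -> cder g x d.
Proof.
move=> hx fg [h1 h2]; split.
  by apply: near_eq_is_derive h1; apply: open_near => // y /fg ->.
by apply: near_eq_is_derive h2; apply: open_near => // y /fg ->.
Qed.

Lemma cder_cderive (f : R -> R[i]) x d : cder f x d -> cderive f x = d.
Proof.
move=> [[_ h1] [_ h2]]; rewrite /cderive !derive1E; apply/eqP; rewrite eq_complex /=.
by apply/andP; split; apply/eqP; [rewrite -h1|rewrite -h2].
Qed.

Lemma cderivable_cder (f : R -> R[i]) x : cderivable f x -> cder f x (cderive f x).
Proof. by move=> [h1 h2]; split; apply: DeriveDef => //; rewrite /= derive1E. Qed.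

(** The equations hold for classical derivatives, whereas the Fourier coefficients
    see the weak ones; the first two agree because they are continuous. *)
Lemma classical2 m u V x : (3 <= m)%N -> per_family a b m u V -> a < x < b ->
  cder u x (V 1%N x) /\ cder (V 1%N) x (V 2 x).
Proof.
move=> m3 hV hx; have [[u0 w _] c] := hV.
have cc k : (k < m)%N -> ccontinuous_on `[a, b] (V k) by move=> /c[].
have m1 : (1 < m)%N by exact: leq_trans m3.
have m0 : (0 < m)%N by exact: leq_trans m3.
split; last exact: (weak_classical ab (cc 1%N m1) (cc 2%N m3) (w 1%N m1)).
by rewrite -u0; exact: (weak_classical ab (cc 0%N m0) (cc 1%N m1) (w 0%N m0)).
Qed.

Lemma classical2E m u V x : (3 <= m)%N -> per_family a b m u V -> a < x < b ->
  cderive (cderive u) x = V 2 x.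
Proof.
move=> m3 hV hx; apply: cder_cderive.
apply: (@cder_near (V 1%N)) => //; last by have [] := classical2 m3 hV hx.
by move=> y hy; rewrite (@cder_cderive u y (V 1%N y)) //; have [] := classical2 m3 hV hy.
Qed.

Lemma imu2 l : ('i * (mu l)%:C) ^+ 2 = - (mu l ^+ 2)%:C :> R[i].
Proof. by move: (mu l) => p; apply/eqP; rewrite eq_complex /=; apply/andP; split; apply/eqP; ring. Qed.

Context (T : R) (T0 : 0 < T) (m : nat) (m5 : (5 <= m)%N).
Context (eps : R) (eps0 : 0 < eps) (eps1 : eps <= 1).
Context (psi0 : R -> R[i]) (phi0 phi1 : R -> R) (psi : R -> R -> R[i]) (phi phit : R -> R -> R).
Context (sol : KGS_solution a b T eps psi0 phi0 phi1 psi phi phit).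
Context (hpsi : sobolev_C0 a b T m psi) (hphi : sobolev_C1 a b T m (cplx phi) (cplx phit)).
Context (B : R) (B0 : 0 <= B)
  (Bpsi : forall t, 0 <= t <= T -> (sobolev_norm a b m (psi t) <= B%:E)%E)
  (Bphi : forall t, 0 <= t <= T -> (sobolev_norm a b m (cplx phi t) <= B%:E)%E)
  (Bphit : forall t, 0 <= t <= T -> (sobolev_norm a b m (cplx phit t) <= (B / eps ^+ 2)%:E)%E).
Local Notation al := (decay_const a b m * B).
Let rho t x : R[i] := (normc (psi t x) ^+ 2)%:C.
Let ff t x : R[i] := (phi t x)%:C * psi t x.
Let e20 : 0 < eps ^+ 2. Proof. exact: exprn_gt0. Qed.
Let hphi0 : sobolev_C0 a b T m (cplx phi). Proof. by have [] := hphi. Qed.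
Let hphit : sobolev_C0 a b T m (cplx phit). Proof. by have [] := hphi. Qed.

Lemma psi_bnd t : 0 <= t <= T -> bnd m (fc (psi t)) al.
Proof. by move=> ht; have [V hV] := sob_of hpsi ht; apply: (fam_bnd ab hV) => //; exact: Bpsi. Qed.

Lemma phi_bnd t : 0 <= t <= T -> bnd m (fc (cplx phi t)) al.
Proof. by move=> ht; have [V hV] := sob_of hphi0 ht; apply: (fam_bnd ab hV) => //; exact: Bphi. Qed.

Lemma phit_bnd t : 0 <= t <= T -> bnd m (fun l => (eps ^+ 2)%:C * fc (cplx phit t) l) al.
Proof.
move=> ht L; have [V hV] := sob_of hphit ht.
have := fam_bnd ab hV (divr_ge0 B0 (ltW e20)) (Bphit ht) L.
rewrite nrmZ normc_real ger0_norm ?(ltW e20) // mulrA ler_pdivlMr // mulrC //.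
Qed.

Lemma perlip_psi t : 0 <= t <= T -> perlip a b (psi t).
Proof.
move=> ht; have [V hV] := sob_of hpsi ht; rewrite -(fam0 hV); apply: (fam_perlip ab hV).
by apply: leq_trans m5.
Qed.

Lemma perlip_phi t : 0 <= t <= T -> perlip a b (cplx phi t).
Proof.
move=> ht; have [V hV] := sob_of hphi0 ht; rewrite -(fam0 hV); apply: (fam_perlip ab hV).
by apply: leq_trans m5.
Qed.

Lemma perlip_phit t : 0 <= t <= T -> perlip a b (cplx phit t).
Proof.
move=> ht; have [V hV] := sob_of hphit ht; rewrite -(fam0 hV); apply: (fam_perlip ab hV).
by apply: leq_trans m5.
Qed.

Let m1 : (1 <= m)%N. Proof. exact: leq_trans m5. Qed.
Let m2 : (2 <= m)%N. Proof. exact: leq_trans m5. Qed.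
Let m3 : (3 <= m)%N. Proof. exact: leq_trans m5. Qed.
Let m4 : (3 < m)%N. Proof. exact: leq_trans m5. Qed.

Lemma psi_sup t x : 0 <= t <= T -> a <= x <= b -> normc (psi t x) <= 2 * al.
Proof. by move=> ht hx; apply: (fourier_sup ab (perlip_psi ht)) => //; apply: bnd_mono (psi_bnd ht). Qed.

Lemma phi_sup t x : 0 <= t <= T -> a <= x <= b -> `|phi t x| <= 2 * al.
Proof.
move=> ht hx; rewrite -normc_real; apply: (fourier_sup ab (perlip_phi ht)) => //.
by apply: bnd_mono (phi_bnd ht).
Qed.

Let al0 : 0 <= al.
Proof. by apply: (bnd_ge0 (psi_bnd (t := 0) _)); rewrite lexx ltW. Qed.

Let in_T t : 0 < t < T -> 0 <= t <= T. Proof. by move=> /andP[h1 h2]; rewrite !ltW. Qed.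
Let in_I x : a < x < b -> a <= x <= b. Proof. by move=> /andP[h1 h2]; rewrite !ltW. Qed.
Let Iab x : I x -> a < x < b. Proof. by rewrite /= in_itv. Qed.

Lemma cbm_psi t : 0 <= t <= T -> cbm I (psi t).
Proof. by move=> ht; exact: (perlip_cbm ab (perlip_psi ht)). Qed.
Lemma cbm_phi t : 0 <= t <= T -> cbm I (cplx phi t).
Proof. by move=> ht; exact: (perlip_cbm ab (perlip_phi ht)). Qed.
Lemma cig_ff t : 0 <= t <= T -> cig I (ff t).
Proof. by move=> ht; apply: (cig_bm mI' fI'); apply: cbm_M; [exact: cbm_phi|exact: cbm_psi]. Qed.

Lemma rhoE t x : rho t x = psi t x * (psi t x)^*.
Proof. by rewrite /rho normcE2; case: (psi t x) => p q; apply/eqP; rewrite eq_complex /=; apply/andP; split; apply/eqP; ring. Qed.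

Lemma cig_rho t : 0 <= t <= T -> cig I (rho t).
Proof.
move=> ht; apply: (cig_bm mI' fI').
by apply: (cbm_eq (fun x => esym (rhoE t x))); apply: cbm_M; [|apply: cbm_J]; exact: cbm_psi.
Qed.

(** Projection of the equation on a character; the space derivatives become powers of
    [i mu]. *)
Lemma fc_schrodinger t l : 0 < t < T ->
  cder (fun s => fc (psi s) l) t ('i * (fc (ff t) l - (mu l ^+ 2)%:C * fc (psi t) l)).
Proof.
move=> ht.
have dE s x : 0 < s < T -> a < x < b -> exists V, per_family a b m (psi s) V /\
    cderive (psi^~ x) s = 'i * (V 2 x + ff s x).
  move=> hs hx; have [V hV] := sob_of hpsi (in_T hs); exists V; split => //.
  have := KGS_schrodinger sol hs hx; rewrite (classical2E m3 hV hx) -/(ff s x).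
  set D := cderive (psi^~ x) s; set z := V 2 x; set y := ff s x => E.
  have -> : D = - ('i * ('i * D)) by rewrite mulrA sqri; ring.
  have -> : 'i * D = - (z + y) by apply/eqP; rewrite -addr_eq0 addrA; apply/eqP; exact: E.
  by ring.
have key := @fc_under R a b ab T psi (fun s x => cderive (psi^~ x) s) l
  (2 * (kmu ^+ 2 * al) + 2 * al * (2 * al)).
have [V hV] := sob_of hpsi (in_T ht).
have -> : 'i * (fc (ff t) l - (mu l ^+ 2)%:C * fc (psi t) l) = fc (fun x => cderive (psi^~ x) t) l.
  rewrite [RHS](@fc_eq _ _ _ _ (fun x => 'i * (V 2 x + ff t x))); last first.
    move=> x /Iab hx; have := KGS_schrodinger sol ht hx; rewrite (classical2E m3 hV hx) -/(ff t x).
    set D := cderive (psi^~ x) t; set z := V 2 x; set y := ff t x => E.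
    have -> : D = - ('i * ('i * D)) by rewrite mulrA sqri; ring.
    have -> : 'i * D = - (z + y) by apply/eqP; rewrite -addr_eq0 addrA; apply/eqP; exact: E.
    by ring.
  have c2 := fam_cig ab hV m2; have cf := cig_ff (in_T ht).
  rewrite (fcZ _ _ (cig_D mI' c2 cf)) (fcD _ c2 cf) (fam_fc ab hV l m2) imu2.
  by move: (fc (ff t) l) ((mu l ^+ 2)%:C) (fc _ l) => z1 z2 z3; ring.
apply: key => //.
- by move=> s /in_T hs; apply: (cig_bm mI' fI'); exact: cbm_psi.
- by move=> s x hs hx; apply: cderivable_cder; have [] := KGS_psi_derivable sol hs hx.
- move=> s x hs hx; have [W [hW ->]] := dE s x hs hx.
  rewrite normcM normc_i mul1r; apply: (le_trans (normcD _ _)); apply: lerD.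
    by apply: (fam_sup ab hW m4 (psi_bnd (in_T hs))); exact: in_I.
  rewrite normcM normc_real; apply: ler_pM => //; first exact: normc_ge0.
    by apply: phi_sup; [exact: in_T|exact: in_I].
  by apply: psi_sup; [exact: in_T|exact: in_I].
Qed.

Lemma fc_phi t l : 0 < t < T -> cder (fun s => fc (cplx phi s) l) t (fc (cplx phit t) l).
Proof. exact: (fc_derivative ab l hphi). Qed.

Lemma fc_klein_gordon t l : 0 < t < T ->
  cder (fun s => fc (cplx phit s) l) t
    (((eps ^+ 2)^-1)%:C * (fc (rho t) l - ((mu l ^+ 2)%:C + ((eps ^+ 2)^-1)%:C) * fc (cplx phi t) l)).
Proof.
move=> ht.
have dE s x V : 0 < s < T -> a < x < b -> per_family a b m (cplx phi s) V ->
    (derive1 (phit^~ x) s)%:C = ((eps ^+ 2)^-1)%:C * (V 2 x - ((eps ^+ 2)^-1)%:C * cplx phi s x + rho s x).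
  move=> hs hx hV.
  have h1 y : a < y < b -> cder (cplx phi s) y (V 1%N y) by move=> hy; have [] := classical2 m3 hV hy.
  have [[_ h2r] [_ h2i]] : cder (V 1%N) x (V 2 x) by have [] := classical2 m3 hV hx.
  have i1 y : a < y < b -> Im (V 1%N y) = 0.
    by move=> /h1[_ [_ <-]]; rewrite derive_cst.
  have r1 y : a < y < b -> derive1 (phi s) y = Re (V 1%N y).
    by move=> /h1[[_ <-] _]; rewrite derive1E.
  have i2 : Im (V 2 x) = 0.
    rewrite -h2i (@near_eq_derive _ _ _ _ (fun _ => 0 : R)); first by rewrite derive_cst.
    by apply: open_near => // y /i1 ->.
  have r2 : derive1 (derive1 (phi s)) x = Re (V 2 x).
    by rewrite -h2r derive1E; apply: near_eq_derive; apply: open_near => // y /r1 ->.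
  have := KGS_klein_gordon sol hs hx; rewrite r2 => E.
  rewrite (_ : derive1 (phit^~ x) s = (eps ^+ 2)^-1 * (Re (V 2 x) - (eps ^+ 2)^-1 * phi s x + normc (psi s x) ^+ 2)).
    rewrite rcM rcD rcB rcM; congr (_ * (_ - _ + _)).
    by rewrite -{2}[V 2 x]/(V 2 x); case: (V 2 x) i2 => p q /= ->.
  apply: (mulfI (lt0r_neq0 e20)); rewrite mulrA divff ?mul1r ?lt0r_neq0 //.
  by move: E; set p := eps ^+ 2 * _; set q := (eps ^+ 2)^-1; lra.
have key := @fc_under R a b ab T (cplx phit) (fun s x => (derive1 (phit^~ x) s)%:C) l
  (`|(eps ^+ 2)^-1| * (2 * (kmu ^+ 2 * al) + `|(eps ^+ 2)^-1| * (2 * al) + 2 * al * (2 * al))).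
have [V hV] := sob_of hphi0 (in_T ht).
have -> : ((eps ^+ 2)^-1)%:C * (fc (rho t) l - ((mu l ^+ 2)%:C + ((eps ^+ 2)^-1)%:C) * fc (cplx phi t) l) =
   fc (fun x => (derive1 (phit^~ x) t)%:C) l.
  rewrite [RHS](@fc_eq _ _ _ _ (fun x => ((eps ^+ 2)^-1)%:C * (V 2 x - ((eps ^+ 2)^-1)%:C * cplx phi t x + rho t x))); last first.
    by move=> x /Iab hx; exact: (dE t x V ht hx hV).
  have c2 := fam_cig ab hV m2; have cr := cig_rho (in_T ht); have cp := cig_bm mI' fI' (cbm_phi (in_T ht)).
  have cz := cig_Z mI' ((eps ^+ 2)^-1)%:C cp.
  rewrite (fcZ _ _ (cig_D mI' (cig_B mI' c2 cz) cr)) (fcD _ (cig_B mI' c2 cz) cr) (fcB _ c2 cz) (fcZ _ _ cp).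
  rewrite (fam_fc ab hV l m2) imu2.
  by move: (fc (rho t) l) (fc _ l) (((eps ^+ 2)^-1)%:C) ((mu l ^+ 2)%:C) => z1 z2 z3 z4; ring.
apply: key => //.
- move=> s /in_T hs; have [W hW] := sob_of hphit hs; rewrite -(fam0 hW); exact: (fam_cig ab hW (leq0n m)).
- move=> s x hs hx; have [_ h _ _] := KGS_phi_derivable sol hs hx; split.
    by apply: DeriveDef => //=; rewrite derive1E.
  exact: is_derive_cst_fun.
- move=> s x hs hx; have [W hW] := sob_of hphi0 (in_T hs).
  rewrite (dE s x W hs hx hW) normcM normc_real ler_wpM2l //.
  apply: (le_trans (normcD _ _)); apply: lerD.
    apply: (le_trans (normcB _ _)); apply: lerD.
      by apply: (fam_sup ab hW m4 (phi_bnd (in_T hs))); exact: in_I.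
    by rewrite normcM !normc_real ler_wpM2l //; apply: phi_sup; [exact: in_T|exact: in_I].
  rewrite normc_real ger0_norm ?sqr_ge0 //.
  by apply: ler_pM; rewrite ?normc_ge0 //; apply: psi_sup; [exact: in_T|exact: in_I|exact: in_T|exact: in_I].
Qed.

Lemma ode_psi l : CD T (fun t => fc (psi t) l) (fun t => 'i * (fc (ff t) l - (mu l ^+ 2)%:C * fc (psi t) l)).
Proof.
by have [h1 h2] := fc_continuous ab l hpsi; split => // t; exact: fc_schrodinger.
Qed.

Lemma ode_phi l : CD T (fun t => fc (cplx phi t) l) (fun t => fc (cplx phit t) l).
Proof.
by have [h1 h2] := fc_continuous ab l hphi0; split => // t; exact: fc_phi.
Qed.

Lemma ode_phit l : CD T (fun t => fc (cplx phit t) l) (fun t =>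
   ((eps ^+ 2)^-1)%:C * (fc (rho t) l - ((mu l ^+ 2)%:C + ((eps ^+ 2)^-1)%:C) * fc (cplx phi t) l)).
Proof.
by have [h1 h2] := fc_continuous ab l hphit; split => // t; exact: fc_klein_gordon.
Qed.

Lemma ff_clim t : 0 <= t <= T -> clim (fun M => conv M (fc (cplx phi t)) (fc (psi t))) (fc (ff t)).
Proof.
move=> ht; apply: (fc_product ab (perlip_phi ht)); last exact: cbm_psi.
by apply: bnd_mono (phi_bnd ht); exact: m2.
Qed.

(** Conjugating a function conjugates the coefficients and reverses the frequencies,
    which maps a window into the next one. *)
Lemma bnd_opp_conj s (A : int -> R[i]) be : bnd s A be -> bnd s (fun l => (A (- l))^*) be.
Proof.
move=> hA L; apply: l2_le; first exact: bnd_ge0 hA.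
apply: le_trans (bnd_sum (P := xpredT) (e := fun k : 'I_L.*2 => - lidx L.*2 k) _ hA); last first.
  by move=> i j _ _ /oppr_inj /lidx_inj /val_inj.
by apply: ler_sum => k _; rewrite normcJ /wt abszN.
Qed.

Lemma fc_conj_psi t l : 0 <= t <= T -> fc (fun x => (psi t x)^*) l = (fc (psi t) (- l))^*.
Proof. by move=> ht; apply: fc_conj; apply: (cig_bm mI' fI'); exact: cbm_psi. Qed.

Lemma rho_clim t : 0 <= t <= T ->
  clim (fun M => conv M (fc (psi t)) (fun l => (fc (psi t) (- l))^*)) (fc (rho t)).
Proof.
move=> ht l de de0.
have h2 : bnd 2 (fc (psi t)) al by apply: bnd_mono (psi_bnd ht); exact: m2.
have [M0 h] := fc_product ab (perlip_psi ht) h2 (cbm_J (cbm_psi ht)) l de0.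
exists M0 => M /h; rewrite (@fc_eq _ _ _ (rho t) (fun x => psi t x * (psi t x)^*)); last by move=> x _; exact: rhoE.
by apply: le_trans; rewrite /conv; rewrite (eq_bigr (fun j : 'I_M.*2 => fc (psi t) (lidx M.*2 j) * fc (fun x => (psi t x)^*) (l - lidx M.*2 j))) // => j _; rewrite fc_conj_psi.
Qed.

Lemma ff_bnd t : 0 <= t <= T -> bnd m (fc (ff t)) (2 ^+ m.+2 * al * al).
Proof.
move=> ht; apply: (bnd_lim (ff_clim ht)) => M.
exact: (conv_bnd _ m1 (phi_bnd ht) (psi_bnd ht)).
Qed.

Lemma rho_bnd t : 0 <= t <= T -> bnd m (fc (rho t)) (2 ^+ m.+2 * al * al).
Proof.
move=> ht; apply: (bnd_lim (rho_clim ht)) => M.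
exact: (conv_bnd _ m1 (psi_bnd ht) (bnd_opp_conj (psi_bnd ht))).
Qed.

Context (N : nat) (N0 : (0 < N)%N) (Ne : ~~ odd N).

Lemma ff_alias t : 0 <= t <= T ->
  nrm N 1 (fun l => fc (ff t) l - star a b N (fc (cplx phi t)) (fc (psi t)) l) <=
    Calias m * al * al * (2 / N%:R) ^+ (m - 1).
Proof. by move=> ht; exact: (product_aliasing ab N0 Ne m1 (phi_bnd ht) (psi_bnd ht) (ff_clim ht)). Qed.

(** On the grid the conjugate of a function has the conjugate coefficients,
    except at the unpaired frequency [-N/2]. *)
Lemma cj_opp (A : int -> R[i]) be : bnd m A be ->
  nrm N 1 (fun l => (A (- l))^* - cj a b N A l) <= 2 * (be * (2 / N%:R) ^+ (m - 1)).
Proof.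
move=> hA; pose A2 l : R[i] := if (absz l < N./2)%N then 0 else A l.
have c0 : 0 <= (2 / N%:R : R) by rewrite divr_ge0.
have h2 : bnd 1 A2 (be * (2 / N%:R) ^+ (m - 1)).
  move=> L; rewrite mulrC; apply: (@le_trans _ _ ((2 / N%:R) ^+ (m - 1) * nrm L.*2 m A)); last first.
    by rewrite ler_wpM2l ?exprn_ge0.
  rewrite -{2}(subnKC m1); apply: nrm_le; first exact: exprn_ge0.
  move=> k; set l := lidx _ _; rewrite /A2.
  case: ifPn => [_|h].
    by rewrite ComplexField.Normc.normc0 !mulr_ge0 ?exprn_ge0 ?wt_ge0 ?normc_ge0.
  rewrite -exprMn ler_peMl ?normc_ge0 // exprn_ege1 //.
  rewrite mulrAC ler_pdivlMr ?ltr0n // mul1r /wt -natrM ler_nat.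
  by move: h Ne; clear; lia.
rewrite (@eq_nrm _ _ _ _ (fun l => (A2 (- l))^* - cj a b N A2 l)); last first.
  move=> k; rewrite !(cj_idx ab N0 Ne); have kN := ltn_ord k.
  have [k0|k0] := posnP k.
    rewrite /A2 !ifF //; first by rewrite /lidx /= k0 subn0 modnn; clear; lia.
    by rewrite /lidx k0; clear; lia.
  have -> : - lidx N k = lidx N (oppk N0 k).
    by rewrite /lidx /oppk /= modn_small; move: Ne k0 kN; clear; lia.
  by rewrite !subrr.
apply: (le_trans (nrmB _ _ _ _)); rewrite mulr2n mulrDl mul1r; apply: lerD.
  by have := bnd_opp_conj h2 N./2; rewrite (_ : N./2.*2 = N) //; move: Ne; clear; lia.
rewrite (nrm_cj ab N0 Ne); have := h2 N./2; rewrite (_ : N./2.*2 = N) //; move: Ne; clear; lia.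
Qed.

Lemma rho_alias t : 0 <= t <= T ->
  nrm N 1 (fun l => fc (rho t) l - star a b N (fc (psi t)) (cj a b N (fc (psi t))) l) <=
    (Calias m + 48) * al * al * (2 / N%:R) ^+ (m - 1).
Proof.
move=> ht; set g := fc (psi t); set et := (2 / N%:R) ^+ (m - 1).
pose gc l : R[i] := (g (- l))^*.
have hg : bnd m g al := psi_bnd ht.
have h1 := product_aliasing ab N0 Ne m1 hg (bnd_opp_conj hg) (rho_clim ht).
have h2 := cj_opp hg.
have ng : nrm N 1 g <= al.
  by have := bnd_mono m1 hg N./2; rewrite (_ : N./2.*2 = N) //; move: Ne; clear; lia.
rewrite (@eq_nrm _ _ _ _ (fun l => (fc (rho t) l - star a b N g gc l) + star a b N g (fun l => gc l - cj a b N g l) l)); last first.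
  by move=> k; rewrite starBr; ring.
apply: (le_trans (nrmD _ _ _ _)).
rewrite (_ : _ * al * al * et = Calias m * al * al * et + 24 * al * (2 * (al * et))); last by ring.
apply: lerD; first exact: h1.
apply: (le_trans (nrm_star ab N0 Ne _ _ (leqnn 1))).
rewrite (_ : 3 * 2 ^+ 3 = 24 :> R); last by ring.
apply: ler_pM => //; rewrite ?mulr_ge0 ?nrm_ge0 //.
by rewrite ler_wpM2l.
Qed.

End ExactSolution.

(** * Regularity of the initial field *)
Section Virial.
Context {R : realType} (T : R) (T0 : 0 < T) (m n : nat) (M : int -> R) (M0 : forall l, 0 <= M l).
Context (f d Q : R -> int -> R[i]) (al qb : R).
Context (df : forall l, CD T (fun t => f t l) (fun t => d t l))
  (dd : forall l, CD T (fun t => d t l) (fun t => Q t l - (M l)%:C * f t l)).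
Context (bf : forall t, 0 <= t <= T -> nrm n m (f t) <= al)
  (bd : forall t, 0 <= t <= T -> nrm n m (d t) <= al)
  (bQ : forall t, 0 <= t <= T -> nrm n m (Q t) <= qb).
Local Notation W k := ((wt (lidx n k) ^+ m) ^+ 2 : R).

Lemma ip_le (p q : int -> R[i]) x y : nrm n m p <= x -> nrm n m q <= y ->
  `|\sum_(k < n) W k * Re (p (lidx n k) * (q (lidx n k))^*)| <= x * y.
Proof.
move=> hp hq; have x0 := le_trans (nrm_ge0 _ _ _) hp; have y0 := le_trans (nrm_ge0 _ _ _) hq.
apply: (@le_trans _ _ (nrm n m p * nrm n m q)); last by apply: ler_pM => //; exact: nrm_ge0.
apply: (@le_trans _ _ (\sum_(k < n) (wt (lidx n k) ^+ m * normc (p (lidx n k))) * (wt (lidx n k) ^+ m * normc (q (lidx n k))))).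
  apply: (le_trans (ler_norm_sum _ _ _)); apply: ler_sum => k _.
  rewrite normrM ger0_norm ?sqr_ge0 // mulrACA -expr2 ler_wpM2l ?sqr_ge0 //.
  by apply: (le_trans (Re_le_normc _)); rewrite normcM normcJ.
apply: ler_sqr2; first by rewrite mulr_ge0 ?nrm_ge0.
by apply: (le_trans (sum_CauchySchwarz _ _ _ _)); rewrite exprMn /nrm !l2_sq.
Qed.

Lemma re_mono (p : R) z : Re (p%:C * z) = p * Re z.
Proof. by rewrite ReM /= mul0r subr0. Qed.

Lemma normc_sqJ (z : R[i]) : Re (z * z^*) = normc z ^+ 2.
Proof. by rewrite normcE2; case: z => x y /=; ring. Qed.

(** The virial identity: [X' = (kinetic) - (potential) + (forcing)] with
    [X] the pairing of the field with its time derivative.  As [X] is bounded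
    at both ends and the energy is almost conserved, the energy is bounded, and
    with it one more derivative of the field than assumed. *)
Lemma virial : \sum_(k < n) W k * (M (lidx n k) * normc (f 0 (lidx n k)) ^+ 2) <=
  2 * al ^+ 2 + qb * al + 2 * (qb * al * T) + 2 * al ^+ 2 / T.
Proof.
pose Zx t := \sum_(k < n) (W k)%:C * (d t (lidx n k) * (f t (lidx n k))^*).
pose Zx' t := \sum_(k < n) (W k)%:C * ((Q t (lidx n k) - (M (lidx n k))%:C * f t (lidx n k)) * (f t (lidx n k))^*
   + d t (lidx n k) * (d t (lidx n k))^*).
pose Zy t := \sum_(k < n) (W k)%:C * ((M (lidx n k))%:C * (f t (lidx n k) * (f t (lidx n k))^*) + d t (lidx n k) * (d t (lidx n k))^*).
pose Zy' t := \sum_(k < n) (W k)%:C * ((M (lidx n k))%:C * (d t (lidx n k) * (f t (lidx n k))^* + f t (lidx n k) * (d t (lidx n k))^*)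
   + ((Q t (lidx n k) - (M (lidx n k))%:C * f t (lidx n k)) * (d t (lidx n k))^*
     + d t (lidx n k) * (Q t (lidx n k) - (M (lidx n k))%:C * f t (lidx n k))^*)).
have cx : CD T Zx Zx'.
  by apply: CD_sum => k _; apply: CD_Z; apply: CD_M => //; exact: CD_conj.
have cy : CD T Zy Zy'.
  apply: CD_sum => k _; apply: CD_Z; apply: CD_D; last by apply: CD_M => //; exact: CD_conj.
  by apply: CD_Z; apply: CD_M => //; exact: CD_conj.
pose P t := \sum_(k < n) W k * (M (lidx n k) * normc (f t (lidx n k)) ^+ 2).
pose K t := \sum_(k < n) W k * normc (d t (lidx n k)) ^+ 2.
have in0 : 0 <= (0 : R) <= T by rewrite lexx ltW.
have inT : 0 <= T <= T by rewrite lexx andbT ltW.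
have al0 : 0 <= al := le_trans (nrm_ge0 _ _ _) (bf in0).
have qb0 : 0 <= qb := le_trans (nrm_ge0 _ _ _) (bQ in0).
have K2 t : 0 <= t <= T -> 0 <= K t <= al ^+ 2.
  move=> ht; rewrite sumr_ge0 => [|k _]; last by rewrite mulr_ge0 ?sqr_ge0.
  have := ip_le (bd ht) (bd ht); rewrite -expr2; apply: le_trans; apply: le_trans (ler_norm _).
  by apply: ler_sum => k _; rewrite normc_sqJ.
have P0 t : 0 <= P t by apply: sumr_ge0 => k _; rewrite mulr_ge0 ?sqr_ge0 // mulr_ge0 ?sqr_ge0.
have ReY t : Re (Zy t) = P t + K t.
  rewrite Re_sum -big_split /=; apply: eq_bigr => k _.
  by rewrite re_mono ReD re_mono !normc_sqJ -mulrDr.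
have ReY' t : Re (Zy' t) = 2 * \sum_(k < n) W k * Re (Q t (lidx n k) * (d t (lidx n k))^*).
  rewrite Re_sum mulr_sumr; apply: eq_bigr => k _.
  rewrite re_mono mulrCA; congr (_ * _).
  by case: (Q t _) (d t _) (f t _) => [? ?] [? ?] [? ?] /=; ring.
have ReX' t : Re (Zx' t) = \sum_(k < n) W k * Re (Q t (lidx n k) * (f t (lidx n k))^*) - P t + K t.
  rewrite Re_sum /P /K -sumrB -big_split /=; apply: eq_bigr => k _.
  rewrite re_mono -!normc_sqJ.
  by case: (Q t _) (d t _) (f t _) => [? ?] [? ?] [? ?] /=; ring.
have ReX t : 0 <= t <= T -> `|Re (Zx t)| <= al ^+ 2.
  move=> ht; rewrite expr2 Re_sum (eq_bigr (fun k : 'I_n => W k * Re (d t (lidx n k) * (f t (lidx n k))^*))).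
    exact: ip_le (bd ht) (bf ht).
  by move=> k _; rewrite re_mono.
have energy t : 0 < t < T -> P 0 <= P t + al ^+ 2 + 2 * (qb * al * T).
  move=> /andP[t0 tT]; have ct := CD_sub (ltW tT) cy.
  have [c] : exists2 c, c \in `]0, t[ & Re (Zy t) - Re (Zy 0) = Re (Zy' c) * (t - 0).
    apply: (@MVT _ (fun t => Re (Zy t)) (fun t => Re (Zy' t))) => //; last exact: CD_re ct.
    by move=> s; rewrite in_itv /= => hs; exact: (CD_der ct hs).1.
  rewrite in_itv /= subr0 => /andP[c0 cT] E.
  have ci : 0 <= c <= T by rewrite ltW //= (le_trans (ltW cT)) // ltW.
  have ti : 0 <= t <= T by rewrite !ltW.
  have h := ip_le (bQ ci) (bd ci).
  move: E; rewrite !ReY ReY'; set s := \sum_(k < n) _ in h * => E.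
  have h' : `|2 * s * t| <= 2 * (qb * al * T).
    rewrite normrM normrM (ger0_norm (ltW t0)) (ger0_norm (ler0n _ 2)) -mulrA ler_wpM2l //.
    by apply: ler_pM => //; exact: ltW.
  have := ler_norm (- (2 * s * t)); rewrite normrN => h''.
  by have /andP[k1 k2] := K2 t ti; have /andP[k3 k4] := K2 0 in0; lra.
have [c] : exists2 c, c \in `]0, T[ & Re (Zx T) - Re (Zx 0) = Re (Zx' c) * (T - 0).
  apply: (@MVT _ (fun t => Re (Zx t)) (fun t => Re (Zx' t))) => //; last exact: CD_re cx.
  by move=> s; rewrite in_itv /= => hs; exact: (CD_der cx hs).1.
rewrite in_itv /= subr0 ReX' => hc E.
have ci : 0 <= c <= T by move: hc => /andP[? ?]; rewrite !ltW.
have h1 := ip_le (bQ ci) (bf ci); have h2 := le_trans (ler_norm _) h1.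
have h3 := energy c hc; have /andP[_ h4] := K2 c ci.
have x1 := ReX T inT; have x2 := ReX 0 in0.
move: E; set s := \sum_(k < n) _ in h1 h2 * => E.
have X1 : - (2 * al ^+ 2) <= (s - P c + K c) * T.
  rewrite -E; have := ler_norm (- Re (Zx T)); have := ler_norm (Re (Zx 0)); rewrite normrN; lra.
have X2 : P c <= s + K c + 2 * al ^+ 2 / T.
  have : - (2 * al ^+ 2) / T <= s - P c + K c by rewrite ler_pdivrMr.
  by rewrite mulNr; lra.
by rewrite -/(P 0); lra.
Qed.

End Virial.

(** * Errors of the initial data *)
Section InitialData.
Context {R : realType} (a b : R) (ab : a < b).
Local Notation fc := (@fc R a b).
Local Notation mu := (@mu R a b).
Local Notation kmu := (@kmu R a b).
Local Notation cwt := (@cwt R a b).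
Local Notation I := (`]a, b[%classic : set (measurableTypeR R)).

(** The bound of [virial]. *)
Definition energy_bound (T al qb : R) : R :=
  2 * al ^+ 2 + qb * al + 2 * (qb * al * T) + 2 * al ^+ 2 / T.

(** The virial bound on each window is uniform in the window, and its weight is that of
    one more derivative. *)
Lemma phi0_regular (T : R) m psi0 phi0 phi1 (psi : R -> R -> R[i]) (phi phit : R -> R -> R) (B : R)
  (al := decay_const a b m * B) : 0 < T -> (5 <= m)%N ->
  KGS_solution a b T 1 psi0 phi0 phi1 psi phi phit ->
  sobolev_C0 a b T m psi -> sobolev_C1 a b T m (cplx phi) (cplx phit) -> 0 <= B ->
  (forall t, 0 <= t <= T -> (sobolev_norm a b m (psi t) <= B%:E)%E) ->
  (forall t, 0 <= t <= T -> (sobolev_norm a b m (cplx phi t) <= B%:E)%E) ->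
  (forall t, 0 <= t <= T -> (sobolev_norm a b m (cplx phit t) <= B%:E)%E) ->
  bnd m.+1 (fc (cplx phi 0)) (Num.sqrt ((1 + cwt ^+ 2) * energy_bound T al (2 ^+ m.+2 * al * al))).
Proof.
move=> T0 m5 sol hpsi hphi B0 Bpsi Bphi Bphit L.
have M0 l : 0 <= 1 + mu l ^+ 2 by rewrite addr_ge0 ?sqr_ge0.
have o1 : (0 : R) < 1 by exact: ltr01.
have Bphit1 t : 0 <= t <= T -> (sobolev_norm a b m (cplx phit t) <= (B / 1 ^+ 2)%:E)%E.
  by rewrite expr1n divr1; exact: Bphit.
have dd l : CD T (fun t => fc (cplx phit t) l) (fun t =>
     fc (fun x => (normc (psi t x) ^+ 2)%:C) l - (1 + mu l ^+ 2)%:C * fc (cplx phi t) l).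
  apply: (CD_eq (ode_phit ab m5 o1 sol hpsi hphi B0 Bpsi Bphi l)) => t _ /=.
  by rewrite expr1n invr1 rcD; ring.
have bdt t : 0 <= t <= T -> nrm L.*2 m (fc (cplx phit t)) <= al.
  move=> ht; have := phit_bnd ab o1 hphi B0 Bphit1 ht L; congr (_ <= _); apply: eq_nrm => k.
  by rewrite expr1n mul1r.
have V := virial T0 M0 (ode_phi ab hphi) dd
  (fun t ht => phi_bnd ab hphi B0 Bphi ht L) bdt (fun t ht => rho_bnd ab m5 hpsi B0 Bpsi ht L).
rewrite -/(energy_bound _ _ _) in V.
have c1 : 0 <= 1 + cwt ^+ 2 by rewrite addr_ge0 ?sqr_ge0.
apply: l2_le; first exact: sqrtr_ge0.
rewrite sqr_sqrtr; last first.
  rewrite mulr_ge0 //; apply: le_trans V; apply: sumr_ge0 => k _.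
  by rewrite mulr_ge0 ?sqr_ge0 // mulr_ge0 ?sqr_ge0.
apply: le_trans (ler_wpM2l c1 V); rewrite mulr_sumr; apply: ler_sum => k _.
have h := wt_mu ab 1 (lidx L.*2 k); rewrite !expr1 in h.
have W0 := sqr_ge0 (wt (lidx L.*2 k) ^+ m : R).
have F0 := sqr_ge0 (normc (fc (cplx phi 0) (lidx L.*2 k))).
have m20 := sqr_ge0 (mu (lidx L.*2 k)); have c0 := sqr_ge0 cwt.
have -> : (wt (lidx L.*2 k) ^+ m.+1 * normc (fc (cplx phi 0) (lidx L.*2 k))) ^+ 2 =
    wt (lidx L.*2 k) ^+ 2 * ((wt (lidx L.*2 k) ^+ m) ^+ 2 * normc (fc (cplx phi 0) (lidx L.*2 k)) ^+ 2).
  by rewrite (exprS _ m); move: (wt (lidx L.*2 k) : R) => x; move: (x ^+ m) (normc _) => y z; ring.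
move: h W0 F0 m20 c0; set w := wt (lidx L.*2 k); move: (w ^+ 2) ((w ^+ m) ^+ 2) (normc _ ^+ 2) (mu _ ^+ 2) (cwt ^+ 2).
move=> w2 W F u2 c h W0 F0 u20 c0.
have -> : (1 + c) * (W * ((1 + u2) * F)) = ((1 + c) * (1 + u2)) * (W * F) by ring.
rewrite ler_wpM2r ?mulr_ge0 //; apply: (le_trans h); nra.
Qed.

Lemma node_in (N : nat) (j : 'I_N) : (0 < N)%N -> a <= node a b N j <= b.
Proof.
move=> N0; have N0' : (0 : R) < N%:R by rewrite ltr0n.
have ba0 : 0 < b - a by rewrite subr_gt0.
have m0 : 0 <= mesh a b N by rewrite divr_ge0 // ltW.
have h : j%:R * mesh a b N <= b - a.
  by rewrite /mesh mulrCA ger_pMr // ler_pdivrMr // mul1r ler_nat ltnW.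
rewrite /node lerDl mulr_ge0 //=; lra.
Qed.

Lemma sample_error (N : nat) m r (u u0 : R -> R[i]) al : (0 < N)%N -> ~~ odd N ->
  perlip a b u -> bnd m (fc u) al -> (2 <= m)%N -> (r <= m)%N ->
  (forall x, a <= x <= b -> u x = u0 x) ->
  nrm N r (fun l => fc u l - dft a b (sample a b (N := N) u0) l) <= Csample m * al * (N%:R^-1) ^+ (m - r).
Proof.
move=> N0 Ne pu hb m2 rm uu0; rewrite nrm_distC.
have al0 := bnd_ge0 hb; have h2 : bnd 2 (fc u) al by exact: bnd_mono hb.
apply: (sample_aliasing ab N0 Ne) => //; first exact: ltnW.
move=> de de0; exists (Num.truncn (2 * al / de)).+1 => M hM j.
have hx := @node_in N j N0; rewrite -uu0 //.
have M0 : (0 < M)%N by exact: leq_trans hM.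
apply: (le_trans (fourier_uniform ab pu h2 M0 hx)).
have M0' : (0 : R) < M%:R by rewrite ltr0n.
have -> : 2 * (al * (2 / M.*2%:R)) = (2 * al) / M%:R.
  by rewrite -mul2n natrM; field; rewrite gt_eqF.
rewrite ler_pdivrMr // [de * _]mulrC -ler_pdivrMr //.
apply: (@le_trans _ _ ((Num.truncn (2 * al / de)).+1%:R)); last by rewrite ler_nat.
by apply/ltW; apply: truncnS_gt.
Qed.

Definition Cinit (m : nat) (al ga : R) : R :=
  Csample m * al + ((1 + kmu) * (Csample m.+1 * ga) + Csample m * al).

(** The factor of the energy norm costs one derivative, uniformly in [eps]. *)
Lemma om_wt eps l : 0 < eps -> eps <= 1 -> normc (eps ^+ 2 * omega a b eps l)%:C <= (1 + kmu) * wt l ^+ 1.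
Proof.
move=> e0 e1; rewrite normc_real ger0_norm; last first.
  by rewrite mulr_ge0 ?sqr_ge0 // divr_ge0 ?sqrtr_ge0 ?sqr_ge0.
rewrite /omega mulrCA divff ?mulr1 ?expf_neq0 ?lt0r_neq0 // expr1.
have k0 := kmu_ge0 ab; have w1 : 1 <= wt l :> R by exact: wt_ge1.
have kw : 0 <= (1 + kmu) * wt l by rewrite mulr_ge0 ?addr_ge0 ?wt_ge0.
apply: ler_sqr2 => //; rewrite sqr_sqrtr; last by rewrite addr_ge0 // mulr_ge0 ?sqr_ge0.
have h := mu_norm_wt ab l; have h2 : mu l ^+ 2 <= (kmu * wt l) ^+ 2.
  by rewrite -real_normK ?num_real // lerXn2r ?nnegrE ?(mulr_ge0 k0 (wt_ge0 _)).
have e2 : eps ^+ 2 <= 1 by rewrite expr_le1 // ltW.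
apply: (@le_trans _ _ (1 + (kmu * wt l) ^+ 2)).
  by rewrite lerD2l (le_trans _ h2) // ler_piMl ?sqr_ge0.
by move: k0 w1; generalize kmu (wt l : R) => k w k0 w1; nra.
Qed.

(** The extra derivative of [phi0] pays for the one lost in the energy norm. *)
Lemma init_error (N : nat) (T : R) m eps psi0 phi0 phi1 (psi : R -> R -> R[i]) (phi phit : R -> R -> R) (B : R) ga
  (al := decay_const a b m * B) : 0 < T -> (5 <= m)%N -> 0 < eps -> eps <= 1 -> (0 < N)%N -> ~~ odd N ->
  KGS_solution a b T eps psi0 phi0 phi1 psi phi phit ->
  sobolev_C0 a b T m psi -> sobolev_C1 a b T m (cplx phi) (cplx phit) -> 0 <= B ->
  (forall t, 0 <= t <= T -> (sobolev_norm a b m (psi t) <= B%:E)%E) ->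
  (forall t, 0 <= t <= T -> (sobolev_norm a b m (cplx phi t) <= B%:E)%E) ->
  (forall t, 0 <= t <= T -> (sobolev_norm a b m (cplx phit t) <= (B / eps ^+ 2)%:E)%E) ->
  bnd m.+1 (fc (cplx phi 0)) ga ->
  @dist R a b N eps (fun t => fc (psi t)) (fun t => fc (cplx phi t)) (fun t => fc (cplx phit t)) 0
    (mti_init a b eps N psi0 phi0 phi1) <= Cinit m al ga * (N%:R^-1) ^+ (m - 1).
Proof.
move=> T0 m5 e0 e1 N0 Ne sol hpsi hphi B0 Bpsi Bphi Bphit hga.
have in0 : 0 <= (0 : R) <= T by rewrite lexx ltW.
have m2 : (2 <= m)%N by exact: leq_trans m5.
have m1 : (1 <= m)%N by exact: leq_trans m5.
have e20 : 0 < eps ^+ 2 by exact: exprn_gt0.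
have k0 := kmu_ge0 ab.
rewrite /dist /Cinit mulrDl; apply: lerD.
  by apply: (sample_error N0 Ne (perlip_psi ab m5 hpsi in0) (psi_bnd ab hpsi B0 Bpsi in0)) => // x; exact: (KGS_psi_init sol).
rewrite mulrDl; apply: en_le.
  apply: (@le_trans _ _ ((1 + kmu) * nrm N (1 + 1) (fun l => fc (cplx phi 0) l - dft a b (sample a b (N := N) (fun x => (phi0 x)%:C)) l))).
    apply: nrm_le; first by rewrite addr_ge0.
    by move=> k; rewrite normcM ler_wpM2r ?normc_ge0 //; exact: om_wt.
  rewrite -[leRHS]mulrA ler_wpM2l ?addr_ge0 //.
  have -> : (m - 1 = m.+1 - 2)%N by rewrite subSS.
  apply: (sample_error N0 Ne (perlip_phi ab m5 hphi in0) hga) => //; try exact: leqW.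
  by move=> x hx; rewrite /cplx (KGS_phi_init sol hx).
have h : bnd m (fc (cplx phit 0)) (al / eps ^+ 2).
  move=> L; have := phit_bnd ab e0 hphi B0 Bphit in0 L.
  by rewrite nrmZ normc_real ger0_norm ?(ltW e20) // ler_pdivlMr // mulrC.
rewrite nrmZ normc_real ger0_norm ?(ltW e20) //.
rewrite mulrC -ler_pdivlMr //.
apply: (le_trans (sample_error (u0 := fun x => (phi1 x / eps ^+ 2)%:C) N0 Ne (perlip_phit ab m5 hphi in0) h m2 m1 _)).
  by move=> x hx; rewrite /cplx (KGS_phit_init sol hx).
by rewrite le_eqVlt; apply/orP; left; apply/eqP; rewrite /al; move: ((eps ^+ 2)^-1) (N%:R^-1 ^+ _) => p q; ring.
Qed.

End InitialData.

(** * Errors of a run in Sobolev norms *)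
Section Assembly.
Context {R : realType} (a b : R) (ab : a < b) (T : R) (T0 : 0 < T) (m : nat) (m5 : (5 <= m)%N).
Context (B : R) (B0 : 0 <= B) (ga : R).
Local Notation fc := (@fc R a b).
Local Notation mu := (@mu R a b).
Local Notation kmu := (@kmu R a b).
Local Notation tp := (@tp R a b).
Local Notation al := (decay_const a b m * B).

(** A constant for which all the hypotheses of [dist_iter] hold. *)
Definition Kuniform : R := 96 + kmu ^+ 2 + al + 2 ^+ m.+2 * al * al.
Definition cmesh : R := (2 / (b - a)) ^+ (m - 1).
Definition Cdata : R := Cinit a b m al ga * ((b - a)^-1) ^+ (m - 1) + (Calias m + 48) * al * al * cmesh.
Definition Csob : R := Num.sqrt ((b - a) * (1 + kmu ^+ 2)).
(** The bound of [dist_iter], with the aliasing and initial errors in powers of the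
    mesh size. *)
Definition dist_bound (N : nat) (eps tau : R) : R :=
  growth T Kuniform * (Cdata * mesh a b N ^+ (m - 1) + kappa eps tau).

Let ba0 : 0 < b - a. Proof. by rewrite subr_gt0. Qed.
Let al0 : 0 <= al. Proof. by rewrite mulr_ge0 // sqrtr_ge0. Qed.
Let m1 : (1 <= m)%N. Proof. exact: leq_trans m5. Qed.
Let cmesh0 : 0 <= cmesh. Proof. by rewrite exprn_ge0 // divr_ge0 // ltW. Qed.
Let qb0 : 0 <= 2 ^+ m.+2 * al * al.
Proof. by apply: mulr_ge0 => //; apply: mulr_ge0 => //; exact: exprn_ge0. Qed.
Let Calias0 : 0 <= Calias m :> R. Proof. by rewrite addr_ge0 // exprn_ge0. Qed.

Lemma Csob_ge0 : 0 <= Csob. Proof. exact: sqrtr_ge0. Qed.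

Lemma meshN (N : nat) : (0 < N)%N -> (2 / N%:R) ^+ (m - 1) = cmesh * mesh a b N ^+ (m - 1) :> R.
Proof.
move=> N0; rewrite /cmesh -[RHS]exprMn; congr (_ ^+ _); rewrite /mesh.
have N0' : (0 : R) < N%:R by rewrite ltr0n.
by field; rewrite !gt_eqF.
Qed.

Lemma Cdata_ge0 : 0 <= ga -> 0 <= Cdata.
Proof.
move=> ga0; have Cs k : 0 <= Csample k :> R by rewrite mulr_ge0 // exprn_ge0.
have k0 : 0 <= 1 + kmu by rewrite addr_ge0 // kmu_ge0.
move: al0 cmesh0 Calias0 k0; rewrite /Cdata /Cinit; move: al cmesh (1 + kmu) (Calias m) => x y z w x0 y0 w0 z0.
have i0 : 0 <= (b - a)^-1 ^+ (m - 1) by rewrite exprn_ge0 // invr_ge0 ltW.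
apply: addr_ge0; last by rewrite !mulr_ge0 // addr_ge0.
apply: mulr_ge0 => //; apply: addr_ge0; first exact: mulr_ge0.
by apply: addr_ge0; apply: mulr_ge0 => //; apply: mulr_ge0.
Qed.

Lemma kappa_ge0 (eps tau : R) : 0 <= kappa eps tau.
Proof. by rewrite /kappa le_min divr_ge0 ?sqr_ge0. Qed.

Section OneRun.
Context (eps : R) (eps0 : 0 < eps) (eps1 : eps <= 1).
Context (psi0 : R -> R[i]) (phi0 phi1 : R -> R) (psi : R -> R -> R[i]) (phi phit : R -> R -> R).
Context (sol : KGS_solution a b T eps psi0 phi0 phi1 psi phi phit).
Context (hpsi : sobolev_C0 a b T m psi) (hphi : sobolev_C1 a b T m (cplx phi) (cplx phit)).
Context (Bpsi : forall t, 0 <= t <= T -> (sobolev_norm a b m (psi t) <= B%:E)%E)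
  (Bphi : forall t, 0 <= t <= T -> (sobolev_norm a b m (cplx phi t) <= B%:E)%E)
  (Bphit : forall t, 0 <= t <= T -> (sobolev_norm a b m (cplx phit t) <= (B / eps ^+ 2)%:E)%E).
Context (hga : bnd m.+1 (fc (cplx phi 0)) ga).
Context (N : nat) (N0 : (0 < N)%N) (Ne : ~~ odd N) (tau : R) (tau0 : 0 < tau) (tau1 : tau <= 1).
Context (n : nat) (nT : n%:R * tau <= T) (Dle1 : dist_bound N eps tau <= 1).
Local Notation S := (@mti_fp R a b eps tau N psi0 phi0 phi1 n).
Local Notation t := (n%:R * tau).
Local Notation D := (dist_bound N eps tau).
Let e20 : 0 < eps ^+ 2. Proof. exact: exprn_gt0. Qed.

Lemma tT : 0 <= t <= T. Proof. by rewrite nT mulr_ge0 // ltW. Qed.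

Lemma run_dist : @dist R a b N eps (fun s => fc (psi s)) (fun s => fc (cplx phi s)) (fun s => fc (cplx phit s)) t S <= D.
Proof.
pose eta := (Calias m + 48) * al * al * (2 / N%:R) ^+ (m - 1).
have NN (s : nat) c x : bnd s c x -> nrm N s c <= x.
  by move=> h; have := h N./2; rewrite (_ : N./2.*2 = N) //; move: Ne; clear; lia.
have [K96 [Kal [Kqb Kmu]]] : 96 <= Kuniform /\ al <= Kuniform /\ 2 ^+ m.+2 * al * al <= Kuniform /\ kmu ^+ 2 <= Kuniform.
  move: qb0 al0 (sqr_ge0 kmu); rewrite /Kuniform; move: (2 ^+ m.+2 * al * al) (kmu ^+ 2) (al) => x y z x0 y0 z0.
  by repeat split; lra.
have hmu l : mu l ^+ 2 <= Kuniform * wt l ^+ 2.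
  apply: (@le_trans _ _ (kmu ^+ 2 * wt l ^+ 2)); first exact: mu_wt.
  apply: ler_wpM2r; first exact: sqr_ge0.
  exact: Kmu.
have t2 : 0 <= 2 / N%:R :> R by rewrite divr_ge0.
have eta0 : 0 <= eta.
  rewrite /eta; move: al0 Calias0; move: al (Calias m) => x y x0 y0.
  by rewrite !mulr_ge0 ?exprn_ge0 // addr_ge0.
have aF s : 0 <= s <= T -> nrm N 1 (fun l => fc (fun x => (phi s x)%:C * psi s x) l - star a b N (fc (cplx phi s)) (fc (psi s)) l) <= eta.
  move=> hs; apply: (le_trans (ff_alias ab m5 hpsi hphi B0 Bpsi Bphi N0 Ne hs)).
  rewrite /eta; move: al0; move: al => x x0; rewrite ler_wpM2r ?exprn_ge0 //.
  by rewrite ler_wpM2r // ler_wpM2r // lerDl.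
have aQ s : 0 <= s <= T -> nrm N 1 (fun l => fc (fun x => (normc (psi s x) ^+ 2)%:C) l - star a b N (fc (psi s)) (cj a b N (fc (psi s))) l) <= eta.
  by move=> hs; exact: (rho_alias ab m5 hpsi B0 Bpsi N0 Ne hs).
have bd s : 0 <= s <= T -> nrm N 3 (fun l => (eps ^+ 2)%:C * fc (cplx phit s) l) <= Kuniform.
  move=> hs; apply: le_trans Kal; apply: NN; apply: bnd_mono (phit_bnd ab eps0 hphi B0 Bphit hs).
  exact: leq_trans m5.
have bf s : 0 <= s <= T -> nrm N 3 (fc (cplx phi s)) <= Kuniform.
  move=> hs; apply: le_trans Kal; apply: NN; apply: bnd_mono (phi_bnd ab hphi B0 Bphi hs).
  exact: leq_trans m5.
have bg s : 0 <= s <= T -> nrm N 5 (fc (psi s)) <= Kuniform.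
  by move=> hs; apply: le_trans Kal; apply: NN; apply: bnd_mono (psi_bnd ab hpsi B0 Bpsi hs).
have bF s : 0 <= s <= T -> nrm N 3 (fc (fun x => (phi s x)%:C * psi s x)) <= Kuniform.
  move=> hs; apply: le_trans Kqb; apply: NN; apply: bnd_mono (ff_bnd ab m5 hpsi hphi B0 Bpsi Bphi hs).
  exact: leq_trans m5.
have bQ s : 0 <= s <= T -> nrm N 1 (fc (fun x => (normc (psi s x) ^+ 2)%:C)) <= Kuniform.
  move=> hs; apply: le_trans Kqb; apply: NN; apply: bnd_mono (rho_bnd ab m5 hpsi B0 Bpsi hs).
  exact: leq_trans m5.
have i0 := init_error ab T0 m5 eps0 eps1 N0 Ne sol hpsi hphi B0 Bpsi Bphi Bphit hga.
set S0 := mti_init a b eps N psi0 phi0 phi1 in i0.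
have r1 : real_grid (s_phi S0) by [].
have r2 : real_grid (s_dphi S0) by [].
have G0 : 0 <= growth T Kuniform by exact: expR_ge0.
have le1 : growth T Kuniform * (@dist R a b N eps (fun s => fc (psi s)) (fun s => fc (cplx phi s)) (fun s => fc (cplx phit s)) 0 S0 + (eta + kappa eps tau)) <= D.
  rewrite ler_wpM2l // addrA lerD2r /Cdata mulrDl; apply: lerD.
    apply: (le_trans i0); rewrite -[leRHS]mulrA -exprMn le_eqVlt; apply/orP; left; apply/eqP.
    congr (_ * _ ^+ _); rewrite /mesh mulrA mulVf ?mul1r // gt_eqF //.
  by rewrite /eta meshN // [leLHS]mulrA.
apply: (le_trans _ le1).
apply: (@dist_iter _ _ _ ab _ N0 Ne _ _ _ _ _ K96 tau0 tau1 eps0 eps1 eta0 hmu (fun s => fc (psi s)) (fun s => fc (cplx phi s)) (fun s => fc (cplx phit s)) _ _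
  (fun k => ode_psi ab m5 sol hpsi hphi B0 Bpsi Bphi (lidx N k))
  (fun k => ode_phi ab hphi (lidx N k))
  (fun k => ode_phit ab m5 eps0 sol hpsi hphi B0 Bpsi Bphi (lidx N k))
  bg bf bd bF bQ aF aQ _ r1 r2 _ nT).
exact: (le_trans le1 Dle1).
Qed.

Lemma run_psi : nrm N 1 (fun l => fc (psi t) l - dft a b (s_psi S) l) <= D.
Proof. by apply: le_trans run_dist; rewrite /dist lerDl en_ge0. Qed.

(** The weight [eps^2 omega] is at least 1. *)
Lemma run_phi : nrm N 1 (fun l => fc (cplx phi t) l - dft a b (s_phi S) l) <= D.
Proof.
apply: le_trans run_dist; apply: (@le_trans _ _ (en N (fun l => (eps ^+ 2 * omega a b eps l)%:C * (fc (cplx phi t) l - dft a b (s_phi S) l))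
   (fun l => (eps ^+ 2)%:C * (fc (cplx phit t) l - dft a b (s_dphi S) l)))); last by rewrite /dist lerDr nrm_ge0.
apply: le_trans (en_l _ _ _); apply: nrm_le0 => k; rewrite normcM ler_peMl ?normc_ge0 //.
rewrite normc_real /omega mulrCA divff ?mulr1 ?expf_neq0 ?lt0r_neq0 // ger0_norm ?sqrtr_ge0 //.
by rewrite -{1}(sqrtr1 R) ler_wsqrtr // lerDl mulr_ge0 ?sqr_ge0.
Qed.

Lemma run_phit : eps ^+ 2 * nrm N 1 (fun l => fc (cplx phit t) l - dft a b (s_dphi S) l) <= D.
Proof.
apply: le_trans run_dist; apply: (@le_trans _ _ (en N (fun l => (eps ^+ 2 * omega a b eps l)%:C * (fc (cplx phi t) l - dft a b (s_phi S) l))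
   (fun l => (eps ^+ 2)%:C * (fc (cplx phit t) l - dft a b (s_dphi S) l)))); last by rewrite /dist lerDr nrm_ge0.
by apply: le_trans (en_r _ _ _); rewrite nrmZ normc_real ger0_norm // ltW.
Qed.

Lemma run_total_error : (total_error a b eps psi phi phit S t <=
  (3 * (Csob * (al * cmesh * mesh a b N ^+ (m - 1) + D)))%:E)%E.
Proof.
have m2 : (2 < m)%N by exact: leq_trans m5.
have ht := tT; have [hphi0 hphit0 _] := hphi.
have [V1 h1] := sob_of hpsi ht; have [V2 h2] := sob_of hphi0 ht; have [V3 h3] := sob_of hphit0 ht.
have E1 := sobolev_error ab (dft a b (s_psi S)) h1 m2 (psi_bnd ab hpsi B0 Bpsi ht) N0 Ne.
have E2 := sobolev_error ab (dft a b (s_phi S)) h2 m2 (phi_bnd ab hphi B0 Bphi ht) N0 Ne.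
have b3 : bnd m (fc (cplx phit t)) (al / eps ^+ 2).
  move=> L; have := phit_bnd ab eps0 hphi B0 Bphit ht L.
  by rewrite nrmZ normc_real ger0_norm ?(ltW e20) // ler_pdivlMr // mulrC.
have E3 := sobolev_error ab (dft a b (s_dphi S)) h3 m2 b3 N0 Ne.
rewrite -/Csob meshN // in E1 E2 E3.
have s0 := Csob_ge0; set H := mesh a b N ^+ (m - 1) in E1 E2 E3 *.
rewrite /total_error.
have -> : 3 * (Csob * (al * cmesh * H + D)) = Csob * (al * (cmesh * H) + D) + Csob * (al * (cmesh * H) + D) + Csob * (al * (cmesh * H) + D).
  by clear; move: (al) (D) (Csob) (cmesh) H => ? ? ? ? ?; ring.
rewrite !EFinD; apply: leeD; first apply: leeD.
- by apply: (le_trans E1); rewrite lee_fin ler_wpM2l // lerD2l; exact: run_psi.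
- by apply: (le_trans E2); rewrite lee_fin ler_wpM2l // lerD2l; exact: run_phi.
- apply: (@le_trans _ _ ((eps ^+ 2)%:E * (Csob * (al / eps ^+ 2 * (cmesh * H) + nrm N 1 (fun l => fc (cplx phit t) l - dft a b (s_dphi S) l)))%:E)%E).
    by apply: lee_wpmul2l => //; rewrite lee_fin ltW.
  rewrite -EFinM lee_fin mulrCA ler_wpM2l // mulrDr; apply: lerD; last exact: run_phit.
  rewrite le_eqVlt; apply/orP; left; apply/eqP; move: e20; move: (al) (eps ^+ 2) (cmesh * H) => x y z y0.
  by field; rewrite gt_eqF.
Qed.

Context (small' : Csob * D <= 1).

Lemma run_interp_psi : (sobolev_norm a b 1 (interp a b (s_psi S)) <= sobolev_norm a b m (psi t) + 1)%E.
Proof.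
have [V hV] := sob_of hpsi tT; have E := fam_norm ab hV; set r := Num.sqrt _ in E.
have r0 : 0 <= r by exact: sqrtr_ge0.
have er : (sobolev_norm a b m (psi t) <= r%:E)%E by rewrite E.
apply: (le_trans (sobolev_tp ab (dft a b (s_psi S)) N hV m1 r0 er)).
rewrite E -EFinD lee_fin lerD2l; apply: le_trans small'.
by rewrite -/Csob ler_wpM2l ?Csob_ge0 //; exact: run_psi.
Qed.

Lemma run_interp_phi : (sobolev_norm a b 1 (interp a b (s_phi S)) <= sobolev_norm a b m (cplx phi t) + 1)%E.
Proof.
have [hphi0 _ _] := hphi; have [V hV] := sob_of hphi0 tT; have E := fam_norm ab hV; set r := Num.sqrt _ in E.
have r0 : 0 <= r by exact: sqrtr_ge0.
have er : (sobolev_norm a b m (cplx phi t) <= r%:E)%E by rewrite E.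
apply: (le_trans (sobolev_tp ab (dft a b (s_phi S)) N hV m1 r0 er)).
rewrite E -EFinD lee_fin lerD2l; apply: le_trans small'.
by rewrite -/Csob ler_wpM2l ?Csob_ge0 //; exact: run_phi.
Qed.

Lemma run_interp_phit : (sobolev_norm a b 1 (interp a b (s_dphi S)) <=
  (eps ^- 2)%:E * ((eps ^+ 2)%:E * sobolev_norm a b m (cplx phit t) + 1))%E.
Proof.
have [_ hphit _] := hphi; have [V hV] := sob_of hphit tT; have E := fam_norm ab hV; set r := Num.sqrt _ in E.
have r0 : 0 <= r by exact: sqrtr_ge0.
have er : (sobolev_norm a b m (cplx phit t) <= r%:E)%E by rewrite E.
apply: (le_trans (sobolev_tp ab (dft a b (s_dphi S)) N hV m1 r0 er)).
have -> : ((eps ^- 2)%:E * ((eps ^+ 2)%:E * sobolev_norm a b m (cplx phit t) + 1) = (eps ^- 2 * (eps ^+ 2 * r + 1))%:E)%E.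
  by rewrite E; move: (eps ^- 2) (eps ^+ 2) => x y; rewrite EFinM EFinD EFinM.
have -> : eps ^- 2 * (eps ^+ 2 * r + 1) = r + 1 / eps ^+ 2.
  by move: e20; move: (eps ^+ 2) => x x0; field; rewrite gt_eqF.
rewrite lee_fin lerD2l.
rewrite ler_pdivlMr //; apply: le_trans small'.
by rewrite -/Csob -mulrA [X in _ * X]mulrC ler_wpM2l ?Csob_ge0 //; exact: run_phit.
Qed.

End OneRun.
End Assembly.

(** [eps^2] and [tau^2 / eps^2] have product [tau^2], so one of them is at most
    [tau]. *)
Lemma kappa_le_tau {R : realType} (eps tau : R) : 0 < eps -> 0 < tau -> kappa eps tau <= tau.
Proof.
move=> e0 t0; rewrite /kappa ge_min; have [h|h] := leP (eps ^+ 2) tau; first by rewrite orbT.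
by rewrite ler_pdivrMr ?exprn_gt0 // expr2 ler_wpM2l // ltW.
Qed.

(** The two bounds balance at [e = sqrt tau]. *)
Lemma sup_kappa {R : realType} (tau : R) : 0 < tau -> tau <= 1 ->
  is_maximum [set Num.min (tau ^+ 2 / e ^+ 2) (e ^+ 2) | e in `]0, 1]%classic] tau.
Proof.
move=> t0 t1; split.
  exists (Num.sqrt tau); last by rewrite sqr_sqrtr ?(ltW t0) // expr2 mulfK ?gt_eqF // minxx.
  by rewrite /= in_itv /= sqrtr_gt0 t0 -(sqrtr1 R) ler_wsqrtr.
by move=> _ [e /= + <-]; rewrite in_itv /= => /andP[e0 _]; exact: (kappa_le_tau e0 t0).
Qed.

Section Ereal.
Context {R : realType} (a b T : R).

Lemma sobolev_norm_ge0 m (u : R -> R[i]) : (0 <= sobolev_norm a b m u)%E.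
Proof. by apply: le_ereal_inf_tmp => _ [U _ <-]; rewrite lee_fin sqrtr_ge0. Qed.

Lemma le_sup_norm m (u : R -> R -> R[i]) t : 0 <= t <= T ->
  (sobolev_norm a b m (u t) <= sobolev_sup_norm a b T m u)%E.
Proof. by move=> ht; apply: ereal_sup_ubound; exists t; rewrite //= in_itv. Qed.

Lemma sup_norm_ge0 m (u : R -> R -> R[i]) : 0 <= T -> (0 <= sobolev_sup_norm a b T m u)%E.
Proof.
move=> T0; apply: (le_trans (sobolev_norm_ge0 m (u 0))); apply: le_sup_norm.
by rewrite lexx T0.
Qed.

End Ereal.

Section Main.
Context (R : realType) (a b T : R) (m0 : nat)
    (psi0 : R -> R[i]) (phi0 phi1 : R -> R)
    (psi : R -> R -> R -> R[i]) (phi phit : R -> R -> R -> R)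
    (ab : a < b) (T_gt0 : 0 < T) (m0_ge5 : (5 <= m0)%N)
    (sol : forall eps, 0 < eps <= 1 ->
       KGS_solution a b T eps psi0 phi0 phi1 (psi eps) (phi eps) (phit eps))
    (hA : assumption_A a b T m0 psi phi phit).

(** Both terms of the bound on the field are nonnegative, so it splits. *)
Lemma uniform_bound : exists2 B : R, 0 <= B & forall eps t, 0 < eps <= 1 -> 0 <= t <= T ->
  [/\ (sobolev_norm a b m0 (psi eps t) <= B%:E)%E,
      (sobolev_norm a b m0 (cplx (phi eps) t) <= B%:E)%E &
      (sobolev_norm a b m0 (cplx (phit eps) t) <= (B / eps ^+ 2)%:E)%E].
Proof.
have [M1 h1] := A_psi_bounded hA; have [M2 h2] := A_phi_bounded hA.
exists (`|M1| + `|M2|); first exact: addr_ge0.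
have l1 : (M1%:E <= (`|M1| + `|M2|)%:E)%E.
  by rewrite lee_fin (le_trans (ler_norm _)) // lerDl.
have l2 : (M2%:E <= (`|M1| + `|M2|)%:E)%E.
  by rewrite lee_fin (le_trans (ler_norm _)) // lerDr.
move=> eps t he ht; have /andP[e0 _] := he; have e20 : 0 < eps ^+ 2 by exact: exprn_gt0.
have T0 := ltW T_gt0.
have e2e : (0 <= (eps ^+ 2)%:E)%E by rewrite lee_fin ltW.
split.
- exact: (le_trans (le_trans (le_sup_norm a b m0 (psi eps) ht) (h1 eps he)) l1).
- apply: (le_trans (le_trans (le_sup_norm a b m0 (cplx (phi eps)) ht) _) l2).
  apply: (le_trans _ (h2 eps he)); rewrite leeDl // mule_ge0 // sup_norm_ge0 //.
- have h : ((eps ^+ 2)%:E * sobolev_norm a b m0 (cplx (phit eps) t) <= (`|M1| + `|M2|)%:E)%E.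
    apply: (le_trans _ l2); apply: (le_trans _ (h2 eps he)).
    apply: (@le_trans _ _ ((eps ^+ 2)%:E * sobolev_sup_norm a b T m0 (cplx (phit eps)))%E).
      by apply: lee_wpmul2l => //; exact: le_sup_norm.
    by rewrite leeDr // sup_norm_ge0.
  move: h; have := sobolev_norm_ge0 a b m0 (cplx (phit eps) t).
  case: (sobolev_norm a b m0 (cplx (phit eps) t)) => [r| |] // _.
    by rewrite -EFinM !lee_fin ler_pdivlMr // mulrC.
  by rewrite gt0_muley ?lte_fin.
Qed.

(** The step sizes are small when the bound [dist_bound] is below 1, also after
    multiplication by the constant that compares [nrm] with the Sobolev norm.  Both
    follow from [kappa <= tau <= h0] and [h^(m0-1) <= h <= h0]. *)
Lemma convergence :
  exists h0 tau0 C : R, [/\ 0 < h0 < 1, 0 < tau0 < 1, 0 < C &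
    forall (eps : R) (N : nat) (tau : R) (n : nat),
      0 < eps <= 1 ->
      (0 < N)%N -> ~~ odd N -> 0 < mesh a b N <= h0 ->
      0 < tau <= tau0 ->
      n%:R <= T / tau ->
      let h := mesh a b N in
      let S := mti_fp a b eps tau N psi0 phi0 phi1 n in
      let err := total_error a b eps (psi eps) (phi eps) (phit eps) S
                   (n%:R * tau) in
      [/\ (err <= (C * (h ^+ (m0 - 1) + kappa eps tau))%:E)%E,
          (sobolev_norm a b 1 (interp a b (s_psi S))
                 <= C_psi a b T m0 psi + 1)%E,
              (sobolev_norm a b 1 (interp a b (s_phi S))
                 <= C_phi a b T m0 phi phit + 1)%E &
              (sobolev_norm a b 1 (interp a b (s_dphi S))
                 <= (eps ^- 2)%:E * (C_phi a b T m0 phi phit + 1))%E]].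
Proof.
have [B B0 hB] := uniform_bound.
have i1 : 0 < (1 : R) <= 1 by rewrite ltr01 lexx.
have in0 : 0 <= (0 : R) <= T by rewrite lexx ltW.
pose al := decay_const a b m0 * B.
(* the coefficients of [phi0] are those of the solution with [eps = 1] at time 0 *)
pose ga := Num.sqrt ((1 + cwt a b ^+ 2) * energy_bound T al (2 ^+ m0.+2 * al * al)).
have ga0 : 0 <= ga by exact: sqrtr_ge0.
have reg1 : bnd m0.+1 (fc a b (cplx (phi 1) 0)) ga.
  apply: (phi0_regular ab T_gt0 m0_ge5 (sol i1) (A_psi_C0 hA i1) (A_phi_C1 hA i1) B0).
  - by move=> t /(hB 1 t i1)[].
  - by move=> t /(hB 1 t i1)[].
  - by move=> t /(hB 1 t i1)[_ _]; rewrite expr1n divr1.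
have reg eps : 0 < eps <= 1 -> bnd m0.+1 (fc a b (cplx (phi eps) 0)) ga.
  move=> he L.
  have E l : fc a b (cplx (phi eps) 0) l = fc a b (cplx (phi 1) 0) l.
    apply: (@fc_eq R a b (cplx (phi eps) 0) (cplx (phi 1) 0)) => x.
    rewrite /= in_itv /= => /andP[ax xb]; have hx : a <= x <= b by rewrite !ltW.
    by rewrite /cplx (KGS_phi_init (sol i1) hx) (KGS_phi_init (sol he) hx).
  by rewrite (@eq_nrm _ _ _ _ (fc a b (cplx (phi 1) 0)) (fun k => E _)).
set G := growth T (Kuniform a b m0 B); set C1 := Cdata a b m0 B ga; set s := Csob a b.
have G0 : 0 < G by exact: expR_gt0.
have C10 : 0 <= C1 by exact: Cdata_ge0.
have s0 : 0 <= s by exact: Csob_ge0.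
have cm0 : 0 <= al * cmesh a b m0.
  by rewrite !mulr_ge0 ?sqrtr_ge0 // exprn_ge0 // divr_ge0 // subr_ge0 ltW.
pose X := (s + 1) * (G * (C1 + 1)).
have X0 : 0 < X by rewrite !mulr_gt0 // ltr_wpDl.
pose h0 := (X + 1)^-1.
have X1 : 0 < X + 1 by rewrite addr_gt0.
have h00 : 0 < h0 by rewrite invr_gt0.
have h01 : h0 < 1 by rewrite invf_lt1 // ltrDr.
exists h0, h0, (3 * (s * (al * cmesh a b m0 + G * (C1 + 1))) + 1).
split; rewrite ?h00 ?h01 //.
  by rewrite ltr_wpDl // mulr_ge0 // mulr_ge0 // addr_ge0 // mulr_ge0 ?(ltW G0) // addr_ge0.
move=> eps N tau n he N0 Ne /andP[hm0 hm] /andP[t0 t1] hn /=.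
have /andP[e0 e1] := he.
have tau1 : tau <= 1 by apply: (le_trans t1); exact: ltW.
have nT : n%:R * tau <= T by rewrite -ler_pdivlMr.
set H := mesh a b N ^+ (m0 - 1).
have H0 : 0 <= H by rewrite exprn_ge0 // ltW.
have HhO : H <= h0.
  apply: (le_trans _ hm); rewrite /H -{2}[mesh a b N]expr1.
  apply: ler_wiXn2l; [exact: ltW|exact: (le_trans hm (ltW h01))|].
  by move: m0_ge5; clear; lia.
have k0 := kappa_ge0 eps tau; have kt := kappa_le_tau e0 t0.
pose D := dist_bound a b T m0 B ga N eps tau.
have DE : D = G * (C1 * H + kappa eps tau) by [].
have DX : (s + 1) * D <= 1.
  rewrite DE; apply: (@le_trans _ _ ((s + 1) * (G * (C1 * h0 + h0)))).
    rewrite ler_wpM2l ?addr_ge0 // ler_wpM2l ?(ltW G0) //; apply: lerD; last exact: (le_trans kt t1).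
    by rewrite ler_wpM2l.
  rewrite (_ : (s + 1) * (G * (C1 * h0 + h0)) = X * h0); last by rewrite /X; move: (h0) => h; ring.
  by rewrite /h0 ler_pdivrMr // mul1r lerDl.
have D0 : 0 <= D by rewrite DE mulr_ge0 ?(ltW G0) // addr_ge0 // mulr_ge0.
have sD0 : 0 <= s * D by exact: mulr_ge0.
have D1 : D <= 1 by move: DX; rewrite mulrDl mul1r; lra.
have D2 : s * D <= 1 by move: DX; rewrite mulrDl mul1r; lra.
have b1 t (ht : 0 <= t <= T) : (sobolev_norm a b m0 (psi eps t) <= B%:E)%E by have [] := hB eps t he ht.
have b2 t (ht : 0 <= t <= T) : (sobolev_norm a b m0 (cplx (phi eps) t) <= B%:E)%E by have [] := hB eps t he ht.
have b3 t (ht : 0 <= t <= T) : (sobolev_norm a b m0 (cplx (phit eps) t) <= (B / eps ^+ 2)%:E)%E by have [] := hB eps t he ht.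
have tin : 0 <= n%:R * tau <= T by rewrite nT mulr_ge0 // ltW.
have eI : `]0, 1]%classic eps by rewrite /= in_itv /= he.
split.
- apply: (le_trans (run_total_error ab T_gt0 m0_ge5 B0 e0 e1 (sol he) (A_psi_C0 hA he) (A_phi_C1 hA he) b1 b2 b3 (reg eps he) N0 Ne t0 tau1 nT D1)).
  rewrite lee_fin -/D -/al -/s -/H DE.
  move: k0 H0 G0 C10 s0 cm0; clear; move: (kappa eps tau) (al * _) => k c.
  move: G C1 H s => G C1 H s k0 H0 G0 C10 s0 c0.
  have x1 : 0 <= s * (c * k) by rewrite !mulr_ge0.
  have x2 : 0 <= s * (G * (C1 * k)) by rewrite !mulr_ge0 // ltW.
  have x3 : 0 <= s * (G * H) by rewrite !mulr_ge0 // ltW.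
  rewrite -subr_ge0 (_ : _ - _ = 3 * (s * (c * k)) + 3 * (s * (G * (C1 * k))) + 3 * (s * (G * H)) + (H + k)); last by ring.
  by rewrite !addr_ge0 // mulr_ge0.
- apply: (le_trans (run_interp_psi ab T_gt0 m0_ge5 B0 e0 e1 (sol he) (A_psi_C0 hA he) (A_phi_C1 hA he) b1 b2 b3 (reg eps he) N0 Ne t0 tau1 nT D1 D2)).
  apply: leeD => //; apply: (le_trans (le_sup_norm a b m0 (psi eps) tin)).
  by apply: ereal_sup_ubound; exists eps.
- apply: (le_trans (run_interp_phi ab T_gt0 m0_ge5 B0 e0 e1 (sol he) (A_psi_C0 hA he) (A_phi_C1 hA he) b1 b2 b3 (reg eps he) N0 Ne t0 tau1 nT D1 D2)).
  apply: leeD => //; apply: (le_trans (le_sup_norm a b m0 (cplx (phi eps)) tin)).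
  apply: (@le_trans _ _ (maxe (sobolev_sup_norm a b T m0 (cplx (phi eps))) ((eps ^+ 2)%:E * sobolev_sup_norm a b T m0 (cplx (phit eps)))%E)).
    by rewrite le_max lexx.
  by apply: ereal_sup_ubound; exists eps.
- apply: (le_trans (run_interp_phit ab T_gt0 m0_ge5 B0 e0 e1 (sol he) (A_psi_C0 hA he) (A_phi_C1 hA he) b1 b2 b3 (reg eps he) N0 Ne t0 tau1 nT D1 D2)).
  apply: lee_wpmul2l; first by rewrite lee_fin invr_ge0 sqr_ge0.
  apply: leeD => //.
  apply: (@le_trans _ _ (maxe (sobolev_sup_norm a b T m0 (cplx (phi eps))) ((eps ^+ 2)%:E * sobolev_sup_norm a b T m0 (cplx (phit eps)))%E)).
    rewrite le_max; apply/orP; right; apply: lee_wpmul2l; first by rewrite lee_fin sqr_ge0.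
    exact: le_sup_norm.
  by apply: ereal_sup_ubound; exists eps.
Qed.

End Main.

Local Close Scope complex_scope.

Theorem theorem4p1 (R : realType) (a b T : R) (m0 : nat)
    (psi0 : R -> R[i]) (phi0 phi1 : R -> R)
    (psi : R -> R -> R -> R[i]) (phi phit : R -> R -> R -> R)
    (ab : a < b) (T_gt0 : 0 < T) (m0_ge5 : (5 <= m0)%N)
    (sol : forall eps, 0 < eps <= 1 ->
       KGS_solution a b T eps psi0 phi0 phi1 (psi eps) (phi eps) (phit eps))
    (hA : assumption_A a b T m0 psi phi phit) :
  exists h0 tau0 C : R, [/\ 0 < h0 < 1, 0 < tau0 < 1, 0 < C &
    forall (eps : R) (N : nat) (tau : R) (n : nat),
      0 < eps <= 1 ->
      (0 < N)%N -> ~~ odd N -> 0 < mesh a b N <= h0 ->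
      0 < tau <= tau0 ->
      n%:R <= T / tau ->
      let h := mesh a b N in
      let S := mti_fp a b eps tau N psi0 phi0 phi1 n in
      let err := total_error a b eps (psi eps) (phi eps) (phit eps) S
                   (n%:R * tau) in
      [/\ [/\ (err <= (C * (h ^+ (m0 - 1) + tau ^+ 2 / eps ^+ 2))%:E)%E &
              (err <= (C * (h ^+ (m0 - 1) + eps ^+ 2))%:E)%E],
          [/\ (sobolev_norm a b 1 (interp a b (s_psi S))
                 <= C_psi a b T m0 psi + 1)%E,
              (sobolev_norm a b 1 (interp a b (s_phi S))
                 <= C_phi a b T m0 phi phit + 1)%E &
              (sobolev_norm a b 1 (interp a b (s_dphi S))
                 <= (eps ^- 2)%:E * (C_phi a b T m0 phi phit + 1))%E] &
          exists M : R,
            [/\ is_maximum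
                  [set Num.min (tau ^+ 2 / e ^+ 2) (e ^+ 2) | e in `]0, 1]] M,
                (err <= (C * (h ^+ (m0 - 1) + M))%:E)%E &
                h ^+ (m0 - 1) + M <= C * (h ^+ (m0 - 1) + tau)]]].
Proof.
have [h0 [tau0 [C [h01 tau01 C0 main]]]] := convergence ab T_gt0 m0_ge5 sol hA.
exists h0, tau0, (C + 1); split => //; first by rewrite addr_gt0.
move=> eps N tau n he N0 Ne hh ht hn h S err.
have /andP[e0 e1] := he; have /andP[t0 tt] := ht.
have tau1 : tau <= 1 by apply: (le_trans tt); case/andP: tau01 => _ /ltW.
have h_ge0 : 0 <= h by case/andP: hh => /ltW.
have H0 : 0 <= h ^+ (m0 - 1) by exact: exprn_ge0.
have [E i1 i2 i3] := main eps N tau n he N0 Ne hh ht hn.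
have key y : kappa eps tau <= y -> (err <= ((C + 1) * (h ^+ (m0 - 1) + y))%:E)%E.
  move=> hy; apply: (le_trans E); rewrite lee_fin; apply: ler_pM.
  - exact: ltW.
  - by rewrite addr_ge0 // kappa_ge0.
  - by rewrite lerDl.
  - by rewrite lerD2l.
split; first by split; apply: key; rewrite /kappa ge_min lexx ?orbT.
  by [].
exists tau; split; first exact: sup_kappa.
  by apply: key; exact: kappa_le_tau.
by rewrite mulrDl mul1r lerDr mulr_ge0 ?addr_ge0 // ltW.
Qed.
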